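(* Let $U\subset\mathbb R^n$ be an open neighborhood of the origin and let $f:U\to\mathbb R$ be a $C^\infty$ function with $f(0)=0$, $\nabla f(0)=0$, $\Gamma_+(f)\ne\emptyset$, which belongs to $\hat{\mathcal E}(U)$ and is nondegenerate over $\mathbb R$ with respect to $\Gamma_+(f)$. Then there is a neighborhood $V$ of $0$ such that for every $C^\infty$ $\varphi:\mathbb R^n\to\mathbb C$ supported in $V$, the functions $Z_\pm(s;\varphi)$ and $Z(s;\varphi)$ extend meromorphically to $\mathbb C$, with poles contained in $$\Big\{-\frac{\langle a\rangle+\nu}{l(a)}:\ \nu\in\mathbb Z_+,\ a\in\Sigma^{(1)},\ l(a)>0\Big\}\cup(-\mathbb N).$$ Moreover, the largest element of the first set is $-1/d(f)$, and if $Z_\pm(s;\varphi)$ or $Z(s;\varphi)$ has a pole at $s=-1/d(f)$, its order is at most $m(f)$ when $1/d(f)$ is not an integer, and at most $\min\{m(f)+1,n\}$ otherwise.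
   Context: $Z_\pm(s;\varphi)=\int_{\mathbb R^n}f(x)_\pm^s\varphi(x)dx$, $f_+=\max\{f,0\}$, $f_-=\max\{-f,0\}$, and $Z(s;\varphi)=\int|f(x)|^s\varphi(x)dx$, defined for $\mathrm{Re}\,s>0$. $\langle a\rangle=a_1+\dots+a_n$. Notation: $H(a,l)=\{x:\langle a,x\rangle=l\}$, $H^+(a,l)=\{x:\langle a,x\rangle\ge l\}$. A polyhedron is a finite intersection of sets $H^+(a,l)$ with $(a,l)\in\mathbb Z^n\times\mathbb Z$; $(a,l)$ valid for $P$ if $P\subset H^+(a,l)$; faces are $P\cap H(a,l)$ for valid $(a,l)$; $(a,l)$ defines $\gamma$ if $P\cap H(a,l)=\gamma$. Newton polyhedron $\Gamma_+(f)$: convex hull of $\bigcup\{\alpha+\mathbb R_+^n:c_\alpha\ne0\}$, $c_\alpha$ Taylor coefficients at $0$. $d(f)$: $(d(f),\dots,d(f))$ is where the diagonal meets $\partial\Gamma_+(f)$; principal face $\tau_*$: the face whose relative interior contains that point; $m(f)=n-\dim\tau_*$. $\gamma$-part and classes: for a polyhedron $P\subset\mathbb R_+^n$ with $P+\mathbb R_+^n\subset P$, $\Gamma_+(f)\subset P$, and face $\gamma$ of $P$: $f$ admits the $\gamma$-part on $U$ if for all $x\in U$, $\lim_{t\to0^+}f(t^{a_1}x_1,\dots,t^{a_n}x_n)/t^l$ exists for all valid $(a,l)\in\mathbb Z_+^n\times\mathbb Z_+$ defining $\gamma$ (value $f_\gamma(x)$). $\hat{\mathcal E}[P](U)$: smooth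 $f$ with $\Gamma_+(f)\subset P$ admitting all $\gamma$-parts; $\hat{\mathcal E}(U)=\{f:f\in\hat{\mathcal E}[\Gamma_+(f)](U)\}$. Nondegeneracy: for every compact face $\gamma$ of $\Gamma_+(f)$, $f_\gamma=\sum_{\alpha\in\gamma}c_\alpha x^\alpha$ has $\nabla f_\gamma\ne0$ on $U\cap(\mathbb R\setminus\{0\})^n$. Fan: with $P=\Gamma_+(f)$, $l(a)=\min\{\langle a,\alpha\rangle:\alpha\in P\}$ for $a\in\mathbb R_+^n$. For each face $\gamma$, $\gamma^*=\{a\in\mathbb R_+^n:H(a,l(a))\cap P=\gamma\}$; the closures of the $\gamma^*$ form a fan $\Sigma_0$ with support $\mathbb R_+^n$. $\Sigma$ is a fixed simplicial subdivision of $\Sigma_0$ (same support, each cone inside a cone of $\Sigma_0$, skeleton of each cone completable to a $\mathbb Z$-basis of $\mathbb Z^n$); $\Sigma^{(1)}$ is the set of primitive integer generators of its one-dimensional cones. *)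

(* Defs.v *)
From HB Require Import structures.
From mathcomp Require Import all_boot all_order all_algebra.
From mathcomp Require Import all_classical all_reals all_analysis.
From mathcomp Require Import complex.
Import Order.TTheory GRing.Theory Num.Theory numFieldNormedType.Exports.

Set Implicit Arguments.
Unset Strict Implicit.
Unset Printing Implicit Defensive.

Local Open Scope classical_set_scope.
Local Open Scope ring_scope.

Definition realv {R : realType} {n : nat} (a : 'rV[int]_n) : 'rV[R]_n :=
  \row_i ((a 0 i)%:~R : R).

Definition dot {R : realType} {n : nat} (a x : 'rV[R]_n) : R :=
  \sum_i a 0 i * x 0 i.

Definition orthant (R : realType) (n : nat) : set 'rV[R]_n :=
  [set x | forall i, 0 <= x 0 i].

Definition pderivs {R : realType} {n : nat} (g : 'rV[R]_n -> R)
  (s : seq 'I_n) : 'rV[R]_n -> R :=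
  foldr (fun i h => 'D_('e_i : 'rV[R]_n) h) g s.

Definition smooth_on {R : realType} {n : nat} (U : set 'rV[R]_n)
  (g : 'rV[R]_n -> R) : Prop :=
  forall (s : seq 'I_n) (x : 'rV[R]_n), U x ->
    {for x, continuous (pderivs g s)} /\
    forall i : 'I_n, derivable (pderivs g s) x ('e_i : 'rV[R]_n).

Definition taylor_coef {R : realType} {n : nat} (g : 'rV[R]_n -> R)
  (alpha : 'I_n -> nat) : R :=
  pderivs g (flatten [seq nseq (alpha i) i | i <- enum 'I_n]) 0
  / (\prod_i (alpha i)`!)%:R.

Definition mi_pt {R : realType} {n : nat} (alpha : 'I_n -> nat) : 'rV[R]_n :=
  \row_i ((alpha i)%:R : R).

Definition conv_hull {R : realType} {n : nat} (A : set 'rV[R]_n) : set 'rV[R]_n :=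
  [set x | exists (k : nat) (w : 'I_k -> R) (p : 'I_k -> 'rV[R]_n),
     (forall j, 0 <= w j) /\ \sum_j w j = 1 /\ (forall j, A (p j)) /\
     x = \sum_j w j *: p j].

Definition aff_hull {R : realType} {n : nat} (A : set 'rV[R]_n) : set 'rV[R]_n :=
  [set x | exists (k : nat) (w : 'I_k -> R) (p : 'I_k -> 'rV[R]_n),
     \sum_j w j = 1 /\ (forall j, A (p j)) /\ x = \sum_j w j *: p j].

Definition relint {R : realType} {n : nat} (A : set 'rV[R]_n) : set 'rV[R]_n :=
  [set x | A x /\ exists2 e : R, 0 < e &
     forall y, aff_hull A y -> (forall i, `|y 0 i - x 0 i| < e) -> A y].

Definition affdim {R : realType} {n : nat} (A : set 'rV[R]_n) (k : nat) : Prop :=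
  (exists p : 'I_k.+1 -> 'rV[R]_n, (forall j, A (p j)) /\
     \rank (\matrix_(j < k) (p (lift ord0 j) - p ord0)) = k) /\
  (forall p : 'I_k.+2 -> 'rV[R]_n, (forall j, A (p j)) ->
     (\rank (\matrix_(j < k.+1) (p (lift ord0 j) - p ord0)) <= k)%N).

Definition newton {R : realType} {n : nat} (g : 'rV[R]_n -> R) : set 'rV[R]_n :=
  conv_hull [set x | exists alpha : 'I_n -> nat,
          taylor_coef g alpha != 0 /\ forall i, (alpha i)%:R <= x 0 i].

Definition hyper {R : realType} {n : nat} (a : 'rV[R]_n) (l : R) : set 'rV[R]_n :=
  [set x | dot a x = l].

Definition valid {R : realType} {n : nat} (P : set 'rV[R]_n) (a : 'rV[R]_n) (l : R) :=
  P `<=` [set x | l <= dot a x].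

Definition is_face {R : realType} {n : nat} (P g : set 'rV[R]_n) : Prop :=
  g !=set0 /\ exists (a : 'rV[int]_n) (l : int),
    valid P (realv a) l%:~R /\ g = P `&` hyper (realv a) l%:~R.

Definition admits_part {R : realType} {n : nat} (U : set 'rV[R]_n)
  (f : 'rV[R]_n -> R) (P g : set 'rV[R]_n) : Prop :=
  forall (a : 'rV[int]_n) (l : int), (forall i, 0 <= a 0 i) -> 0 <= l ->
    valid P (realv a) l%:~R -> P `&` hyper (realv a) l%:~R = g ->
    forall x, U x ->
      cvg ((fun t : R => f (\row_i (t ^ a 0 i * x 0 i)) / t ^ l) t @[t --> 0^'+]).

(* f in \hat{E}(U) (smoothness is assumed separately) *)
Definition in_hatE {R : realType} {n : nat} (U : set 'rV[R]_n) (f : 'rV[R]_n -> R) :=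
  forall g, is_face (newton f) g -> admits_part U f (newton f) g.

(* f_gamma = sum_{alpha in gamma} c_alpha x^alpha, the sum computed over the
   multi-indices with entries < N (N any bound for the compact face) *)
Definition fpart {R : realType} {n : nat} (f : 'rV[R]_n -> R) (g : set 'rV[R]_n)
  (N : nat) (x : 'rV[R]_n) : R :=
  \sum_(alpha : {ffun 'I_n -> 'I_N} | `[< g (mi_pt (fun i => (alpha i : nat))) >])
    taylor_coef f (fun i => (alpha i : nat)) * \prod_i x 0 i ^+ alpha i.

Definition nondeg_R {R : realType} {n : nat} (U : set 'rV[R]_n)
  (f : 'rV[R]_n -> R) : Prop :=
  forall g, is_face (newton f) g -> compact g ->
  forall N : nat, (forall y, g y -> forall i, y 0 i < N%:R) ->
  forall x, U x -> (forall i, x 0 i != 0) ->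
    exists j : 'I_n, 'D_('e_j : 'rV[R]_n) (fpart f g N) x != 0.

Definition lsupp {R : realType} {n : nat} (P : set 'rV[R]_n) (a : 'rV[R]_n) : R :=
  inf [set dot a x | x in P].

Definition dual_cone {R : realType} {n : nat} (P g : set 'rV[R]_n) : set 'rV[R]_n :=
  [set a | @orthant R n a /\ P `&` hyper a (lsupp P a) = g].

Definition dval {R : realType} {n : nat} (P : set 'rV[R]_n) : R :=
  inf [set t : R | P (const_mx t)].

(* Fans.  A simplicial cone is given by its skeleton (seq of integer
   vectors); a fan is a finite list of such cones.                     *)

Definition coneR {R : realType} {n : nat} (S : seq 'rV[int]_n) : set 'rV[R]_n :=
  [set x | exists c : 'I_(size S) -> R, (forall j, 0 <= c j) /\
     x = \sum_j c j *: realv (S`_j)].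

Definition cone_face {R : realType} {n : nat} (C F : set 'rV[R]_n) : Prop :=
  exists a : 'rV[R]_n, (forall x, C x -> 0 <= dot a x) /\ F = C `&` hyper a 0.

Definition unimodular {n : nat} (S : seq 'rV[int]_n) : Prop :=
  uniq S /\ exists M : 'M[int]_n, (\det M = 1 \/ \det M = -1) /\
    {subset S <= [seq row i M | i <- enum 'I_n]}.

Definition simplicial_subdivision (R : realType) {n : nat} (P : set 'rV[R]_n)
  (Sig : seq (seq 'rV[int]_n)) : Prop :=
  (forall s, s \in Sig -> unimodular s) /\
  (forall s (C : set 'rV[R]_n), s \in Sig -> cone_face (coneR s) C ->
     exists2 t, t \in Sig & coneR t = C) /\
  (forall s t, s \in Sig -> t \in Sig ->
     cone_face (coneR s) (coneR s `&` coneR t : set 'rV[R]_n) /\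
     cone_face (coneR t) (coneR s `&` coneR t : set 'rV[R]_n)) /\
  (\bigcup_(s in [set s | s \in Sig]) (coneR s : set 'rV[R]_n) = @orthant R n) /\
  (forall s, s \in Sig -> exists g, is_face P g /\
     (coneR s : set 'rV[R]_n) `<=` closure (dual_cone P g)).

Definition primitive {n : nat} (a : 'rV[int]_n) : Prop :=
  forall k : int, (forall i, (k %| a ord0 i)%Z) -> k = 1 \/ k = -1.

Definition rays (R : realType) {n : nat} (Sig : seq (seq 'rV[int]_n))
  (a : 'rV[int]_n) : Prop :=
  primitive a /\ exists2 s, s \in Sig & (coneR s : set 'rV[R]_n) = coneR [:: a].

Definition cand_poles (R : realType) {n : nat} (P : set 'rV[R]_n)
  (Sig : seq (seq 'rV[int]_n)) : set R :=
  [set r | exists (nu : nat) (a : 'rV[int]_n), rays R Sig a /\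
     0 < lsupp P (realv a) /\
     r = - ((\sum_i ((a 0 i)%:~R : R) + nu%:R) / lsupp P (realv a))].

Definition cmod {R : realType} (z : R[i]) : R :=
  Num.sqrt (complex.Re z ^+ 2 + complex.Im z ^+ 2).

Definition cofR {R : realType} (r : R) : R[i] := Complex r 0.

(* r^s for r >= 0 (with 0^s = 0, used only for Re s > 0) *)
Definition cpowR {R : realType} (r : R) (s : R[i]) : R[i] :=
  if r <= 0 then 0 else
  Complex (powR r (complex.Re s) * cos (complex.Im s * ln r))
          (powR r (complex.Re s) * sin (complex.Im s * ln r)).

(* Lebesgue integral over R^n, computed as iterated one-dimensional
   Lebesgue integrals (the integrands used below are continuous with
   compact support, so this is the n-dimensional Lebesgue integral). *)
Fixpoint iint (R : realType) (n : nat) : ('rV[R]_n -> R) -> R :=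
  match n with
  | 0 => fun g => g 0
  | n'.+1 => fun g => Rintegral lebesgue_measure setT
        (fun t : R => iint (fun y : 'rV[R]_n' => g (row_mx (\row_(_ < 1) t) y)))
  end.

Definition cint {R : realType} {n : nat} (g : 'rV[R]_n -> R[i]) : R[i] :=
  Complex (iint (fun x => complex.Re (g x))) (iint (fun x => complex.Im (g x))).

Definition Zplus {R : realType} {n : nat} (f : 'rV[R]_n -> R)
  (phi : 'rV[R]_n -> R[i]) (s : R[i]) : R[i] :=
  cint (fun x => cpowR (Num.max (f x) 0) s * phi x).

Definition Zminus {R : realType} {n : nat} (f : 'rV[R]_n -> R)
  (phi : 'rV[R]_n -> R[i]) (s : R[i]) : R[i] :=
  cint (fun x => cpowR (Num.max (- f x) 0) s * phi x).

Definition Zabs {R : realType} {n : nat} (f : 'rV[R]_n -> R)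
  (phi : 'rV[R]_n -> R[i]) (s : R[i]) : R[i] :=
  cint (fun x => cpowR `|f x| s * phi x).

Definition holo_at {R : realType} (F : R[i] -> R[i]) (z : R[i]) : Prop :=
  exists F' : R[i], forall e : R, 0 < e -> exists2 d : R, 0 < d &
    forall h : R[i], 0 < cmod h < d -> cmod ((F (z + h) - F z) / h - F') < e.

Definition pole_le {R : realType} (F : R[i] -> R[i]) (z : R[i]) (k : nat) : Prop :=
  exists M : R, exists2 d : R, 0 < d &
    forall s, 0 < cmod (s - z) < d -> cmod ((s - z) ^+ k * F s) <= M.

Definition mero_ext {R : realType} (S : set R[i]) (G : R[i] -> R[i])
  (extra : (R[i] -> R[i]) -> Prop) : Prop :=
  exists F : R[i] -> R[i],
    (forall s, 0 < complex.Re s -> F s = G s) /\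
    (forall z, ~ S z -> holo_at F z) /\
    (forall z, S z -> exists k, pole_le F z k) /\
    extra F.

Definition supp {R : realType} {n : nat} (phi : 'rV[R]_n -> R[i]) : set 'rV[R]_n :=
  closure [set x | phi x != 0].

(* Main.v *)
(** Instead of a toric resolution we integrate by parts in logarithmic
    coordinates.  On each open orthant near [0] write
    [x_i = eps_i delta exp (- v_i)]; the positive orthant of [v]-space is cut by
    the cones of the fan, and [v = \sum_j c_j a_j] there.  A "symbol of order
    [mu]" is a function of [v] which is [O(exp (- \sum_j c_j mu(a_j)))] together
    with all its derivatives and for which [- D_a g - mu(a) g] is a symbol whose
    order is one larger at the generator [a].  Membership of [f] in the class
    [hat E] makes [f] a symbol of order [l(a)]; the Jacobian is a symbol of order
    [<a>]; and nondegeneracy, through a compactness argument over the faces,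
    gives the lower bound [\sum_i (x_i d_i f)^2 >= C exp (- 2 \sum_j c_j l(a_j))].

    Two integrations by parts then continue
    [Val s psi = \int f_+^s psi dv].  The field [grad f / |grad f|^2] gives
    [(s + 1) Val s psi = - Val (s + 1) psi'], hence the poles at negative
    integers, and the constant field [a] gives
    [(l(a) s + mu(a)) Val s psi = - s Val (s - 1) ((E_a f) psi) - Val s psi''],
    in which the order at [a] has been raised by one, hence the poles at
    [- (<a> + nu) / l(a)].

    The order of the pole at [- 1/d] is read off from the size of the integral
    at [- 1/d + ep] with [ep > 0] real: [exp (- ep |v| - c |B v|)], with [B]
    spanning the directions of the principal face, has integral
    [O(ep ^ - (n - dim tau))].  A possible extra factor [1 / (s - s0)] appears
    when [1/d] is an integer.  If moreover the principal face is a vertex then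
    [d = 1], and the extra factor is compensated by using
    [|grad f|^2 M' + f^2 M], where [M'] is the sum of the squares of the vertex
    monomials other than [x_1 ... x_n]. *)

Require Import Defs.
From HB Require Import structures.
From mathcomp Require Import all_boot all_order all_algebra.
From mathcomp Require Import all_classical all_reals all_analysis.
From mathcomp Require Import measurable_realfun complex ring lra zify.
Import Order.TTheory GRing.Theory Num.Theory numFieldNormedType.Exports.
Set Implicit Arguments.
Unset Strict Implicit.
Unset Printing Implicit Defensive.
Local Open Scope classical_set_scope.
Local Open Scope ring_scope.

(** * Calculus in several variables *)

Section Calculus.
Context {R : realType}.

(** The obstacle is that in logarithmic coordinates [f] is not a monomial times a unit: it may
    vanish along hypersurfaces inside a cone, and there only its gradient is bounded below. This is
    why two different integrations by parts are needed. The gradient field trades [Val s] for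
    [Val (s + 1)] and keeps the combined order [s l(a) + mu(a)]; the constant field [a] raises that
    order at [a] but brings back [Val (s - 1)]. Gradient steps are therefore taken in advance,
    enough of them to pay for the constant-field steps. Orders belong to generators, not to cones,
    and each integration by parts is global on the orthant, with amplitudes that vanish near its
    boundary. Bounds are read cone by cone, yet no partition of unity and no boundary term occurs.
    Holomorphy and poles are expressed by polynomial approximation to every finite order. For such
    an expansion, growth along a single real ray bounds the order of the pole, so absolute estimates
    at [- 1/d + ep] are enough. *)

Lemma mvt_bound (h dh : R -> R) (a b C : R) : a <= b ->
  (forall t, a <= t <= b -> is_derive t (1 : R) h (dh t)) ->
  (forall t, a < t < b -> `|dh t| <= C) ->
  `|h b - h a| <= C * (b - a).
Proof.
rewrite le_eqVlt => /orP[/eqP <- _ _|ab hd hC]; first by rewrite !subrr normr0 mulr0.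
have [||c] := @MVT R h dh a b ab.
- by move=> x; rewrite in_itv/= => /andP[? ?]; apply: hd; rewrite !ltW.
- apply: derivable_within_continuous => x; rewrite in_itv/= => xab.
  by have [] := hd x xab.
rewrite in_itv/= => cab ->; rewrite normrM (gtr0_norm (x:=b-a)) ?subr_gt0//.
by rewrite ler_wpM2r ?hC// subr_ge0 ltW.
Qed.

Lemma is_derive_line (V : normedModType R) (g : V -> R) (x v : V) (t : R) :
  derivable g (x + t *: v) v ->
  is_derive t (1 : R) (fun s : R => g (x + s *: v)) ('D_v g (x + t *: v)).
Proof.
move=> /derivableP dg.
have E : (fun h : R => h^-1 *: (((fun s : R => g (x + s *: v)) \o shift t) (h *: (1 : R)) - g (x + t *: v)))
  = (fun h : R => h^-1 *: ((g \o shift (x + t *: v)) (h *: v) - g (x + t *: v))).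
  apply/funext => h /=; do 3 f_equal.
  by rewrite [h *: _]mulr1 scalerDl addrCA.
by have [dg1 dg2] := dg; constructor; rewrite /derivable/derive E.
Qed.

Lemma mvt_dir (V : normedModType R) (g : V -> R) (x v : V) (T C : R) : 0 <= T ->
  (forall t, 0 <= t <= T -> derivable g (x + t *: v) v) ->
  (forall t, 0 <= t <= T -> `|'D_v g (x + t *: v)| <= C) ->
  `|g (x + T *: v) - g x| <= C * T.
Proof.
move=> T0 dg gC.
have := @mvt_bound (fun s : R => g (x + s *: v)) (fun s => 'D_v g (x + s *: v)) 0 T C T0.
rewrite scale0r addr0 subr0; apply.
  by move=> t tT; apply: is_derive_line; exact: dg.
by move=> t /andP[/ltW t0 /ltW tT]; apply: gC; rewrite t0.
Qed.

Lemma ler_coord_norm n (x : 'rV[R]_n) i : `|x 0 i| <= `|x|.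
Proof.
rewrite [leRHS]/Num.norm /= mx_normrE.
by apply: (@le_bigmax _ _ _ _ (fun ij : 'I_1 * 'I_n => `|x ij.1 ij.2|) (0, i)).
Qed.

Lemma norm_coord_lt n (x : 'rV[R]_n) (C : R) : 0 < C -> (forall i, `|x 0 i| < C) -> `|x| < C.
Proof.
move=> C0 xC; rewrite [ltLHS]/Num.norm /= mx_normrE.
by apply/bigmax_ltP; split => // -[i j] _ /=; rewrite ord1.
Qed.

Lemma near_ball_rV n (x : 'rV[R]_n) (P : set 'rV[R]_n) :
  nbhs x P -> exists2 e : R, 0 < e & forall y : 'rV[R]_n, (forall i, `|y 0 i - x 0 i| < e) -> P y.
Proof.
move=> /nbhs_ballP[e /= e0 eP]; exists e => // y yx; apply: eP.
rewrite -ball_normE /=; apply: norm_coord_lt => // i.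
by rewrite !mxE distrC.
Qed.

Lemma rV_ball_near n (x : 'rV[R]_n) (P : set 'rV[R]_n) (e : R) : 0 < e ->
  (forall y : 'rV[R]_n, (forall i, `|y 0 i - x 0 i| < e) -> P y) -> nbhs x P.
Proof.
move=> e0 eP; apply/nbhs_ballP; exists e => //= y.
rewrite -ball_normE /= => xy; apply: eP => i.
rewrite distrC; apply: le_lt_trans xy.
by have := ler_coord_norm (x - y) i; rewrite !mxE.
Qed.

Lemma continuous_rVP n (g : 'rV[R]_n -> R) x : {for x, continuous g} <->
  forall e : R, 0 < e -> exists2 r : R, 0 < r &
    forall y : 'rV[R]_n, (forall i, `|y 0 i - x 0 i| < r) -> `|g y - g x| < e.
Proof.
split.
- move=> /cvgrPdist_lt gc e e0; have /near_ball_rV[r r0 rP] := gc e e0.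
  by exists r => // y /rP; rewrite distrC.
- move=> H; apply/(@cvgrPdist_lt _ _ _ (nbhs x) _) => e e0; have [r r0 rP] := H e e0.
  by apply: (rV_ball_near r0) => y /rP; rewrite distrC.
Qed.

Lemma cvg_bigsum (T I : Type) (F : set_system T) (FF : Filter F) (r : seq I) (P : pred I)
  (f : I -> T -> R) (l : I -> R) : (forall i, P i -> f i t @[t --> F] --> l i) ->
  (\sum_(i <- r | P i) f i t) @[t --> F] --> \sum_(i <- r | P i) l i.
Proof.
move=> fl; elim: r => [|i r IH].
  by under eq_fun do rewrite big_nil; rewrite big_nil; exact: cvg_cst.
under eq_fun do rewrite big_cons; rewrite big_cons.
by case: ifPn => // Pi; apply: cvgD => //; exact: fl.
Qed.

(** The increment is split along the staircase [p k], which moves the first [k] coordinates only;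
    each edge is a one-dimensional mean value estimate for [g] minus its linear part. *)
Lemma partials_differentiable n (g : 'rV[R]_n -> R) (x : 'rV[R]_n) :
  (\forall y \near x, forall i, derivable g y ('e_i : 'rV[R]_n)) ->
  (forall i, {for x, continuous ('D_('e_i : 'rV[R]_n) g)}) ->
  is_diff x g (fun v => \sum_i v 0 i * 'D_('e_i : 'rV[R]_n) g x).
Proof.
move=> /near_ball_rV[r0 r00 dg] gc.
pose L (v : 'rV[R]_n) : R := \sum_i v 0 i * 'D_('e_i : 'rV[R]_n) g x.
have Llin : linear L.
  move=> a u v; suff : L (a *: u + v) = a * L u + L v by [].
  rewrite /L big_distrr -big_split /=; apply: eq_bigr => i _.
  by rewrite !mxE mulrDl mulrA.
pose Ll : {linear 'rV[R]_n -> R} := HB.pack L (GRing.isLinear.Build _ _ _ _ L Llin).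
have Lc : continuous Ll.
  move=> v; apply: (cvg_bigsum (nbhs_filter v)) => i _.
  by apply: cvgM; [exact: coord_continuous|exact: cvg_cst].
have E : g \o shift x = cst (g x) + Ll +o_ (0 : 'rV[R]_n) id.
  apply/eqaddoP => _/posnumP[e].
  (* Each of the [n] edges may cost [e / n.+1] times the norm of [h]; the successor keeps this
     tolerance positive for [n = 0]. *)
  have [r1 r10 r1P] : exists2 r1 : R, 0 < r1 & forall y : 'rV[R]_n, (forall i, `|y 0 i - x 0 i| < r1) ->
      forall i : 'I_n, `|'D_('e_i : 'rV[R]_n) g y - 'D_('e_i : 'rV[R]_n) g x| < e%:num / n.+1%:R.
    have : \forall y \near x, forall i : 'I_n, `|'D_('e_i : 'rV[R]_n) g y - 'D_('e_i : 'rV[R]_n) g x| < e%:num / n.+1%:R.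
      apply: (@filter_forall _ _ (fun i y => `|'D_('e_i : 'rV[R]_n) g y - 'D_('e_i : 'rV[R]_n) g x| < e%:num / n.+1%:R) _ (nbhs_filter x)) => i; have /cvgrPdist_lt := gc i.
      move=> /(_ (e%:num / n.+1%:R)); rewrite divr_gt0// => /(_ isT).
      by apply: filterS => y; rewrite distrC.
    by move=> /near_ball_rV.
  apply: (@rV_ball_near _ _ _ (Num.min r0 r1)); first by rewrite lt_min r00.
  move=> h hr /=.
  have hr0 i : `|h 0 i| < r0 by have := hr i; rewrite !mxE subr0 lt_min => /andP[].
  have hr1 i : `|h 0 i| < r1 by have := hr i; rewrite !mxE subr0 lt_min => /andP[].
  pose p (k : nat) : 'rV[R]_n := \row_i (x 0 i + if (i < k)%N then h 0 i else 0).
  have step k : (k <= n)%N ->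
    `|g (p k) - g x - \sum_(i < n | (i < k)%N) h 0 i * 'D_('e_i : 'rV[R]_n) g x|
      <= e%:num / n.+1%:R * `|h| * k%:R.
    elim: k => [_|k IH kn].
      rewrite mulr0 big_pred0// subr0 (_ : p 0%N = x) ?subrr ?normr0//.
      by apply/rowP => i; rewrite mxE ltn0 addr0.
    pose ik := Ordinal kn.
    have pS : p k.+1 = p k + h 0 ik *: ('e_ik : 'rV[R]_n).
      apply/rowP => i; rewrite !mxE eqxx /= -addrA; congr (_ + _).
      rewrite ltnS leq_eqVlt; have [->|ne] := eqVneq i ik.
        by rewrite eqxx /= ltnn add0r mulr1.
      by rewrite (negbTE (_ : (i != k :> nat))) //= mulr0 addr0.
    have D : `|g (p k.+1) - g (p k) - h 0 ik * 'D_('e_ik : 'rV[R]_n) g x|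
        <= e%:num / n.+1%:R * `|h|.
      pose hh (t : R) := g (p k + t *: ('e_ik : 'rV[R]_n)) - t * 'D_('e_ik : 'rV[R]_n) g x.
      have hhd t : `|t| <= `|h 0 ik| -> is_derive t (1:R) hh ('D_('e_ik : 'rV[R]_n) g (p k + t *: ('e_ik : 'rV[R]_n)) - 'D_('e_ik : 'rV[R]_n) g x).
        move=> th.
        have d2 : is_derive t (1:R) (fun s : R => s * 'D_('e_ik : 'rV[R]_n) g x) ('D_('e_ik : 'rV[R]_n) g x).
          by apply: is_derive_eq; rewrite scaler0 add0r [_ *: _]mulr1.
        apply: (is_deriveB _ d2).
        apply: is_derive_line; apply: dg => i.
        apply: le_lt_trans (hr0 i); rewrite !mxE eqxx /=.
        rewrite (_ : forall a b c : R, a + b + c - a = b + c); last by move=> *; ring.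
        have [->|ne] := eqVneq i ik.
          by rewrite ltnn add0r mulr1.
        by rewrite mulr0 addr0; case: ifP => // _; rewrite normr0.
      have hhC t : `|t| <= `|h 0 ik| -> `|'D_('e_ik : 'rV[R]_n) g (p k + t *: ('e_ik : 'rV[R]_n)) - 'D_('e_ik : 'rV[R]_n) g x| <= e%:num / n.+1%:R.
        move=> th; apply/ltW/r1P => i.
        apply: le_lt_trans (hr1 i); rewrite !mxE eqxx /=.
        rewrite (_ : forall a b c : R, a + b + c - a = b + c); last by move=> *; ring.
        have [->|ne] := eqVneq i ik.
          by rewrite ltnn add0r mulr1.
        by rewrite mulr0 addr0; case: ifP => // _; rewrite normr0.
      rewrite pS; have -> : g (p k + h 0 ik *: ('e_ik : 'rV[R]_n)) - g (p k) - h 0 ik * 'D_('e_ik : 'rV[R]_n) g x = hh (h 0 ik) - hh 0.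
        by rewrite /hh scale0r addr0 mul0r subr0 addrAC.
      have [h0|h0] := leP 0 (h 0 ik).
        apply: le_trans (@mvt_bound hh _ 0 (h 0 ik) (e%:num / n.+1%:R) h0 _ _) _.
        - by move=> t /andP[t0 th]; apply: hhd; rewrite !ger0_norm.
        - by move=> t /andP[t0 th]; apply: hhC; rewrite !ger0_norm// ltW.
        by rewrite subr0 ler_wpM2l// (le_trans (ler_norm _))// ler_coord_norm.
      rewrite distrC.
      apply: le_trans (@mvt_bound hh _ (h 0 ik) 0 (e%:num / n.+1%:R) (ltW h0) _ _) _.
      - by move=> t /andP[t0 th]; apply: hhd; rewrite !ler0_norm ?lerN2// ltW.
      - by move=> t /andP[t0 th]; apply: hhC; rewrite !ler0_norm ?lerN2// ltW.
      by rewrite sub0r ler_wpM2l// (le_trans (ler_norm _))// normrN ler_coord_norm.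
    rewrite (bigD1 ik) //=.
    rewrite (eq_bigl (fun i : 'I_n => (i < k)%N)); last first.
      by move=> i; rewrite -val_eqE /= ltnS ltn_neqAle andbC.
    rewrite -(natr1 k) mulrDr mulr1.
    apply: le_trans (lerD (IH (ltnW kn)) D).
    rewrite -(subrK (g (p k)) (g (p k.+1))); apply: le_trans (ler_normD _ _).
    by rewrite le_eqVlt; apply/orP; left; apply/eqP; congr `|_|; ring.
  have := step n (leqnn n).
  rewrite (eq_bigl xpredT) ?[X in p X]/=; last by move=> i; rewrite ltn_ord.
  have -> : p n = h + x by apply/rowP => i; rewrite !mxE ltn_ord addrC.
  move=> H; have -> : (g \o shift x - (cst (g x) + Ll)) h = g (h + x) - g x - L h.
    by rewrite -[LHS]/(g (h + x) - (g x + L h)) opprD addrA.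
  apply: le_trans H _; rewrite mulrAC ler_wpM2r//.
  by rewrite -mulrA ger_pMr// mulrC ler_pdivrMr// mul1r ler_nat.
have dE := diff_unique Lc E.
constructor; last by rewrite dE.
by apply/diff_locallyP; rewrite dE.
Qed.

End Calculus.

(** * Smooth functions and the symmetry of mixed partial derivatives *)

Section Smooth.
Context {R : realType} {n : nat}.
Implicit Types (g h : 'rV[R]_n -> R) (W : set 'rV[R]_n) (x : 'rV[R]_n) (i j : 'I_n).

Definition pd i g : 'rV[R]_n -> R := 'D_('e_i : 'rV[R]_n) g.

(** The recursion peels off the derivative that acts on [g] first, which turns closure properties
    into inductions on [k]. In the words of [smooth_on] that derivative is the last letter. *)
Fixpoint Ck W (k : nat) g : Prop :=
  (forall x, W x -> {for x, continuous g}) /\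
  (if k is k'.+1 then
     forall i, (forall x, W x -> derivable g x ('e_i : 'rV[R]_n)) /\ Ck W k' (pd i g)
   else True).

Definition Csm W g := forall k, Ck W k g.

Lemma Ck_cont W k g x : Ck W k g -> W x -> {for x, continuous g}.
Proof. by case: k => [|k] [+ _] => /[apply]. Qed.

Lemma near_open W x : open W -> W x -> \forall y \near x, W y.
Proof. by move=> oW Wx; apply: open_nbhs_nbhs; split. Qed.

Lemma eq_on_near W g h x : open W -> (forall y, W y -> g y = h y) -> W x -> \near x, g x = h x.
Proof. by move=> oW gh Wx; apply: filterS (near_open oW Wx) => y; exact: gh. Qed.

Lemma eq_on_derive W g h (v : 'rV[R]_n) x : open W -> (forall y, W y -> g y = h y) -> W x ->
  'D_v g x = 'D_v h x.
Proof. by move=> oW gh Wx; apply: near_eq_derive; exact: eq_on_near Wx. Qed.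

Lemma eq_on_derivable W g h (v : 'rV[R]_n) x : open W -> (forall y, W y -> g y = h y) -> W x ->
  derivable g x v -> derivable h x v.
Proof. by move=> oW gh Wx; apply: near_eq_derivable; exact: eq_on_near Wx. Qed.

Lemma eq_on_continuous W g h x : open W -> (forall y, W y -> g y = h y) -> W x ->
  {for x, continuous g} -> {for x, continuous h}.
Proof.
move=> oW gh Wx /continuous_rVP gc; apply/continuous_rVP => e e0.
have [r r0 rP] := gc e e0; have /near_ball_rV[r' r'0 r'P] := near_open oW Wx.
exists (Num.min r r'); first by rewrite lt_min r0.
move=> y yx; rewrite -!gh//.
  by apply: rP => i; have := yx i; rewrite lt_min => /andP[].
by apply: r'P => i; have := yx i; rewrite lt_min => /andP[].
Qed.

Lemma Ck_congr W k g h : open W -> (forall y, W y -> g y = h y) -> Ck W k g -> Ck W k h.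
Proof.
move=> oW; elim: k g h => [|k IH] g h gh [gc gd]; split => //.
- by move=> x Wx; exact: (eq_on_continuous oW gh Wx (gc x Wx)).
- by move=> x Wx; exact: (eq_on_continuous oW gh Wx (gc x Wx)).
move=> i; have [d1 d2] := gd i; split.
  by move=> x Wx; exact: (eq_on_derivable oW gh Wx (d1 x Wx)).
by apply: IH d2 => y Wy; exact: (eq_on_derive _ oW gh Wy).
Qed.

Lemma Csm_congr W g h : open W -> (forall y, W y -> g y = h y) -> Csm W g -> Csm W h.
Proof. by move=> oW gh gk k; apply: Ck_congr (gk k). Qed.

Lemma Ck_le W k k' g : (k' <= k)%N -> Ck W k g -> Ck W k' g.
Proof.
elim: k' k g => [|k' IH] [|k] g //= kk [gc gd]; split => // i.
by have [d1 d2] := gd i; split => //; apply: IH d2.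
Qed.

Lemma Ck_sub W W' k g : W' `<=` W -> Ck W k g -> Ck W' k g.
Proof.
move=> WW; elim: k g => [|k IH] g [gc gd]; split => //.
- by move=> x /WW; exact: gc.
- by move=> x /WW; exact: gc.
by move=> i; have [d1 d2] := gd i; split; [move=> x /WW; exact: d1|exact: IH].
Qed.

Lemma Csm_sub W W' g : W' `<=` W -> Csm W g -> Csm W' g.
Proof. by move=> WW gk k; apply: Ck_sub (gk k). Qed.

Lemma Csm_cont W g x : Csm W g -> W x -> {for x, continuous g}.
Proof. by move=> /(_ 0%N); exact: Ck_cont. Qed.

Lemma Csm_der W g x i : Csm W g -> W x -> derivable g x ('e_i : 'rV[R]_n).
Proof. by move=> /(_ 1%N)[_ /(_ i)[+ _]] => /[apply]. Qed.

Lemma Csm_pd W g i : Csm W g -> Csm W (pd i g).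
Proof. by move=> gk k; have [_ /(_ i)[_]] := gk k.+1. Qed.

Lemma pderivs_rcons g s i : pderivs g (rcons s i) = pderivs (pd i g) s.
Proof. by rewrite /pderivs foldr_rcons. Qed.

Lemma smooth_onP W g : smooth_on W g <-> Csm W g.
Proof.
split.
- move=> sg k; elim: k g sg => [|k IH] g sg; split => //.
  + by move=> x Wx; have [] := sg [::] x Wx.
  + by move=> x Wx; have [] := sg [::] x Wx.
  move=> i; split; first by move=> x Wx; have [_ /(_ i)] := sg [::] x Wx.
  by apply: IH => s x Wx; rewrite -pderivs_rcons; exact: sg.
- move=> gk s; elim/last_ind: s g gk => [|s i IH] g gk x Wx.
    by split; [exact: Csm_cont gk Wx|move=> i; exact: Csm_der gk Wx].
  by rewrite pderivs_rcons; apply: IH => //; exact: Csm_pd.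
Qed.

Lemma Csm_pderivs W g s : Csm W g -> Csm W (pderivs g s).
Proof. by elim: s => [|i s IH] gk //=; apply: Csm_pd; exact: IH. Qed.

Lemma Ck_cst W k (c : R) : Ck W k (fun=> c).
Proof.
elim: k c => [|k IH] c; split => //.
- by move=> x _; exact: cst_continuous.
- by move=> x _; exact: cst_continuous.
move=> i; split; first by move=> x _; exact: derivable_cst.
by rewrite (_ : pd i _ = fun=> 0) //; apply/funext => x; rewrite /pd derive_cst.
Qed.

Lemma Csm_cst W c : Csm W (fun=> c). Proof. by move=> k; exact: Ck_cst. Qed.

Lemma Ck_add W k g h : open W -> Ck W k g -> Ck W k h -> Ck W k (fun x => g x + h x).
Proof.
move=> oW; elim: k g h => [|k IH] g h [gc gd] [hc hd]; split => //.
- by move=> x Wx; exact: (continuousD (gc _ Wx) (hc _ Wx)).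
- by move=> x Wx; exact: (continuousD (gc _ Wx) (hc _ Wx)).
move=> i; have [gd1 gd2] := gd i; have [hd1 hd2] := hd i; split.
  by move=> x Wx; apply: derivableD; [exact: gd1|exact: hd1].
apply: (Ck_congr (g := fun x => pd i g x + pd i h x)) => //; last exact: IH.
by move=> y Wy; rewrite [RHS]deriveD //; [exact: gd1|exact: hd1].
Qed.

Lemma Csm_add W g h : open W -> Csm W g -> Csm W h -> Csm W (fun x => g x + h x).
Proof. by move=> oW gk hk k; exact: Ck_add. Qed.

Lemma Csm_sum W (I : Type) (r : seq I) (P : pred I) (G : I -> 'rV[R]_n -> R) : open W ->
  (forall k, P k -> Csm W (G k)) -> Csm W (fun x => \sum_(i <- r | P i) G i x).
Proof.
move=> oW GP; elim: r => [|i r IH].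
  by under eq_fun do rewrite big_nil; exact: Csm_cst.
under eq_fun do rewrite big_cons.
by case Pi: (P i) => //; apply: Csm_add => //; exact: GP.
Qed.

Lemma pd_mul g h x i : derivable g x ('e_i : 'rV[R]_n) -> derivable h x ('e_i : 'rV[R]_n) ->
  pd i (fun x => g x * h x) x = pd i g x * h x + g x * pd i h x.
Proof.
move=> dg dh; transitivity (g x *: pd i h x + h x *: pd i g x); first exact: (deriveM dg dh).
by rewrite addrC; congr (_ + _); exact: mulrC.
Qed.

Lemma Ck_mul W k g h : open W -> Ck W k g -> Ck W k h -> Ck W k (fun x => g x * h x).
Proof.
move=> oW; elim: k g h => [|k IH] g h Hg Hh.
  by split => // x Wx; exact: (continuousM (Ck_cont Hg Wx) (Ck_cont Hh Wx)).
have [gc gd] := Hg; have [hc hd] := Hh; split.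
  by move=> x Wx; exact: (continuousM (gc _ Wx) (hc _ Wx)).
move=> i; have [gd1 gd2] := gd i; have [hd1 hd2] := hd i; split.
  by move=> x Wx; apply: derivableM; [exact: gd1|exact: hd1].
apply: (Ck_congr (g := fun x => pd i g x * h x + g x * pd i h x)) => //; last first.
  by apply: Ck_add => //; apply: IH => //; exact: (@Ck_le _ k.+1).
by move=> y Wy; rewrite pd_mul//; [exact: gd1|exact: hd1].
Qed.

Lemma Csm_mul W g h : open W -> Csm W g -> Csm W h -> Csm W (fun x => g x * h x).
Proof. by move=> oW gk hk k; exact: Ck_mul. Qed.

Lemma pd_coord i j x : pd i (fun y : 'rV[R]_n => y 0 j) x = (i == j)%:R.
Proof.
have := @derive_id R 'rV[R]_n x ('e_i : 'rV[R]_n).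
rewrite derive_mx; last exact: derivable_id.
by move=> /rowP/(_ j); rewrite !mxE eqxx /= eq_sym.
Qed.

Lemma derivable_coord j (v : 'rV[R]_n) x : derivable (fun y : 'rV[R]_n => y 0 j) x v.
Proof. exact/diff_derivable/differentiable_coord. Qed.

Lemma Csm_coord W j : Csm W (fun x => x 0 j).
Proof.
case=> [|k]; split => //.
- by move=> x _; exact: coord_continuous.
- by move=> x _; exact: coord_continuous.
move=> i; split; first by move=> x _; exact: derivable_coord.
by rewrite (_ : pd i _ = fun=> (i == j)%:R); [exact: Ck_cst|apply/funext => x; exact: pd_coord].
Qed.

Lemma Csm_scale W (c : R) g : open W -> Csm W g -> Csm W (fun x => c * g x).
Proof. by move=> oW gk; apply: Csm_mul => //; exact: Csm_cst. Qed.

Lemma Csm_diff W g x : open W -> Csm W g -> W x ->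
  is_diff x g (fun v => \sum_i v 0 i * pd i g x).
Proof.
move=> oW gk Wx; apply: partials_differentiable.
  by apply: filterS (near_open oW Wx) => y Wy i; exact: Csm_der gk Wy.
by move=> i; apply: Csm_cont Wx; exact: Csm_pd.
Qed.

(** Mean value estimates in the two directions, one inside the other, compare the second difference
    over a square of side [r] with the mixed derivative at its corner; continuity of that derivative
    makes the error uniform on the square. *)
Lemma schwarz_half W g x i j (e : R) : open W -> Csm W g -> W x -> 0 < e ->
  exists2 r0 : R, 0 < r0 & forall r : R, 0 < r < r0 ->
  `|g (x + r *: 'e_i + r *: 'e_j) - g (x + r *: 'e_i) - g (x + r *: 'e_j) + g x
    - r * r * pd j (pd i g) x| <= e * (r * r).
Proof.
move=> oW gk Wx e0.
have /continuous_rVP/(_ e e0)[ra ra0 raP] := Csm_cont (Csm_pd j (Csm_pd i gk)) Wx.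
have /near_ball_rV[rb rb0 rbP] := near_open oW Wx.
pose r1 := Num.min ra rb.
have r10 : 0 < r1 by rewrite lt_min ra0.
have r1P (y : 'rV[R]_n) : (forall k, `|y 0 k - x 0 k| < r1) -> W y /\ `|pd j (pd i g) y - pd j (pd i g) x| < e.
  move=> yx; split; [apply: rbP|apply: raP] => k;
  by have := yx k; rewrite lt_min => /andP[].
exists (r1 / 2); first by rewrite divr_gt0.
move=> r /andP[r0 rr].
have inW (t s : R) : 0 <= t <= r -> 0 <= s <= r -> forall k, `|(x + t *: 'e_i + s *: 'e_j) 0 k - x 0 k| < r1.
  move=> /andP[t0 tr] /andP[s0 sr] k; rewrite !mxE eqxx /=.
  rewrite (_ : forall a b c : R, a + b + c - a = b + c); last by move=> *; ring.
  apply: le_lt_trans (ler_normD _ _) _; rewrite !normrM !ger0_norm//.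
  have b01 (b : bool) : `|b%:R : R| <= 1 by case: b; rewrite ?normr1 ?normr0.
  apply: (@le_lt_trans _ _ (t + s)).
    by rewrite lerD// ler_piMr// (le_trans (ler_norm _))// b01.
  lra.
pose B := pd j (pd i g) x.
have Hu t : 0 <= t <= r -> `|pd i g (x + t *: 'e_i + r *: 'e_j) - pd i g (x + t *: 'e_i) - r * B| <= e * r.
  move=> t0r.
  pose h (s : R) := pd i g (x + t *: 'e_i + s *: 'e_j) - s * B.
  have hd s : 0 <= s <= r -> is_derive s (1:R) h (pd j (pd i g) (x + t *: 'e_i + s *: 'e_j) - B).
    move=> s0r.
    have d2 : is_derive s (1:R) (fun s : R => s * B) B.
      by apply: is_derive_eq; rewrite scaler0 add0r [_ *: _]mulr1.
    apply: (is_deriveB _ d2); apply: (@is_derive_line R 'rV[R]_n (pd i g) (x + t *: 'e_i) 'e_j s).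
    by have [Wy _] := r1P _ (inW _ _ t0r s0r); exact: (Csm_der (Csm_pd i gk) Wy).
  have := @mvt_bound R h _ 0 r e (ltW r0) hd.
  rewrite /h scale0r addr0 mul0r !subr0 => H.
  rewrite -addrA (addrC (- pd i g _)) addrA; apply: H => s /andP[s0 sr].
  have s0r : 0 <= s <= r by rewrite !ltW.
  by have [_ /ltW] := r1P _ (inW _ _ t0r s0r).
pose u (t : R) := g (x + t *: 'e_i + r *: 'e_j) - g (x + t *: 'e_i) - t * (r * B).
have r0r : 0 <= r <= r by rewrite lexx ltW.
have z0r : 0 <= (0 : R) <= r by rewrite lexx ltW.
have ud t : 0 <= t <= r -> is_derive t (1:R) u
    (pd i g (x + t *: 'e_i + r *: 'e_j) - pd i g (x + t *: 'e_i) - r * B).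
  move=> t0r.
  have d3 : is_derive t (1:R) (fun s : R => s * (r * B)) (r * B).
    by apply: is_derive_eq; rewrite scaler0 add0r [_ *: _]mulr1.
  have d2 : is_derive t (1:R) (fun t : R => g (x + t *: 'e_i)) (pd i g (x + t *: 'e_i)).
    apply: (@is_derive_line R 'rV[R]_n g x 'e_i t); have [Wy _] := r1P _ (inW _ _ t0r z0r).
    by rewrite scale0r addr0 in Wy; exact: (Csm_der gk Wy).
  apply: (is_deriveB (is_deriveB _ d2) d3).
  rewrite (_ : (fun t => _) = (fun t : R => g ((x + r *: 'e_j) + t *: 'e_i))); last first.
    by apply/funext => s; rewrite addrAC.
  rewrite addrAC.
  apply: (@is_derive_line R 'rV[R]_n g (x + r *: 'e_j) 'e_i t); have [Wy _] := r1P _ (inW _ _ t0r r0r).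
  by rewrite addrAC in Wy; exact: (Csm_der gk Wy).
have := @mvt_bound R u _ 0 r (e * r) (ltW r0) ud.
rewrite /u scale0r addr0 mul0r !subr0 => H.
have {}H := H (fun t tr => Hu t (introT andP (let: conj a b := andP tr in conj (ltW a) (ltW b)))).
rewrite -mulrA in H; apply: le_trans H.
by rewrite le_eqVlt; apply/orP; left; apply/eqP; congr `|_|; rewrite -/B; ring.
Qed.

(** The second difference is symmetric in the two directions, so after division by [r * r] both
    mixed derivatives approximate the same number. *)
Lemma schwarz W g x i j : open W -> Csm W g -> W x -> pd j (pd i g) x = pd i (pd j g) x.
Proof.
move=> oW gk Wx; apply/eqP; rewrite -subr_eq0 -normr_le0; apply/ler_addgt0Pl => e e0.
rewrite addr0.
have e20 : 0 < e / 2 by rewrite divr_gt0.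
have [r1 r10 H1] := schwarz_half i j oW gk Wx e20.
have [r2 r20 H2] := schwarz_half j i oW gk Wx e20.
pose r := Num.min r1 r2 / 2.
have m0 : 0 < Num.min r1 r2 by rewrite lt_min r10.
have r0 : 0 < r by rewrite divr_gt0.
have rm : r < Num.min r1 r2 by rewrite /r; lra.
move: rm; rewrite lt_min => /andP[rr1 rr2].
have {}H1 := H1 r; have {}H2 := H2 r.
rewrite r0 rr1 in H1; rewrite r0 rr2 in H2.
have {}H1 := H1 isT; have {}H2 := H2 isT.
rewrite (addrAC x) in H2.
have rr0 : 0 < r * r by rewrite mulr_gt0.
move: (g (x + r *: 'e_i + r *: 'e_j)) (g (x + r *: 'e_i)) (g (x + r *: 'e_j)) (g x)
  (pd j (pd i g) x) (pd i (pd j g) x) H1 H2 => a b c d0 p q H1 H2.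
suff : `|(p - q) * (r * r)| <= e * (r * r).
  by rewrite normrM (gtr0_norm rr0) ler_pM2r.
have -> : e * (r * r) = e / 2 * (r * r) + e / 2 * (r * r) by rewrite -mulrDl -splitr.
apply: (le_trans _ (lerD H2 H1)); apply: le_trans (ler_normB _ _).
by rewrite le_eqVlt; apply/orP; left; apply/eqP; congr `|_|; ring.
Qed.

End Smooth.

(** * Vanishing orders along weighted dilations *)

(** The inverse of one plus the sum of the inverses is a lower bound, also over an empty index
    type. *)
Lemma fin_lb (R : realType) (I : finType) (F : I -> R) : (forall i, 0 < F i) ->
  exists2 e : R, 0 < e & forall i, e <= F i.
Proof.
move=> F0; pose S := \sum_i (F i)^-1.
have S0 : 0 <= S by apply: sumr_ge0 => i _; rewrite invr_ge0 ltW.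
exists (S + 1)^-1; first by rewrite invr_gt0; lra.
move=> i; rewrite -[leRHS]invrK lef_pV2 ?posrE ?invr_gt0//; last lra.
rewrite /S (bigD1 i) //= -addrA lerDl addr_ge0//.
by apply: sumr_ge0 => j _; rewrite invr_ge0 ltW.
Qed.

Lemma fin_ub (R : realType) (I : finType) (F : I -> R) :
  exists2 C : R, 0 <= C & forall i, F i <= C.
Proof.
exists (\sum_i `|F i|); first by apply: sumr_ge0.
move=> i; rewrite (bigD1 i) //=; apply: le_trans (ler_norm _) _.
by rewrite lerDl; apply: sumr_ge0.
Qed.

Lemma is_derive_expM (R : realType) (k : nat) (c t : R) :
  is_derive t (1 : R) (fun s : R => s ^+ k * c) (k%:R * t ^+ k.-1 * c).
Proof.
have H : is_derive t (1 : R) (fun s : R => s ^+ k) (k%:R * t ^+ k.-1).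
  constructor; first exact: exprn_derivable.
  by rewrite exp_derive [_ *: (1 : R)]mulr1.
have := is_deriveM H (is_derive_cst c t (1 : R)) => D.
by apply: (is_derive_eq D); rewrite scaler0 add0r [_ *: _]mulrC.
Qed.

Section Vanishing.
Context {R : realType} {n : nat}.
Implicit Types (g h : 'rV[R]_n -> R) (W : set 'rV[R]_n) (x : 'rV[R]_n) (i : 'I_n).
Implicit Types (a b : 'I_n -> nat).

Definition box (r : R) : set 'rV[R]_n := [set x | forall i, `|x 0 i| < r].

Lemma open_box r : open (box r).
Proof.
rewrite openE => x xr; rewrite /interior.
have [e e0 ep] : exists2 e : R, 0 < e & forall i, `|x 0 i| + e <= r.
  have [|e e0 eP] := @fin_lb R 'I_n (fun i => r - `|x 0 i|).
    by move=> i; rewrite subr_gt0; exact: xr.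
  by exists e => // i; have := eP i; lra.
apply: (rV_ball_near e0) => y yx i; have := yx i; have := ep i.
have := ler_normD (y 0 i - x 0 i) (x 0 i); rewrite subrK; lra.
Qed.

Lemma closed_box_bounded W g (r : R) : (forall x, (forall i, `|x 0 i| <= r) -> W x) ->
  (forall x, W x -> {for x, continuous g}) ->
  exists2 C : R, 0 <= C & forall x, (forall i, `|x 0 i| <= r) -> `|g x| <= C.
Proof.
move=> rW gc.
pose B : set 'rV[R]_n := [set x | forall i, `[- r, r]%classic (x 0 i)].
have BP x : B x <-> forall i, `|x 0 i| <= r.
  by split => H i; have := H i; rewrite /= in_itv /= ler_norml.
have cB : compact B by apply: (@rV_compact _ _ (fun=> `[- r, r]%classic)) => _; exact: segment_compact.
have [[x0 Bx0]|B0] := pselect (B !=set0); last first.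
  by exists 0 => // x /BP Bx; exfalso; apply: B0; exists x.
have [|c /= Bc cP] := @EVT_max_rV R n (fun x => `|g x|) B (ex_intro _ _ Bx0) cB.
  apply: continuous_in_subspaceT => x /set_mem /BP Bx.
  apply: continuous_comp; first by apply: gc; exact: rW.
  exact: norm_continuous.
by exists `|g c| => // x /BP Bx; apply: cP; exact: mem_set.
Qed.

Lemma Csm_curve W g (c : R -> 'rV[R]_n) (dc : 'rV[R]_n) (t : R) : open W -> Csm W g -> W (c t) ->
  (forall i, is_derive t (1 : R) (fun s => c s 0 i) (dc 0 i)) ->
  is_derive t (1 : R) (fun s => g (c s)) (\sum_i dc 0 i * pd i g (c t)).
Proof.
move=> oW gk Wc dcP.
have dc1 : derivable c t 1.
  by apply/derivable_mxP => i j; rewrite ord1; have [] := dcP j.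
have dcE : 'D_1 c t = dc.
  by rewrite derive_mx //; apply/rowP => i; rewrite mxE; have [_ ->] := dcP i.
have Dc : differentiable c t by exact/derivable1_diffP.
have Dg := Csm_diff oW gk Wc.
have Dgd := @ex_diff _ _ _ _ _ _ _ Dg.
have D : differentiable (g \o c) t by exact: differentiable_comp.
constructor; first exact: diff_derivable.
rewrite deriveE // diff_comp //= (@diff_val _ _ _ _ _ _ _ Dg).
by rewrite -(deriveE _ Dc) dcE.
Qed.

(** Weighted vanishing order at least [m] along the subspace where all coordinates of positive
    weight are zero: a derivative in [x_i] lowers the required order by [a i], and truncated
    subtraction switches the condition off once it reaches zero. The depth [k] counts derivatives;
    [VanA] asks for all depths. *)
Fixpoint Van W a (k m : nat) g : Prop :=
  ((0 < m)%N -> forall x, W x -> (forall i, (0 < a i)%N -> x 0 i = 0) -> g x = 0) /\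
  (if k is k'.+1 then forall i, Van W a k' (m - a i) (pd i g) else True).

Definition VanA W a m g := forall k, Van W a k m g.

Lemma Van_congr W a k m g h : open W -> (forall y, W y -> g y = h y) ->
  Van W a k m g -> Van W a k m h.
Proof.
move=> oW; elim: k m g h => [|k IH] m g h gh [g0 gd]; split => //.
- by move=> m0 x Wx xa; rewrite -gh// g0.
- by move=> m0 x Wx xa; rewrite -gh// g0.
by move=> i; apply: IH (gd i) => y Wy; exact: (eq_on_derive _ oW gh Wy).
Qed.

Lemma Van_le W a k m m' g : (m' <= m)%N -> Van W a k m g -> Van W a k m' g.
Proof.
elim: k m m' g => [|k IH] m m' g mm [g0 gd]; split => //.
- by move=> m0; apply: g0; exact: leq_trans m0 mm.
- by move=> m0; apply: g0; exact: leq_trans m0 mm.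
by move=> i; apply: IH (gd i); exact: (leq_sub2r _ mm).
Qed.

Lemma Van_S W a k m g : Van W a k.+1 m g -> Van W a k m g.
Proof.
elim: k m g => [|k IH] m g [g0 gd]; split => // i.
exact: (IH _ _ (gd i)).
Qed.

Lemma Van_0 W a k g : Van W a k 0 g.
Proof. by elim: k g => [|k IH] g; split => // i; rewrite sub0n. Qed.

Lemma VanA_0 W a g : VanA W a 0 g. Proof. by move=> k; exact: Van_0. Qed.

Lemma VanA_le W a m m' g : (m' <= m)%N -> VanA W a m g -> VanA W a m' g.
Proof. by move=> mm gk k; exact: Van_le mm (gk k). Qed.

Lemma VanA_congr W a m g h : open W -> (forall y, W y -> g y = h y) ->
  VanA W a m g -> VanA W a m h.
Proof. by move=> oW gh gk k; exact: Van_congr oW gh (gk k). Qed.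

Lemma VanA_pd W a m g i : VanA W a m g -> VanA W a (m - a i) (pd i g).
Proof. by move=> gk k; have [_ /(_ i)] := gk k.+1. Qed.

Lemma Van_add W a k m g h : open W -> Csm W g -> Csm W h ->
  Van W a k m g -> Van W a k m h -> Van W a k m (fun x => g x + h x).
Proof.
move=> oW; elim: k m g h => [|k IH] m g h gk hk [g0 gd] [h0 hd]; split => //.
- by move=> m0 x Wx xa; rewrite g0// h0// addr0.
- by move=> m0 x Wx xa; rewrite g0// h0// addr0.
move=> i; apply: (@Van_congr _ _ _ _ (fun x => pd i g x + pd i h x)) => //; last first.
  exact: (IH _ _ _ (Csm_pd i gk) (Csm_pd i hk) (gd i) (hd i)).
move=> y Wy; symmetry; apply: deriveD; [exact: Csm_der gk Wy|exact: Csm_der hk Wy].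
Qed.

Lemma Van_cstM W a k m g (c : R) : open W -> Csm W g ->
  Van W a k m g -> Van W a k m (fun x => c * g x).
Proof.
move=> oW; elim: k m g => [|k IH] m g gk [g0 gd]; split => //.
- by move=> m0 x Wx xa; rewrite g0// mulr0.
- by move=> m0 x Wx xa; rewrite g0// mulr0.
move=> i; apply: (@Van_congr _ _ _ _ (fun x => c * pd i g x)) => //; last first.
  exact: (IH _ _ (Csm_pd i gk) (gd i)).
move=> y Wy; symmetry; exact: (deriveZ c (Csm_der gk Wy)).
Qed.

Lemma VanA_add W a m g h : open W -> Csm W g -> Csm W h ->
  VanA W a m g -> VanA W a m h -> VanA W a m (fun x => g x + h x).
Proof. by move=> oW gk hk gv hv k; exact: Van_add. Qed.

Lemma VanA_cstM W a m g c : open W -> Csm W g -> VanA W a m g -> VanA W a m (fun x => c * g x).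
Proof. by move=> oW gk gv k; exact: Van_cstM. Qed.

Lemma VanA_cst0 W a m : open W -> VanA W a m (fun=> 0).
Proof.
move=> oW k; elim: k m => [|k IH] m; split => // i.
by rewrite (_ : pd i _ = fun=> 0) //; apply/funext => x; rewrite /pd derive_cst.
Qed.

Lemma VanA_sum W a m (I : Type) (r : seq I) (G : I -> 'rV[R]_n -> R) : open W ->
  (forall k, Csm W (G k)) -> (forall k, VanA W a m (G k)) ->
  VanA W a m (fun x => \sum_(k <- r) G k x).
Proof.
move=> oW Gk GV; elim: r => [|k r IH].
  by under eq_fun do rewrite big_nil; exact: VanA_cst0.
by under eq_fun do rewrite big_cons; apply: VanA_add => //; exact: Csm_sum.
Qed.

Lemma pd_coordM W g i j x : Csm W g -> W x ->
  pd j (fun x => x 0 i * g x) x = (j == i)%:R * g x + x 0 i * pd j g x.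
Proof.
move=> gk Wx; rewrite pd_mul ?pd_coord //; first exact: derivable_coord.
exact: Csm_der gk Wx.
Qed.

Lemma Van_mulcoord W a k m g i : open W -> Csm W g ->
  Van W a k m g -> Van W a k (m + a i) (fun x => x 0 i * g x).
Proof.
move=> oW; elim: k m g => [|k IH] m g gk gV; have [g0 gd] := gV.
  split => // m0 x Wx xa; case: (posnP (a i)) => [ai0|ai]; last by rewrite xa// mul0r.
  by rewrite g0 ?mulr0//; move: m0; rewrite ai0 addn0.
split.
  move=> m0 x Wx xa; case: (posnP (a i)) => [ai0|ai]; last by rewrite xa// mul0r.
  by rewrite g0 ?mulr0//; move: m0; rewrite ai0 addn0.
move=> j; apply: (@Van_congr _ _ _ _ (fun x => (j == i)%:R * g x + x 0 i * pd j g x)) => //.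
  by move=> y Wy; rewrite (pd_coordM _ _ gk Wy).
have ck : Csm W (fun x : 'rV[R]_n => x 0 i * pd j g x).
  by apply: Csm_mul => //; [exact: Csm_coord|exact: Csm_pd].
apply: Van_add => //; first exact: Csm_scale.
  have [->|ne] := eqVneq j i.
    apply: Van_cstM => //; rewrite addnK.
    exact: Van_S.
  rewrite (_ : (fun x => _) = fun=> 0); first exact: VanA_cst0.
  by apply/funext => x; rewrite mul0r.
apply: (@Van_le _ _ _ ((m - a j) + a i)); first lia.
exact: (IH _ _ (Csm_pd j gk) (gd j)).
Qed.

Definition th i g : 'rV[R]_n -> R := fun x => x 0 i * pd i g x.
(** The weighted Euler field. In logarithmic coordinates it becomes minus the derivative along the
    constant vector [a]. *)
Definition Eu a g : 'rV[R]_n -> R := fun x => \sum_i (a i)%:R * th i g x.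

Lemma Csm_th W i g : open W -> Csm W g -> Csm W (th i g).
Proof. by move=> oW gk; apply: Csm_mul => //; [exact: Csm_coord|exact: Csm_pd]. Qed.

Lemma Csm_Eu W a g : open W -> Csm W g -> Csm W (Eu a g).
Proof. by move=> oW gk; apply: Csm_sum => // i _; apply: Csm_scale => //; exact: Csm_th. Qed.

Lemma VanA_th W a m i g : open W -> Csm W g -> VanA W a m g -> VanA W a m (th i g).
Proof.
move=> oW gk gV k; apply: (@Van_le _ _ _ ((m - a i) + a i)); first lia.
by apply: Van_mulcoord => //; [exact: Csm_pd|exact: VanA_pd].
Qed.

Lemma VanA_Eu W a b m g : open W -> Csm W g -> VanA W a m g -> VanA W a m (Eu b g).
Proof.
move=> oW gk gV; apply: VanA_sum => // i.
  by apply: Csm_scale => //; exact: Csm_th.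
by apply: VanA_cstM => //; [exact: Csm_th|exact: VanA_th].
Qed.

Lemma pd_Eu W a g j x : open W -> Csm W g -> W x ->
  pd j (Eu a g) x = Eu a (pd j g) x + (a j)%:R * pd j g x.
Proof.
move=> oW gk Wx.
have dt i : derivable (fun x => (a i)%:R * th i g x) x ('e_j : 'rV[R]_n).
  by apply: Csm_der Wx; apply: Csm_scale => //; exact: Csm_th.
have E : Eu a g = \sum_(i < n) (fun x => (a i)%:R * th i g x).
  by apply/funext => y; rewrite fct_sumE.
rewrite /pd E derive_sum // /Eu -/(pd j _).
rewrite (eq_bigr (fun i => (a i)%:R * th i (pd j g) x + (a i)%:R * ((j == i)%:R * pd i g x))).
  rewrite big_split /=; congr (_ + _); rewrite (bigD1 j) //= eqxx mul1r.
  by rewrite big1 ?addr0// => i ij; rewrite eq_sym (negbTE ij) mul0r mulr0.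
move=> i _; rewrite -mulrDr.
have <- : pd j (th i g) x = th i (pd j g) x + (j == i)%:R * pd i g x.
  transitivity ((j == i)%:R * pd i g x + x 0 i * pd j (pd i g) x).
    exact: (pd_coordM i j (Csm_pd i gk) Wx).
  by rewrite addrC (schwarz i j oW gk Wx).
by apply: deriveZ; apply: Csm_der Wx; exact: Csm_th.
Qed.

(** [Eu a - m] annihilates weighted homogeneous terms of degree [m]. By the commutator [pd_Eu], a
    derivative in [x_j] turns the expression into the same one for [pd j g] with [m - a j], so
    induction on the depth closes. *)
Lemma Van_raise W a k m g : open W -> Csm W g -> VanA W a m g ->
  Van W a k m.+1 (fun x => Eu a g x - m%:R * g x).
Proof.
move=> oW.
have v0 m' g' : VanA W a m' g' -> forall x, W x -> (forall i, (0 < a i)%N -> x 0 i = 0) ->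
    Eu a g' x - m'%:R * g' x = 0.
  move=> gV x Wx xa; rewrite /Eu big1 ?sub0r; last first.
    by move=> i _; case: (posnP (a i)) => [->|ai]; rewrite ?mul0r// /th xa// mul0r mulr0.
  by case: (posnP m') => [->|m0]; [rewrite mul0r oppr0|have [-> //] := gV 0%N; rewrite mulr0 oppr0].
elim: k m g => [|k IH] m g gk gV; first by split => // _; exact: v0.
split => [_|j]; first exact: v0.
have [aj|aj] := leqP (a j) m; last first.
  by rewrite (_ : m.+1 - a j = 0)%N; [exact: Van_0|lia].
apply: (@Van_congr _ _ _ _ (fun x => Eu a (pd j g) x - (m - a j)%:R * pd j g x)) => //.
  move=> y Wy.
  have d1 : derivable (Eu a g) y ('e_j : 'rV[R]_n) by apply: Csm_der Wy; exact: Csm_Eu.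
  have d2 : derivable (fun x => m%:R * g x) y ('e_j : 'rV[R]_n) by apply: Csm_der Wy; exact: Csm_scale.
  symmetry; transitivity (pd j (Eu a g) y - pd j (fun x => m%:R * g x) y); first exact: deriveB.
  have E2 : pd j (fun x => m%:R * g x) y = m%:R * pd j g y by exact: (deriveZ _ (Csm_der gk Wy)).
  by rewrite E2 (pd_Eu _ _ oW gk Wy) natrB //; ring.
rewrite subSn //; apply: IH; [exact: Csm_pd|exact: VanA_pd].
Qed.

Lemma VanA_raise W a m g : open W -> Csm W g -> VanA W a m g ->
  VanA W a m.+1 (fun x => Eu a g x - m%:R * g x).
Proof. by move=> oW gk gV k; exact: Van_raise. Qed.

(** In the chart of a cone with generators [A j] this is the toric monomial map in the parameters
    [y j], applied to the point [x]. *)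
Definition mdil p (A : 'I_p -> 'I_n -> nat) (y : 'I_p -> R) x : 'rV[R]_n :=
  \row_i ((\prod_j y j ^+ A j i) * x 0 i).

Lemma prod01 (I : finType) (P : pred I) (F : I -> R) (e : I -> nat) : 
  (forall u, 0 <= F u <= 1) -> 0 <= \prod_(u | P u) F u ^+ e u <= 1.
Proof.
move=> F01; apply/andP; split.
  by apply: prodr_ge0 => i _; apply: exprn_ge0; case/andP: (F01 i).
by apply: prodr_ile1 => i _; case/andP: (F01 i) => f0 f1; rewrite exprn_ge0 // exprn_ile1.
Qed.

Lemma mdil_le p (A : 'I_p -> 'I_n -> nat) (y : 'I_p -> R) x (r : R) :
  (forall j : 'I_p, 0 <= y j <= 1) -> (forall i, `|x 0 i| <= r) -> forall i, `|mdil A y x 0 i| <= r.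
Proof.
move=> y01 xr i; rewrite mxE normrM; apply: le_trans (xr i).
have /andP[p0 p1] := @prod01 _ xpredT y (fun j => A j i) y01.
by rewrite ger0_norm // ler_piMl.
Qed.

(** Vanishing orders for several weights combine into one product bound. Induction on the sum of the
    orders: for an index [j] of positive order [g] is zero at [y j = 0], and its derivative in [y j]
    is a combination of those [pd i g] with [A j i > 0], whose order at [j] has dropped. *)
Lemma VanA_bound p (A : 'I_p -> 'I_n -> nat) (m : 'I_p -> nat) (r r' : R) g : r' < r ->
  Csm (box r) g -> (forall j : 'I_p, VanA (box r) (A j) (m j) g) ->
  exists2 C : R, 0 <= C & forall x (y : 'I_p -> R), (forall i, `|x 0 i| <= r') ->
    (forall j : 'I_p, 0 <= y j <= 1) -> `|g (mdil A y x)| <= C * \prod_j y j ^+ m j.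
Proof.
(* Truncated subtraction does no harm: when the order of [pd i g] reaches zero, the factor
   [t ^+ (A j i).-1] supplies the exponent alone. *)
move=> r'r; have hexp (u v : nat) : (0 < u)%N -> (v.-1 <= u.-1 + (v - u))%N by lia.
have [N] := ubnP (\sum_j m j); elim: N m g => // N IH m g mN gk gV.
have rW x : (forall i, `|x 0 i| <= r') -> box r x.
  by move=> xr i; apply: le_lt_trans r'r.
have oW : open (box r : set 'rV[R]_n) by exact: open_box.
have [m0|/forallPn[j mj0]] := boolP [forall j, m j == 0%N].
  have [C C0 CP] := closed_box_bounded rW (fun x => Csm_cont (x:=x) gk).
  exists C => // x y xr y01; rewrite big1 ?mulr1; first by apply: CP; exact: mdil_le.
  by move=> j _; rewrite (eqP (forallP m0 j)).
have mj : (0 < m j)%N by rewrite lt0n.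
have /choice[C CP] : forall i, exists C : R, 0 <= C /\ ((0 < A j i)%N -> forall x (y : 'I_p -> R), (forall i, `|x 0 i| <= r') ->
    (forall j : 'I_p, 0 <= y j <= 1) -> `|pd i g (mdil A y x)| <= C * \prod_j y j ^+ (m j - A j i)).
  move=> i; have [A0|Aji] := posnP (A j i); first by exists 0; split.
  have [|||C C0 CP] := IH (fun j => m j - A j i)%N (pd i g).
  - rewrite -ltnS; apply: leq_ltn_trans mN; rewrite (bigD1 j) //= [leqRHS](bigD1 j) //= -addSn.
    apply: leq_add; first by rewrite ltn_subrL Aji mj.
    by apply: leq_sum => k _; exact: leq_subr.
  - exact: Csm_pd.
  - by move=> k; exact: VanA_pd.
  by exists C; split.
pose K := \sum_i (A j i)%:R * C i * `|r'|.
have K0 : 0 <= K.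
  by apply: sumr_ge0 => i _; rewrite !mulr_ge0//; case: (CP i).
exists K => // x y xr y01.
pose yt (t : R) (k : 'I_p) := if k == j then t else y k.
pose c (t : R) := mdil A (yt t) x.
pose z i := (\prod_(k | k != j) y k ^+ A k i) * x 0 i.
have cE (t : R) i : c t 0 i = t ^+ A j i * z i.
  rewrite mxE (bigD1 j) //= /yt eqxx -mulrA; congr (_ * (_ * _)).
  by apply: eq_bigr => k kj; rewrite (negbTE kj).
have yt01 (t : R) : 0 <= t <= 1 -> forall k, 0 <= yt t k <= 1.
  by move=> t01 k; rewrite /yt; case: eqP.
have /andP[yj0 yj1] := y01 j.
have cW (t : R) : 0 <= t <= 1 -> box r (c t).
  by move=> t01; apply: rW => i; apply: mdil_le => //; exact: yt01.
have gE : g (mdil A y x) = g (c (y j)).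
  congr g; apply/rowP => i; rewrite !mxE; congr (_ * _); apply: eq_bigr => k _.
  by rewrite /yt; case: eqP => [->|].
have g0 : g (c 0) = 0.
  have [+ _] := gV j 0%N; apply => //; first by apply: cW; rewrite lexx ler01.
  by move=> i Aji; rewrite cE expr0n gtn_eqF // mul0r.
pose dc (t : R) : 'rV[R]_n := \row_i ((A j i)%:R * t ^+ (A j i).-1 * z i).
have dcP (t : R) i : is_derive t (1:R) (fun s => c s 0 i) (dc t 0 i).
  rewrite (_ : (fun s => _) = (fun s : R => s ^+ A j i * z i)); last by apply/funext => s; rewrite cE.
  by rewrite mxE; exact: is_derive_expM.
pose Y := \prod_(k | k != j) y k ^+ m k.
have Y0 : 0 <= Y by case/andP: (@prod01 _ (fun k => k != j) y m y01).
have dG (t : R) : 0 <= t <= 1 -> is_derive t (1:R) (fun s => g (c s)) (\sum_i dc t 0 i * pd i g (c t)).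
  by move=> t01; apply: (Csm_curve oW gk (cW _ t01)).
have dGb (t : R) : 0 < t < y j -> `|\sum_i dc t 0 i * pd i g (c t)| <= K * (y j ^+ (m j).-1 * Y).
  move=> /andP[t0 ty]; have t01 : 0 <= t <= 1 by rewrite !ltW // (lt_le_trans ty).
  apply: le_trans (ler_norm_sum _ _ _) _; rewrite /K mulr_suml; apply: ler_sum => i _.
  rewrite mxE; have [A0|Aji] := posnP (A j i).
    by rewrite A0 !mul0r normr0.
  have [C0 /(_ Aji) {}CP] := CP i; have {}CP := CP x (yt t) xr (yt01 _ t01).
  have -> : `|(A j i)%:R * t ^+ (A j i).-1 * z i * pd i g (c t)|
      = (A j i)%:R * (t ^+ (A j i).-1 * (`|z i| * `|pd i g (c t)|)).
    rewrite normrM [X in X * _]normrM [X in X * _ * _]normrM normr_nat.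
    by rewrite (ger0_norm (exprn_ge0 _ (ltW t0))) !mulrA.
  rewrite -!mulrA ler_wpM2l //.
  (* At the other indices [k], the powers [y k ^+ A k i] carried by the coordinate [i] restore what
     [pd i] has taken from the order at [k]. *)
  have zY : `|z i| * \prod_(k | k != j) y k ^+ (m k - A k i) <= `|r'| * Y.
    rewrite normrM mulrC mulrCA mulrA mulrC.
    rewrite [`|\prod_(k | _) _|]ger0_norm; last by case/andP: (@prod01 _ (fun k => k != j) y (fun k => A k i) y01).
    rewrite -big_split /=; apply: ler_pM => //.
    - by case/andP: (@prod01 _ (fun k => k != j) y (fun k => (A k i + (m k - A k i))%N) y01) => + _; under eq_bigr do rewrite exprD.
    - by apply: le_trans (xr i) _; exact: ler_norm.
    - apply: ler_prod => k _; have /andP[y0 y1] := y01 k.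
      apply/andP; split; first by rewrite mulr_ge0 ?exprn_ge0.
      by rewrite -exprD; apply: ler_wiXn2l => //; rewrite -leq_subLR.
  apply: (@le_trans _ _ (t ^+ (A j i).-1 * (`|z i| * (C i * \prod_k yt t k ^+ (m k - A k i))))).
    by rewrite ler_wpM2l ?exprn_ge0 ?(ltW t0)// ler_wpM2l.
  rewrite (bigD1 j) //= {1}/yt eqxx (eq_bigr (fun k => y k ^+ (m k - A k i))); last first.
    by move=> k kj; rewrite /yt (negbTE kj).
  rewrite [leLHS](_ : _ = C i * ((t ^+ (A j i).-1 * t ^+ (m j - A j i)) * (`|z i| * \prod_(k < p | k != j) y k ^+ (m k - A k i)))); last by ring.
  rewrite [leRHS](_ : _ = C i * (y j ^+ (m j).-1 * (`|r'| * Y))); last by ring.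
  rewrite ler_wpM2l // ler_pM // ?mulr_ge0 ?exprn_ge0 ?(ltW t0)//.
    by case/andP: (@prod01 _ (fun k => k != j) y (fun k => (m k - A k i)%N) y01).
  rewrite -exprD; apply: (@le_trans _ _ (t ^+ (m j).-1)).
    by apply: ler_wiXn2l; rewrite ?(ltW t0) ?hexp //; case/andP: t01.
  by apply: lerXn2r; rewrite ?nnegrE ?(ltW t0) ?(ltW ty).
have dG' (t : R) : 0 <= t <= y j -> is_derive t (1:R) (fun s => g (c s)) (\sum_i dc t 0 i * pd i g (c t)).
  by move=> /andP[t0 ty]; apply: dG; rewrite t0 (le_trans ty).
have := mvt_bound yj0 dG' dGb; rewrite g0 !subr0 -gE => H; apply: le_trans H _.
rewrite (bigD1 j) //= -[in leRHS](prednK mj) exprSr.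
by rewrite le_eqVlt; apply/orP; left; apply/eqP; rewrite /Y; ring.
Qed.

End Vanishing.

(** * From bounds along weighted curves to vanishing orders *)

Section Curves.
Context {R : realType} {n : nat}.
Implicit Types (g h : 'rV[R]_n -> R) (W : set 'rV[R]_n) (x : 'rV[R]_n) (i : 'I_n).
Implicit Types (a b : 'I_n -> nat).

Definition dil a (t : R) x : 'rV[R]_n := \row_i (t ^+ a i * x 0 i).

Lemma VanA_bound1 a m (r r' : R) g : r' < r -> Csm (box r) g -> VanA (box r) a m g ->
  exists2 C : R, 0 <= C & forall x (t : R), (forall i, `|x 0 i| <= r') ->
    0 <= t <= 1 -> `|g (dil a t x)| <= C * t ^+ m.
Proof.
move=> rr gk gV.
have [C C0 CP] := @VanA_bound R n 1 (fun=> a) (fun=> m) r r' g rr gk (fun=> gV).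
exists C => // x t xr t01; have := CP x (fun=> t) xr (fun=> t01).
rewrite big_ord1 (_ : mdil _ _ _ = dil a t x) //.
by apply/rowP => i; rewrite !mxE big_ord1.
Qed.

Lemma taylor2 W g x i (T K : R) : open W -> Csm W g -> 0 <= T ->
  (forall q : R, 0 <= q <= T -> W (x + q *: 'e_i)) ->
  (forall q : R, 0 <= q <= T -> `|pd i (pd i g) (x + q *: 'e_i)| <= K) ->
  `|g (x + T *: 'e_i) - g x - T * pd i g x| <= K * T * T.
Proof.
move=> oW gk T0 xW xK.
pose h (q : R) := g (x + q *: 'e_i) - q * pd i g x.
have hd (q : R) : 0 <= q <= T -> is_derive q (1:R) h (pd i g (x + q *: 'e_i) - pd i g x).
  move=> q0T.
  have d2 : is_derive q (1:R) (fun s : R => s * pd i g x) (pd i g x).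
    by apply: is_derive_eq; rewrite scaler0 add0r [_ *: _]mulr1.
  apply: (is_deriveB _ d2); apply: (@is_derive_line R 'rV[R]_n g x 'e_i q).
  exact: (Csm_der gk (xW _ q0T)).
have hb (q : R) : 0 < q < T -> `|pd i g (x + q *: 'e_i) - pd i g x| <= K * T.
  move=> /andP[q0 qT].
  have K0 : 0 <= K.
    by apply: le_trans (xK 0 _); rewrite ?lexx.
  apply: (@le_trans _ _ (K * q)); last by rewrite ler_wpM2l // ltW.
  have inT (t : R) : 0 <= t <= q -> 0 <= t <= T.
    by move=> /andP[-> tq] /=; rewrite (le_trans tq)// ltW.
  apply: (@mvt_dir R 'rV[R]_n (pd i g) x 'e_i q K (ltW q0)).
    by move=> t /inT tT; exact: (Csm_der (Csm_pd i gk) (xW _ tT)).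
  by move=> t /inT tT; exact: xK.
have := mvt_bound T0 hd hb; rewrite /h scale0r addr0 mul0r !subr0.
by rewrite addrAC.
Qed.

(** The radius [d] may depend on [x]: the class of [f] supplies a limit on each curve separately,
    without uniformity. *)
Definition ocurve a k g x := forall e : R, 0 < e -> exists2 d : R, 0 < d &
  forall t : R, 0 < t < d -> `|g (dil a t x)| <= e * t ^+ k.

Lemma dil_addZ a (t s : R) x i : dil a t (x + s *: 'e_i) = dil a t x + (s * t ^+ a i) *: 'e_i.
Proof.
apply/rowP => j; rewrite !mxE eqxx /= mulrDr; congr (_ + _).
by have [->|] := eqVneq j i; rewrite ?mulr1 ?mulr0// mulrC.
Qed.

Lemma box_dil r a (t : R) x : 0 <= t <= 1 -> box r x -> box r (dil a t x).
Proof.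
move=> /andP[t0 t1] xr i; rewrite mxE normrM; apply: le_lt_trans (xr i).
by rewrite ler_piMl// ger0_norm ?exprn_ge0// exprn_ile1.
Qed.

(** An interpolation argument that gets by without uniformity in [x]. Over a step of length
    [s t ^ a_i] in the direction [i], the Taylor remainder is controlled by the second derivative,
    whose size is known from [VanA]; a small fixed [s] makes it small relative to the step. The [o]
    estimate on [g] is then used on two curves only, those of [x] and of [x + s e_i]. *)
Lemma ocurve_pd (r : R) a k g i : Csm (box r) g -> VanA (box r) a k g -> (a i <= k)%N ->
  (forall x, box r x -> ocurve a k g x) ->
  forall x, box r x -> ocurve a (k - a i) (pd i g) x.
Proof.
move=> gk gV aik go x xr e e0.
have hk : (k <= k - a i - a i + a i + a i)%N by lia.
have oW : open (box r : set 'rV[R]_n) by exact: open_box.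
have [|e1 e10 e1P] := @fin_lb R 'I_n (fun i => r - `|x 0 i|).
  by move=> j; rewrite subr_gt0; exact: xr.
pose r' := r - e1 / 2.
have r'r : r' < r by rewrite /r'; lra.
have gV2 := VanA_pd i (VanA_pd i gV).
have [C C0 CP] := VanA_bound1 r'r (Csm_pd i (Csm_pd i gk)) gV2.
(* The first entry keeps the segment inside the box, the second makes the Taylor remainder at most
   half of the target. *)
pose s : R := Num.min (e1 / 2) (e / (2 * (C + 1))).
have s0 : 0 < s by rewrite lt_min !divr_gt0//; lra.
have se1 : s <= e1 / 2 by rewrite /s ge_min lexx.
have sC : C * s <= e / 2.
  have : s <= e / (2 * (C + 1)) by rewrite /s ge_min lexx orbT.
  rewrite ler_pdivlMr; last lra.
  nra.
have xs (q : R) : 0 <= q <= s -> forall j, `|(x + q *: 'e_i) 0 j| <= r'.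
  move=> /andP[q0 qs] j; rewrite !mxE eqxx /=; apply: le_trans (ler_normD _ _) _.
  have := e1P j; rewrite normrM (ger0_norm q0) /r'.
  by case: (j == i); rewrite ?normr1 ?normr0; lra.
have xsb (q : R) : 0 <= q <= s -> box r (x + q *: 'e_i).
  by move=> /xs qs j; apply: le_lt_trans r'r.
have e'0 : 0 < e * s / 4 by rewrite divr_gt0// mulr_gt0.
have [d1 d10 d1P] := go x xr _ e'0.
have s0s : 0 <= s <= s by rewrite lexx ltW.
have [d2 d20 d2P] := go _ (xsb s s0s) _ e'0.
exists (Num.min 1 (Num.min d1 d2)); first by rewrite !lt_min ltr01 d10.
move=> t /andP[t0]; rewrite !lt_min => /and3P[t1 td1 td2].
have {}d1P : `|g (dil a t x)| <= e * s / 4 * t ^+ k by apply: d1P; rewrite t0.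
have {}d2P : `|g (dil a t (x + s *: 'e_i))| <= e * s / 4 * t ^+ k by apply: d2P; rewrite t0.
have t01 : 0 <= t <= 1 by rewrite !ltW.
pose T : R := s * t ^+ a i.
have ta0 : 0 < t ^+ a i by rewrite exprn_gt0.
have T0 : 0 < T by rewrite mulr_gt0.
have qE (q : R) : dil a t x + q *: 'e_i = dil a t (x + (q / t ^+ a i) *: 'e_i).
  by rewrite dil_addZ divfK// gt_eqF.
have qs (q : R) : 0 <= q <= T -> 0 <= q / t ^+ a i <= s.
  move=> /andP[q0 qT]; rewrite divr_ge0 ?(ltW ta0)//=.
  by rewrite ler_pdivrMr.
have H : `|g (dil a t x + T *: 'e_i) - g (dil a t x) - T * pd i g (dil a t x)|
    <= C * t ^+ (k - a i - a i) * T * T.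
  apply: (@taylor2 (box r) g (dil a t x) i T (C * t ^+ (k - a i - a i)) oW gk (ltW T0)).
- move=> q /qs q0T; rewrite qE; apply: box_dil => //; exact: xsb.
- by move=> q /qs q0T; rewrite qE; apply: CP => //; exact: xs.
have {}d2P : `|g (dil a t x + T *: 'e_i)| <= e * s / 4 * t ^+ k by move: d2P; rewrite dil_addZ.
have tk : t ^+ k = t ^+ (k - a i) * t ^+ a i by rewrite -exprD subnK.
have H2 : C * t ^+ (k - a i - a i) * T * T <= C * s * s * t ^+ k.
  rewrite /T (_ : _ * _ * _ = C * s * s * (t ^+ (k - a i - a i) * t ^+ a i * t ^+ a i)); last by ring.
  rewrite ler_wpM2l ?mulr_ge0 ?(ltW s0)//.
  by rewrite -!exprD; apply: ler_wiXn2l; rewrite ?(ltW t0) ?(ltW t1).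
have H3 : T * `|pd i g (dil a t x)| <= e * s * t ^+ k.
  have -> : T * `|pd i g (dil a t x)| = `|T * pd i g (dil a t x)| by rewrite normrM (gtr0_norm T0).
  have tk0 : 0 <= t ^+ k by rewrite exprn_ge0 // ltW.
  have H4 : C * s * s * t ^+ k <= e / 2 * s * t ^+ k.
    by rewrite !ler_wpM2r // ltW.
  move: H d1P d2P H2; generalize (g (dil a t x + T *: 'e_i)) (g (dil a t x)) (T * pd i g (dil a t x)) => u v w H d1P d2P H2.
  have : `|w| <= `|u - v - w| + (`|u| + `|v|).
    have := ler_normB (u - v) (u - v - w); have := ler_normB u v.
    rewrite (_ : u - v - (u - v - w) = w); [lra|ring].
  have -> : e * s * t ^+ k = e * s / 4 * t ^+ k + e * s / 4 * t ^+ k + e / 2 * s * t ^+ k by field.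
  lra.
move: H3; rewrite /T tk (_ : e * s * _ = s * t ^+ a i * (e * t ^+ (k - a i))); last by ring.
by rewrite ler_pM2l.
Qed.

(** Improving the bound along curves from order [k] to [o(t ^ k)] gains one order. Points of the
    subspace in [Van] are fixed by the dilation, so for [k = 0] the hypothesis forces the value zero
    there; derivatives are handled by [ocurve_pd]. *)
Lemma Van_next (r : R) a k g : Csm (box r) g -> VanA (box r) a k g ->
  (forall x, box r x -> ocurve a k g x) -> VanA (box r) a k.+1 g.
Proof.
have v0 k' g' : VanA (box r) a k' g' -> (forall x, box r x -> ocurve a k' g' x) ->
    forall x, box r x -> (forall i, (0 < a i)%N -> x 0 i = 0) -> g' x = 0.
  move=> gV go x xr xa; case: (posnP k') => [k0|k0]; last by have [+ _] := gV 0%N; apply.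
  have xE (t : R) : dil a t x = x.
    apply/rowP => i; rewrite mxE; case: (posnP (a i)) => [->|/xa ->]; rewrite ?mulr0//.
    by rewrite expr0 mul1r.
  apply/eqP; rewrite -normr_le0; apply/ler_addgt0Pl => e e0; rewrite addr0.
  have [d d0 dP] := go x xr e e0; have := dP (d / 2).
  by rewrite xE k0 expr0 mulr1; apply; lra.
move=> + + + q; elim: q k g => [|q IH] k g gk gV go.
  by split => // _; exact: v0 gV go.
split => [_|i]; first exact: v0 gV go.
have [aik|kai] := leqP (a i) k; last first.
  by rewrite (_ : k.+1 - a i = 0)%N; [exact: Van_0|lia].
rewrite subSn //; apply: IH; [exact: Csm_pd|exact: VanA_pd|].
exact: ocurve_pd.
Qed.

(** For [k < l] a bound [O(t ^ l)] is [o(t ^ k)], so orders can be gained one by one up to [l]. This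
    converts the pointwise limits in the definition of the class into a vanishing order that also
    governs all derivatives. *)
Lemma Van_hat (r : R) a l g : Csm (box r) g ->
  (forall x, box r x -> exists M : R, exists2 d : R, 0 < d &
     forall t : R, 0 < t < d -> `|g (dil a t x)| <= M * t ^+ l) ->
  VanA (box r) a l g.
Proof.
move=> gk gO; suff : forall k, (k <= l)%N -> VanA (box r) a k g by apply.
elim=> [_|k IH kl]; first exact: VanA_0.
apply: Van_next => //; first by apply: IH; exact: ltnW.
move=> x xr e e0; have [M [d d0 dP]] := gO x xr.
pose M' := `|M| + 1.
have M'0 : 0 < M' by rewrite /M'; have := normr_ge0 M; lra.
exists (Num.min d (Num.min 1 (e / M'))); first by rewrite !lt_min d0 ltr01 divr_gt0.
move=> t /andP[t0]; rewrite !lt_min => /and3P[td t1 te].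
apply: le_trans (dP t _) _; first by rewrite t0.
have -> : l = (k + 1 + (l - k.+1))%N by lia.
rewrite !exprD expr1; have tk0 : 0 <= t ^+ k by rewrite exprn_ge0 // ltW.
have : t ^+ (l - k.+1) <= 1 by rewrite exprn_ile1 // ltW.
have : 0 <= t ^+ (l - k.+1) by rewrite exprn_ge0 // ltW.
generalize (t ^+ (l - k.+1)) => u u0 u1.
move: te; rewrite ltr_pdivlMr // => te.
rewrite (_ : M * _ = (M * t * u) * t ^+ k); last by ring.
rewrite ler_wpM2r //.
have : M <= M' by rewrite /M'; have := ler_norm M; lra.
move=> MM; apply: (@le_trans _ _ (M' * t * 1)); last by rewrite mulr1 mulrC ltW.
apply: (@le_trans _ _ (M' * t * u)); first by rewrite !ler_wpM2r // ltW.
by rewrite ler_wpM2l // mulr_ge0 // ltW.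
Qed.

End Curves.

(** * Taylor coefficients and initial forms *)

Section Taylor.
Context {R : realType} {n : nat}.
Implicit Types (g h : 'rV[R]_n -> R) (W : set 'rV[R]_n) (x : 'rV[R]_n) (i : 'I_n).
Implicit Types (a b al : 'I_n -> nat).

Lemma pderivs_congr W g h s : open W -> (forall y, W y -> g y = h y) ->
  forall y, W y -> pderivs g s y = pderivs h s y.
Proof.
move=> oW gh; elim: s => [|i s IH] //= y Wy.
exact: (eq_on_derive _ oW IH Wy).
Qed.

Lemma pderivs_sub W g h s : open W -> Csm W g -> Csm W h ->
  forall y, W y -> pderivs (fun x => g x - h x) s y = pderivs g s y - pderivs h s y.
Proof.
move=> oW gk hk; elim: s => [|i s IH] //= y Wy.
transitivity (pd i (fun x => pderivs g s x - pderivs h s x) y).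
  exact: (eq_on_derive _ oW IH Wy).
apply: deriveB; [exact: (Csm_der (Csm_pderivs s gk) Wy)|exact: (Csm_der (Csm_pderivs s hk) Wy)].
Qed.

Lemma pderivs_scale W g s (c : R) : open W -> Csm W g ->
  forall y, W y -> pderivs (fun x => c * g x) s y = c * pderivs g s y.
Proof.
move=> oW gk; elim: s => [|i s IH] //= y Wy.
transitivity (pd i (fun x => c * pderivs g s x) y).
  exact: (eq_on_derive _ oW IH Wy).
exact: (deriveZ _ (Csm_der (Csm_pderivs s gk) Wy)).
Qed.

Lemma pderivs_cst0 s y : pderivs (fun _ : 'rV[R]_n => 0) s y = 0 :> R.
Proof.
elim: s y => [|i s IH] //= y.
rewrite (_ : pderivs _ s = cst 0); last by apply/funext.
exact: derive_cst.
Qed.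

Lemma pderivs_sum W (I : Type) (r : seq I) (P : pred I) (G : I -> 'rV[R]_n -> R) s : open W ->
  (forall k, Csm W (G k)) ->
  forall y, W y -> pderivs (fun x => \sum_(k <- r | P k) G k x) s y = \sum_(k <- r | P k) pderivs (G k) s y.
Proof.
move=> oW Gk; elim: r => [|k r IH] y Wy.
  rewrite big_nil -[RHS](pderivs_cst0 s y).
  by apply: (pderivs_congr s oW) Wy => z _; rewrite big_nil.
rewrite big_cons; case Pk: (P k).
  rewrite -(IH y Wy).
  have Sk : Csm W (fun x => \sum_(j <- r | P j) G j x) by exact: Csm_sum.
  have Nk : Csm W (fun x => (-1) * \sum_(j <- r | P j) G j x) by exact: Csm_scale.
  transitivity (pderivs (fun x => G k x - (-1) * \sum_(j <- r | P j) G j x) s y).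
    by apply: (pderivs_congr s oW) Wy => z _; rewrite big_cons Pk mulN1r opprK.
  by rewrite (pderivs_sub s oW (Gk k) Nk Wy) (pderivs_scale s _ oW Sk Wy) mulN1r opprK.
by rewrite -(IH y Wy); apply: (pderivs_congr s oW) Wy => z _; rewrite big_cons Pk.
Qed.

Lemma pderivs_move W g i s1 s2 : open W -> Csm W g ->
  forall y, W y -> pderivs g (i :: s1 ++ s2) y = pderivs g (s1 ++ i :: s2) y.
Proof.
move=> oW gk; elim: s1 => [|j s1 IH] //= y Wy.
have C := Csm_pderivs (s1 ++ s2) gk.
transitivity (pd j (pd i (pderivs g (s1 ++ s2))) y); first exact: (schwarz j i oW C Wy).
exact: (eq_on_derive _ oW IH Wy).
Qed.

Lemma pderivs_perm W g s t : open W -> Csm W g -> perm_eq s t ->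
  forall y, W y -> pderivs g s y = pderivs g t y.
Proof.
move=> oW gk; elim: s t => [|i s IH] t.
  by rewrite perm_sym => /perm_nilP ->.
move=> st y Wy; have it : i \in t by rewrite -(perm_mem st) mem_head.
case/splitPr: it st => t1 t2 st.
have st' : perm_eq s (t1 ++ t2).
  by rewrite -(perm_cons i); apply: (perm_trans st); rewrite perm_catC /= perm_cons perm_catC.
rewrite -(pderivs_move i t1 t2 oW gk Wy).
exact: (eq_on_derive _ oW (IH _ st') Wy).
Qed.

Definition mono al x : R := \prod_i x 0 i ^+ al i.
Definition dec al i : 'I_n -> nat := fun j => (al j - (j == i))%N.

Lemma Csm_exp W g k : open W -> Csm W g -> Csm W (fun x => g x ^+ k).
Proof.
move=> oW gk; elim: k => [|k IH]; first by under eq_fun do rewrite expr0; exact: Csm_cst.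
by under eq_fun do rewrite exprS; exact: Csm_mul.
Qed.

Lemma Csm_mono W al : open W -> Csm W (mono al).
Proof.
move=> oW; rewrite /mono; elim: (index_enum _) => [|i r IH].
  by under eq_fun do rewrite big_nil; exact: Csm_cst.
under eq_fun do rewrite big_cons; apply: Csm_mul => //; apply: Csm_exp => //.
exact: Csm_coord.
Qed.

Lemma derive_of_line g x (v : 'rV[R]_n) (D : R) :
  is_derive (0 : R) (1 : R) (fun t : R => g (x + t *: v)) D -> 'D_v g x = D.
Proof.
move=> [_ <-]; rewrite /derive.
have E : (fun h : R => h^-1 *: ((g \o shift x) (h *: v) - g x)) =
    (fun h : R => h^-1 *: (((fun t : R => g (x + t *: v)) \o shift (0 : R)) (h *: (1 : R)) - g (x + (0 : R) *: v))).
  by apply/funext => h /=; rewrite scale0r !addr0 [h *: (1 : R)]mulr1 (addrC (h *: v) x).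
by rewrite E.
Qed.

Lemma pd_mono al i x : pd i (mono al) x = (al i)%:R * mono (dec al i) x.
Proof.
apply: derive_of_line.
pose c := \prod_(j | j != i) x 0 j ^+ al j.
have E : (fun t : R => mono al (x + t *: 'e_i)) = (fun t : R => (x 0 i + t *: 1) ^+ al i * c).
  apply/funext => t; rewrite /mono (bigD1 i) //= !mxE !eqxx; congr (_ * _).
  apply: eq_bigr => j ji; rewrite !mxE (negbTE ji) /= mulr0 addr0 //.
rewrite E.
have H := @is_derive_line R R (fun s : R => s ^+ al i * c) (x 0 i) 1 0.
have [Hd HD] := is_derive_expM (al i) c (x 0 i).
have {}H := H _; rewrite scale0r addr0 in H.
have {}H := H Hd; rewrite HD in H; apply: (is_derive_eq H).
rewrite -mulrA; congr (_ * _); rewrite /mono (bigD1 i) //= /dec eqxx subn1; congr (_ * _).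
by apply: eq_bigr => j ji; rewrite (negbTE ji) subn0.
Qed.

Lemma pderivs_mono al s : pderivs (mono al) s 0 =
  if [forall i, count_mem i s == al i] then (\prod_i (al i)`!)%:R else 0.
Proof.
elim/last_ind: s al => [|s i IH] al.
  rewrite /= /mono; case: ifPn => [/forallP H|/forallPn [i ai]].
    rewrite !big1 // => i _; first by rewrite -(eqP (H i)).
    by rewrite -(eqP (H i)) expr0.
  rewrite eq_sym in ai; rewrite (bigD1 i) //= mxE expr0n (negbTE ai) mul0r //.
rewrite pderivs_rcons.
rewrite (_ : pd i (mono al) = fun x => (al i)%:R * mono (dec al i) x); last first.
  by apply/funext => x; exact: pd_mono.
rewrite (pderivs_scale s _ (@openT 'rV[R]_n) (Csm_mono _ openT)) // IH.
have [ai0|ai0] := posnP (al i).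
  rewrite ai0 mul0r; case: ifPn => // /forallP/(_ i).
  by rewrite -cats1 count_cat /= eqxx ai0 addn1.
have -> : [forall j, count_mem j s == dec al i j] = [forall j, count_mem j (rcons s i) == al j].
  apply: eq_forallb => j; rewrite -cats1 count_cat /= addn0 /dec eq_sym.
  rewrite (eq_sym i j); have [->|] := eqVneq j i; first by rewrite subn1 addn1 -(prednK ai0) eqSS eq_sym.
  by rewrite subn0 addn0 eq_sym.
case: ifP => _; last by rewrite mulr0.
rewrite -natrM; congr (_%:R).
rewrite (bigD1 i) //= [RHS](bigD1 i) //= /dec eqxx subn1 mulnA; congr (_ * _)%N.
  by rewrite -{1 3}(prednK ai0) -factS.
by apply: eq_bigr => j ji; rewrite (negbTE ji) subn0.
Qed.

Lemma pderivs_taylor W g s : open W -> Csm W g -> W 0 ->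
  pderivs g s 0 = taylor_coef g (fun i => count_mem i s) * (\prod_i (count_mem i s)`!)%:R.
Proof.
move=> oW gk W0; rewrite /taylor_coef divfK; last first.
  rewrite pnatr_eq0 -lt0n; apply: prodn_gt0 => i; exact: fact_gt0.
apply: (pderivs_perm oW gk _ W0); apply/allP => i _ /=; apply/eqP.
rewrite count_flatten -map_comp sumnE big_map big_enum /= (bigD1 i) //= count_nseq /= eqxx mul1n.
by rewrite big1 ?addn0 // => j ji; rewrite count_nseq /= (negbTE ji) mul0n.
Qed.

(** With all weights positive the subspace in [Van] reduces to the origin, so the vanishing order is
    read off from the Taylor coefficients. *)
Lemma VanA_point W b m g : open W -> (forall i, (0 < b i)%N) ->
  (forall s, (\sum_(i <- s) b i < m)%N -> pderivs g s 0 = 0) -> VanA W b m g.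
Proof.
move=> oW b0 + k; elim: k m g => [|k IH] m g gs; split => //.
- move=> m0 x Wx xa; have -> : x = 0 by apply/rowP => i; rewrite xa ?mxE.
  by apply: (gs [::]); rewrite big_nil.
- move=> m0 x Wx xa; have -> : x = 0 by apply/rowP => i; rewrite xa ?mxE.
  by apply: (gs [::]); rewrite big_nil.
move=> i; apply: IH => s; rewrite ltn_subRL => sm; rewrite -pderivs_rcons; apply: gs.
by rewrite -cats1 big_cat /= big_seq1 addnC.
Qed.

Lemma sum_count b (s : seq 'I_n) : (\sum_(i <- s) b i = \sum_i b i * count_mem i s)%N.
Proof.
elim: s => [|j s IH]; first by rewrite big_nil big1 // => i _; rewrite muln0.
rewrite big_cons IH /= [RHS](eq_bigr (fun i => b i * (j == i) + b i * count_mem i s)%N); last first.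
  by move=> i _; rewrite mulnDr.
rewrite big_split /=; congr (_ + _)%N; rewrite (bigD1 j) //= eqxx muln1.
by rewrite big1 ?addn0// => i ij; rewrite eq_sym (negbTE ij) muln0.
Qed.

Section InitialForm.
Variables (f : 'rV[R]_n -> R) (b : 'I_n -> nat) (l : nat) (gam : set 'rV[R]_n) (N : nat).
Hypothesis b0 : forall i, (0 < b i)%N.
Hypothesis lN : (l < N)%N.
Hypothesis fl : forall al, taylor_coef f al != 0 -> (l <= \sum_i b i * al i)%N.
Hypothesis gam1 : forall al, taylor_coef f al != 0 -> (\sum_i b i * al i)%N = l -> gam (mi_pt al).
Hypothesis gam2 : forall al, gam (mi_pt al) -> (\sum_i b i * al i)%N = l.

Lemma fpart_mono x : fpart f gam N x =
  \sum_(al : {ffun 'I_n -> 'I_N} | `[< gam (mi_pt (fun i => (al i : nat))) >])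
    taylor_coef f (fun i => (al i : nat)) * mono (fun i => (al i : nat)) x.
Proof. by []. Qed.

Lemma Csm_fpart W : open W -> Csm W (fpart f gam N).
Proof.
move=> oW; apply: Csm_sum => // al _; apply: Csm_scale => //; exact: Csm_mono.
Qed.

(** Up to weight [l] the face part and [f] have the same derivatives at the origin: below weight [l]
    all coefficients vanish, and an exponent of weight [l] in the support lies in [gam]. *)
Lemma pderivs_fpart s : (\sum_(i <- s) b i < l.+1)%N ->
  pderivs (fpart f gam N) s 0 =
  taylor_coef f (fun i => count_mem i s) * (\prod_i (count_mem i s)`!)%:R.
Proof.
rewrite sum_count ltnS => sl.
(* Since the weights are positive, each entry of the multi-index is at most its weight, hence it
   occurs in the finite sum defining [fpart]. *)
have cN i : (count_mem i s < N)%N.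
  apply: leq_ltn_trans lN; apply: leq_trans sl; rewrite (bigD1 i) //=.
  apply: leq_trans (leq_addr _ _); exact: leq_pmull.
rewrite /fpart (pderivs_sum _ _ s (@openT 'rV[R]_n)) //; last first.
  by move=> al; apply: Csm_scale; [exact: openT|exact: (Csm_mono (fun i => (al i : nat)) openT)].
pose a0 : {ffun 'I_n -> 'I_N} := [ffun i => Ordinal (cN i)].
have a0E : (fun i => (a0 i : nat)) = (fun i => count_mem i s).
  by apply/funext => i; rewrite ffunE.
rewrite (eq_bigr (fun al : {ffun 'I_n -> 'I_N} => if al == a0 then
    taylor_coef f (fun i => count_mem i s) * (\prod_i (count_mem i s)`!)%:R else 0)); last first.
  move=> al _.
  rewrite (pderivs_scale s _ (@openT 'rV[R]_n) (Csm_mono (fun i => (al i : nat)) openT)) //.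
  rewrite pderivs_mono; have [->|ne] := eqVneq al a0.
    have -> : [forall i, count_mem i s == a0 i] by apply/forallP => i; rewrite ffunE.
    by rewrite a0E; congr (_ * _%:R); apply: eq_bigr => i _; rewrite ffunE.
  case: ifPn => [/forallP H|]; last by rewrite mulr0.
  case/eqP: ne; apply/ffunP => i; apply/val_inj; rewrite ffunE /=.
  by rewrite -(eqP (H i)).
rewrite -big_mkcondr /=.
have [c0|c0] := eqVneq (taylor_coef f (fun i => count_mem i s)) 0.
  by rewrite c0 mul0r big1.
have gs : gam (mi_pt (fun i => count_mem i s)).
  by apply: gam1 => //; apply/eqP; rewrite eqn_leq sl fl.
rewrite (big_pred1 a0) // => al /=; case: eqP => [->|]; rewrite ?andbF// andbT.
by rewrite a0E; apply/asboolP.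
Qed.

Lemma VanA_fpart W : open W -> W 0 -> Csm W f -> VanA W b l.+1 (fun x => f x - fpart f gam N x).
Proof.
move=> oW W0 fk; apply: VanA_point => // s sl.
rewrite (pderivs_sub s oW fk (Csm_fpart oW) W0) pderivs_fpart //.
by rewrite (pderivs_taylor s oW fk W0) subrr.
Qed.

Lemma mono_dil al (t : R) x : mono al (dil b t x) = t ^+ (\sum_i b i * al i)%N * mono al x.
Proof.
rewrite /mono expr_sum -big_split /=; apply: eq_bigr => i _.
by rewrite mxE exprMn exprM.
Qed.

Lemma th_mono i al x : th i (mono al) x = (al i)%:R * mono al x.
Proof.
rewrite /th pd_mono; have [->|a0] := posnP (al i); first by rewrite !mul0r mulr0.
rewrite mulrCA; congr (_ * _); rewrite /mono (bigD1 i) //= [RHS](bigD1 i) //=.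
rewrite mulrA (eq_bigr (fun j => x 0 j ^+ al j)); last by move=> j ji; rewrite /dec (negbTE ji) subn0.
by congr (_ * _); rewrite /dec eqxx subn1 -exprS prednK.
Qed.

Lemma th_fpart i x : th i (fpart f gam N) x =
  \sum_(al : {ffun 'I_n -> 'I_N} | `[< gam (mi_pt (fun i => (al i : nat))) >])
    taylor_coef f (fun i => (al i : nat)) * ((al i)%:R * mono (fun i => (al i : nat)) x).
Proof.
rewrite /th -[pd i _ x]/(pderivs (fpart f gam N) [:: i] x).
rewrite (pderivs_sum _ _ [:: i] (@openT 'rV[R]_n)) //; last first.
  by move=> al; apply: Csm_scale; [exact: openT|exact: (Csm_mono (fun i => (al i : nat)) openT)].
rewrite mulr_sumr; apply: eq_bigr => al _.
rewrite (pderivs_scale [:: i] _ (@openT 'rV[R]_n) (Csm_mono (fun i => (al i : nat)) openT)) //.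
rewrite mulrCA; congr (_ * _); exact: th_mono.
Qed.

Lemma fpart_dil (t : R) x : fpart f gam N (dil b t x) = t ^+ l * fpart f gam N x.
Proof.
rewrite !fpart_mono mulr_sumr; apply: eq_bigr => al /asboolP/gam2 al_l.
by rewrite mono_dil al_l mulrCA.
Qed.

Lemma th_fpart_dil i (t : R) x : th i (fpart f gam N) (dil b t x) = t ^+ l * th i (fpart f gam N) x.
Proof.
rewrite !th_fpart mulr_sumr; apply: eq_bigr => al /asboolP/gam2 al_l.
by rewrite mono_dil al_l; ring.
Qed.

End InitialForm.

End Taylor.

(** * The fan and the Newton polyhedron *)

(** Minimise [phi], the squared norm of the positive part of [w B], over the simplex. If the infimum
    is zero, near-minimisers give the second alternative. If it is [v > 0], the positive part [r] of
    a near-minimiser is the required vector: moving the weights slightly towards the vertex [j]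
    cannot bring [phi] below [v], which forces a positive pairing of [r] with the row [B j]. A
    near-minimiser suffices, so compactness of the simplex is not invoked. *)
Lemma approx_farkas (R : realType) (m n : nat) (B : 'I_m -> 'I_n -> R) : (0 < m)%N ->
  (exists2 a : 'I_n -> R, forall i, 0 <= a i & forall j, 0 < \sum_i B j i * a i) \/
  (forall e : R, 0 < e -> exists w : 'I_m -> R,
     [/\ forall j, 0 <= w j, \sum_j w j = 1 & forall i, \sum_j w j * B j i <= e]).
Proof.
move=> m0.
pose simp (w : 'I_m -> R) := (forall j, 0 <= w j) /\ \sum_j w j = 1.
pose pos (x : R) := Num.max 0 x.
have pos0 x : 0 <= pos x by rewrite le_max lexx.
have xpos x : x <= pos x by rewrite le_max lexx orbT.
have pos_sqr x y z : x <= y -> 0 <= y -> pos (x + z) ^+ 2 <= (y + z) ^+ 2.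
  move=> xy y0; rewrite -[leRHS]real_normK ?num_real // lerXn2r ?nnegrE//.
  by rewrite ge_max normr_ge0 (le_trans _ (ler_norm _))// lerD2r.
pose wB (w : 'I_m -> R) i := \sum_j w j * B j i.
pose phi w := \sum_i pos (wB w i) ^+ 2.
have phi0 w : 0 <= phi w by apply: sumr_ge0 => i _; exact: sqr_ge0.
pose E := [set phi w | w in simp].
have w0s : simp (fun j => if j == Ordinal m0 then 1 else 0).
  split; first by move=> j; case: ifP.
  by rewrite -big_mkcond big_pred1_eq.
have E0 : E !=set0 by exists (phi (fun j => if j == Ordinal m0 then 1 else 0)); eexists; [exact: w0s|].
have Elb : lbound E 0 by move=> _ [w _ <-].
have Ei : has_inf E by split => //; exists 0.
pose v := inf E.
have v0 : 0 <= v by exact: lb_le_inf.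
have vP w : simp w -> v <= phi w by move=> sw; apply: ge_inf; [exists 0|exists w].
have [v_eq0|vne0] := eqVneq v 0.
  right => e e0.
  have [_ [w [w1 w2] <-]] := inf_adherent (exprn_gt0 2 e0) Ei.
  rewrite -/v v_eq0 add0r => lt; exists w; split => // i.
  apply: le_trans (xpos _) _; rewrite -(@ler_pXn2r _ 2%N) ?nnegrE ?(ltW e0)//.
  apply: le_trans (ltW lt); rewrite /phi (bigD1 i) //= lerDl.
  by apply: sumr_ge0 => k _; exact: sqr_ge0.
left; have vgt0 : 0 < v by rewrite lt_def vne0.
have [K K0 KP] := @fin_ub R ('I_m * 'I_n)%type (fun ji => `|B ji.1 ji.2|).
pose C := n%:R * (2 * K) ^+ 2.
have C0 : 0 <= C by rewrite mulr_ge0// exprn_ge0// mulr_ge0.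
(* Step length of the perturbation. The quadratic error [h * C] is at most [v / 2], and [w] is
   chosen within [h * v] of the infimum, so that a positive amount, at least [v / 2], is left at the
   end. *)
pose h := Num.min 1 (v / (2 * (C + 1))).
have h0 : 0 < h by rewrite lt_min ltr01 divr_gt0//; lra.
have h1 : h <= 1 by rewrite ge_min lexx.
have hC : h * C <= v / 2.
  have : h <= v / (2 * (C + 1)) by rewrite ge_min lexx orbT.
  rewrite ler_pdivlMr; last lra.
  nra.
have hv0 : 0 < h * v by rewrite mulr_gt0.
have [_ [w [w1 w2] <-]] := inf_adherent hv0 Ei.
rewrite -/v => lt.
pose r i := pos (wB w i).
exists r => [i|j]; first exact: pos0.
pose w' k := w k + h * ((k == j)%:R - w k).
have w's : simp w'.
  split.
    move=> k; rewrite /w' (_ : _ + _ = (1 - h) * w k + h * (k == j)%:R); last by ring.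
    by rewrite addr_ge0 // mulr_ge0 // ?subr_ge0 // ltW.
  rewrite /w' big_split /= w2 -mulr_sumr big_split /= sumrN w2.
  rewrite -[X in X - 1]/(\sum_i (i == j)%:R) (bigD1 j) //= eqxx big1 ?addr0 ?subrr ?mulr0 ?addr0//.
  by move=> k /negbTE ->.
have zK i : `|B j i - wB w i| <= 2 * K.
  apply: le_trans (ler_normB _ _) _; rewrite mulr2n mulrDl mul1r.
  apply: lerD; first exact: (KP (j, i)).
  apply: le_trans (ler_norm_sum _ _ _) _.
  apply: (@le_trans _ _ (\sum_k w k * K)); last by rewrite -mulr_suml w2 mul1r.
  apply: ler_sum => k _; rewrite normrM (ger0_norm (w1 k)) ler_wpM2l//; exact: (KP (k, i)).
have E1 i : wB w' i = wB w i + h * (B j i - wB w i).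
  rewrite /wB /w' (eq_bigr (fun k => w k * B k i + h * ((k == j)%:R * B k i - w k * B k i))); last by move=> k _; ring.
  rewrite big_split /= -mulr_sumr big_split /= sumrN; congr (_ + _ * (_ - _)).
  rewrite (bigD1 j) //= eqxx mul1r big1 ?addr0// => k /negbTE ->; exact: mul0r.
have := vP _ w's => Hv.
have Hphi : phi w' <= phi w + 2 * h * (\sum_i r i * (B j i - wB w i)) + h * h * C.
  apply: (@le_trans _ _ (\sum_i (r i ^+ 2 + 2 * h * (r i * (B j i - wB w i)) + h * h * (2 * K) ^+ 2))).
    apply: ler_sum => i _; rewrite E1; apply: le_trans (pos_sqr _ (r i) _ (xpos _) (pos0 _)) _.
    have -> (u z : R) : (u + h * z) ^+ 2 = u ^+ 2 + 2 * h * (u * z) + h * h * z ^+ 2 by ring.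
    rewrite lerD2l ler_wpM2l ?mulr_ge0 ?(ltW h0)//.
    by rewrite -[leLHS]real_normK ?num_real// lerXn2r ?nnegrE ?mulr_ge0.
  rewrite !big_split /= -mulr_sumr lerD2l sumr_const card_ord -mulr_natl /C.
  by rewrite le_eqVlt; apply/orP; left; apply/eqP; ring.
have Hr : \sum_i r i * wB w i = phi w.
  apply: eq_bigr => i _; rewrite /r expr2 /pos maxEle; case: ifP => // _; rewrite ?mul0r //.
have Hs : \sum_i r i * (B j i - wB w i) = (\sum_i B j i * r i) - phi w.
  rewrite -Hr -sumrB; apply: eq_bigr => i _; ring.
rewrite Hs in Hphi.
have : h * (2 * (\sum_i B j i * r i)) >= h * (2 * phi w - v - h * C) by nra.
rewrite ler_pM2l // => H.
have pv := vP w (conj w1 w2); lra.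
Qed.

Section Fan.
Context {R : realType} {n : nat}.
Variables (f : 'rV[R]_n -> R) (Sig : seq (seq 'rV[int]_n)).
Hypothesis f0 : f 0 = 0.
Hypothesis df0 : forall i : 'I_n, 'D_('e_i : 'rV[R]_n) f 0 = 0.
Hypothesis Pne : newton f !=set0.
Hypothesis sub : simplicial_subdivision (newton f) Sig.

Let P := newton f.
Implicit Types (x y p u : 'rV[R]_n) (al be : 'I_n -> nat).
Definition insupp (al : 'I_n -> nat) := taylor_coef f al != 0.
Definition wt (a : 'rV[int]_n) : 'I_n -> nat := fun i => absz (a 0 i).
Definition wsum (a : 'rV[int]_n) : nat := (\sum_i wt a i)%N.
Definition gens := flatten Sig.

Lemma gensP a : reflect (exists2 s, s \in Sig & a \in s) (a \in gens).
Proof. exact: flattenP. Qed.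

Lemma newton_ge al x : insupp al -> (forall i, (al i)%:R <= x 0 i) -> P x.
Proof.
move=> sa ax; exists 1%N, (fun=> 1), (fun=> x); rewrite !big_ord1 scale1r.
by do !split => //; move=> j; exists al.
Qed.

Lemma newton_mi al : insupp al -> P (mi_pt al).
Proof. by move=> sa; apply: (newton_ge sa) => i; rewrite mxE. Qed.

Lemma dotC (u x : 'rV[R]_n) : dot u x = dot x u.
Proof. by apply: eq_bigr => i _; rewrite mulrC. Qed.

Lemma dot_suml (I : Type) (r : seq I) (c : I -> R) (u : I -> 'rV[R]_n) (x : 'rV[R]_n) :
  dot (\sum_(k <- r) c k *: u k) x = \sum_(k <- r) c k * dot (u k) x.
Proof.
rewrite /dot; under [RHS]eq_bigr do rewrite mulr_sumr.
rewrite exchange_big /=; apply: eq_bigr => i _.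
by rewrite summxE mulr_suml; apply: eq_bigr => k _; rewrite mxE mulrA.
Qed.

Lemma dot_le (u x y : 'rV[R]_n) : orthant u -> (forall i, x 0 i <= y 0 i) -> dot u x <= dot u y.
Proof. by move=> u0 xy; apply: ler_sum => i _; rewrite ler_wpM2l. Qed.

Lemma newton_lb (u : 'rV[R]_n) (c : R) x : orthant u ->
  (forall be, insupp be -> c <= dot u (mi_pt be)) -> P x -> c <= dot u x.
Proof.
move=> u0 uc [k [w [p [w0 [w1 [pA ->]]]]]].
rewrite dotC dot_suml -[leLHS]mul1r -w1 mulr_suml; apply: ler_sum => j _.
rewrite ler_wpM2l // dotC; have [al [sa ap]] := pA j.
by apply: le_trans (uc al sa) _; apply: dot_le => // i; rewrite mxE.
Qed.

Lemma newton_orthant x : P x -> orthant x.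
Proof.
move=> [k [w [p [w0 [w1 [pA ->]]]]]] i; rewrite summxE; apply: sumr_ge0 => j _.
rewrite mxE mulr_ge0 //; have [al [_ /(_ i)]] := pA j; exact: le_trans.
Qed.

Lemma supp_ex : exists al, insupp al.
Proof.
have [x [k [w [p [w0 [w1 [pA xE]]]]]]] := Pne.
case: k w p w0 w1 pA xE => [|k] w p w0 w1 pA _.
  by move: w1; rewrite big_ord0 => /eqP; rewrite eq_sym oner_eq0.
by have [al [sa _]] := pA ord0; exists al.
Qed.

Lemma supp_ge2 al : insupp al -> (2 <= \sum_i al i)%N.
Proof.
rewrite /insupp /taylor_coef => sa.
have sz : size (flatten [seq nseq (al i) i | i <- enum 'I_n]) = (\sum_i al i)%N.
  rewrite size_flatten /shape -map_comp sumnE big_map big_enum /=.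
  by apply: eq_bigr => i _; rewrite size_nseq.
case: (flatten _) sa sz => [|i [|j s]] /= sa <- //.
- by rewrite f0 mul0r eqxx in sa.
- by rewrite df0 mul0r eqxx in sa.
Qed.

Lemma cone_orthant s (u : 'rV[R]_n) : s \in Sig -> coneR s u -> orthant u.
Proof. by move=> sS su; have [_ [_ [_ [<- _]]]] := sub; exists s. Qed.

Lemma orthant_cone (u : 'rV[R]_n) : orthant u -> exists2 s, s \in Sig & coneR s u.
Proof. by have [_ [_ [_ [<- _]]]] := sub => -[s sS su]; exists s. Qed.

Lemma mem_cone s a : a \in s -> (coneR s : set 'rV[R]_n) (realv a).
Proof.
move=> as_; have ls : (index a s < size s)%N by rewrite index_mem.
exists (fun j => if j == Ordinal ls then 1 else 0); split.
  by move=> j; case: ifP.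
rewrite (bigD1 (Ordinal ls)) //= eqxx scale1r nth_index // big1 ?addr0//.
by move=> j /negbTE ->; rewrite scale0r.
Qed.

Lemma gens_ge0 a i : a \in gens -> 0 <= a 0 i.
Proof.
case/gensP => s sS as_; have := cone_orthant sS (mem_cone as_) i.
by rewrite mxE ler0z.
Qed.

Lemma wtE a i : a \in gens -> (wt a i : int) = a 0 i.
Proof. by move=> ag; rewrite /wt gez0_abs // gens_ge0. Qed.

Lemma realv_wt a i : a \in gens -> (realv a : 'rV[R]_n) 0 i = (wt a i)%:R.
Proof. by move=> ag; rewrite mxE -(wtE _ ag). Qed.

(** Expansion along the row: a common divisor of its entries divides the determinant, which is a
    unit. *)
Lemma primitive_row (M : 'M[int]_n) i : \det M = 1 \/ \det M = -1 -> primitive (row i M).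
Proof.
move=> dM k kM.
have : (k %| \det M)%Z.
  rewrite (expand_det_row M i); apply: rpred_sum => j _; apply: dvdz_mulr.
  by have := kM j; rewrite mxE.
have -> : (k %| \det M)%Z = (k %| 1)%Z by case: dM => ->; rewrite ?dvdzN.
by rewrite dvdz1 => /eqP; case: (intP k) => [|[|m]|[|m]] // _; [left|right].
Qed.

(** The completion of the skeleton to a basis has a dual covector with value 0 at [a] and 1 at the
    other generators; it is nonnegative on the cone and vanishes exactly on the ray. *)
Lemma cone_ray_face s a : unimodular s -> a \in s ->
  cone_face (coneR s : set 'rV[R]_n) (coneR [:: a]).
Proof.
move=> [us [M [dM sM]]] as_.
have /mapP[i0 _ aE] := sM _ as_.
pose MR : 'M[R]_n := map_mx intr M.
have MRu : MR \in unitmx.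
  by rewrite unitmxE /MR det_map_mx; case: dM => ->; rewrite ?rmorphN /= ?unitrN unitr1.
pose z : 'cV[R]_n := invmx MR *m (\col_i (i != i0)%:R).
have zM : MR *m z = \col_i (i != i0)%:R by rewrite mulKVmx.
pose c : 'rV[R]_n := z^T.
have cM i : dot c (realv (row i M)) = (i != i0)%:R.
  have /colP/(_ i) := zM; rewrite !mxE => <-.
  by apply: eq_bigr => j _; rewrite !mxE mulrC.
have cs j : j \in s -> dot c (realv j) = (j != a)%:R.
  move=> js; have /mapP[i _ jE] := sM _ js; rewrite jE cM aE.
  have [->|ne] := eqVneq i i0; first by rewrite eqxx.
  have [rE|//] := eqVneq (row i M) (row i0 M).
  have := cM i; rewrite rE cM eqxx ne /= => /eqP.
  by rewrite eq_sym oner_eq0.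
exists c; split.
  move=> x [w [w0 ->]]; rewrite dotC dot_suml; apply: sumr_ge0 => j _.
  by rewrite mulr_ge0 // dotC cs ?mem_nth // ler0n.
apply/seteqP; split => x.
  move=> [w [w0 ->]]; rewrite big_ord1 /=; split.
    have ls : (index a s < size s)%N by rewrite index_mem.
    exists (fun j => if j == Ordinal ls then w ord0 else 0); split.
      by move=> j; case: ifP.
    rewrite [RHS](bigD1 (Ordinal ls)) //= eqxx nth_index // big1 ?addr0//.
    by move=> j /negbTE ->; rewrite scale0r.
  have := cs _ as_; rewrite eqxx /hyper /= => ca.
  transitivity (w ord0 * dot c (realv a)); last by rewrite ca mulr0.
  by rewrite /dot mulr_sumr; apply: eq_bigr => i _; rewrite !mxE mulrCA.
move=> [[w [w0 xE]]]; rewrite /hyper /= => cx.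
have wj (j : 'I_(size s)) : nth 0 s j != a -> w j = 0.
  move=> ja; have : dot c x = \sum_j w j * (nth 0 s j != a)%:R.
    rewrite xE dotC dot_suml; apply: eq_bigr => k _; rewrite dotC cs ?mem_nth //.
  rewrite cx => /esym/eqP; rewrite psumr_eq0; last by move=> k _; rewrite mulr_ge0// ler0n.
  move=> /allP/(_ j); rewrite mem_index_enum ja mulr1 => /(_ isT)/implyP/(_ isT) /eqP //.
exists (fun _ => \sum_j w j); split; first by move=> _; apply: sumr_ge0.
rewrite big_ord1 /= xE scaler_suml; apply: eq_bigr => j _.
by have [->//|/wj ->] := eqVneq (nth 0 s j) a; rewrite !scale0r.
Qed.

Lemma gens_rays a : a \in gens -> rays R Sig a.
Proof.
case/gensP => s sS as_; have [uni [fac _]] := sub; split.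
  have [_ [M [dM sM]]] := uni s sS; have /mapP[i _ ->] := sM _ as_; exact: primitive_row.
exact: fac sS (cone_ray_face (uni s sS) as_).
Qed.

Lemma wsum_gt0 a : a \in gens -> (0 < wsum a)%N.
Proof.
move=> ag; rewrite lt0n; apply/eqP => /eqP; rewrite sum_nat_eq0 => /forallP az.
have [pa _] := gens_rays ag.
have : (2 : int) = 1 \/ (2 : int) = -1.
  apply: pa => i; have := az i; rewrite /wt absz_eq0 => /eqP ->; exact: dvdz0.
by case.
Qed.

Lemma dot_continuous (x : 'rV[R]_n) : continuous (fun u : 'rV[R]_n => dot u x).
Proof.
move=> u; apply: (cvg_bigsum (nbhs_filter u)) => i _.
by apply: cvgM; [exact: coord_continuous|exact: cvg_cst].
Qed.

(** A point [p] of the face attached to the cone minimises every functional of the dual cone, hence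
    by continuity every functional in its closure. Writing [p] as a convex combination, any term
    [q j] of positive weight is again a minimiser, and so is the support exponent below it, because
    the functionals are nonnegative. The choice of [j] is made before [u], so one exponent serves
    the whole cone. *)
Lemma alpha_ex s : s \in Sig -> exists al, insupp al /\ forall u : 'rV[R]_n, coneR s u ->
  (forall be, insupp be -> dot u (mi_pt al) <= dot u (mi_pt be)) /\
  lsupp P u = dot u (mi_pt al).
Proof.
move=> sS; have [_ [_ [_ [_ /(_ s sS) [g [gf sg]]]]]] := sub.
have [[p gp] [ga [gl [_ gE]]]] := gf.
have Pp : P p by move: gp; rewrite gE => -[].
have pmin u : coneR s u -> forall x, P x -> dot u p <= dot u x.
  move=> /sg ucl x Px; rewrite leNgt; apply/negP => lt.
  have cont : {for u, continuous (fun u : 'rV[R]_n => dot u p - dot u x)}.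
    by apply: continuousB; exact: dot_continuous.
  have lt0 : 0 < dot u p - dot u x by rewrite subr_gt0.
  have /continuous_rVP/(_ _ lt0)[r r0 rP] := cont.
  have nb : nbhs u [set y | 0 < dot y p - dot y x].
    apply: (rV_ball_near r0) => y /rP; rewrite /= ltr_norml => /andP[+ _]; lra.
  have [u' [[u'0 u'g] /=]] := ucl _ nb.
  have : (P `&` hyper u' (lsupp P u')) p by rewrite u'g.
  move=> [_]; rewrite /hyper /= => ->; rewrite subr_gt0; apply/negP; rewrite -leNgt.
  apply: ge_inf; last by exists x.
  exists 0 => _ [y Py <-]; apply: sumr_ge0 => i _; rewrite mulr_ge0 //; exact: newton_orthant.
have [k [w [q [w0 [w1 [qA pE]]]]]] := Pp.
have [j wj] : exists j, 0 < w j.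
  apply: contrapT => /forallNP H; have : \sum_j w j <= 0.
    by apply: sumr_le0 => j _; rewrite leNgt; apply/negP; exact: H.
  by rewrite w1 ler10.
have Pq i : P (q i) by have [be [sb bq]] := qA i; exact: (newton_ge sb bq).
have [al [sa aq]] := qA j.
exists al; split => // u su.
have u0 := cone_orthant sS su.
have eqj : dot u (q j) = dot u p.
  have : \sum_i w i * (dot u (q i) - dot u p) = 0.
    rewrite (eq_bigr (fun i => w i * dot u (q i) - w i * dot u p)); last by move=> i _; rewrite mulrBr.
    rewrite sumrB -mulr_suml w1 mul1r.
    have -> : dot u p = \sum_i w i * dot u (q i).
      by rewrite pE dotC dot_suml; apply: eq_bigr => i _; rewrite dotC.
    by rewrite subrr.
  move=> /eqP; rewrite psumr_eq0; last first.
    by move=> i _; rewrite mulr_ge0 // subr_ge0; exact: pmin.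
  move=> /allP/(_ j); rewrite mem_index_enum => /(_ isT) /implyP/(_ isT).
  by rewrite mulf_eq0 gt_eqF //= subr_eq0 => /eqP.
have alp : dot u (mi_pt al) <= dot u p.
  by rewrite -eqj; apply: dot_le => // i; rewrite mxE.
split.
  move=> be sb; apply: le_trans alp _; apply: pmin => //; exact: newton_mi.
apply/eqP; rewrite eq_le; apply/andP; split.
  apply: ge_inf; last by exists (mi_pt al) => //; exact: newton_mi.
  exists 0 => _ [y Py <-]; apply: sumr_ge0 => i _; rewrite mulr_ge0 //; exact: newton_orthant.
apply: lb_le_inf; first by exists (dot u p); exists p.
move=> _ [x Px <-]; exact: le_trans alp (pmin _ su _ Px).
Qed.

Definition alph (s : seq 'rV[int]_n) : 'I_n -> nat :=
  xget (fun=> 0%N) [set al | insupp al /\ forall u : 'rV[R]_n, coneR s u ->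
  (forall be, insupp be -> dot u (mi_pt al) <= dot u (mi_pt be)) /\
  lsupp P u = dot u (mi_pt al)].

Lemma alphP s : s \in Sig -> insupp (alph s) /\ forall u : 'rV[R]_n, coneR s u ->
  (forall be, insupp be -> dot u (mi_pt (alph s)) <= dot u (mi_pt be)) /\
  lsupp P u = dot u (mi_pt (alph s)).
Proof. by move=> sS; have := xgetPex (fun=> 0%N) (alpha_ex sS). Qed.

(** Truncation loses nothing on generators: by [lsuppE] the support function takes a natural value
    there. *)
Definition lw (a : 'rV[int]_n) : nat := Num.truncn (lsupp P (realv a)).

Lemma dot_wt a al : a \in gens -> dot (realv a) (mi_pt al) = (\sum_i wt a i * al i)%:R :> R.
Proof.
move=> ag; rewrite natr_sum; apply: eq_bigr => i _.
by rewrite (realv_wt _ ag) mxE natrM.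
Qed.

Lemma lwE s a : s \in Sig -> a \in s -> lw a = (\sum_i wt a i * alph s i)%N.
Proof.
move=> sS as_; have ag : a \in gens by apply/gensP; exists s.
have [_ /(_ _ (mem_cone as_)) [_ lE]] := alphP sS.
by rewrite /lw lE dot_wt // natrK.
Qed.

Lemma lsuppE a : a \in gens -> lsupp P (realv a) = (lw a)%:R.
Proof.
case/gensP => s sS as_; have ag : a \in gens by apply/gensP; exists s.
have [_ /(_ _ (mem_cone as_)) [_ ->]] := alphP sS.
by rewrite (lwE sS as_) dot_wt.
Qed.

Lemma lw_min a be : a \in gens -> insupp be -> (lw a <= \sum_i wt a i * be i)%N.
Proof.
case/gensP => s sS as_ sb; have ag : a \in gens by apply/gensP; exists s.
have [_ /(_ _ (mem_cone as_)) [+ _]] := alphP sS.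
by move=> /(_ be sb); rewrite !dot_wt // ler_nat -lwE.
Qed.

Lemma dval_set_lb t : P (const_mx t) -> 2 <= t * n%:R.
Proof.
move=> Pt; have : 2 <= dot (const_mx 1) (const_mx t : 'rV[R]_n).
  apply: (newton_lb _ _ Pt) => [i|be sb]; first by rewrite mxE.
  rewrite /dot (eq_bigr (fun i => (be i)%:R)); last by move=> i _; rewrite !mxE mul1r.
  by rewrite -natr_sum ler_nat supp_ge2.
rewrite /dot (eq_bigr (fun=> t)); last by move=> i _; rewrite !mxE mul1r.
by rewrite sumr_const card_ord mulr_natr.
Qed.

Lemma n_gt0 : (0 < n)%N.
Proof.
have [al sa] := supp_ex; have := supp_ge2 sa; case: n al {sa} => // al.
by rewrite big_ord0.
Qed.

Lemma dval_set_ne : exists t, P (const_mx t).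
Proof.
have [al sa] := supp_ex; have [C C0 CP] := @fin_ub R 'I_n (fun i => (al i)%:R).
by exists C; apply: (newton_ge sa) => i; rewrite mxE.
Qed.

Lemma dval_gt0 : 0 < dval P.
Proof.
have n0 : 0 < n%:R :> R by rewrite ltr0n n_gt0.
have : 2 / n%:R <= dval P.
  apply: lb_le_inf; first by have [t Pt] := dval_set_ne; exists t.
  by move=> t /dval_set_lb; rewrite ler_pdivrMr.
by apply: lt_le_trans; rewrite divr_gt0.
Qed.

Lemma dval_le t : P (const_mx t) -> dval P <= t.
Proof.
move=> Pt; apply: ge_inf => //; exists 0 => u /dval_set_lb.
have : 0 < n%:R :> R by rewrite ltr0n n_gt0.
nra.
Qed.

Lemma lsupp_dval (u : 'rV[R]_n) : orthant u -> lsupp P u <= dval P * \sum_i u 0 i.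
Proof.
move=> u0; have S0 : 0 <= \sum_i u 0 i by apply: sumr_ge0.
have lt t : P (const_mx t) -> lsupp P u <= t * \sum_i u 0 i.
  move=> Pt; rewrite (_ : t * _ = dot u (const_mx t)); last first.
    by rewrite mulrC mulr_suml; apply: eq_bigr => i _; rewrite mxE.
  apply: ge_inf; last by exists (const_mx t).
  exists 0 => _ [y Py <-]; apply: sumr_ge0 => i _; rewrite mulr_ge0 //; exact: newton_orthant.
have [S00|Sne] := eqVneq (\sum_i u 0 i) 0.
  by have [t Pt] := dval_set_ne; have := lt t Pt; rewrite S00 !mulr0.
have Spos : 0 < \sum_i u 0 i by rewrite lt_def Sne.
rewrite -ler_pdivrMr //; apply: lb_le_inf; first by have [t Pt] := dval_set_ne; exists t.
by move=> t /lt; rewrite ler_pdivrMr.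
Qed.

Lemma sum_realv a : a \in gens -> \sum_i (realv a : 'rV[R]_n) 0 i = (wsum a)%:R.
Proof. by move=> ag; rewrite natr_sum; apply: eq_bigr => i _; rewrite realv_wt. Qed.

Lemma sum_cone s (c : 'I_(size s) -> R) : s \in Sig ->
  \sum_i (\sum_j c j *: realv (nth 0 s j) : 'rV[R]_n) 0 i = \sum_j c j * (wsum (nth 0 s j))%:R.
Proof.
move=> sS; under eq_bigr do rewrite summxE; rewrite exchange_big /=; apply: eq_bigr => j _.
rewrite -sum_realv; last by apply/gensP; exists s; rewrite ?mem_nth.
by rewrite mulr_sumr; apply: eq_bigr => i _; rewrite !mxE.
Qed.

Lemma lw_dval a : a \in gens -> (lw a)%:R <= dval P * (wsum a)%:R.
Proof.
move=> ag; rewrite -(lsuppE ag) -(sum_realv ag); apply: lsupp_dval => i.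
by rewrite realv_wt.
Qed.

(** Otherwise a smaller value [t] still satisfies [l(a) <= t <a>] for all generators. In the
    alternative of [approx_farkas] for the vectors [alph s - (t, ..., t)], a separating [u]
    contradicts this inequality on the cone containing [u]; almost balancing weights put the
    diagonal point at [t + e / 2] into the polyhedron, against the minimality of [dval P]. *)
Lemma dval_attained : exists2 a, a \in gens & (lw a)%:R = dval P * (wsum a)%:R.
Proof.
apply: contrapT => noa.
have lt a : a \in gens -> (lw a)%:R < dval P * (wsum a)%:R.
  move=> ag; rewrite lt_neqAle lw_dval // andbT; apply/eqP => e; by apply: noa; exists a.
have [|e e0 eP] := @fin_lb R 'I_(size gens) (fun k => dval P - (lw (nth 0 gens k))%:R / (wsum (nth 0 gens k))%:R).
  move=> k; have kg : nth 0 gens k \in gens by rewrite mem_nth.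
  by rewrite subr_gt0 ltr_pdivrMr ?ltr0n ?wsum_gt0 // lt.
pose t := dval P - e.
have tP a : a \in gens -> (lw a)%:R <= t * (wsum a)%:R.
  move=> ag; have ks : (index a gens < size gens)%N by rewrite index_mem.
  have := eP (Ordinal ks); rewrite /= nth_index // => H.
  by rewrite -ler_pdivrMr ?ltr0n ?wsum_gt0 // /t; lra.
have S0 : (0 < size Sig)%N.
  have [|s sS _] := @orthant_cone 0; first by move=> i; rewrite mxE.
  by case: Sig sS.
have [[a a0 aB]|H] := @approx_farkas R (size Sig) n (fun j i => (alph (nth [::] Sig j) i)%:R - t) S0.
  pose u : 'rV[R]_n := \row_i a i.
  have [|s sS su] := @orthant_cone u; first by move=> i; rewrite mxE.
  have ks : (index s Sig < size Sig)%N by rewrite index_mem.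
  have := aB (Ordinal ks); rewrite /= nth_index // => pos.
  have [c [c0 uE]] := su.
  have : dot u (mi_pt (alph s)) <= t * \sum_i u 0 i.
    rewrite uE dot_suml sum_cone //.
    rewrite mulr_sumr; apply: ler_sum => j _.
    have js : nth 0 s j \in s by rewrite mem_nth.
    have jg : nth 0 s j \in gens by apply/gensP; exists s.
    by rewrite mulrCA ler_wpM2l // dot_wt // -(lwE sS js) tP.
  apply/negP; rewrite -ltNge -subr_gt0.
  rewrite (_ : _ - _ = \sum_i ((alph s i)%:R - t) * a i) //.
  rewrite /dot mulr_sumr -sumrB; apply: eq_bigr => i _; rewrite !mxE; ring.
have [w [w0 w1 wB]] := H (e / 2) ltac:(lra).
suff : P (const_mx (t + e / 2)) by move=> /dval_le; rewrite /t; lra.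
(* All exponents are translated by the same nonnegative slack [y]: they stay above the support, and
   their barycentre becomes the diagonal point. *)
pose y : 'rV[R]_n := const_mx (t + e / 2) - \sum_j w j *: mi_pt (alph (nth [::] Sig j)).
exists (size Sig), w, (fun j => mi_pt (alph (nth [::] Sig j)) + y); split => //; split => //; split.
  move=> j; have jS : nth [::] Sig j \in Sig by rewrite mem_nth.
  exists (alph (nth [::] Sig j)); split; first by have [] := alphP jS.
  move=> i; rewrite !mxE lerDl summxE subr_ge0.
  have := wB i; rewrite (eq_bigr (fun j => w j * (alph (nth [::] Sig j) i)%:R - w j * t)); last by move=> k _; ring.
  rewrite sumrB -mulr_suml w1 mul1r => H1.
  by rewrite (eq_bigr (fun j : 'I_(size Sig) => w j * (alph (nth [::] Sig j) i)%:R)); [lra|move=> k _; rewrite !mxE].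
under eq_bigr do rewrite scalerDr; rewrite big_split /= -scaler_suml w1 scale1r /y addrC subrK //.
Qed.

Lemma cand_polesP :
  cand_poles P Sig (- (dval P)^-1) /\ (forall r, cand_poles P Sig r -> r <= - (dval P)^-1).
Proof.
have d0 := dval_gt0.
split.
  have [a ag aE] := dval_attained.
  have w0 : 0 < (wsum a)%:R :> R by rewrite ltr0n wsum_gt0.
  exists 0%N, a; split; first exact: gens_rays.
  rewrite lsuppE // aE; split; first by rewrite mulr_gt0.
  have -> : \sum_i ((a 0 i)%:~R : R) = (wsum a)%:R.
    by rewrite -(sum_realv ag); apply: eq_bigr => i _; rewrite mxE.
  by rewrite addr0 invfM mulrCA divff ?mulr1// gt_eqF.
move=> r [nu [a [[_ [s sS sE]] [l0 ->]]]]; rewrite lerN2.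
have u0 : orthant (realv a : 'rV[R]_n).
  by apply: (cone_orthant sS); rewrite sE; apply: mem_cone; rewrite mem_head.
have := lsupp_dval u0.
have -> : \sum_i (realv a : 'rV[R]_n) 0 i = \sum_i ((a 0 i)%:~R : R).
  by apply: eq_bigr => i _; rewrite mxE.
move=> H; rewrite ler_pdivlMr // ler_pdivrMl //; apply: le_trans H _.
by rewrite ler_pM2l // lerDl.
Qed.

End Fan.

(** * Symbols in logarithmic coordinates *)

Lemma continuous_comp_rV (R : realType) (m n : nat) (X : 'rV[R]_m -> 'rV[R]_n) (g : 'rV[R]_n -> R) v :
  (forall i, {for v, continuous (fun v => X v 0 i)}) -> {for X v, continuous g} ->
  {for v, continuous (g \o X)}.
Proof.
move=> Xc /continuous_rVP gc; apply/continuous_rVP => e e0; have [r r0 rP] := gc e e0.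
have /choice[d dP] : forall i, exists d : R, 0 < d /\ forall y : 'rV[R]_m, (forall k, `|y 0 k - v 0 k| < d) -> `|X y 0 i - X v 0 i| < r.
  by move=> i; have /continuous_rVP/(_ r r0)[d d0 dP] := Xc i; exists d.
have [|d' d'0 d'P] := @fin_lb R 'I_n d; first by move=> i; case: (dP i).
exists d' => // y yv; apply: rP => i; have [_] := dP i; apply => k.
exact: lt_le_trans (yv k) (d'P i).
Qed.

Lemma is_derive_affine (R : realType) (a b t : R) :
  is_derive t (1 : R) (fun s : R => a - s * b) (- b).
Proof.
have d2 : is_derive t (1:R) (fun s : R => s * b) b.
  by apply: is_derive_eq; rewrite scaler0 add0r [_ *: _]mulr1.
have d3 := is_deriveB (is_derive_cst a t (1 : R)) d2.
by apply: (is_derive_eq d3); rewrite sub0r.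
Qed.

Lemma is_derive_expaff (R : realType) (a b t : R) :
  is_derive t (1 : R) (fun s : R => expR (a - s * b)) (- b * expR (a - t * b)).
Proof.
have d := @is_derive1_comp R expR (fun s : R => a - s * b) t _ _ (is_derive_expR _) (is_derive_affine a b t).
by apply: (is_derive_eq d); rewrite mulrC.
Qed.

Section Symbols.
Context {R : realType} {n : nat}.
Variable Sig : seq (seq 'rV[int]_n).
Hypothesis cover : forall v : 'rV[R]_n, orthant v -> exists2 s, s \in Sig & coneR s v.
Hypothesis gen0 : forall a i, a \in gens Sig -> 0 <= a 0 i.
Implicit Types (g h : 'rV[R]_n -> R) (v w : 'rV[R]_n) (mu nu : 'rV[int]_n -> int).

Definition Qp : set 'rV[R]_n := [set v | forall i, 0 < v 0 i].

Lemma open_Qp : open Qp.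
Proof.
rewrite openE => v v0; have [e e0 eP] := @fin_lb R 'I_n (fun i => v 0 i) v0.
apply: (rV_ball_near e0) => y yv i; have := yv i; have := eP i.
rewrite ltr_norml => ? /andP[]; lra.
Qed.

Definition wexp mu (s : seq 'rV[int]_n) (c : 'I_(size s) -> R) : R :=
  expR (- \sum_j c j * (mu (nth 0 s j))%:~R).

Definition cpt (s : seq 'rV[int]_n) (c : 'I_(size s) -> R) : 'rV[R]_n :=
  \sum_j c j *: realv (nth 0 s j).

(** The estimate is stated in the coordinates of each cone, while [mu] depends on the generators
    alone. A point on a common face satisfies the estimates of all cones containing it, so nothing
    has to be matched between cones. *)
Definition bnd mu g := exists2 C : R, 0 <= C & forall s, s \in Sig ->
  forall c : 'I_(size s) -> R, (forall j, 0 <= c j) -> Qp (cpt c) -> `|g (cpt c)| <= C * wexp mu c.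

Definition inc mu (a : 'rV[int]_n) : 'rV[int]_n -> int := fun b => mu b + (b == a)%:R.

Lemma wexpD mu nu s (c : 'I_(size s) -> R) : wexp (fun a => mu a + nu a) c = wexp mu c * wexp nu c.
Proof.
rewrite /wexp -expRD -opprD -big_split /=; congr (expR (- _)); apply: eq_bigr => j _.
by rewrite intrD mulrDr.
Qed.

Lemma wexpN mu s (c : 'I_(size s) -> R) : wexp (fun a => - mu a) c = (wexp mu c)^-1.
Proof.
rewrite /wexp -expRN opprK -sumrN; congr expR; apply: eq_bigr => j _.
by rewrite intrN mulrN opprK.
Qed.

Lemma wexp_gt0 mu s (c : 'I_(size s) -> R) : 0 < wexp mu c. Proof. exact: expR_gt0. Qed.

Lemma Qp_cpt v : Qp v -> exists2 s, s \in Sig & exists2 c : 'I_(size s) -> R,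
  (forall j, 0 <= c j) & v = cpt c.
Proof.
move=> v0; have [|s sS [c [c0 vE]]] := @cover v; first by move=> i; exact: ltW.
by exists s => //; exists c.
Qed.

Lemma bnd_congr mu g h : (forall v, Qp v -> g v = h v) -> bnd mu g -> bnd mu h.
Proof.
by move=> gh [C C0 CP]; exists C => // s sS c c0 Qc; rewrite -gh //; exact: CP.
Qed.

Lemma bnd_add mu g h : bnd mu g -> bnd mu h -> bnd mu (fun v => g v + h v).
Proof.
move=> [C C0 CP] [D D0 DP]; exists (C + D); first exact: addr_ge0.
move=> s sS c c0 Qc; apply: le_trans (ler_normD _ _) _.
by rewrite mulrDl lerD //; [exact: CP|exact: DP].
Qed.

Lemma bnd_mul mu nu g h : bnd mu g -> bnd nu h -> bnd (fun a => mu a + nu a) (fun v => g v * h v).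
Proof.
move=> [C C0 CP] [D D0 DP]; exists (C * D); first exact: mulr_ge0.
move=> s sS c c0 Qc; rewrite normrM wexpD mulrACA ler_pM //; [exact: CP|exact: DP].
Qed.

Lemma bnd_scale mu (k : R) g : bnd mu g -> bnd mu (fun v => k * g v).
Proof.
move=> [C C0 CP]; exists (`|k| * C); first exact: mulr_ge0.
by move=> s sS c c0 Qc; rewrite normrM -mulrA ler_wpM2l //; exact: CP.
Qed.

(** Depth [k] of the notion of symbol. The operator [- D_a - mu(a)] kills the leading behaviour
    [exp (- c mu(a))] in the direction [a]; the minus sign before [D_a] comes from [x_i] being a
    decreasing exponential in [v_i]. *)
Fixpoint Sk (k : nat) mu g : Prop :=
  (forall v, Qp v -> {for v, continuous g}) /\ bnd mu g /\
  (if k is k'.+1 then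
    (forall i : 'I_n, (forall v, Qp v -> derivable g v ('e_i : 'rV[R]_n)) /\ Sk k' mu (pd i g)) /\
    (forall a, a \in gens Sig -> (forall v, Qp v -> derivable g v (realv a)) /\
       Sk k' (inc mu a) (fun v => - 'D_(realv a) g v - (mu a)%:~R * g v))
   else True).

Definition Sym mu g := forall k, Sk k mu g.

Lemma Sk_cont k mu g v : Sk k mu g -> Qp v -> {for v, continuous g}.
Proof. by case: k => [|k] [+ _] => /[apply]. Qed.

Lemma Sk_bnd k mu g : Sk k mu g -> bnd mu g.
Proof. by case: k => [|k] [_ []]. Qed.

Lemma Sk_congr k mu g h : (forall v, Qp v -> g v = h v) -> Sk k mu g -> Sk k mu h.
Proof.
have oQ := open_Qp; elim: k mu g h => [|k IH] mu g h gh [gc [gb gd]]; split.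
- by move=> v Qv; exact: (eq_on_continuous oQ gh Qv (gc v Qv)).
- by split => //; exact: bnd_congr gb.
- by move=> v Qv; exact: (eq_on_continuous oQ gh Qv (gc v Qv)).
split; first exact: bnd_congr gb.
have [gd1 gd2] := gd; split => [i|a ag].
  have [d1 d2] := gd1 i; split; first by move=> v Qv; exact: (eq_on_derivable oQ gh Qv (d1 v Qv)).
  by apply: IH d2 => v Qv; exact: (eq_on_derive _ oQ gh Qv).
have [d1 d2] := gd2 a ag; split; first by move=> v Qv; exact: (eq_on_derivable oQ gh Qv (d1 v Qv)).
by apply: IH d2 => v Qv; rewrite (eq_on_derive _ oQ gh Qv) gh.
Qed.

Lemma Sk_S k mu g : Sk k.+1 mu g -> Sk k mu g.
Proof.
elim: k mu g => [|k IH] mu g [gc [gb [gd1 gd2]]]; first by [].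
split => //; split => //; split => [i|a ag].
  by have [d1 d2] := gd1 i; split => //; exact: IH.
by have [d1 d2] := gd2 a ag; split => //; exact: IH.
Qed.

Lemma Sk_mueq k mu nu g : mu = nu -> Sk k mu g -> Sk k nu g. Proof. by move=> ->. Qed.

Lemma Sk_add k mu g h : Sk k mu g -> Sk k mu h -> Sk k mu (fun v => g v + h v).
Proof.
elim: k mu g h => [|k IH] mu g h [gc [gb gd]] [hc [hb hd]]; split.
- by move=> v Qv; exact: (continuousD (gc _ Qv) (hc _ Qv)).
- by split => //; exact: bnd_add.
- by move=> v Qv; exact: (continuousD (gc _ Qv) (hc _ Qv)).
split; first exact: bnd_add.
have [gd1 gd2] := gd; have [hd1 hd2] := hd; split => [i|a ag].
  have [d1 d2] := gd1 i; have [e1 e2] := hd1 i; split.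
    by move=> v Qv; exact: (derivableD (d1 v Qv) (e1 v Qv)).
  apply: Sk_congr (IH _ _ _ d2 e2) => v Qv; symmetry; exact: (deriveD (d1 v Qv) (e1 v Qv)).
have [d1 d2] := gd2 a ag; have [e1 e2] := hd2 a ag; split.
  by move=> v Qv; exact: (derivableD (d1 v Qv) (e1 v Qv)).
apply: Sk_congr (IH _ _ _ d2 e2) => v Qv.
have -> : 'D_(realv a) (fun v => g v + h v) v = 'D_(realv a) g v + 'D_(realv a) h v.
  exact: (deriveD (d1 v Qv) (e1 v Qv)).
ring.
Qed.

Lemma Sk_scale k mu (r : R) g : Sk k mu g -> Sk k mu (fun v => r * g v).
Proof.
elim: k mu g => [|k IH] mu g [gc [gb gd]]; split.
- by move=> v Qv; apply: continuousM; [exact: cst_continuous|exact: gc].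
- by split => //; exact: bnd_scale.
- by move=> v Qv; apply: continuousM; [exact: cst_continuous|exact: gc].
split; first exact: bnd_scale.
have [gd1 gd2] := gd; split => [i|a ag].
  have [d1 d2] := gd1 i; split.
    by move=> v Qv; exact: (derivableZ (k:=r) (d1 v Qv)).
  apply: Sk_congr (IH _ _ d2) => v Qv; symmetry; exact: (deriveZ r (d1 v Qv)).
have [d1 d2] := gd2 a ag; split.
  by move=> v Qv; exact: (derivableZ (k:=r) (d1 v Qv)).
apply: Sk_congr (IH _ _ d2) => v Qv.
have -> : 'D_(realv a) (fun v => r * g v) v = r * 'D_(realv a) g v.
  exact: (deriveZ r (d1 v Qv)).
ring.
Qed.

Lemma inc_addl mu nu a : (fun b => inc mu a b + nu b) = inc (fun b => mu b + nu b) a.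
Proof. by apply/funext => b; rewrite /inc addrAC. Qed.

Lemma inc_addr mu nu a : (fun b => mu b + inc nu a b) = inc (fun b => mu b + nu b) a.
Proof. by apply/funext => b; rewrite /inc addrA. Qed.

Lemma derive_mul g h v w : derivable g v w -> derivable h v w ->
  'D_w (fun v => g v * h v) v = 'D_w g v * h v + g v * 'D_w h v.
Proof.
move=> dg dh; transitivity (g v *: 'D_w h v + h v *: 'D_w g v); first exact: (deriveM dg dh).
by rewrite addrC; congr (_ + _); exact: mulrC.
Qed.

(** Since orders add up, [- D_a - (mu + nu)(a)] obeys the Leibniz rule with the corresponding
    operators of the two factors, and raising one factor raises the product. *)
Lemma Sk_mul k mu nu g h : Sk k mu g -> Sk k nu h -> Sk k (fun a => mu a + nu a) (fun v => g v * h v).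
Proof.
elim: k mu nu g h => [|k IH] mu nu g h Hg Hh; have [gc [gb gd]] := Hg; have [hc [hb hd]] := Hh; split.
- by move=> v Qv; exact: (continuousM (gc _ Qv) (hc _ Qv)).
- by split => //; exact: bnd_mul.
- by move=> v Qv; exact: (continuousM (gc _ Qv) (hc _ Qv)).
split; first exact: bnd_mul.
have [gd1 gd2] := gd; have [hd1 hd2] := hd; split => [i|a ag].
  have [d1 d2] := gd1 i; have [e1 e2] := hd1 i; split.
    by move=> v Qv; exact: (derivableM (d1 v Qv) (e1 v Qv)).
  apply: Sk_congr (Sk_add (IH _ _ _ _ d2 (Sk_S Hh)) (IH _ _ _ _ (Sk_S Hg) e2)) => v Qv.
  by rewrite /pd derive_mul //; [exact: d1|exact: e1].
have [d1 d2] := gd2 a ag; have [e1 e2] := hd2 a ag; split.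
  by move=> v Qv; exact: (derivableM (d1 v Qv) (e1 v Qv)).
have A1 := Sk_mueq (inc_addl _ _ _) (IH _ _ _ _ d2 (Sk_S Hh)).
have A2 := Sk_mueq (inc_addr _ _ _) (IH _ _ _ _ (Sk_S Hg) e2).
apply: Sk_congr (Sk_add A1 A2) => v Qv.
rewrite derive_mul //; [|exact: d1|exact: e1].
rewrite intrD; ring.
Qed.

Definition lbnd mu g := exists2 C : R, 0 < C & forall s, s \in Sig ->
  forall c : 'I_(size s) -> R, (forall j, 0 <= c j) -> Qp (cpt c) -> C * wexp mu c <= `|g (cpt c)|.

Lemma lbnd_neq0 mu g v : lbnd mu g -> Qp v -> g v != 0.
Proof.
move=> [C C0 CP] Qv; have [s sS [c c0 vE]] := Qp_cpt Qv.
rewrite -normr_gt0 vE; rewrite vE in Qv; apply: lt_le_trans (CP s sS c c0 Qv).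
by rewrite mulr_gt0 // wexp_gt0.
Qed.

Lemma bnd_inv mu g : lbnd mu g -> bnd (fun a => - mu a) (fun v => (g v)^-1).
Proof.
move=> gl; have [C C0 CP] := gl; exists C^-1; first by rewrite invr_ge0 ltW.
move=> s sS c c0 Qc; rewrite wexpN normfV -invfM lef_pV2 ?CP //.
- by rewrite posrE normr_gt0; exact: lbnd_neq0 gl Qc.
- by rewrite posrE mulr_gt0 // wexp_gt0.
Qed.

Lemma derive_inv g v w : g v != 0 -> derivable g v w ->
  'D_w (fun v => (g v)^-1) v = - 'D_w g v * (g v)^-1 * (g v)^-1.
Proof.
move=> g0 dg; transitivity (- g v ^- 2 *: 'D_w g v); first exact: (deriveV g0 dg).
by rewrite [_ *: _]mulrC -mulrA -invfM -expr2 mulrN mulNr.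
Qed.

(** The raised function of [1 / g] is minus the raised function of [g] divided by [g ^ 2], so
    products and induction on the depth suffice once [1 / g] is bounded. *)
Lemma Sk_inv k mu g : lbnd mu g -> Sk k mu g -> Sk k (fun a => - mu a) (fun v => (g v)^-1).
Proof.
move=> gl; have gn0 v := @lbnd_neq0 mu g v gl.
have gib := bnd_inv gl.
elim: k => [|k IH] Hg; have [gc [gb gd]] := Hg; split.
- by move=> v Qv; apply: (continuousV (gn0 _ Qv)); exact: gc.
- by split.
- by move=> v Qv; apply: (continuousV (gn0 _ Qv)); exact: gc.
split => //.
have Ii := IH (Sk_S Hg).
have [gd1 gd2] := gd; split => [i|a ag].
  have [d1 d2] := gd1 i; split.
    by move=> v Qv; exact: (derivableV (gn0 _ Qv) (d1 v Qv)).
  have A := Sk_scale (-1) (Sk_mul (Sk_mul d2 Ii) Ii).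
  have E : (fun a => mu a + - mu a + - mu a) = (fun a => - mu a) by apply/funext => a; rewrite subrr add0r.
  apply: Sk_congr (Sk_mueq E A) => v Qv.
  rewrite /pd derive_inv ?gn0 //; [ring|exact: d1].
have [d1 d2] := gd2 a ag; split.
  by move=> v Qv; exact: (derivableV (gn0 _ Qv) (d1 v Qv)).
have A := Sk_scale (-1) (Sk_mul (Sk_mul d2 Ii) Ii).
have E : (fun b => inc mu a b + - mu b + - mu b) = inc (fun b => - mu b) a.
  by apply/funext => b; rewrite /inc; ring.
apply: Sk_congr (Sk_mueq E A) => v Qv.
rewrite derive_inv ?gn0 //; last exact: d1.
have := gn0 v Qv; rewrite intrN; generalize (g v) ('D_(realv a) g v) => x y x0; by field.
Qed.

Lemma Sym_add mu g h : Sym mu g -> Sym mu h -> Sym mu (fun v => g v + h v).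
Proof. by move=> G H k; exact: Sk_add. Qed.
Lemma Sym_scale mu r g : Sym mu g -> Sym mu (fun v => r * g v).
Proof. by move=> G k; exact: Sk_scale. Qed.
Lemma Sym_mul mu nu g h : Sym mu g -> Sym nu h -> Sym (fun a => mu a + nu a) (fun v => g v * h v).
Proof. by move=> G H k; exact: Sk_mul. Qed.
Lemma Sym_inv mu g : lbnd mu g -> Sym mu g -> Sym (fun a => - mu a) (fun v => (g v)^-1).
Proof. by move=> L G k; exact: Sk_inv. Qed.
Lemma Sym_pd mu g i : Sym mu g -> Sym mu (pd i g).
Proof. by move=> G k; have [_ [_ [/(_ i) [] ]]] := G k.+1. Qed.
Lemma Sym_der mu g i v : Sym mu g -> Qp v -> derivable g v ('e_i : 'rV[R]_n).
Proof. by move=> G Qv; have [_ [_ [/(_ i) [H _] _]]] := G 1%N; exact: H. Qed.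
Lemma Sym_dera mu g a v : a \in gens Sig -> Sym mu g -> Qp v -> derivable g v (realv a).
Proof. by move=> ag G Qv; have [_ [_ [_ /(_ a ag) [H _]]]] := G 1%N; exact: H. Qed.
Lemma Sym_raise mu g a : a \in gens Sig -> Sym mu g ->
  Sym (inc mu a) (fun v => - 'D_(realv a) g v - (mu a)%:~R * g v).
Proof. by move=> ag G k; have [_ [_ [_ /(_ a ag) []]]] := G k.+1. Qed.
Lemma Sym_mueq mu nu g : mu = nu -> Sym mu g -> Sym nu g. Proof. by move=> ->. Qed.
Lemma Sym_cont mu g v : Sym mu g -> Qp v -> {for v, continuous g}.
Proof. by move=> /(_ 0%N); exact: Sk_cont. Qed.
Lemma Sym_bnd mu g : Sym mu g -> bnd mu g.
Proof. by move=> /(_ 0%N); exact: Sk_bnd. Qed.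

Lemma Sk_0 k mu : Sk k mu (fun=> 0).
Proof.
have c0 v : {for v, continuous (fun _ : 'rV[R]_n => 0 : R)} by exact: cst_continuous.
have b0 nu : bnd nu (fun=> 0) by exists 0 => // s sS c _ _; rewrite normr0 mul0r.
elim: k mu => [|k IH] mu; split => //; split => //; split => [i|a ag]; split.
- by move=> v _; exact: derivable_cst.
- by rewrite (_ : pd i _ = fun=> 0) //; apply/funext => x; rewrite /pd derive_cst.
- by move=> v _; exact: derivable_cst.
- rewrite (_ : (fun v => _) = fun=> 0) //; apply/funext => x.
  have -> : 'D_(realv a) (fun _ : 'rV[R]_n => 0 : R) x = 0 by exact: derive_cst.
  by rewrite mulr0 !oppr0 addr0.
Qed.

Lemma Sym_sum mu (I : Type) (r : seq I) (G : I -> 'rV[R]_n -> R) :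
  (forall k, Sym mu (G k)) -> Sym mu (fun v => \sum_(k <- r) G k v).
Proof.
move=> GS; elim: r => [|k r IH].
  by under eq_fun do rewrite big_nil; move=> q; exact: Sk_0.
by under eq_fun do rewrite big_cons; apply: Sym_add.
Qed.

Lemma derive_line_is g v w (D : R) :
  is_derive (0 : R) (1 : R) (fun t : R => g (v + t *: w)) D -> is_derive v w g D.
Proof.
move=> H; constructor; last exact: derive_of_line.
apply/derivable1P; have [+ _] := H.
by rewrite (_ : (fun t : R => g (v + t *: w)) = (fun t : R => g (t *: w + v))) //; apply/funext => t; rewrite addrC.
Qed.

Lemma realv_gen a i : a \in gens Sig -> (realv a : 'rV[R]_n) 0 i = (wt a i)%:R.
Proof. by move=> ag; rewrite mxE /wt -[in LHS](gez0_abs (gen0 i ag)). Qed.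

Lemma cpt_coord s (c : 'I_(size s) -> R) i : s \in Sig ->
  cpt c 0 i = \sum_j c j * (wt (nth 0 s j) i)%:R.
Proof.
move=> sS; rewrite summxE; apply: eq_bigr => j _; rewrite mxE realv_gen //.
by apply/gensP; exists s; rewrite ?mem_nth.
Qed.

(** * Pullback of smooth functions to logarithmic coordinates *)

Section Pullback.
Variables (ep : 'rV[R]_n) (de r : R).
Hypothesis ep1 : forall i, `|ep 0 i| = 1.
Hypothesis de0 : 0 < de.
Hypothesis der : de < r.

Definition Xp v : 'rV[R]_n := \row_i (ep 0 i * de * expR (- v 0 i)).

Lemma Xp_box v : Qp v -> box r (Xp v).
Proof.
move=> v0 i; rewrite mxE !normrM ep1 mul1r (gtr0_norm de0) (gtr0_norm (expR_gt0 _)).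
apply: lt_trans der; rewrite gtr_pMr //; rewrite -expR0 ltr_expR oppr_lt0; exact: v0.
Qed.

Lemma is_derive_Xp v w i :
  is_derive (0 : R) (1 : R) (fun t : R => Xp (v + t *: w) 0 i) (- w 0 i * Xp v 0 i).
Proof.
pose k := ep 0 i * de.
have E : (fun t : R => Xp (v + t *: w) 0 i) = (fun t : R => k * expR (- v 0 i - t * w 0 i)).
  by apply/funext => t; rewrite !mxE opprD.
rewrite E mxE.
have d3 := is_deriveZ k (is_derive_expaff (- v 0 i) (w 0 i) 0).
by apply: (is_derive_eq d3); rewrite mul0r subr0 /= -/k [_ *: _]mulrCA.
Qed.

Lemma is_derive_pull g v w : Csm (box r) g -> Qp v ->
  is_derive v w (g \o Xp) (- \sum_i w 0 i * th i g (Xp v)).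
Proof.
move=> gk Qv; apply: derive_line_is.
have H := @Csm_curve R n (box r) g (fun t : R => Xp (v + t *: w)) (\row_i (- w 0 i * Xp v 0 i)) 0 (@open_box _ _ _) gk.
have {}H := H _ _; rewrite scale0r addr0 in H.
have {}H := H (Xp_box Qv) _.
have D : is_derive (0 : R) (1 : R) (fun t : R => g (Xp (v + t *: w))) (\sum_i (\row_i (- w 0 i * Xp v 0 i)) 0 i * pd i g (Xp v)).
  by apply: H => i; rewrite [X in is_derive _ _ _ X]mxE; exact: is_derive_Xp.
apply: (is_derive_eq D); rewrite -sumrN; apply: eq_bigr => i _; rewrite mxE /th; ring.
Qed.

Lemma Xp_cpt s (c : 'I_(size s) -> R) : s \in Sig ->
  Xp (cpt c) = mdil (fun j : 'I_(size s) => wt (nth 0 s j)) (fun j => expR (- c j)) (\row_i (ep 0 i * de)).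
Proof.
move=> sS; apply/rowP => i; rewrite !mxE mulrC; congr (_ * _).
rewrite cpt_coord // -sumrN expR_sum; apply: eq_bigr => j _.
by rewrite -mulNr mulrC -expRM_natl mulr_natl.
Qed.

(** On a cone [Xp] is [mdil] with parameters [exp (- c j)], and the product bound of [VanA_bound] is
    the exponential bound. *)
Lemma bnd_pull (m : 'rV[int]_n -> nat) g : Csm (box r) g ->
  (forall a, a \in gens Sig -> VanA (box r) (wt a) (m a) g) -> bnd (fun a => (m a)%:Z) (g \o Xp).
Proof.
move=> gk gV.
have /choice[C CP] : forall k : 'I_(size Sig), exists C : R, 0 <= C /\
    forall c : 'I_(size (nth [::] Sig k)) -> R, (forall j, 0 <= c j) ->
    `|g (Xp (cpt c))| <= C * wexp (fun a => (m a)%:Z) c.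
  move=> k; set s := nth [::] Sig k.
  have sS : s \in Sig by rewrite mem_nth.
  have [|C C0 CP] := @VanA_bound R n (size s) (fun j => wt (nth 0 s j)) (fun j => m (nth 0 s j)) r de g der gk.
    by move=> j; apply: gV; apply/gensP; exists s; rewrite ?mem_nth.
  exists C; split => // c c0; rewrite Xp_cpt //.
  apply: le_trans (CP _ _ _ _) _ => [i|j|].
  - by rewrite mxE normrM ep1 mul1r (gtr0_norm de0).
  - by rewrite ltW ?expR_gt0 //= -expR0 ler_expR oppr_le0.
  rewrite ler_wpM2l // /wexp -sumrN expR_sum le_eqVlt; apply/orP; left; apply/eqP.
  by apply: eq_bigr => j _; rewrite -mulNr mulrC -expRM_natl mulr_natl.
have [C' C'0 C'P] := @fin_ub R 'I_(size Sig) C.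
exists C' => // s sS c c0 _; have ks : (index s Sig < size Sig)%N by rewrite index_mem.
have := CP (Ordinal ks); rewrite /= nth_index // => -[_ /(_ c c0) H].
by apply: le_trans H _; rewrite ler_wpM2r ?(ltW (wexp_gt0 _ _)).
Qed.

(** Under the pullback [- D_a - m(a)] is the operator [Eu (wt a) - m(a)]: it gains one order at the
    weight [a] by [VanA_raise] and loses none at the other generators by [VanA_Eu]. This is what
    [m'] records. *)
Lemma Sk_pull k (m : 'rV[int]_n -> nat) g : Csm (box r) g ->
  (forall a, a \in gens Sig -> VanA (box r) (wt a) (m a) g) -> Sk k (fun a => (m a)%:Z) (g \o Xp).
Proof.
have oB : open (box r : set 'rV[R]_n) by exact: open_box.
have gc g' v : Csm (box r) g' -> Qp v -> {for v, continuous (g' \o Xp)}.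
  move=> gk Qv; apply: continuous_comp_rV; last by apply: (Csm_cont gk); exact: Xp_box.
  move=> i; rewrite (_ : (fun v => _) = (fun v : 'rV[R]_n => ep 0 i * de * expR (- v 0 i))); last first.
    by apply/funext => w; rewrite mxE.
  apply: continuousM; first exact: cst_continuous.
  apply: (@continuous_comp _ _ _ (fun v : 'rV[R]_n => - v 0 i) expR); last exact: continuous_expR.
  by apply: continuousN; exact: coord_continuous.
elim: k m g => [|k IH] m g gk gV; split.
- by move=> v; exact: gc.
- by split => //; exact: bnd_pull.
- by move=> v; exact: gc.
split; first exact: bnd_pull.
split => [i|a ag]; split.
- by move=> v Qv; have [] := is_derive_pull ('e_i) gk Qv.
- have H := Sk_scale (-1) (IH m (th i g) (Csm_th i oB gk) (fun a ag => VanA_th i oB gk (gV a ag))).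
  apply: Sk_congr H => v Qv; rewrite /pd; have [_ ->] := is_derive_pull ('e_i : 'rV[R]_n) gk Qv.
  rewrite mulN1r (bigD1 i) //= mxE !eqxx mul1r big1 ?addr0// => j ji.
  by rewrite mxE (negbTE ji) andbF mul0r.
- by move=> v Qv; have [] := is_derive_pull (realv a) gk Qv.
pose m' b := (m b + (b == a))%N.
have H := IH m' (fun x => Eu (wt a) g x - (m a)%:R * g x) _ _.
have {}H : Sk k (fun b => (m' b)%:Z) ((fun x => Eu (wt a) g x - (m a)%:R * g x) \o Xp).
  apply: H.
    rewrite (_ : (fun x => _) = (fun x => Eu (wt a) g x + (- (m a)%:R) * g x)); last first.
      by apply/funext => x; rewrite mulNr.
    by apply: Csm_add => //; [exact: Csm_Eu|exact: Csm_scale].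
  move=> b bg; rewrite /m'; have [->|ne] := eqVneq b a.
    by rewrite addn1; apply: VanA_raise => //; exact: gV.
  rewrite addn0; apply: (@VanA_congr _ _ _ _ _ (fun x => Eu (wt a) g x + (- (m a)%:R) * g x)) => //.
    by move=> y _; rewrite mulNr.
  apply: VanA_add => //; [exact: Csm_Eu|exact: Csm_scale| |].
    by apply: VanA_Eu => //; exact: gV.
  by apply: VanA_cstM => //; exact: gV.
have E : (fun b => (m' b)%:Z) = inc (fun a => (m a)%:Z) a.
  by apply/funext => b; rewrite /inc /m' PoszD; case: eqP.
apply: Sk_congr (Sk_mueq E H) => v Qv; have [_ ->] := is_derive_pull (realv a) gk Qv.
rewrite opprK /= /Eu -pmulrn; congr (_ - _); apply: eq_bigr => i _.
by rewrite realv_gen.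
Qed.

Lemma Sym_pull (m : 'rV[int]_n -> nat) g : Csm (box r) g ->
  (forall a, a \in gens Sig -> VanA (box r) (wt a) (m a) g) -> Sym (fun a => (m a)%:Z) (g \o Xp).
Proof. by move=> gk gV k; exact: Sk_pull. Qed.

End Pullback.
Definition jac v : R := expR (- \sum_i v 0 i).

Lemma is_derive_jac v w : is_derive v w jac (- (\sum_i w 0 i) * jac v).
Proof.
apply: derive_line_is.
have E : (fun t : R => jac (v + t *: w)) = (fun t : R => expR (- (\sum_i v 0 i) - t * \sum_i w 0 i)).
  apply/funext => t; rewrite /jac; congr expR; rewrite -opprD mulr_sumr -big_split /=.
  by congr (- _); apply: eq_bigr => i _; rewrite !mxE.
rewrite E.
have d2 := is_derive_expaff (- \sum_i v 0 i) (\sum_i w 0 i) 0.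
by apply: (is_derive_eq d2); rewrite mul0r subr0.
Qed.

Lemma sum_realv_gen a : a \in gens Sig -> \sum_i (realv a : 'rV[R]_n) 0 i = (wsum a)%:R.
Proof. by move=> ag; rewrite natr_sum; apply: eq_bigr => i _; rewrite realv_gen. Qed.

Lemma jac_cpt s (c : 'I_(size s) -> R) : s \in Sig -> jac (cpt c) = wexp (fun a => (wsum a)%:Z) c.
Proof.
move=> sS; congr (expR (- _)); under eq_bigr do rewrite cpt_coord //.
rewrite exchange_big /=; apply: eq_bigr => j _; rewrite -mulr_sumr; congr (_ * _).
by rewrite -pmulrn natr_sum.
Qed.

(** The Jacobian is an exact exponential, so its raised functions are identically zero. *)
Lemma Sk_jac k : Sk k (fun a => (wsum a)%:Z) jac.
Proof.
have jc v : {for v, continuous jac}.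
  apply: (@continuous_comp _ _ _ (fun v : 'rV[R]_n => - \sum_i v 0 i) expR); last exact: continuous_expR.
  apply: continuousN; apply: (cvg_bigsum (nbhs_filter v)) => i _; exact: coord_continuous.
have jb : bnd (fun a => (wsum a)%:Z) jac.
  exists 1 => // s sS c c0 _; rewrite mul1r jac_cpt // gtr0_norm // wexp_gt0 //.
elim: k => [|k IH]; split => //; split => //; split => [i|a ag]; split.
- by move=> v _; have [] := is_derive_jac v ('e_i).
- apply: Sk_congr (Sk_scale (-1) IH) => v _; rewrite /pd; have [_ ->] := is_derive_jac v ('e_i).
  rewrite (bigD1 i) //= mxE !eqxx big1 ?addr0// => j ji.
  by rewrite mxE (negbTE ji) andbF.
- by move=> v _; have [] := is_derive_jac v (realv a).
- apply: Sk_congr (Sk_0 k _) => v _; have [_ ->] := is_derive_jac v (realv a).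
  by rewrite sum_realv_gen // mulNr opprK -pmulrn subrr.
Qed.

Lemma Sym_jac : Sym (fun a => (wsum a)%:Z) jac.
Proof. by move=> k; exact: Sk_jac. Qed.

End Symbols.

(** * Lower bounds from nondegeneracy *)

Lemma mvt_dom (R : realType) (h dh E dE : R -> R) (a b : R) : a <= b ->
  (forall t : R, a <= t <= b -> is_derive t (1 : R) h (dh t)) ->
  (forall t : R, a <= t <= b -> is_derive t (1 : R) E (dE t)) ->
  (forall t : R, a <= t <= b -> `|dh t| <= dE t) ->
  `|h b - h a| <= E b - E a.
Proof.
move=> ab hd Ed le.
have mono (k dk : R -> R) : (forall t : R, a <= t <= b -> is_derive t (1 : R) k (dk t)) ->
    (forall t : R, a <= t <= b -> dk t <= 0) -> k b <= k a.
  move=> kd k0; have [||c] := @MVT_segment R k dk a b ab.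
  - by move=> x; rewrite in_itv/= => /andP[? ?]; apply: kd; rewrite !ltW.
  - by apply: derivable_within_continuous => x; rewrite in_itv/= => /kd[].
  rewrite in_itv/= => cab E1; rewrite -subr_le0 E1.
  by rewrite mulr_le0_ge0 ?k0 // subr_ge0.
have le' (t : R) : a <= t <= b -> - dE t <= dh t <= dE t.
  by move=> /le; rewrite ler_norml.
rewrite ler_norml; apply/andP; split.
  have H : - h b - E b <= - h a - E a.
    apply: (mono (fun t => - h t - E t) (fun t => - dh t - dE t)).
      by move=> t tab; apply: is_deriveB; [apply: is_deriveN; exact: hd|exact: Ed].
    by move=> t /le'; lra.
  lra.
have H : h b - E b <= h a - E a.
  apply: (mono (fun t => h t - E t) (fun t => dh t - dE t)).
    by move=> t tab; apply: is_deriveB; [exact: hd|exact: Ed].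
  by move=> t /le'; lra.
lra.
Qed.

Lemma exists_nat_gt (R : realType) (x : R) : exists K : nat, x < K%:R.
Proof.
exists (Num.Def.archi_bound `|x|); exact: le_lt_trans (ler_norm x) (archi_boundP (normr_ge0 x)).
Qed.

Section LowerBound.
Context {R : realType} {n : nat}.
Variable Sig : seq (seq 'rV[int]_n).
Hypothesis cover : forall v : 'rV[R]_n, orthant v -> exists2 s, s \in Sig & coneR s v.
Hypothesis gen0 : forall a i, a \in gens Sig -> 0 <= a 0 i.
Variable l : 'rV[int]_n -> nat.
Let li a := (l a)%:Z.
Variable s : seq 'rV[int]_n.
Hypothesis sS : s \in Sig.
Notation crd := ('I_(size s) -> R).

(** Division by the expected size leaves a bounded function of the cone coordinates; its limits as
    some [c j] go to infinity will be values of initial forms. *)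
Definition Hn (G : 'rV[R]_n -> R) (c : crd) : R := (wexp li c)^-1 * G (cpt c).

Lemma cpt_mono (c c' : crd) i : (forall j, c j <= c' j) -> cpt c 0 i <= cpt c' 0 i.
Proof.
move=> cc; rewrite !(cpt_coord gen0 _ _ sS); apply: ler_sum => j _.
by rewrite ler_wpM2r.
Qed.

Definition upd (c : crd) j (t : R) : crd := fun k => if k == j then t else c k.

(** The derivative of [Hn G] in [c j] is minus the raised function of [G] over [wexp], which is
    [O(exp (- c j))]. The right-hand side is the integral of this bound. *)
Lemma Hn_step G : Sym Sig li G -> exists2 C : R, 0 <= C & forall (c : crd) j (T : R),
  (forall j, 0 <= c j) -> Qp (cpt c) -> c j <= T ->
  `|Hn G (upd c j T) - Hn G c| <= C * (expR (- c j) - expR (- T)).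
Proof.
move=> GS.
have /choice[C CP] : forall j : 'I_(size s), exists C : R, 0 <= C /\
    forall c : crd, (forall j, 0 <= c j) -> Qp (cpt c) ->
    `|- 'D_(realv (nth 0 s j)) G (cpt c) - (li (nth 0 s j))%:~R * G (cpt c)| <= C * (wexp li c * expR (- c j)).
  move=> j; have jg : nth 0 s j \in gens Sig by apply/gensP; exists s; rewrite ?mem_nth.
  have [C C0 CP] := Sym_bnd (Sym_raise jg GS); exists C; split => // c c0 Qc.
  apply: le_trans (CP s sS c c0 Qc) _; rewrite ler_wpM2l // /wexp -expRD ler_expR -opprD lerN2.
  rewrite /inc [leRHS](eq_bigr (fun k => c k * (li (nth 0 s k))%:~R + c k * (nth 0 s k == nth 0 s j)%:R)); last first.
    by move=> k _; rewrite intrD mulrDr; congr (_ + _ * _); case: eqP.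
  rewrite big_split /= lerD2l (bigD1 j) //= eqxx mulr1 lerDl.
  by apply: sumr_ge0 => k _; rewrite mulr_ge0.
have [C' C'0 C'P] := @fin_ub R 'I_(size s) C.
exists C' => // c j T c0 Qc cT.
have jg : nth 0 s j \in gens Sig by apply/gensP; exists s; rewrite ?mem_nth.
pose a := nth 0 s j.
pose S := \sum_(k | k != j) c k * (li (nth 0 s k))%:~R : R.
pose z : 'rV[R]_n := \sum_(k | k != j) c k *: realv (nth 0 s k).
have cptE (t : R) : cpt (upd c j t) = z + t *: realv a.
  rewrite /cpt (bigD1 j) //= /upd eqxx addrC; congr (_ + _).
  by apply: eq_bigr => k /negbTE ->.
have wE (t : R) : (wexp li (upd c j t))^-1 = expR (S - t * (- (li a)%:~R)).
  have sE : \sum_k upd c j t k * (li (nth 0 s k))%:~R = t * (li a)%:~R + S.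
    by rewrite (bigD1 j) //= /upd eqxx; congr (_ + _); apply: eq_bigr => k /negbTE ->.
  by rewrite /wexp sE -expRN; congr expR; ring.
have ud : upd c j (c j) = c by apply/funext => k; rewrite /upd; case: eqP => [->|].
have u0 (t : R) : c j <= t <= T -> forall k, 0 <= upd c j t k.
  by move=> /andP[ct _] k; rewrite /upd; case: ifP => // _; exact: le_trans (c0 j) ct.
have Qt (t : R) : c j <= t <= T -> Qp (cpt (upd c j t)).
  move=> /andP[ct _] i; apply: lt_le_trans (Qc i) _; apply: cpt_mono => k.
  by rewrite /upd; case: eqP => [->|].
pose dF (t : R) := - ((wexp li (upd c j t))^-1 *
   (- 'D_(realv a) G (cpt (upd c j t)) - (li a)%:~R * G (cpt (upd c j t)))).
have dFP (t : R) : c j <= t <= T -> is_derive t (1:R) (fun t => Hn G (upd c j t)) (dF t).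
  move=> tT; rewrite /Hn.
  rewrite (_ : (fun t => _) = (fun t : R => expR (S - t * (- (li a)%:~R)) * G (z + t *: realv a))); last first.
    by apply/funext => q; rewrite wE cptE.
  have d1 := is_derive_expaff S (- (li a)%:~R) t.
  have Qz : Qp (z + t *: realv a) by rewrite -cptE; exact: Qt.
  have d2 := @is_derive_line R 'rV[R]_n G z (realv a) t (Sym_dera jg GS Qz).
  apply: (is_derive_eq (is_deriveM d1 d2)); rewrite /dF wE cptE.
  have E3 (e g d : R) : e * d + g * (- - (li a)%:~R * e) = - (e * (- d - (li a)%:~R * g)) by ring.
  exact: E3.
have dE (t : R) : is_derive t (1:R) (fun t : R => - (C' * expR (0 - t * 1))) (C' * expR (- t)).
  have d3 := is_deriveN (is_deriveZ C' (is_derive_expaff 0 1 t)).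
  by apply: (is_derive_eq d3); rewrite -[_ *: _]/(_ * _) sub0r mulr1; ring.
have := @mvt_dom R _ _ _ _ (c j) T cT dFP (fun t _ => dE t).
rewrite ud !sub0r !mulr1 => H.
have -> : C' * (expR (- c j) - expR (- T)) = - (C' * expR (- T)) - - (C' * expR (- c j)) by ring.
apply: H => t tT.
rewrite normrN normrM (gtr0_norm (_ : 0 < (wexp li (upd c j t))^-1)); last by rewrite invr_gt0 wexp_gt0.
rewrite ler_pdivrMl ?wexp_gt0 //.
have [_ /(_ _ (u0 t tT) (Qt t tT))] := CP j.
rewrite {4}/upd eqxx => H1; apply: le_trans H1 _.
by rewrite mulrCA ler_wpM2l ?(ltW (wexp_gt0 _ _))// ler_wpM2r ?expR_ge0.
Qed.

Lemma Hn_up G : Sym Sig li G -> exists2 C : R, 0 <= C & forall (c c' : crd),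
  (forall j, 0 <= c j) -> Qp (cpt c) -> (forall j, c j <= c' j) ->
  `|Hn G c' - Hn G c| <= C * \sum_j (expR (- c j) - expR (- c' j)).
Proof.
move=> GS; have [C C0 CP] := Hn_step GS; exists C => // c c' c0 Qc cc.
pose m (k : nat) : crd := fun j => if (j < k)%N then c' j else c j.
have cm k j : c j <= m k j by rewrite /m; case: ifP.
have step k : (k <= size s)%N -> `|Hn G (m k) - Hn G c| <=
   C * \sum_(j < size s | (j < k)%N) (expR (- c j) - expR (- c' j)).
  elim: k => [_|k IH ks].
    rewrite big_pred0 // mulr0 (_ : m 0%N = c) ?subrr ?normr0//; by apply/funext => j.
  pose jk := Ordinal ks.
  have mS : m k.+1 = upd (m k) jk (c' jk).
    apply/funext => j; rewrite /m /upd ltnS leq_eqVlt -val_eqE /=.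
    case: eqP => [jE|] //=; congr c'; exact: val_inj.
  rewrite (bigD1 jk) //= (eq_bigl (fun j : 'I_(size s) => (j < k)%N)); last first.
    by move=> j; rewrite -val_eqE /= ltnS ltn_neqAle andbC.
  rewrite mulrDr -(subrKA (Hn G (m k))); apply: le_trans (ler_normD _ _) _.
  apply: lerD (IH (ltnW ks)); rewrite mS.
  have mk : m k jk = c jk by rewrite /m ltnn.
  rewrite -mk; apply: CP.
  - by move=> j; exact: le_trans (c0 j) (cm k j).
  - by move=> i; apply: lt_le_trans (Qc i) _; exact: cpt_mono.
  - by rewrite mk.
have := step (size s) (leqnn _).
rewrite (eq_bigl xpredT); last by move=> j; rewrite ltn_ord.
by rewrite (_ : m _ = c') //; apply/funext => j; rewrite /m ltn_ord.
Qed.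

(** Lipschitz continuity in the variables [exp (- c j)], by which [Hn G] extends to a compact cube.
    Both points are joined to their coordinatewise maximum [d], because increasing coordinates keeps
    [cpt] inside [Qp], while decreasing them might not. *)
Lemma Hn_lip G : Sym Sig li G -> exists2 C : R, 0 <= C & forall (c c' : crd),
  (forall j, 0 <= c j) -> (forall j, 0 <= c' j) -> Qp (cpt c) -> Qp (cpt c') ->
  `|Hn G c' - Hn G c| <= C * \sum_j `|expR (- c' j) - expR (- c j)|.
Proof.
move=> GS; have [C C0 CP] := Hn_up GS; exists (2 * C); first by rewrite mulr_ge0.
move=> c c' c0 c'0 Qc Qc'.
pose d : crd := fun j => Num.max (c j) (c' j).
have H1 : `|Hn G d - Hn G c| <= C * \sum_j (expR (- c j) - expR (- d j)).
  by apply: CP => // j; rewrite /d le_max lexx.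
have H2 : `|Hn G d - Hn G c'| <= C * \sum_j (expR (- c' j) - expR (- d j)).
  by apply: CP => // j; rewrite /d le_max lexx orbT.
have le1 j : expR (- c j) - expR (- d j) <= `|expR (- c' j) - expR (- c j)|.
  rewrite /d maxEle; case: ifP => _; last by rewrite subrr.
  by rewrite distrC ler_norm.
have le2 j : expR (- c' j) - expR (- d j) <= `|expR (- c' j) - expR (- c j)|.
  by rewrite /d maxEle; case: ifP => _; [rewrite subrr|rewrite ler_norm].
rewrite (_ : Hn G c' - Hn G c = (Hn G d - Hn G c) - (Hn G d - Hn G c')); last by ring.
apply: le_trans (ler_normB _ _) _.
rewrite -mulrA mulr2n mulrDl mul1r; apply: lerD.
- by apply: le_trans H1 _; rewrite ler_wpM2l // ler_sum.
- by apply: le_trans H2 _; rewrite ler_wpM2l // ler_sum.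
Qed.

(** Compactness in the variables [exp (- c j)]. A sequence violating the bound has a cluster point
    in the unit cube, whose zero coordinates [I] are those escaping to infinity; near it all
    [Hn (G t)] are close to the limits [h], where [Phi] is positive. Since all coordinates of [cpt]
    go to infinity, each coordinate direction meets a generator of [I], and the faces concerned are
    the compact ones. *)
Lemma limit_lb p (G : 'I_p -> 'rV[R]_n -> R) (Phi : 'rV[R]_p -> R) :
  (forall t, Sym Sig li (G t)) -> continuous Phi ->
  (forall (I : pred 'I_(size s)) (cs : crd), (forall j, 0 <= cs j) ->
     (forall i, exists2 j, I j & (0 < wt (nth 0%R s j) i)%N) ->
     exists h : 'rV[R]_p, 0 < Phi h /\ forall t (e : R), 0 < e -> exists T0 : R, forall tau : R, T0 <= tau ->
       `|Hn (G t) (fun j => if I j then tau else cs j) - h 0 t| <= e) ->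
  exists N0 : R, exists2 c0 : R, 0 < c0 & forall c : crd, (forall j, 0 <= c j) ->
    (forall i, N0 <= cpt c 0 i) -> Qp (cpt c) -> c0 <= Phi (\row_t Hn (G t) c).
Proof.
move=> GS Pc lim; apply: contrapT => no.
have /choice[cs csP] : forall k : nat, exists c : crd, [/\ (forall j, 0 <= c j),
    (forall i, k%:R <= cpt c 0 i), Qp (cpt c) & Phi (\row_t Hn (G t) c) < k.+1%:R^-1].
  move=> k; apply: contrapT => nk; apply: no; exists k%:R, k.+1%:R^-1; first by rewrite invr_gt0.
  move=> c c0 cN Qc; rewrite leNgt; apply/negP => lt; apply: nk; by exists c.
pose y (k : nat) : 'rV[R]_(size s) := \row_j expR (- cs k j).
pose B : set 'rV[R]_(size s) := [set v | forall j, `[0, 1]%classic (v 0 j)].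
have cB : compact B by apply: (@rV_compact _ _ (fun=> `[(0:R), 1]%classic)) => _; exact: segment_compact.
have yB k : B (y k).
  move=> j; rewrite /= in_itv /= mxE expR_ge0 -expR0 ler_expR oppr_le0.
  by have [-> ] := csP k.
have yF : (y @ \oo) B by exists 0%N => // k _; exact: yB.
have [ys [Bys clu]] := cB _ _ yF.
have cluster (r : R) (K : nat) : 0 < r -> exists2 k : nat, (K <= k)%N & forall j, `|y k 0 j - ys 0 j| < r.
  move=> r0.
  have nb : nbhs ys [set v : 'rV[R]_(size s) | forall j, `|v 0 j - ys 0 j| < r] by exact: (rV_ball_near r0).
  have fb : (y @ \oo) [set v | exists2 k : nat, (K <= k)%N & v = y k].
    by exists K => // k Kk; exists k.
  by have [_ [[k Kk ->] yk]] := clu _ _ fb nb; exists k.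
pose I : pred 'I_(size s) := fun j => ys 0 j == 0.
have ys01 j : 0 <= ys 0 j <= 1 by have := Bys j; rewrite /= in_itv.
have yspos j : ~~ I j -> 0 < ys 0 j.
  by move=> Ij; case/andP: (ys01 j) => y0 _; rewrite lt_def y0 andbT.
pose cst j := - ln (ys 0 j).
have cst0 j : 0 <= cst j.
  by rewrite oppr_ge0 -ln1; case: (boolP (I j)) => [/eqP->|/yspos p0]; [rewrite ln0 ?ln1|rewrite ler_ln ?posrE //; case/andP: (ys01 j)].
(* Without an escaping generator in the direction [i], the coordinate [i] of [cpt (cs k)] would be
   at most [Bd] for indices [k] near the cluster point, although it is at least [k]. *)
have Ipos i : exists2 j, I j & (0 < wt (nth 0%R s j) i)%N.
  apply: contrapT => noI.
  have wI j : I j -> wt (nth 0%R s j) i = 0%N.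
    by move=> Ij; apply/eqP; rewrite -leqn0 leqNgt; apply/negP => w0; apply: noI; exists j.
  pose f j := if I j then 1 else ys 0 j / 2.
  have [|r r0 rP] := @fin_lb R 'I_(size s) f.
    by move=> j; rewrite /f; case: ifPn => // /yspos p0; rewrite divr_gt0.
  pose Bd := \sum_j (- ln (ys 0 j / 2)) * (wt (nth 0%R s j) i)%:R.
  have [K KP] := exists_nat_gt Bd.
  have [k Kk yk] := cluster r K r0.
  have [c0 /(_ i) cN _ _] := csP k.
  suff : cpt (cs k) 0 i <= Bd.
    move=> le; have := le_lt_trans (le_trans cN le) KP; rewrite ltr_nat ltnNge Kk //.
  rewrite (cpt_coord gen0 _ _ sS); apply: ler_sum => j _.
  have [Ij|Ij] := boolP (I j); first by rewrite wI // !mulr0.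
  rewrite ler_wpM2r // lerNr -[leRHS]expRK ler_ln ?posrE ?expR_gt0 ?divr_gt0 ?yspos //.
  have := yk j; have := rP j; rewrite /f (negbTE Ij) mxE ltr_norml => ? /andP[]; lra.
have [h [Ph hP]] := lim I cst cst0 Ipos.
have [r r0 rP] : exists2 r : R, 0 < r & forall z : 'rV[R]_p, (forall t, `|z 0 t - h 0 t| < r) -> Phi h / 2 < Phi z.
  have /continuous_rVP/(_ (Phi h / 2)) := Pc h.
  rewrite divr_gt0 // => /(_ isT)[r r0 rP]; exists r => // z /rP; rewrite ltr_norml => /andP[]; lra.
have /choice[C CP] : forall t, exists C : R, 0 <= C /\ forall (c c' : crd),
  (forall j, 0 <= c j) -> (forall j, 0 <= c' j) -> Qp (cpt c) -> Qp (cpt c') ->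
  `|Hn (G t) c' - Hn (G t) c| <= C * \sum_j `|expR (- c' j) - expR (- c j)|.
  by move=> t; have [C C0 CP] := Hn_lip (GS t); exists C.
have [C' C'0 C'P] := @fin_ub R 'I_p C.
pose S := (size s)%:R : R.
(* Chosen so that the Lipschitz estimate at distance [2 * q] in each coordinate is at most
   [r / 4]. *)
pose q := r / (8 * (C' + 1) * (S + 1)).
have S0 : 0 <= S by rewrite /S.
have q0 : 0 < q by rewrite divr_gt0 // !mulr_gt0 //; lra.
have /choice[T0 T0P] : forall t, exists T0 : R, forall tau : R, T0 <= tau ->
    `|Hn (G t) (fun j => if I j then tau else cst j) - h 0 t| <= r / 4.
  by move=> t; apply: hP; rewrite divr_gt0.
have [T1 T10 T1P] := @fin_ub R 'I_p T0.
pose tau := Num.max (T1 + 1) (- ln q).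
have tau0 : 0 < tau by rewrite lt_max; apply/orP; left; lra.
have tauq : expR (- tau) <= q.
  rewrite -[leRHS]lnK ?posrE // ler_expR lerNl /tau le_max lexx orbT //.
have [K KP] := exists_nat_gt (Phi h / 2)^-1.
have [k Kk yk] := cluster q K q0.
have [c0 _ Qc Pk] := csP k.
pose ct : crd := fun j => if I j then tau else cst j.
have ct0 j : 0 <= ct j by rewrite /ct; case: ifP => // _; exact: ltW.
have Qct : Qp (cpt ct).
  move=> i; have [j Ij wj] := Ipos i; rewrite (cpt_coord gen0 _ _ sS) (bigD1 j) //= {1}/ct Ij.
  rewrite ltr_pwDl // ?mulr_gt0 ?ltr0n //.
  by apply: sumr_ge0 => m _; rewrite mulr_ge0.
have dist j : `|expR (- cs k j) - expR (- ct j)| <= 2 * q.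
  have := yk j; rewrite mxE /ct; case: ifPn => Ij.
    rewrite (eqP Ij) subr0 => /ltW y1; apply: le_trans (ler_normB _ _) _.
    by rewrite mulr2n mulrDl mul1r lerD // ger0_norm ?expR_ge0.
  rewrite /cst opprK lnK ?posrE ?yspos // => /ltW y1; apply: le_trans y1 _; lra.
have sum_dist : \sum_j `|expR (- cs k j) - expR (- ct j)| <= S * (2 * q).
  apply: (@le_trans _ _ (\sum_(j < size s) (2 * q))); first exact: ler_sum.
  by rewrite sumr_const card_ord -[leLHS]mulr_natl.
have close t : `|Hn (G t) (cs k) - h 0 t| < r.
  have [C0 /(_ _ _ ct0 c0 Qct Qc) HC] := CP t.
  have H1 : `|Hn (G t) (cs k) - Hn (G t) ct| <= r / 4.
    apply: le_trans HC _; apply: (@le_trans _ _ (C' * (S * (2 * q)))).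
      apply: ler_pM => //; apply: sumr_ge0 => j _; exact: normr_ge0.
    have -> : r / 4 = (C' + 1) * ((S + 1) * (2 * q)).
      by rewrite /q; field; apply/andP; split; rewrite gt_eqF //; lra.
    have := mulr_ge0 C'0 (ltW q0); have := mulr_ge0 S0 (ltW q0).
    by move: (q) q0 => q' q'0 ? ?; nra.
  have H2 : `|Hn (G t) ct - h 0 t| <= r / 4.
    by apply: T0P; rewrite /tau le_max; apply/orP; left; have := T1P t; lra.
  rewrite -(subrKA (Hn (G t) ct)); apply: le_lt_trans (ler_normD _ _) _; lra.
have Pk2 : Phi h / 2 < Phi (\row_t Hn (G t) (cs k)) by apply: rP => t; rewrite mxE.
have k1 : k.+1%:R^-1 <= Phi h / 2 :> R.
  rewrite -[leRHS]invrK lef_pV2 ?posrE ?invr_gt0 ?divr_gt0 //.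
  by apply: le_trans (ltW KP) _; rewrite ler_nat (leq_trans Kk).
by have := lt_le_trans (lt_trans Pk2 Pk) k1; rewrite ltxx.
Qed.

End LowerBound.

Lemma VanA_mono (R : realType) (n : nat) (r : R) (a q : 'I_n -> nat) :
  VanA (box r) a (\sum_i a i * q i)%N (mono q : 'rV[R]_n -> R).
Proof.
apply: Van_hat; first by apply: Csm_mono; exact: open_box.
move=> x xr; exists `|mono q x|, 1 => // t /andP[t0 _].
by rewrite mono_dil normrM ger0_norm ?exprn_ge0 ?(ltW t0)// mulrC.
Qed.

Lemma continuous_into_rV (R : realType) (m n : nat) (X : 'rV[R]_m -> 'rV[R]_n) v :
  (forall i, {for v, continuous (fun v => X v 0 i)}) -> {for v, continuous X}.
Proof.
move=> Xc B /near_ball_rV[e e0 eB].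
have /choice[d dP] : forall i, exists d : R, 0 < d /\ forall y : 'rV[R]_m, (forall k, `|y 0 k - v 0 k| < d) -> `|X y 0 i - X v 0 i| < e.
  by move=> i; have /continuous_rVP/(_ e e0)[d d0 dP] := Xc i; exists d.
have [|d' d'0 d'P] := @fin_lb R 'I_n d; first by move=> i; case: (dP i).
apply: (rV_ball_near d'0) => y yv; apply: eB => i; have [_] := dP i; apply => k.
exact: lt_le_trans (yv k) (d'P i).
Qed.

(** * Vanishing orders of [f] and compact faces attached to cones *)

Section Hyps.
Context {R : realType} {n : nat}.
Variables (U : set 'rV[R]_n) (f : 'rV[R]_n -> R) (Sig : seq (seq 'rV[int]_n)).
Hypothesis oU : open U.
Hypothesis U0 : U 0.
Hypothesis sf : smooth_on U f.
Hypothesis f0 : f 0 = 0.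
Hypothesis df0 : forall i : 'I_n, 'D_('e_i : 'rV[R]_n) f 0 = 0.
Hypothesis Pne : newton f !=set0.
Hypothesis fhat : in_hatE U f.
Hypothesis fnd : nondeg_R U f.
Hypothesis sub : simplicial_subdivision (newton f) Sig.

Let P := newton f.
Let l := lw f.

Lemma box_in_U : exists2 r : R, 0 < r & box r `<=` U.
Proof.
have : nbhs (0 : 'rV[R]_n) U by apply: open_nbhs_nbhs; split.
move=> /near_ball_rV[r r0 rP]; exists r => // x xr; apply: rP => i.
by rewrite mxE subr0; exact: xr.
Qed.

Variable r : R.
Hypothesis r0 : 0 < r.
Hypothesis rU : box r `<=` U.

Lemma box_r0 : box r (0 : 'rV[R]_n). Proof. by move=> i; rewrite mxE normr0. Qed.

Lemma fsm : Csm (box r) f.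
Proof. by apply: (Csm_sub rU); apply/smooth_onP. Qed.

(** The pair [(a, l a)] defines a face, so the class provides a limit of [f] divided by [t ^ l] on
    each curve. Convergence gives the local bound that [Van_hat] requires. *)
Lemma fvan a : a \in gens Sig -> VanA (box r) (wt a) (l a) f.
Proof.
move=> ag; apply: Van_hat; first exact: fsm.
move=> x xr.
have av : valid P (realv a) ((l a)%:Z%:~R).
  move=> y Py; rewrite /= -pmulrn -(lsuppE sub ag); apply: ge_inf; last by exists y.
  exists 0 => _ [z Pz <-]; apply: sumr_ge0 => i _; rewrite mulr_ge0 //.
    by rewrite (realv_wt sub).
  exact: newton_orthant Pz i.
have gf : is_face P (P `&` hyper (realv a) (l a)%:Z%:~R).
  split; last by exists a, (l a)%:Z.
  case/gensP: (ag) => s sS as_; exists (mi_pt (alph f s)).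
  have [sa _] := alphP sub sS; split; first exact: newton_mi.
  by rewrite /hyper /= (dot_wt sub) // -(lwE sub sS as_) -pmulrn.
have := fhat gf; rewrite /admits_part => /(_ a (l a)%:Z (fun i => gens_ge0 sub i ag) _ av erefl x (rU xr)).
move=> /(_ isT) /cvg_ex[L].
move=> /cvgrPdist_lt/(_ 1 ltr01); rewrite near_withinE => /nbhs_ballP[d /= d0 dP].
exists (`|L| + 1), d => // t /andP[t0 td].
have {}dP : `|L - f (\row_i (t ^ a 0 i * x 0 i)) / t ^ l a| < 1.
  by apply: dP => //; rewrite /ball /= sub0r normrN gtr0_norm.
have fE : f (\row_i (t ^ a 0 i * x 0 i)) = f (dil (wt a) t x).
  by congr f; apply/rowP => i; rewrite !mxE -(wtE sub i ag).
have tl0 : 0 < t ^+ l a by rewrite exprn_gt0.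
rewrite fE -exprnP in dP; rewrite -ler_pdivrMr // -[X in _ / X](gtr0_norm tl0) -normf_div.
have := ler_normB (f (dil (wt a) t x) / t ^+ l a - L) (- L); rewrite opprK subrK normrN => H.
by apply: le_trans H _; rewrite addrC lerD2l distrC ltW.
Qed.

Lemma thvan i a : a \in gens Sig -> VanA (box r) (wt a) (l a) (th i f).
Proof.
by move=> ag; apply: VanA_th; [exact: open_box|exact: fsm|exact: fvan].
Qed.

Lemma monovan q a : insupp f q -> a \in gens Sig -> VanA (box r) (wt a) (l a) (mono q).
Proof.
move=> sq ag; apply: (@VanA_le _ _ _ _ (\sum_i wt a i * q i)%N); last exact: VanA_mono.
exact: (lw_min sub).
Qed.

Section Face.
Variables (s : seq 'rV[int]_n) (I : pred 'I_(size s)).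
Hypothesis sS : s \in Sig.
Hypothesis Ipos : forall i : 'I_n, exists2 j, I j & (0 < wt (nth 0%R s j) i)%N.

(** An integer vector in the relative interior of the cone spanned by the generators in [I]. By
    [Ipos] all its entries are positive, which makes the face it defines compact. *)
Definition fb : 'I_n -> nat := fun i => (\sum_(j | I j) wt (nth 0%R s j) i)%N.
Definition flb : nat := (\sum_(j | I j) l (nth 0%R s j))%N.

Lemma fb_gt0 i : (0 < fb i)%N.
Proof.
have [j Ij wj] := Ipos i; rewrite /fb (bigD1 j) //=; exact: leq_trans wj (leq_addr _ _).
Qed.

Lemma fb_dot q : (\sum_i fb i * q i = \sum_(j | I j) \sum_i wt (nth 0%R s j) i * q i)%N.
Proof.
rewrite exchange_big /=; apply: eq_bigr => i _; rewrite /fb big_distrl //.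
Qed.

Lemma sgens (j : 'I_(size s)) : nth 0 s j \in gens Sig.
Proof. by apply/gensP; exists s; rewrite ?mem_nth. Qed.

Lemma flbE : (\sum_i fb i * alph f s i = flb)%N.
Proof.
by rewrite fb_dot; apply: eq_bigr => j _; rewrite -(lwE sub sS) ?mem_nth.
Qed.

Lemma flb_min q : insupp f q -> (flb <= \sum_i fb i * q i)%N.
Proof.
move=> sq; rewrite fb_dot; apply: leq_sum => j _; apply: (lw_min sub) => //; exact: sgens.
Qed.

Definition fbi : 'rV[int]_n := \row_i (fb i : int).

Lemma dot_fbi q : dot (realv fbi) (mi_pt q) = (\sum_i fb i * q i)%:R :> R.
Proof.
rewrite natr_sum; apply: eq_bigr => i _; rewrite !mxE -pmulrn natrM //.
Qed.

Definition fgam : set 'rV[R]_n := P `&` hyper (realv fbi) (flb%:Z)%:~R.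

Lemma orthant_fbi : orthant (realv fbi : 'rV[R]_n).
Proof. by move=> i; rewrite !mxE. Qed.

Lemma fgam_face : is_face P fgam.
Proof.
split.
  exists (mi_pt (alph f s)); have [sa _] := alphP sub sS; split; first exact: newton_mi.
  by rewrite /hyper /= dot_fbi flbE -pmulrn.
exists fbi, flb; split => // x Px; rewrite /= -pmulrn.
apply: (newton_lb orthant_fbi _ Px) => be sb.
by rewrite dot_fbi ler_nat flb_min.
Qed.

Lemma fgam_lt y i : fgam y -> y 0 i < flb.+1%:R.
Proof.
move=> [Py]; rewrite /hyper /= -pmulrn => yE.
have y0 := newton_orthant Py.
have : y 0 i <= dot (realv fbi) y.
  rewrite /dot (bigD1 i) //= !mxE -pmulrn.
  apply: le_trans (_ : (fb i)%:R * y 0 i <= _); first by rewrite ler_peMl ?y0 // ler1n fb_gt0.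
  by rewrite lerDl; apply: sumr_ge0 => j _; rewrite mulr_ge0 ?y0 // !mxE.
by rewrite yE => /le_lt_trans; apply; rewrite ltr_nat.
Qed.

Lemma fgam1 q : insupp f q -> (\sum_i fb i * q i)%N = flb -> fgam (mi_pt q).
Proof.
move=> sq qE; split; first exact: newton_mi.
by rewrite /hyper /= dot_fbi qE -pmulrn.
Qed.

Lemma fgam2 q : fgam (mi_pt q) -> (\sum_i fb i * q i)%N = flb.
Proof.
by move=> [_]; rewrite /hyper /= dot_fbi -pmulrn => /eqP; rewrite eqr_nat => /eqP.
Qed.

(** As all weights [fb i] are positive, only finitely many exponents lie on the face, and the face
    is their convex hull. It is exhibited as a linear image of [A], the compact set of convex
    weights that vanish outside the exponents selected by [ok]. *)
Lemma fgam_compact : compact fgam.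
Proof.
pose T := {ffun 'I_n -> 'I_flb.+1}.
pose ok (al : T) := `[< insupp f (fun i => al i : nat) /\ (\sum_i fb i * al i)%N = flb >].
pose m := #|{: T}|.
pose B : set 'rV[R]_m := [set w | forall k, `[0, 1]%classic (w 0 k)].
have cB : compact B by apply: (@rV_compact _ _ (fun=> `[(0:R), 1]%classic)) => _; exact: segment_compact.
pose hh (w : 'rV[R]_m) : R := `|\sum_k w 0 k - 1| + \sum_(k | ~~ ok (enum_val k)) `|w 0 k|.
have c1 (w : 'rV[R]_m) : {for w, continuous (fun w : 'rV[R]_m => \sum_k w 0 k - 1)}.
  apply: continuousB; last exact: cst_continuous.
  by apply: (cvg_bigsum (nbhs_filter w)) => i _; exact: coord_continuous.
have c2 (w : 'rV[R]_m) : {for w, continuous (fun w : 'rV[R]_m => `|\sum_k w 0 k - 1|)}.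
  by apply: (continuous_comp (c1 w)); exact: norm_continuous.
have c3 (w : 'rV[R]_m) : {for w, continuous (fun w : 'rV[R]_m => \sum_(k | ~~ ok (enum_val k)) `|w 0 k|)}.
  apply: (cvg_bigsum (nbhs_filter w)) => i _.
  apply: (@continuous_comp _ _ _ (fun w : 'rV[R]_m => w 0 i) (@Num.norm R R)); last exact: norm_continuous.
  exact: coord_continuous.
have chh : continuous hh by move=> w; exact: (continuousD (c2 w) (c3 w)).
have clh : closed (hh @^-1` [set 0]).
  by apply: closed_comp => [x _|]; [exact: chh|exact: closed_eq].
pose A := hh @^-1` [set 0] `&` B.
have cA : compact A.
  apply: (@subclosed_compact _ _ B) => //; last by move=> x [].
  by apply: closedI => //; exact: compact_closed.
pose Phi (w : 'rV[R]_m) : 'rV[R]_n := \sum_k w 0 k *: mi_pt (fun i => (enum_val k : T) i : nat).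
have cPhi : {within A, continuous Phi}.
  apply: continuous_subspaceT => w; apply: continuous_into_rV => i.
  have -> : (fun w => Phi w 0 i) = (fun w : 'rV[R]_m => \sum_k w 0 k * mi_pt (fun i => (enum_val k : T) i : nat) 0 i).
    by apply/funext => u; rewrite /Phi summxE; apply: eq_bigr => k _; rewrite mxE.
  apply: (cvg_bigsum (nbhs_filter w)) => k _.
  by apply: cvgM; [exact: coord_continuous|exact: cvg_cst].
have -> : fgam = Phi @` A; last exact: continuous_compact.
apply/seteqP; split => x.
  move=> [Px]; rewrite /hyper /= -pmulrn => xE.
  have [k [w [q [w0 [w1 [qA xS]]]]]] := Px.
  (* A term of positive weight minimises the functional [fb]; positivity of all weights then forces
     it to equal the support exponent below it. *)
  have /choice[al alP] : forall j, exists al : 'I_n -> nat, insupp f al /\ (0 < w j -> q j = mi_pt al /\ (\sum_i fb i * al i)%N = flb).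
    move=> j; have [al [sa aq]] := qA j; exists al; split => // wj.
    have le1 j' : flb%:R <= dot (realv fbi) (q j').
      have [be [sb bq]] := qA j'.
      apply: le_trans (_ : dot (realv fbi) (mi_pt be) <= _); first by rewrite dot_fbi ler_nat flb_min.
      by apply: dot_le => [|i]; [exact: orthant_fbi|rewrite mxE].
    have eqj : dot (realv fbi) (q j) = flb%:R.
      have : \sum_i w i * (dot (realv fbi) (q i) - flb%:R) = 0.
        rewrite (eq_bigr (fun i => w i * dot (realv fbi) (q i) - w i * flb%:R)); last by move=> i _; rewrite mulrBr.
        rewrite sumrB -mulr_suml w1 mul1r -xE xS [in X in _ - X]dotC dot_suml.
        by apply/eqP; rewrite subr_eq0; apply/eqP; apply: eq_bigr => i _; rewrite dotC.
      move=> /eqP; rewrite psumr_eq0; last by move=> i _; rewrite mulr_ge0 // subr_ge0.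
      move=> /allP/(_ j); rewrite mem_index_enum => /(_ isT) /implyP/(_ isT).
      by rewrite mulf_eq0 gt_eqF //= subr_eq0 => /eqP.
    have qal : q j = mi_pt al.
      apply/rowP => i; rewrite mxE; apply/eqP; rewrite -subr_eq0.
      have : \sum_i (fb i)%:R * (q j 0 i - (al i)%:R) <= 0.
        rewrite (eq_bigr (fun i => (fb i)%:R * q j 0 i - (fb i)%:R * (al i)%:R)); last by move=> k0 _; rewrite mulrBr.
        rewrite sumrB (_ : \sum_i (fb i)%:R * q j 0 i = flb%:R); last first.
          by rewrite -eqj; apply: eq_bigr => k0 _; rewrite !mxE -pmulrn.
        rewrite (_ : \sum_i _ = (\sum_i fb i * al i)%:R); last first.
          by rewrite natr_sum; apply: eq_bigr => k0 _; rewrite natrM.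
        by rewrite subr_le0 ler_nat flb_min.
      have nn k0 : 0 <= (fb k0)%:R * (q j 0 k0 - (al k0)%:R) by rewrite mulr_ge0 // subr_ge0.
      move=> le0; have /eqP : \sum_i (fb i)%:R * (q j 0 i - (al i)%:R) = 0.
        by apply/eqP; rewrite eq_le le0 sumr_ge0.
      rewrite psumr_eq0 // => /allP/(_ i); rewrite mem_index_enum => /(_ isT) /implyP/(_ isT).
      by rewrite mulf_eq0 pnatr_eq0 gtn_eqF ?fb_gt0.
    split => //; apply/eqP; rewrite -(eqr_nat R) -dot_fbi -qal eqj //.
  have alN j i : 0 < w j -> (al j i < flb.+1)%N.
    move=> wj; have [_ /(_ wj) [_ <-]] := alP j; rewrite ltnS (bigD1 i) //=.
    by apply: leq_trans (leq_addr _ _); apply: leq_pmull; exact: fb_gt0.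
  (* [inord] is meaningful only where [w j] is positive, hence the restriction [0 < w j] in the sums
     below. *)
  pose tl j : T := [ffun i => inord (al j i)].
  have tlE j i : 0 < w j -> tl j i = al j i :> nat by move=> wj; rewrite ffunE inordK // alN.
  pose W : 'rV[R]_m := \row_k \sum_(j | (tl j == enum_val k) && (0 < w j)) w j.
  have wsum_pos : \sum_(j | 0 < w j) w j = 1.
    rewrite -[RHS]w1 [RHS](bigID (fun j => 0 < w j)) /= [X in _ = _ + X]big1 ?addr0// => j.
    by rewrite -leNgt => wj; apply/eqP; rewrite eq_le wj w0.
  have Wsum (V : lmodType R) (F : T -> V) : \sum_k W 0 k *: F (enum_val k) = \sum_(j | 0 < w j) w j *: F (tl j).
    rewrite (partition_big tl xpredT) //= [RHS](reindex (@enum_val _ {: T})) /=; last exact: onW_bij (enum_val_bij _).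
    apply: eq_bigr => k0 _; rewrite mxE scaler_suml; apply: eq_big => j; first by rewrite andbC.
    by move=> /andP[/eqP -> _].
  have W1 : \sum_k W 0 k = 1.
    have := Wsum R^o (fun=> 1); rewrite (eq_bigr (fun k => W 0 k)); last by move=> k0 _; exact: mulr1.
    by move=> ->; rewrite -[RHS]wsum_pos; apply: eq_bigr => j _; exact: mulr1.
  have W0 k0 : 0 <= W 0 k0 by rewrite mxE; apply: sumr_ge0 => j _.
  exists W.
    split.
      rewrite /hh /= W1 subrr normr0 add0r big1 // => k0 nok; rewrite mxE big1 ?normr0// => j /andP[/eqP tE wj].
      case/negP: nok; apply/asboolP; rewrite -tE.
      have [sa /(_ wj) [_ qE]] := alP j.
      have E : (fun i => tl j i : nat) = al j by apply/funext => i; exact: tlE.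
      split; first by rewrite E.
      transitivity (\sum_i fb i * al j i)%N => //; by apply: eq_bigr => i _; rewrite tlE.
    move=> k0; rewrite /= in_itv /= W0 /= -W1 (bigD1 k0) //= lerDl.
    by apply: sumr_ge0.
  rewrite /Phi (Wsum _ (fun t : T => mi_pt (fun i => t i : nat))) xS [RHS](bigID (fun j => 0 < w j)) /=.
  rewrite [X in _ = _ + X]big1 ?addr0; last first.
    by move=> j; rewrite -leNgt => wj; rewrite (_ : w j = 0) ?scale0r//; apply/eqP; rewrite eq_le wj w0.
  apply: eq_bigr => j wj; congr (_ *: _); have [_ /(_ wj) [-> _]] := alP j.
  by apply/rowP => i; rewrite !mxE tlE.
move=> [w [/= hw Bw] <-].
have w0 k : 0 <= w 0 k by have := Bw k; rewrite /= in_itv /= => /andP[].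
have [ws wok] : \sum_k w 0 k = 1 /\ forall k, ~~ ok (enum_val k) -> w 0 k = 0.
  move: hw; rewrite /hh => /eqP; rewrite paddr_eq0 ?normr_ge0 //; last by apply: sumr_ge0.
  rewrite normr_eq0 subr_eq0 => /andP[/eqP -> ]; rewrite psumr_eq0 // => /allP H; split => // k nok.
  by have := H k; rewrite mem_index_enum nok normr_eq0 => /(_ isT) /eqP.
have [al0 sa0] := supp_ex Pne.
split.
  exists m, (fun k => w 0 k), (fun k => if ok (enum_val k) then mi_pt (fun i => (enum_val k : T) i : nat) else mi_pt al0).
  split => //; split => //; split.
    move=> k; case: ifPn => [/asboolP[sa _]|_]; first by exists (fun i => (enum_val k : T) i : nat); split => // i; rewrite mxE.
    by exists al0; split => // i; rewrite mxE.
  apply: eq_bigr => k _; case: ifPn => // nok; by rewrite wok // !scale0r.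
rewrite /hyper /= -pmulrn dotC dot_suml.
transitivity (\sum_k w 0 k * flb%:R); last by rewrite -mulr_suml ws mul1r.
apply: eq_bigr => k _.
have [/asboolP[_ E]|nok] := boolP (ok (enum_val k)); last by rewrite wok // !mul0r.
by rewrite dotC dot_fbi E.
Qed.

End Face.
End Hyps.

Definition sgv {R : realType} {n : nat} (b : {ffun 'I_n -> bool}) : 'rV[R]_n :=
  \row_i (-1) ^+ b i.

Lemma sgv_norm {R : realType} {n : nat} (b : {ffun 'I_n -> bool}) i : `|(sgv b : 'rV[R]_n) 0 i| = 1.
Proof. by rewrite mxE normrX normrN1 expr1n. Qed.

(** * Lower bounds for the gradient on every cone *)

Section LowerBounds.
Context {R : realType} {n : nat}.
Variables (U : set 'rV[R]_n) (f : 'rV[R]_n -> R) (Sig : seq (seq 'rV[int]_n)).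
Hypothesis Pne : newton f !=set0.
Hypothesis fhat : in_hatE U f.
Hypothesis fnd : nondeg_R U f.
Hypothesis sf : smooth_on U f.
Hypothesis sub : simplicial_subdivision (newton f) Sig.
Variable r : R.
Hypothesis r0 : 0 < r.
Hypothesis rU : box r `<=` U.

Let P := newton f.
Let l := lw f.
Let cover := orthant_cone sub.
Let gen0 a i := gens_ge0 sub (a:=a) i.
Let fk : Csm (box r) f := fsm sf rU.

Section Limit.
Variables (s : seq 'rV[int]_n) (I : pred 'I_(size s)).
Hypothesis sS : s \in Sig.
Hypothesis Ipos : forall i : 'I_n, exists2 j, I j & (0 < wt (nth 0%R s j) i)%N.
Variables (ep : 'rV[R]_n) (de : R).
Hypothesis ep1 : forall i, `|ep 0 i| = 1.
Hypothesis de0 : 0 < de.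
Hypothesis der : de < r.
Variable cs : 'I_(size s) -> R.
Hypothesis cs0 : forall j, 0 <= cs j.

Let ct (tau : R) : 'I_(size s) -> R := fun j => if I j then tau else cs j.
Let xs := Xp ep de (cpt (ct 0)).
Let ws := wexp (fun a => (l a)%:Z) (ct 0) : R.

Lemma xs_le i : `|xs 0 i| <= de.
Proof.
rewrite mxE !normrM ep1 mul1r (gtr0_norm de0) (gtr0_norm (expR_gt0 _)) ler_piMr ?(ltW de0)//.
rewrite -expR0 ler_expR oppr_le0 (cpt_coord gen0 _ _ sS); apply: sumr_ge0 => j _.
by rewrite mulr_ge0 // /ct; case: ifP.
Qed.

Lemma xs_neq0 i : xs 0 i != 0.
Proof.
by rewrite -normr_eq0 mxE !normrM ep1 !mulf_neq0 ?oner_eq0 // normr_eq0 gt_eqF ?expR_gt0.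
Qed.

Lemma sum_ct (F : 'I_(size s) -> R) tau :
  \sum_j ct tau j * F j = tau * (\sum_(j | I j) F j) + \sum_j ct 0 j * F j.
Proof.
rewrite mulr_sumr [X in _ = X + _]big_mkcond -big_split /=; apply: eq_bigr => j _.
by rewrite /ct; case: ifP => _; rewrite ?mul0r ?addr0 ?add0r.
Qed.

Lemma Xp_ct tau : Xp ep de (cpt (ct tau)) = dil (fb I) (expR (- tau)) xs.
Proof.
apply/rowP => i; rewrite !mxE mulrCA; congr (_ * _).
rewrite -expRM_natl -expRD; congr expR; rewrite !(cpt_coord gen0 _ _ sS).
by rewrite (sum_ct (fun j => (wt (nth 0 s j) i)%:R) tau) /fb natr_sum opprD mulrN mulrC.
Qed.

Lemma wexp_ct tau : wexp (fun a => (l a)%:Z) (ct tau) = expR (- tau) ^+ flb f I * ws.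
Proof.
rewrite /ws /wexp -expRM_natl -expRD; congr expR.
rewrite (sum_ct (fun j => (l (nth 0 s j))%:Z%:~R) tau) /flb natr_sum opprD mulrN mulrC.
by congr (- (_ * _) - _); apply: eq_bigr => j _; rewrite -pmulrn.
Qed.

(** Sending the coordinates in [I] to infinity together is the dilation with weights [fb I] and
    parameter [t = exp (- tau)]. The difference [g - g0] vanishes to one more order, so after
    normalisation it is [O(t)]. *)
Lemma init_limit (g g0 : 'rV[R]_n -> R) : Csm (box r) g -> Csm (box r) g0 ->
  VanA (box r) (fb I) (flb f I).+1 (fun x => g x - g0 x) ->
  (forall t x, g0 (dil (fb I) t x) = t ^+ flb f I * g0 x) ->
  forall e : R, 0 < e -> exists T0 : R, forall tau : R, T0 <= tau ->
    `|Hn l (g \o Xp ep de) (ct tau) - ws^-1 * g0 xs| <= e.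
Proof.
move=> gk g0k gV gh e e0.
have gd : Csm (box r) (fun x => g x - g0 x).
  apply: (@Csm_congr _ _ _ (fun x => g x + (-1) * g0 x)); [exact: open_box|by move=> x _; rewrite mulN1r|].
  by apply: Csm_add; [exact: open_box| |apply: Csm_scale => //; exact: open_box].
have [C C0 CP] := VanA_bound1 der gd gV.
have w0 : 0 < ws by exact: wexp_gt0.
have C1 : 0 < C + 1 by rewrite ltr_wpDl.
exists (Num.max 0 (- ln (e * ws / (C + 1)))) => tau; rewrite ge_max => /andP[t0 tl].
pose t := expR (- tau).
have t1 : 0 <= t <= 1 by rewrite expR_ge0 -expR0 ler_expR oppr_le0.
have tp : 0 < t by exact: expR_gt0.
have te : t <= e * ws / (C + 1).
  rewrite -[leRHS]lnK; last by rewrite posrE divr_gt0 ?mulr_gt0.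
  by rewrite ler_expR lerNl.
have := CP xs t xs_le t1; rewrite gh => H.
rewrite /Hn wexp_ct /= Xp_ct -/t.
have -> : (t ^+ flb f I * ws)^-1 * g (dil (fb I) t xs) - ws^-1 * g0 xs =
   (t ^+ flb f I * ws)^-1 * (g (dil (fb I) t xs) - t ^+ flb f I * g0 xs).
  have E3 (a w A B : R) : a != 0 -> w != 0 -> (a * w)^-1 * A - w^-1 * B = (a * w)^-1 * (A - a * B).
    by move=> a0 w0'; field; rewrite a0 w0'.
  by apply: E3; rewrite gt_eqF ?exprn_gt0.
have tl0 : 0 < t ^+ flb f I by rewrite exprn_gt0.
rewrite normrM gtr0_norm ?invr_gt0 ?mulr_gt0 // ler_pdivrMl ?mulr_gt0 //.
apply: le_trans H _; rewrite exprS mulrA mulrC -[leRHS]mulrA ler_wpM2l ?(ltW tl0)//.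
have : C * t <= (C + 1) * t by rewrite ler_wpM2r ?(ltW tp)// lerDl.
move=> /le_trans; apply; rewrite mulrC -ler_pdivlMr //.
by rewrite (mulrC ws).
Qed.

Let f1 := fpart f (fgam f I) (flb f I).+1.

Let H1 := fb_gt0 Ipos.
Let H2 := flb_min sub I sS.
Let H3 := fgam1 (f:=f) (I:=I).
Let H4 := fgam2 (f:=f) (I := I).

Lemma fpart_van : VanA (box r) (fb I) (flb f I).+1 (fun x => f x - f1 x).
Proof.
have oB := @open_box R n r; apply: (VanA_fpart H1 _ H2 H3 oB (box_r0 r0) fk).
exact: leqnn.
Qed.

Lemma f1_csm : Csm (box r) f1.
Proof. by apply: Csm_fpart; exact: open_box. Qed.

Lemma f_limit (e : R) : 0 < e -> exists T0 : R, forall tau : R, T0 <= tau ->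
    `|Hn l (f \o Xp ep de) (ct tau) - ws^-1 * f1 xs| <= e.
Proof.
apply: init_limit; [exact: fk|exact: f1_csm|exact: fpart_van|].
by move=> t x; apply: fpart_dil.
Qed.

Lemma th_limit i (e : R) : 0 < e -> exists T0 : R, forall tau : R, T0 <= tau ->
    `|Hn l (th i f \o Xp ep de) (ct tau) - ws^-1 * th i f1 xs| <= e.
Proof.
have oB := @open_box R n r.
apply: init_limit; [exact: Csm_th|apply: Csm_th => //; exact: f1_csm| |].
  have gd : Csm (box r) (fun x => f x - f1 x).
    apply: (@Csm_congr _ _ _ (fun x => f x + (-1) * f1 x)) => //; first by move=> x _; rewrite mulN1r.
    by apply: Csm_add => //; apply: Csm_scale => //; exact: f1_csm.
  apply: (@VanA_congr _ _ _ _ _ (th i (fun x => f x - f1 x))) => //; last by apply: VanA_th => //; exact: fpart_van.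
  move=> y yB; rewrite /th -mulrBr; congr (_ * _).
  by have := pderivs_sub [:: i] oB fk f1_csm yB.
by move=> t x; apply: th_fpart_dil.
Qed.

Lemma mono_limit q (e : R) : insupp f q -> 0 < e -> exists T0 : R, forall tau : R, T0 <= tau ->
    `|Hn l (mono q \o Xp ep de) (ct tau) -
      ws^-1 * (if (\sum_i fb I i * q i == flb f I)%N then mono q xs else 0)| <= e.
Proof.
move=> sq; have oB := @open_box R n r.
have m1 : Csm (box r) (mono q : 'rV[R]_n -> R) by exact: Csm_mono.
case: eqP => qE.
  apply: init_limit => //; last by move=> t x; rewrite mono_dil qE.
  apply: Van_hat.
    by apply: (@Csm_congr _ _ _ (fun=> 0)) => //; [move=> x _; rewrite subrr|exact: Csm_cst].
  move=> x xr; exists 0, 1 => // t _; by rewrite subrr normr0 mul0r.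
apply: (@init_limit _ (fun=> 0)) => //; first exact: Csm_cst.
  apply: (@VanA_congr _ _ _ _ _ (mono q)) => //; first by move=> y _; rewrite subr0.
  apply: (@VanA_le _ _ _ _ (\sum_i fb I i * q i)%N); last exact: VanA_mono.
  by rewrite ltn_neqAle H2 // andbT; apply/eqP => E; exact: qE.
by move=> t x; rewrite mulr0.
Qed.

(** The point [xs] lies in the box and has no zero coordinate, so nondegeneracy on the compact face
    applies there; a nonzero partial derivative stays nonzero when multiplied by the coordinate. *)
Lemma nondeg_limit : exists j, th j f1 xs != 0.
Proof.
have := fnd (fgam_face sub I sS) (fgam_compact Pne sub sS Ipos) (fun y gy i => fgam_lt Ipos i gy).
move=> /(_ xs); have xr : box r xs by move=> i; exact: le_lt_trans (xs_le i) der.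
move=> /(_ (rU xr) xs_neq0) [j dj]; exists j.
by rewrite mulf_neq0 ?xs_neq0.
Qed.

End Limit.

Definition Dsum (x : 'rV[R]_n) : R := \sum_i th i f x ^+ 2.
Definition alk (k : 'I_(size Sig)) : 'I_n -> nat := alph f (nth [::] Sig k).
Definition Mall (x : 'rV[R]_n) : R := \sum_k mono (alk k) x ^+ 2.
Definition Mno1 (x : 'rV[R]_n) : R := \sum_(k | ~~ [forall i, alk k i == 1%N]) mono (alk k) x ^+ 2.
(** The factor [Mall] gives [f ^ 2] the order [4 l] of the other summand. *)
Definition D2sum (x : 'rV[R]_n) : R := Dsum x * Mno1 x + f x ^+ 2 * Mall x.

Lemma nthS (k : 'I_(size Sig)) : nth [::] Sig k \in Sig.
Proof. by rewrite mem_nth. Qed.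

Lemma alk_supp k : insupp f (alk k).
Proof. by have [] := alphP sub (nthS k). Qed.

(** The points may lie in different cones. The order [l] is a minimum over the support, so at the
    shifted point it is at most the value of the exponent [alph s], which on the cone [s] computes
    [l] exactly. *)
Lemma wexp_ineq s s' (c : 'I_(size s) -> R) (c' : 'I_(size s') -> R) (q : R) :
  s \in Sig -> s' \in Sig -> (forall j, 0 <= c' j) -> cpt c' = cpt c + const_mx q ->
  wexp (fun a => (l a)%:Z) c * expR (- (q * (\sum_i alph f s i)%:R)) <= wexp (fun a => (l a)%:Z) c'.
Proof.
move=> sS s'S c'0 cc; rewrite /wexp -expRD ler_expR -opprD lerN2.
have lin t (d : 'I_(size t) -> R) : t \in Sig ->
    \sum_j d j * (\sum_i wt (nth 0%R t j) i * alph f s i)%:R = \sum_i cpt d 0 i * (alph f s i)%:R.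
  move=> tS; under eq_bigr do rewrite natr_sum mulr_sumr.
  rewrite exchange_big /=; apply: eq_bigr => i _; rewrite (cpt_coord gen0 _ _ tS) mulr_suml.
  by apply: eq_bigr => j _; rewrite natrM mulrA.
apply: (@le_trans _ _ (\sum_j c' j * (\sum_i wt (nth 0%R s' j) i * alph f s i)%:R)).
  apply: ler_sum => j _; rewrite ler_wpM2l // -pmulrn ler_nat.
  apply: (lw_min sub); last by have [] := alphP sub sS.
  by apply/gensP; exists s'; rewrite ?mem_nth.
rewrite lin // cc.
rewrite (eq_bigr (fun i => cpt c 0 i * (alph f s i)%:R + q * (alph f s i)%:R)); last first.
  by move=> i _; rewrite !mxE mulrDl.
rewrite big_split /= -lin // -mulr_sumr natr_sum lerD2r.
by apply: ler_sum => j _; rewrite -(lwE sub sS) ?mem_nth // -pmulrn.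
Qed.

(** A bound valid where all coordinates of [v] exceed [N0] becomes a bound on the whole orthant when
    [de] is replaced by [de exp (- N)], since this shifts [v] by [(N, ..., N)]. By [wexp_ineq] the
    shift costs a constant factor only. *)
Lemma rescale (g : 'rV[R]_n -> R) (K : nat) (de : R) :
  (forall b s, s \in Sig -> exists N0 : R, exists2 c0 : R, 0 < c0 & forall c : 'I_(size s) -> R,
     (forall j, 0 <= c j) -> (forall i, N0 <= cpt c 0 i) -> Qp (cpt c) ->
     c0 * wexp (fun a => (l a)%:Z) c ^+ K <= g (Xp (sgv b) de (cpt c))) ->
  exists N1 : R, forall N : R, N1 <= N -> forall b,
    lbnd Sig (fun a => (K * l a)%:Z) (g \o Xp (sgv b) (de * expR (- N))).
Proof.
move=> H.
have /choice[N0 N0P] : forall bk : {ffun 'I_n -> bool} * 'I_(size Sig), exists N0 : R, exists c0 : R,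
    0 < c0 /\ forall c : 'I_(size (nth [::] Sig bk.2)) -> R,
     (forall j, 0 <= c j) -> (forall i, N0 <= cpt c 0 i) -> Qp (cpt c) ->
     c0 * wexp (fun a => (l a)%:Z) c ^+ K <= g (Xp (sgv bk.1) de (cpt c)).
  by move=> [b k]; have [N0 [c0 c00 cP]] := H b _ (nthS k); exists N0, c0.
have /choice[c0 c0P] := N0P.
have [N1 N10 N1P] := @fin_ub R _ N0.
have [|c1 c10 c1P] := @fin_lb R _ c0; first by move=> bk; case: (c0P bk).
have [A A0 AP] := @fin_ub R _ (fun k => (\sum_i alk k i)%:R).
exists N1 => N NN b.
have N0' : 0 <= N by exact: le_trans N10 NN.
exists (c1 * expR (- (N * A)) ^+ K); first by rewrite mulr_gt0 ?exprn_gt0 ?expR_gt0.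
move=> s sS c c0' Qc.
have Qw : Qp (cpt c + const_mx N) by move=> i; rewrite !mxE ltr_wpDr.
have [s' s'S [c' c'0 wE]] := Qp_cpt cover Qw.
have XE : Xp (sgv b) (de * expR (- N)) (cpt c) = Xp (sgv b) de (cpt c').
  by rewrite -wE; apply/rowP => i; rewrite !mxE opprD expRD; ring.
have [k sk] : exists k : 'I_(size Sig), s = nth [::] Sig k.
  by have /(nthP [::])[k ks <-] := sS; exists (Ordinal ks).
have := s'S => /(nthP [::])[k' k's s'E]; pose k0 := Ordinal k's.
have k0E : s' = nth [::] Sig k0 by rewrite s'E.
rewrite /= XE; apply: le_trans (ler_norm _).
move: c' c'0 wE {XE}; rewrite k0E => c' c'0 wE.
have [c00 cP] := c0P (b, k0).
apply: le_trans (cP c' c'0 _ _); last 2 first.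
- move=> i; rewrite -wE !mxE; apply: le_trans (N1P (b, k0)) _; apply: le_trans NN _.
  by rewrite lerDr ltW.
- by rewrite -wE.
have wK : wexp (fun a => (K * l a)%:Z) c = wexp (fun a => (l a)%:Z) c ^+ K.
  rewrite /wexp -expRM_natl mulrN mulr_sumr; congr (expR (- _)); apply: eq_bigr => j _.
  by rewrite -!pmulrn natrM mulrCA.
rewrite wK -mulrA -exprMn; apply: ler_pM; [exact: ltW| |exact: c1P|].
  by rewrite exprn_ge0 // mulr_ge0 ?expR_ge0 ?(ltW (wexp_gt0 _ _)).
apply: lerXn2r; rewrite ?nnegrE ?mulr_ge0 ?expR_ge0 ?(ltW (wexp_gt0 _ _))//.
have k0S : nth [::] Sig k0 \in Sig by exact: nthS.
apply: le_trans (wexp_ineq sS k0S c'0 (esym wE)).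
rewrite mulrC ler_wpM2l ?(ltW (wexp_gt0 _ _))// ler_expR lerN2 ler_wpM2l //.
by rewrite sk; exact: AP.
Qed.

Section Raw.
Variables (de : R) (b : {ffun 'I_n -> bool}) (s : seq 'rV[int]_n).
Hypothesis de0 : 0 < de.
Hypothesis der : de < r.
Hypothesis sS : s \in Sig.
Let X := Xp (sgv b) de.
Let oB : open (box r : set 'rV[R]_n) := @open_box R n r.

Lemma sym_f : Sym Sig (fun a => (l a)%:Z) (f \o X).
Proof.
refine (Sym_pull (m := l) (g := f) gen0 (sgv_norm b) de0 der fk _) => a ag; exact: (fvan sf fhat sub rU). Qed.

Lemma sym_th i : Sym Sig (fun a => (l a)%:Z) (th i f \o X).
Proof.
apply: (Sym_pull (m := l) (g := th i f) gen0 (sgv_norm b) de0 der); first exact: Csm_th.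
by move=> a ag; exact: (thvan sf fhat sub rU).
Qed.

Lemma sym_mono k : Sym Sig (fun a => (l a)%:Z) (mono (alk k) \o X).
Proof.
apply: (Sym_pull (m := l) (g := mono (alk k)) gen0 (sgv_norm b) de0 der); first exact: Csm_mono.
by move=> a ag; apply: (monovan sub) => //; exact: alk_supp.
Qed.

Lemma HnE g (c : 'I_(size s) -> R) :
  wexp (fun a => (l a)%:Z) c * Hn l (g \o X) c = g (X (cpt c)).
Proof. by rewrite /Hn mulrA mulfV ?mul1r // gt_eqF ?wexp_gt0. Qed.

Lemma lb_Dsum : exists N0 : R, exists2 c0 : R, 0 < c0 & forall c : 'I_(size s) -> R,
  (forall j, 0 <= c j) -> (forall i, N0 <= cpt c 0 i) -> Qp (cpt c) ->
  c0 * wexp (fun a => (l a)%:Z) c ^+ 2 <= Dsum (X (cpt c)).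
Proof.
pose Phi (h : 'rV[R]_n) : R := \sum_i h 0 i ^+ 2.
have cPhi : continuous Phi.
  move=> h; apply: (cvg_bigsum (nbhs_filter h)) => i _; rewrite expr2.
  by apply: cvgM; exact: coord_continuous.
have [|N0 [c0 c00 cP]] := limit_lb gen0 sS (G := fun i => th i f \o X) sym_th cPhi.
  move=> I cs cs0 Ipos.
  have [j dj] := nondeg_limit sS Ipos (sgv_norm b) de0 der cs0.
  set f1 := fpart _ _ _ in dj; set xs := Xp _ _ _ in dj.
  pose w := (wexp (fun a => (l a)%:Z) (fun j => if I j then 0 else cs j))^-1 : R.
  have w0 : 0 < w by rewrite invr_gt0 wexp_gt0.
  exists (\row_i (w * th i f1 xs)); split.
    rewrite /Phi (bigD1 j) //= ltr_pwDl //; last by apply: sumr_ge0 => i _; rewrite sqr_ge0.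
    by rewrite mxE exprn_even_gt0 //= mulf_neq0 // gt_eqF.
  move=> i e e0; have [T0 TP] := th_limit sS Ipos (sgv_norm b) de0 der cs0 i e0.
  by exists T0 => tau tT; rewrite mxE; exact: TP.
exists N0, c0 => // c c0' cN Qc; have := cP c c0' cN Qc.
rewrite -(ler_pM2r (_ : 0 < wexp (fun a => (l a)%:Z) c ^+ 2)) ?exprn_gt0 ?wexp_gt0 //.
move=> /le_trans; apply; rewrite /Phi mulr_suml; apply: ler_sum => i _.
by rewrite mxE -exprMn mulrC HnE.
Qed.

(** In the limit two cases arise. If some [alk k1] different from [(1, ..., 1)] lies on the limiting
    face, the gradient term is positive by nondegeneracy. Otherwise the face has [(1, ..., 1)] as
    its only support exponent, the initial form is a nonzero multiple of one monomial, and the term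
    with [f ^ 2] is positive. *)
Lemma lb_D2sum : exists N0 : R, exists2 c0 : R, 0 < c0 & forall c : 'I_(size s) -> R,
  (forall j, 0 <= c j) -> (forall i, N0 <= cpt c 0 i) -> Qp (cpt c) ->
  c0 * wexp (fun a => (l a)%:Z) c ^+ 4 <= D2sum (X (cpt c)).
Proof.
pose m := size Sig.
pose jt (i : 'I_n) : 'I_(n + (1 + m)) := lshift _ i.
pose jf : 'I_(n + (1 + m)) := rshift n (lshift m ord0).
pose jm (k : 'I_m) : 'I_(n + (1 + m)) := rshift n (rshift 1 k).
pose p1 (k : 'I_m) := [forall i, alk k i == 1%N].
pose Phi (h : 'rV[R]_(n + (1 + m))) : R :=
  (\sum_i h 0 (jt i) ^+ 2) * (\sum_(k | ~~ p1 k) h 0 (jm k) ^+ 2) + h 0 jf ^+ 2 * (\sum_k h 0 (jm k) ^+ 2).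
have csq j (h : 'rV[R]_(n + (1 + m))) : {for h, continuous (fun h : 'rV[R]_(n + (1 + m)) => h 0 j ^+ 2)}.
  have cc : {for h, continuous (fun h : 'rV[R]_(n + (1 + m)) => h 0 j)} by exact: coord_continuous.
  exact: (continuousM cc cc).
have cPhi : continuous Phi.
  move=> h; have cs (K : finType) (Q : pred K) (jj : K -> 'I_(n + (1 + m))) :
      {for h, continuous (fun h : 'rV[R]_(n + (1 + m)) => \sum_(k | Q k) h 0 (jj k) ^+ 2)}.
    by apply: (cvg_bigsum (nbhs_filter h)) => k _; exact: csq.
  exact: (continuousD (continuousM (cs _ xpredT jt) (cs _ _ jm)) (continuousM (csq jf h) (cs _ xpredT jm))).
pose G (j : 'I_(n + (1 + m))) : 'rV[R]_n -> R :=
  match fintype.split j with inl i => th i f | inr j' => match fintype.split j' with inl _ => f | inr k => mono (alk k) end end.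
have Gt i : G (jt i) = th i f by rewrite /G /jt (unsplitK (inl i)).
have Gf : G jf = f by rewrite /G /jf (unsplitK (inr _)) (unsplitK (inl _)).
have Gm k : G (jm k) = mono (alk k) by rewrite /G /jm (unsplitK (inr _)) (unsplitK (inr _)).
have GS j : Sym Sig (fun a => (l a)%:Z) (G j \o X).
  rewrite /G; case: (fintype.split j) => [i|j']; first exact: sym_th.
  by case: (fintype.split j') => [_|k]; [exact: sym_f|exact: sym_mono].
have [|N0 [c0 c00 cP]] := limit_lb gen0 sS (G := fun j => G j \o X) GS cPhi.
  move=> I cs cs0 Ipos.
  have [j dj] := nondeg_limit sS Ipos (sgv_norm b) de0 der cs0.
  have lf := f_limit sS Ipos (sgv_norm b) de0 der cs0.
  have lt i := th_limit sS Ipos (sgv_norm b) de0 der cs0 i.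
  have lm k e := @mono_limit s I sS (sgv b) de (sgv_norm b) de0 der cs cs0 (alk k) e (alk_supp k).
  have xn := xs_neq0 I (sgv_norm b) de0 cs.
  pose xs : 'rV[R]_n := Xp (sgv b) de (cpt (fun j => if I j then 0 else cs j)).
  pose w := (wexp (fun a => (l a)%:Z) (fun j => if I j then 0 else cs j))^-1 : R.
  pose f1 := fpart f (fgam f I) (flb f I).+1.
  have w0 : w != 0 by rewrite gt_eqF // invr_gt0 wexp_gt0.
  pose gm k := (\sum_i fb I i * alk k i == flb f I)%N.
  pose h : 'rV[R]_(n + (1 + m)) := \row_j (w * match fintype.split j with inl i => th i f1 xs | inr j' =>
      match fintype.split j' with inl _ => f1 xs | inr k => if gm k then mono (alk k) xs else 0 end end).
  have ht i : h 0 (jt i) = w * th i f1 xs by rewrite mxE /jt (unsplitK (inl i)).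
  have hf : h 0 jf = w * f1 xs by rewrite mxE /jf (unsplitK (inr _)) (unsplitK (inl _)).
  have hm k : h 0 (jm k) = w * if gm k then mono (alk k) xs else 0.
    by rewrite mxE /jm (unsplitK (inr _)) (unsplitK (inr _)).
  have mn q : mono q xs != 0 by apply/prodf_neq0 => i _; rewrite expf_neq0 //; exact: xn.
  exists h; split; last first.
    move=> t e e0; rewrite /G mxE; case: (fintype.split t) => [i|j']; first exact: lt.
    by case: (fintype.split j') => [_|k]; [exact: lf|exact: lm].
  have [k [kS sk]] : exists k : 'I_m, s = nth [::] Sig k /\ gm k.
    have /(nthP [::])[k ks sE] := sS; exists (Ordinal ks); split => //.
    by rewrite /gm /alk /= sE (flbE sub I sS) eqxx.
  have Mp : 0 < \sum_k h 0 (jm k) ^+ 2.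
    rewrite (bigD1 k) //= ltr_pwDl //; last by apply: sumr_ge0 => i _; rewrite sqr_ge0.
    by rewrite hm sk exprn_even_gt0 //= mulf_neq0.
  have Dp : 0 < \sum_i h 0 (jt i) ^+ 2.
    rewrite (bigD1 j) //= ltr_pwDl //; last by apply: sumr_ge0 => i _; rewrite sqr_ge0.
    by rewrite ht exprn_even_gt0 //= mulf_neq0.
  have [[k1 p1k g1]|no] := pselect (exists2 k1, ~~ p1 k1 & gm k1).
    apply: ltr_pwDl; last by rewrite mulr_ge0 ?sqr_ge0 ?(ltW Mp).
    rewrite mulr_gt0 //.
    rewrite (bigD1 k1) //= ltr_pwDl //; last by apply: sumr_ge0 => i _; rewrite sqr_ge0.
    by rewrite hm g1 exprn_even_gt0 //= mulf_neq0.
  apply: ltr_wpDl.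
    by rewrite mulr_ge0 ?(ltW Dp)//; apply: sumr_ge0 => i _; rewrite sqr_ge0.
  rewrite mulr_gt0 // exprn_even_gt0 //= hf mulf_neq0 //.
  have one k1 : gm k1 -> p1 k1 by move=> g1; apply/negPn/negP => p1k; apply: no; exists k1.
  have pl : (\sum_i fb I i)%N = flb f I.
    by rewrite -(eqP sk); apply: eq_bigr => i _; rewrite (eqP (forallP (one _ sk) i)) muln1.
  (* All support exponents on the face, and not just the selected [alk k1], are shown to equal
     [(1, ..., 1)]. *)
  have key q : insupp f q -> (\sum_i fb I i * q i)%N = flb f I -> forall i, q i = 1%N.
    move=> sq qE.
    have nz i0 : q i0 != 0%N.
      apply/eqP => q0.
      (* Tilting the weights by [e_i0] selects, among the exponents of the face, one with the
         smallest entry at [i0]. If [q i0 = 0] the selected [alph f s'] lies on the face with entry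
         zero there, which [one] excludes. *)
      pose v : 'rV[R]_n := \row_i (fb I i + (i == i0))%:R.
      have [|s' s'S vs] := cover (u := v); first by move=> i; rewrite mxE.
      have [sa /(_ v vs) [/(_ q sq) + _]] := alphP sub s'S.
      have dv q' : dot v (mi_pt q') = (\sum_i fb I i * q' i + q' i0)%:R.
        rewrite natrD natr_sum /dot (eq_bigr (fun i => (fb I i * q' i)%:R + (i == i0)%:R * (q' i)%:R)).
          rewrite big_split /=; congr (_ + _); rewrite (bigD1 i0) //= eqxx mul1r big1 ?addr0// => i /negbTE ->.
          by rewrite mul0r.
        by move=> i _; rewrite !mxE natrD mulrDl natrM.
      rewrite !dv qE q0 addn0 ler_nat => le1.
      have le2 := flb_min sub I sS sa.
      have a0 : alph f s' i0 = 0%N by move: le1 le2; clear; lia.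
      have aE : (\sum_i fb I i * alph f s' i)%N = flb f I by move: le1 le2; clear; lia.
      have /(nthP [::])[k' ks' sE] := s'S.
      have := one (Ordinal ks'); rewrite /gm /p1 /alk /= sE aE eqxx => /(_ isT) /forallP/(_ i0).
      by rewrite a0.
    have le1 i : (fb I i <= fb I i * q i)%N by rewrite leq_pmulr // lt0n nz.
    move=> i; apply/eqP.
    have : (\sum_i fb I i == \sum_i fb I i * q i)%N by rewrite pl qE.
    rewrite (leqif_sum (fun i _ => leqif_eq (le1 i))) => /forallP/(_ i) /=.
    by rewrite -{1}[fb I i]muln1 eqn_pmul2l ?(fb_gt0 Ipos)// eq_sym.
  have F1 : (0 < flb f I)%N.
    rewrite -pl (bigD1 j) //=.
    by apply: leq_trans (leq_addr _ _); exact: (fb_gt0 Ipos).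
  have alE : alk k = (fun=> 1%N) by apply/funext => i; exact/eqP/(forallP (one _ sk)).
  pose a0 : {ffun 'I_n -> 'I_(flb f I).+1} := [ffun _ => inord 1].
  have a0E : (fun i => a0 i : nat) = alk k.
    by rewrite alE; apply/funext => i; rewrite ffunE inordK.
  rewrite /f1 fpart_mono (bigD1 a0) /=; last first.
    by rewrite a0E; apply/asboolP; apply: fgam1; [exact: alk_supp|exact/eqP].
  rewrite big1 ?addr0; first by rewrite a0E mulf_neq0 //; exact: alk_supp.
  move=> al /andP[/asboolP ag ne].
  have [->|sa] := eqVneq (taylor_coef f (fun i => al i : nat)) 0; first by rewrite mul0r.
  case/eqP: ne; apply/ffunP => i; apply/val_inj; rewrite /= ffunE inordK //.
  exact: (key _ sa (fgam2 ag)).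
exists N0, c0 => // c c0' cN Qc; have := cP c c0' cN Qc.
rewrite -(ler_pM2r (_ : 0 < wexp (fun a => (l a)%:Z) c ^+ 4)) ?exprn_gt0 ?wexp_gt0 //.
move=> /le_trans; apply.
set w := wexp _ _.
have E g : (w * Hn l (g \o X) c) ^+ 2 = g (X (cpt c)) ^+ 2 by rewrite HnE.
have S2 (K : finType) (Q : pred K) (H : K -> 'rV[R]_n -> R) :
    w ^+ 2 * \sum_(k | Q k) Hn l (H k \o X) c ^+ 2 = \sum_(k | Q k) H k (X (cpt c)) ^+ 2.
  by rewrite mulr_sumr; apply: eq_bigr => k _; rewrite -exprMn E.
rewrite /Phi /D2sum /Dsum /Mno1 /Mall.
rewrite -(S2 _ xpredT (fun i => th i f)) -(S2 _ _ (fun k => mono (alk k))) -(S2 _ xpredT (fun k => mono (alk k))).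
rewrite -(E f) exprMn.
under eq_bigr do rewrite mxE Gt.
under [X in _ * X + _]eq_bigr do rewrite mxE Gm.
under [X in _ + _ * X]eq_bigr do rewrite mxE Gm.
rewrite mxE Gf.
have Er (W a b1 c1 d : R) : (a * b1 + c1 * d) * W ^+ 4 = W ^+ 2 * a * (W ^+ 2 * b1) + W ^+ 2 * c1 * (W ^+ 2 * d) by ring.
by rewrite Er.
Qed.
End Raw.

Lemma lower_bounds : exists de : R, [/\ 0 < de, de < r & forall b,
  lbnd Sig (fun a => (2 * l a)%:Z) (Dsum \o Xp (sgv b) de) /\
  lbnd Sig (fun a => (4 * l a)%:Z) (D2sum \o Xp (sgv b) de)].
Proof.
have d0 : 0 < r / 2 by rewrite divr_gt0.
have dr : r / 2 < r by rewrite ltr_pdivrMr // ltr_pMr // ltr1n.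
have [N1 N1P] := rescale (fun b s => lb_Dsum b d0 dr).
have [N2 N2P] := rescale (fun b s => lb_D2sum b d0 dr).
pose N := Num.max 0 (Num.max N1 N2).
exists (r / 2 * expR (- N)); split; first by rewrite mulr_gt0 ?expR_gt0.
  by apply: le_lt_trans dr; rewrite ler_piMr ?(ltW d0)// -expR0 ler_expR oppr_le0 /N le_max lexx.
by move=> b; split; [apply: N1P|apply: N2P]; rewrite /N !le_max lexx ?orbT.
Qed.

End LowerBounds.

(** * Integration *)

Definition scvg {R : realType} (u : nat -> R) (L : R) :=
  forall e : R, 0 < e -> exists N : nat, forall k, (N <= k)%N -> `|u k - L| < e.

Lemma scvgP {R : realType} (u : nat -> R) (L : R) : scvg u L <-> u @ \oo --> L.
Proof.
split => [H|H].
  apply/cvgrPdist_lt => e e0; have [N NP] := H e e0; exists N => // k Nk.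
  by rewrite distrC; exact: NP.
move=> e e0; move/cvgrPdist_lt: H => /(_ e e0)[N _ NP]; exists N => k Nk.
by rewrite distrC; exact: NP.
Qed.

Lemma scvg_unique {R : realType} (u : nat -> R) (L M : R) : scvg u L -> scvg u M -> L = M.
Proof.
move=> uL uM; apply/eqP; rewrite -subr_eq0 -normr_eq0; apply/negPn/negP => ne.
have e0 : 0 < `|L - M| / 2 by rewrite divr_gt0 // lt_def ne normr_ge0.
have [N1 N1P] := uL _ e0; have [N2 N2P] := uM _ e0.
have := N1P (maxn N1 N2) (leq_maxl _ _); have := N2P (maxn N1 N2) (leq_maxr _ _).
set x := u _ => h1 h2.
have : `|L - M| <= `|x - M| + `|x - L|.
  by rewrite -[L - M](subrKA x) addrC (distrC x L); exact: ler_normD.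
by move: h1 h2; set a := `|x - M|; set b := `|x - L|; set c := `|L - M|; lra.
Qed.

Lemma continuous_scvg {R : realType} (f : R -> R) (p : R) :
  (forall u, scvg u p -> scvg (f \o u) (f p)) -> {for p, continuous f}.
Proof.
move=> H; apply/cvgrPdist_lt => e e0; apply: contrapT => no.
have /choice[u uP] : forall k : nat, exists x : R, `|x - p| < k.+1%:R^-1 /\ e <= `|f p - f x|.
  move=> k; apply: contrapT => nk; apply: no; apply/nbhs_ballP; exists k.+1%:R^-1 => /=; first by rewrite invr_gt0.
  move=> x; rewrite /ball /= distrC => xp; rewrite ltNge; apply/negP => ef; apply: nk; by exists x.
have up : scvg u p.
  move=> d d0; have [K KP] := exists_nat_gt d^-1; exists K => k Kk; have [h1 _] := uP k.
  apply: lt_le_trans h1 _; rewrite -[leRHS]invrK lef_pV2 ?posrE ?invr_gt0 //.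
  by apply: le_trans (ltW KP) _; rewrite ler_nat (leq_trans Kk).
have [N /(_ N (leqnn _))] := H u up e e0; have [_] := uP N; rewrite distrC => h1 h2.
by have := le_lt_trans h1 h2; rewrite ltxx.
Qed.

Lemma scvg_cont {R : realType} (f : R -> R) (u : nat -> R) (p : R) :
  {for p, continuous f} -> scvg u p -> scvg (f \o u) (f p).
Proof. by move=> fc /scvgP up; apply/scvgP; exact: (cvg_comp u f up fc). Qed.

Section OneDim.
Context {R : realType}.
Notation mu := (@lebesgue_measure R).
Implicit Types (h : R -> R) (C et : R).

Definition cls1 C et h := continuous h /\ forall t : R, `|h t| <= C * expR (- (et * `|t|)).

Lemma cexpabs et : continuous (fun t : R => expR (- (et * `|t|))).
Proof.
move=> t; apply: (@continuous_comp _ _ _ (fun t : R => - (et * `|t|)) expR); last exact: continuous_expR.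
apply: cvgN; apply: cvgM; first exact: cvg_cst.
exact: norm_continuous.
Qed.

Lemma int_expabs et : 0 < et -> (\int[mu]_t (expR (- (et * `|t|)))%:E = (2 / et)%:E)%E.
Proof.
move=> e0; rewrite ge0_symfun_integralT; first last.
- by move=> t /=; rewrite normrN.
- exact: cexpabs.
- by move=> t; exact: expR_ge0.
rewrite -set_itvcy; have -> : (\int[mu]_(t in `[0%R, +oo[%classic) (expR (- (et * `|t|)))%:E =
    \int[mu]_(t in `[0%R, +oo[%classic) (expR (0 - t * et))%:E)%E.
  by apply: eq_integral => t; rewrite inE /= in_itv /= andbT => t0; rewrite ger0_norm // sub0r mulrC.
have dF (x : R) : is_derive x (1 : R) (fun t : R => - et^-1 * expR (0 - t * et)) (expR (0 - x * et)).
  have d := is_deriveZ (- et^-1) (is_derive_expaff 0 et x).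
  apply: (is_derive_eq d); rewrite -[_ *: _]/(_ * _) mulrA mulrNN mulVf ?mul1r // gt_eqF //.
rewrite (@ge0_continuous_FTC2y R _ (fun t : R => - et^-1 * expR (0 - t * et)) 0 0).
- by rewrite mul0r subr0 expR0 mulr1 -EFinB sub0r opprK -EFinM.
- by move=> x _; exact: expR_ge0.
- apply: continuous_subspaceT => t.
  apply: (@continuous_comp _ _ _ (fun t : R => 0 - t * et) expR); last exact: continuous_expR.
  by apply: cvgB; [exact: cvg_cst|apply: cvgM; [exact: cvg_id|exact: cvg_cst]].
- rewrite -[X in _ --> X](mulr0 (- et^-1)); apply: cvgM; first exact: cvg_cst.
  apply/cvgrPdist_lt => e ee; near=> t.
  rewrite !sub0r normrN (gtr0_norm (expR_gt0 _)) -[ltRHS]lnK ?posrE // ltr_expR ltrNl.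
  by rewrite -ltr_pdivrMr //; near: t; apply: nbhs_pinfty_gt; rewrite num_real.
- by move=> x _; have [] := dF x.
- have /derivable_within_continuous : forall x, x \in `](-1 : R), 1[ -> derivable (fun t : R => - et^-1 * expR (0 - t * et)) x (1:R).
    by move=> x _; have [] := dF x.
  move=> H; apply: cvg_at_right_filter.
  by have : {for (0:R), continuous (fun t : R => - et^-1 * expR (0 - t * et))} by (apply: differentiable_continuous; apply/derivable1_diffP; case: (dF 0)).
- by move=> x _; rewrite derive1E; have [_ ->] := dF x.
Unshelve. all: by end_near.
Qed.

Lemma integrable_expabs C et : 0 < et -> mu.-integrable setT (EFin \o (fun t : R => C * expR (- (et * `|t|)))).
Proof.
move=> e0; have mf : measurable_fun setT (fun t : R => expR (- (et * `|t|))) by apply: continuous_measurable_fun; exact: cexpabs.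
have i1 : mu.-integrable setT (EFin \o (fun t : R => expR (- (et * `|t|)))).
  apply/integrableP; split; first exact/measurable_EFinP.
  have -> : (\int[mu]_t `|(EFin \o (fun t : R => expR (- (et * `|t|)))) t| = \int[mu]_t (expR (- (et * `|t|)))%:E)%E.
    by apply: eq_integral => t _ /=; rewrite ger0_norm // expR_ge0.
  by rewrite int_expabs // ltry.
by have := integrableZl measurableT C i1.
Qed.

Lemma Rint_expabs C et : 0 < et -> Rintegral mu setT (fun t : R => C * expR (- (et * `|t|))) = C * (2 / et).
Proof.
move=> e0; rewrite RintegralZl //; last by have := integrable_expabs 1 e0; under eq_fun do rewrite /= mul1r.
by rewrite /Rintegral int_expabs.
Qed.

Lemma cls1_integrable C et h : 0 < et -> measurable_fun setT h ->
  (forall t : R, `|h t| <= C * expR (- (et * `|t|))) -> mu.-integrable setT (EFin \o h).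
Proof.
move=> e0 mh hb; apply: (le_integrable measurableT _ _ (integrable_expabs C e0)).
  exact/measurable_EFinP.
by move=> t _; rewrite /= lee_fin; apply: le_trans (hb t) _; exact: ler_norm.
Qed.

Lemma cls1_int C et h : 0 < et -> cls1 C et h -> mu.-integrable setT (EFin \o h).
Proof. by move=> e0 [hc hb]; apply: (cls1_integrable e0 _ hb); exact: continuous_measurable_fun. Qed.

Lemma cls1_bound C et h : 0 < et -> measurable_fun setT h ->
  (forall t : R, `|h t| <= C * expR (- (et * `|t|))) -> `|Rintegral mu setT h| <= C * (2 / et).
Proof.
move=> e0 mh hb; have ih := cls1_integrable e0 mh hb.
apply: le_trans (le_normr_Rintegral _ ih) _ => //; rewrite -Rint_expabs //.
apply: le_Rintegral => //; last exact: integrable_expabs.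
have := integrable_abse ih; by [].
Qed.

Lemma DCT1 C et (hk : nat -> R -> R) h : 0 < et ->
  (forall k, measurable_fun setT (hk k)) -> measurable_fun setT h ->
  (forall k (t : R), `|hk k t| <= C * expR (- (et * `|t|))) ->
  (forall t, scvg (hk ^~ t) (h t)) ->
  scvg (fun k => Rintegral mu setT (hk k)) (Rintegral mu setT h).
Proof.
move=> e0 mk mh kb kh.
have f_f : {ae mu, forall t, setT t -> (fun k => (hk k t)%:E) @ \oo --> (h t)%:E}.
  by apply: aeW => t _; apply: cvg_EFin; [by apply: nearW|exact/(scvgP (hk ^~ t))].
have f_g : {ae mu, forall t k, setT t -> (`|(hk k t)%:E| <= (C * expR (- (et * `|t|)))%:E)%E}.
  by apply: aeW => t k _; rewrite /= lee_fin.
have [ih _ cv] := @dominated_convergence _ _ R mu setT measurableT (fun k => EFin \o hk k) (EFin \o h)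
   (EFin \o (fun t : R => C * expR (- (et * `|t|)))) (fun k => (measurable_EFinP _ _).2 (mk k)) ((measurable_EFinP _ _).2 mh)
   f_f (integrable_expabs C e0) f_g.
apply/scvgP; apply: fine_cvg.
by rewrite /Rintegral fineK //; exact: integrable_fin_num.
Qed.

Lemma prim_ex C et h : 0 < et -> cls1 C et h ->
  exists F : R -> R, forall x : R, is_derive x (1 : R) F (h x).
Proof.
move=> e0 hcl; have ih := cls1_int e0 hcl; have [hc hb] := hcl.
exists (fun x => \int[mu]_(t in [set` Interval -oo%O (BRight x)]) h t) => x.
have [|||] := @continuous_FTC1 R h -oo%O x (x + 1) _ _ _ (hc x).
- by rewrite ltrDl.
- by apply: integrableS ih => //; exact: measurable_itv.
- exact: ltNyr.
by move=> d1; rewrite derive1E => d2; split.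
Qed.

Lemma prim_cvg C et h (F : R -> R) : 0 < et -> cls1 C et h ->
  (forall x : R, is_derive x (1 : R) F (h x)) ->
  scvg (fun N => F N%:R - F (- N%:R)) (Rintegral mu setT h).
Proof.
move=> e0 hcl dF; have [hc hb] := hcl.
pose I N : set R := `[- N%:R, N%:R]%classic.
have mhk N : measurable_fun setT (h \_ (I N)).
  apply/(measurable_restrictT _ _).1; first exact: measurable_itv.
  by apply: measurable_funTS; exact: continuous_measurable_fun.
have H := @DCT1 C et (fun N => h \_ (I N)) h e0 mhk (continuous_measurable_fun hc).
have {}H : scvg (fun N => Rintegral mu setT (h \_ (I N))) (Rintegral mu setT h).
  apply: H => [N t|t].
    rewrite patchE; case: ifP => _; first exact: hb.
    by rewrite normr0; apply: le_trans (normr_ge0 (h t)) (hb t).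
  move=> e ee; have [N NP] := exists_nat_gt `|t|; exists N => k Nk.
  rewrite patchE mem_set ?subrr ?normr0 // /I /= in_itv /= -ler_norml.
  by apply: le_trans (ltW NP) _; rewrite ler_nat.
move=> e ee; have [N NP] := H e ee; exists N.+1 => k Nk.
have k0 : - k%:R < k%:R :> R.
  by rewrite gtrN // ltr0n; case: k Nk.
suff <- : Rintegral mu setT (h \_ (I k)) = F k%:R - F (- k%:R) by apply: NP; exact: ltnW.
have Fc x : {for x, continuous F}.
  by apply: differentiable_continuous; apply/derivable1_diffP; case: (dF x).
rewrite -Rintegral_mkcond /Rintegral (@continuous_FTC2 R h F _ _ k0) //.
- by apply: continuous_subspaceT.
- split; [by move=> x _; case: (dF x)|apply: cvg_at_right_filter; exact: Fc|apply: cvg_at_left_filter; exact: Fc].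
- by move=> x _; rewrite derive1E; case: (dF x).
Qed.

(** Integrals are identified through the increments of any primitive on [[- N, N]]; translation and
    substitution below are carried out on primitives. *)
Lemma prim_char C et h (F : R -> R) (L : R) : 0 < et -> cls1 C et h ->
  (forall x : R, is_derive x (1 : R) F (h x)) ->
  scvg (fun N => F N%:R - F (- N%:R)) L -> Rintegral mu setT h = L.
Proof. by move=> e0 hcl dF; apply: scvg_unique; exact: (prim_cvg e0 hcl dF). Qed.

Lemma cls1_C0 C et h : cls1 C et h -> 0 <= C.
Proof.
by move=> [_ hb]; have := le_trans (normr_ge0 _) (hb 0); rewrite normr0 mulr0 oppr0 expR0 mulr1.
Qed.

Lemma exp_small et (K e : R) : 0 < et -> 0 <= K -> 0 < e ->
  exists N : nat, forall k, (N <= k)%N -> K * expR (- (et * k%:R)) < e.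
Proof.
move=> e0 K0 ee; have [N NP] := exists_nat_gt (K / (et * e)); exists N => k Nk.
have kp : K / (et * e) < k%:R by apply: lt_le_trans NP _; rewrite ler_nat.
rewrite expRN ltr_pdivrMr ?expR_gt0 //.
have h1 : 1 + et * k%:R <= expR (et * k%:R) by exact: expR_ge1Dx.
move: kp; rewrite ltr_pdivrMr ?mulr_gt0 // => kp.
apply: (@lt_le_trans _ _ (e * (1 + et * k%:R))); last by rewrite ler_wpM2l ?(ltW ee).
apply: lt_trans kp _; have -> : e * (1 + et * k%:R) = k%:R * (et * e) + e by ring.
by rewrite ltrDl.
Qed.

Lemma prim_osc C et h (F : R -> R) (x a : R) : 0 < et -> cls1 C et h ->
  (forall x : R, is_derive x (1 : R) F (h x)) ->
  `|F (x + a) - F x| <= C * expR (et * `|a|) * `|a| * expR (- (et * `|x|)).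
Proof.
move=> e0 hcl dF; have C0 := cls1_C0 hcl; have [hc hb] := hcl.
have hb' t : `|t - x| <= `|a| -> `|h t| <= C * expR (et * `|a|) * expR (- (et * `|x|)).
  move=> tx; apply: le_trans (hb t) _; rewrite -mulrA ler_wpM2l // -expRD ler_expR lerNl opprB lerBlDr -mulrDr ler_wpM2l ?(ltW e0)//.
  have := ler_normB t (t - x); rewrite opprB addrC subrK => h1.
  by move: tx h1; move: `|t| `|x| `|a| `|t - x| => p q r s; lra.
rewrite mulrAC; move: hb'; set M := C * _ * _ => hb'; have [a0|a0] := leP 0 a.
  have xa : x <= x + a by rewrite lerDl.
  have := @mvt_bound R F h x (x + a) M xa (fun t _ => dF t).
  have -> : x + a - x = a by ring.
  rewrite (ger0_norm a0); apply => t /andP[t1 t2]; apply: hb'; rewrite !ger0_norm //; lra.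
have xa : x + a <= x by lra.
have := @mvt_bound R F h (x + a) x M xa (fun t _ => dF t).
have -> : x - (x + a) = - a by ring.
rewrite distrC (ltr0_norm a0); apply => t /andP[t1 t2]; apply: hb'; rewrite (ltr0_norm a0) ler_norml; lra.
Qed.

Lemma cls1_shift C et h (a : R) : 0 < et -> cls1 C et h -> cls1 (C * expR (et * `|a|)) et (fun t => h (t + a)).
Proof.
move=> e0 [hc hb]; have C0 : 0 <= C.
  by have := le_trans (normr_ge0 _) (hb 0); rewrite normr0 mulr0 oppr0 expR0 mulr1.
split => [t|t].
  apply: (@continuous_comp _ _ _ (fun t : R => t + a) h); last exact: hc.
  by apply: cvgD; [exact: cvg_id|exact: cvg_cst].
apply: le_trans (hb _) _; rewrite -mulrA ler_wpM2l // -expRD ler_expR lerNl opprB lerBlDr -mulrDr ler_wpM2l ?(ltW e0)//.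
by have := ler_normB (t + a) a; rewrite addrK.
Qed.

Lemma Rint_shift C et h (a : R) : 0 < et -> cls1 C et h ->
  Rintegral mu setT (fun t => h (t + a)) = Rintegral mu setT h.
Proof.
move=> e0 hcl; have [F dF] := prim_ex e0 hcl; have [hc hb] := hcl.
have C0 : 0 <= C.
  by have := le_trans (normr_ge0 _) (hb 0); rewrite normr0 mulr0 oppr0 expR0 mulr1.
have dFa (x : R) : is_derive x (1 : R) (fun t => F (t + a)) (h (x + a)).
  have d1 : is_derive x (1 : R) (fun t : R => t + a) (1 + 0).
    exact: (is_deriveD (is_derive_id x 1) (is_derive_cst a x 1)).
  apply: (is_derive_eq (@is_derive1_comp R F (fun t : R => t + a) x _ _ (dF (x + a)) d1)); by rewrite addr0 ?mulr1 ?scaler1.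
apply: (prim_char e0 (cls1_shift a e0 hcl) dFa) => e ee.
have e2 : 0 < e / 2 by rewrite divr_gt0.
have [N NP] := prim_cvg e0 hcl dF e2.
pose K := C * expR (et * `|a|) * `|a|.
have K0 : 0 <= K by rewrite !mulr_ge0 ?expR_ge0.
have e4 : 0 < e / 4 by rewrite divr_gt0.
have [M MP] := exp_small e0 K0 e4.
exists (maxn N M) => k; rewrite geq_max => /andP[Nk Mk].
have h1 := NP k Nk; have h2 := MP k Mk.
have h3 := @prim_osc C et h F k%:R a e0 hcl dF; have h4 := @prim_osc C et h F (- k%:R) a e0 hcl dF.
rewrite normrN normr_nat -/K in h4; rewrite normr_nat -/K in h3.
have h3' := le_lt_trans h3 h2; have h4' := le_lt_trans h4 h2.
have -> : F (k%:R + a) - F (- k%:R + a) - Rintegral mu setT h =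
  (F k%:R - F (- k%:R) - Rintegral mu setT h) + ((F (k%:R + a) - F k%:R) - (F (- k%:R + a) - F (- k%:R))) by ring.
apply: le_lt_trans (ler_normD _ _) _; apply: (@lt_le_trans _ _ (e / 2 + (e / 4 + e / 4))); last by lra.
by apply: ltrD => //; apply: le_lt_trans (ler_normB _ _) _; apply: ltrD.
Qed.

Section Subst.
Variables (h : R -> R) (de : R).
Hypothesis de0 : 0 < de.
Hypothesis hc : continuous h.
Hypothesis hs : forall t : R, de <= `|t| -> h t = 0.

Lemma compact_cls1 : exists2 M : R, 0 <= M & forall t, `|h t| <= M.
Proof.
have le0 : - de <= de by apply: le_trans (ltW de0); rewrite oppr_le0 ltW.
have cn : {within `[- de, de], continuous (fun t => `|h t|)}.
  by apply: continuous_subspaceT => t; apply: (@continuous_comp _ _ _ h (@Num.norm R R)); [exact: hc|exact: norm_continuous].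
have [c _ cP] := EVT_max le0 cn.
exists `|h c| => // t; have [td|/hs ->] := ltP `|t| de; last by rewrite normr0.
by apply: cP; rewrite in_itv /= -ler_norml ltW.
Qed.

Lemma cls1_cpt : exists C : R, cls1 C 1 h.
Proof.
have [M M0 MP] := compact_cls1; exists (M * expR de); split => // t.
have [td|/hs ->] := ltP `|t| de; last by rewrite normr0 !mulr_ge0 ?expR_ge0.
apply: le_trans (MP t) _; rewrite -mulrA ler_peMr // -expRD -[leLHS]expR0 ler_expR mul1r.
by rewrite subr_ge0 ltW.
Qed.

(** With [k = sg * de], a primitive in [v] is [- F (k exp (- v)) / k]. Beyond the support [F] is
    constant, which yields the value [F k] as [v] goes to minus infinity; continuity at 0 yields
    [F 0] at the other end. *)
Lemma Rint_subst1 (sg : R) : `|sg| = 1 ->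
  exists2 C : R, cls1 C 1 (fun v => h (sg * de * expR (- v)) * expR (- v)) &
  forall F : R -> R, (forall x : R, is_derive x (1 : R) F (h x)) ->
   Rintegral mu setT (fun v => h (sg * de * expR (- v)) * expR (- v)) = (F (sg * de) - F 0) / (sg * de).
Proof.
move=> sg1; have [M M0 MP] := compact_cls1.
have k0 : sg * de != 0 by rewrite -normr_eq0 normrM sg1 mul1r normr_eq0 gt_eqF.
have cexp : continuous (fun v : R => expR (- v)).
  move=> v; apply: (@continuous_comp _ _ _ (fun v : R => - v) expR); last exact: continuous_expR.
  exact: opp_continuous.
have cE : continuous (fun v : R => sg * de * expR (- v)).
  by move=> v; apply: cvgM; [exact: cvg_cst|exact: cexp].
have gcl : cls1 M 1 (fun v => h (sg * de * expR (- v)) * expR (- v)).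
  split => [v|v].
    apply: cvgM; last exact: cexp.
    by apply: (@continuous_comp _ _ _ (fun v : R => sg * de * expR (- v)) h); [exact: cE|exact: hc].
  have [v0|v0] := leP 0 v.
    by rewrite normrM (gtr0_norm (expR_gt0 _)) (ger0_norm v0) mul1r ler_wpM2r ?expR_ge0.
  rewrite hs ?mul0r ?normr0 ?mulr_ge0 ?expR_ge0 //.
  rewrite !normrM sg1 mul1r (gtr0_norm de0) (gtr0_norm (expR_gt0 _)) ler_peMr ?(ltW de0)//.
  by rewrite -expR0 ler_expR oppr_ge0 ltW.
exists M => // F dF.
pose k := sg * de.
have dG (v : R) : is_derive v (1 : R) (fun v : R => - k^-1 * F (k * expR (0 - v * 1))) (h (sg * de * expR (- v)) * expR (- v)).
  have d1 := is_deriveZ k (is_derive_expaff 0 1 v).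
  have d2 := @is_derive1_comp R F (fun v : R => k * expR (0 - v * 1)) v _ _ (dF (k * expR (0 - v * 1))) d1.
  have d3 := is_deriveZ (- k^-1) d2.
  apply: (is_derive_eq d3); rewrite -/k sub0r mulr1 -![_ *: _]/(_ * _).
  by field.
apply: (prim_char ltr01 gcl dG) => e ee.
have Fc : {for (0:R), continuous F}.
  by apply: differentiable_continuous; apply/derivable1_diffP; case: (dF 0).
have kn : `|k| = de by rewrite normrM sg1 mul1r gtr0_norm.
have up : scvg (fun N : nat => k * expR (- (1 * N%:R))) 0.
  move=> d d0; have [N NP] := exp_small ltr01 (ltW de0) d0; exists N => j Nj.
  by rewrite subr0 normrM kn (gtr0_norm (expR_gt0 _)); exact: NP.
have kd : 0 < de * e by rewrite mulr_gt0.
have [N NP] := scvg_cont Fc up kd; exists N => j Nj.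
have := NP j Nj; rewrite /= mul1r !sub0r !mulr1 opprK -/k.
have -> : F (k * expR j%:R) = F k.
  apply/eqP; rewrite -subr_eq0 -normr_le0.
  have e1 : 1 <= expR j%:R :> R by rewrite -expR0 ler_expR.
  have dl (t : R) : is_derive t (1 : R) (fun t : R => F (k * t)) (k * h (k * t)).
    have d1 : is_derive t (1 : R) (fun t : R => k * t) k.
      by have := is_deriveZ k (is_derive_id t (1:R)); rewrite -[_ *: 1]/(_ * _) mulr1.
    by apply: (is_derive_eq (@is_derive1_comp R F (fun t : R => k * t) t _ _ (dF (k * t)) d1)); rewrite -?[_ *: _]/(_ * _) mulrC.
  have := @mvt_bound R (fun t : R => F (k * t)) _ 1 (expR j%:R) 0 e1 (fun t _ => dl t).
  rewrite mul0r mulr1; apply => t /andP[t1 _]; rewrite hs ?mulr0 ?normr0//.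
  by rewrite normrM kn ler_peMr ?(ltW de0)// (le_trans (ltW t1)) ?ler_norm.
have -> : - k^-1 * F (k * expR (- j%:R)) - - k^-1 * F k - (F k - F 0) / k = - (k^-1 * (F (k * expR (- j%:R)) - F 0)) by field.
by rewrite normrN normrM normfV kn => h1; rewrite ltr_pdivrMl.
Qed.

Lemma Rint_subst : Rintegral mu setT h =
  de * (Rintegral mu setT (fun v => h (1 * de * expR (- v)) * expR (- v)) +
        Rintegral mu setT (fun v => h (-1 * de * expR (- v)) * expR (- v))).
Proof.
have [C hcl] := cls1_cpt; have [F dF] := prim_ex ltr01 hcl.
have [|_ _ ->//] := Rint_subst1 (sg := 1); first by rewrite normr1.
have [|_ _ ->//] := Rint_subst1 (sg := -1); first by rewrite normrN1.
have -> : de * ((F (1 * de) - F 0) / (1 * de) + (F (-1 * de) - F 0) / (-1 * de)) = F de - F (- de).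
  by rewrite mul1r mulN1r; field; rewrite gt_eqF.
apply: (prim_char ltr01 hcl dF) => e ee.
have [N NP] := exists_nat_gt de; exists N => j Nj.
have dj : de <= j%:R by apply: le_trans (ltW NP) _; rewrite ler_nat.
have h1 : F j%:R = F de.
  apply/eqP; rewrite -subr_eq0 -normr_le0.
  have := @mvt_bound R F h de j%:R 0 dj (fun t _ => dF t); rewrite mul0r; apply => t /andP[t1 _].
  by rewrite hs ?normr0 // (le_trans (ltW t1)) ?ler_norm.
have h2 : F (- j%:R) = F (- de).
  apply/eqP; rewrite -subr_eq0 -normr_le0 distrC.
  have dj' : - j%:R <= - de by rewrite lerN2.
  have := @mvt_bound R F h _ _ 0 dj' (fun t _ => dF t); rewrite mul0r; apply => t /andP[_ t1].
  by rewrite hs ?normr0 // -normrN (le_trans _ (ler_norm _)) // lerNr ltW.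
by rewrite h1 h2 subrr normr0.
Qed.
End Subst.

End OneDim.

(** * Iterated integrals of exponentially decaying functions *)

Section IteratedIntegral.
Context {R : realType}.
Notation mu := (@lebesgue_measure R).

Definition consr n (t : R) (y : 'rV[R]_n) : 'rV[R]_n.+1 := row_mx (\row_(_ < 1) t) y.

Lemma consr0 n (t : R) (y : 'rV[R]_n) : consr t y 0 ord0 = t.
Proof.
have -> : ord0 = lshift n (ord0 : 'I_1) :> 'I_(1 + n) by apply: val_inj.
by rewrite /consr (row_mxEl (\row_(_ < 1) t) y) mxE.
Qed.

Lemma consrS n (t : R) (y : 'rV[R]_n) i : consr t y 0 (lift ord0 i) = y 0 i.
Proof.
have -> : lift ord0 i = rshift 1 i :> 'I_(1 + n) by apply: val_inj.
by rewrite /consr (row_mxEr (\row_(_ < 1) t) y).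
Qed.

Lemma consrP n (x y : 'rV[R]_n.+1) : x 0 ord0 = y 0 ord0 ->
  (forall i, x 0 (lift ord0 i) = y 0 (lift ord0 i)) -> x = y.
Proof. by move=> h0 hS; apply/rowP => i; case: (unliftP ord0 i) => [j ->|->]. Qed.

Definition l1 n (v : 'rV[R]_n) : R := \sum_i `|v 0 i|.

Lemma l1_ge0 n (v : 'rV[R]_n) : 0 <= l1 v.
Proof. by apply: sumr_ge0. Qed.

Lemma l1_consr n t (y : 'rV[R]_n) : l1 (consr t y) = `|t| + l1 y.
Proof. by rewrite /l1 big_ord_recl consr0; congr (_ + _); apply: eq_bigr => i _; rewrite consrS. Qed.

Lemma l1_tri n (v w : 'rV[R]_n) : l1 v <= l1 (v + w) + l1 w.
Proof.
rewrite -big_split /=; apply: ler_sum => i _; have := ler_normB (v 0 i + w 0 i) (w 0 i).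
by rewrite addrK mxE.
Qed.

(** The constants are parameters because dominated convergence asks for one bound along a whole
    sequence. Exponential decay takes the place of compact support, which is lost in logarithmic
    coordinates. *)
Definition cls n (C et : R) (G : 'rV[R]_n -> R) :=
  continuous G /\ forall v, `|G v| <= C * expR (- (et * l1 v)).
Definition Cls n (G : 'rV[R]_n -> R) := exists C et : R, 0 < et /\ cls C et G.

Lemma cls_C0 n C et (G : 'rV[R]_n -> R) : cls C et G -> 0 <= C.
Proof.
move=> [_ Gb]; have := le_trans (normr_ge0 _) (Gb 0).
by rewrite pmulr_lge0 // expR_gt0.
Qed.

Lemma cls_le n (C et C' et' : R) (G : 'rV[R]_n -> R) : C <= C' -> et' <= et -> 0 <= C' -> cls C et G -> cls C' et' G.
Proof.
move=> CC ee C0 [Gc Gb]; split => // v; apply: le_trans (Gb v) _; apply: ler_pM => //.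
- by have := cls_C0 (conj Gc Gb).
- by rewrite ler_expR lerN2 ler_wpM2r ?l1_ge0.
Qed.

Lemma consr_cont n (t : R) (y : 'rV[R]_n) i : {for y, continuous (fun y : 'rV[R]_n => consr t y 0 i)}.
Proof.
case: (unliftP ord0 i) => [j ->|->].
  have -> : (fun y : 'rV[R]_n => consr t y 0 (lift ord0 j)) = (fun y => y 0 j) by apply/funext => z; rewrite consrS.
  exact: coord_continuous.
have -> : (fun y : 'rV[R]_n => consr t y 0 ord0) = (fun=> t) by apply/funext => z; rewrite consr0.
exact: cst_continuous.
Qed.

Lemma consr_cont1 n (G : 'rV[R]_n.+1 -> R) (y : 'rV[R]_n) : continuous G -> continuous (fun t : R => G (consr t y)).
Proof.
move=> Gc t; apply/(@cvgrPdist_lt _ _ _ (nbhs t)) => e e0.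
have /continuous_rVP/(_ e e0)[r r0 rP] := Gc (consr t y).
apply/nbhs_ballP; exists r => //= s; rewrite /ball /= distrC => st; rewrite distrC; apply: rP => i.
by case: (unliftP ord0 i) => [j ->|->]; rewrite ?consrS ?consr0 ?subrr ?normr0.
Qed.

Lemma cls_consr n C et (G : 'rV[R]_n.+1 -> R) t : cls C et G ->
  cls (C * expR (- (et * `|t|))) et (fun y => G (consr t y)).
Proof.
move=> [Gc Gb]; split => [y|y].
  by apply: (@continuous_comp_rV R n n.+1 (consr t) G); [exact: consr_cont|exact: Gc].
by apply: le_trans (Gb _) _; rewrite -mulrA -expRD l1_consr mulrDr opprD.
Qed.

Lemma cls_consr' n C et (G : 'rV[R]_n.+1 -> R) t : 0 <= et -> cls C et G ->
  cls C et (fun y => G (consr t y)).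
Proof.
move=> e0 Gc; have C0 := cls_C0 Gc; apply: (cls_le _ _ C0 (cls_consr t Gc)) => //.
by rewrite ler_piMr // -expR0 ler_expR oppr_le0 mulr_ge0.
Qed.

(** The size bound and dominated convergence are proved by one induction: the inner integral must be
    continuous in the outer variable, which is dominated convergence in the lower dimension, and
    must decay, which is the size bound. *)
Lemma iint_main n : forall C et : R, 0 < et ->
  (forall G : 'rV[R]_n -> R, cls C et G -> `|iint G| <= C * (2 / et) ^+ n) /\
  (forall (Gk : nat -> 'rV[R]_n -> R) G, (forall k, cls C et (Gk k)) -> cls C et G ->
    (forall v, scvg (Gk ^~ v) (G v)) -> scvg (fun k => iint (Gk k)) (iint G)).
Proof.
elim: n => [|n IH] C et e0.
  split => [G [_ Gb]|Gk G _ _ cv] /=; last exact: cv.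
  by have := Gb 0; rewrite /l1 big_ord0 mulr0 oppr0 expR0 expr0.
have inner (G : 'rV[R]_n.+1 -> R) : cls C et G ->
    cls1 (C * (2 / et) ^+ n) et (fun t => iint (fun y => G (consr t y))).
  move=> Gcl; split => [t|t]; last first.
    by have [/(_ _ (cls_consr t Gcl)) + _] := IH (C * expR (- (et * `|t|))) et e0; rewrite mulrAC.
  apply: continuous_scvg => u up; have [_ dct] := IH C et e0.
  apply: dct; [move=> k; exact: (cls_consr' _ (ltW e0))|exact: (cls_consr' _ (ltW e0))|].
  move=> y; apply: (scvg_cont (f := fun t => G (consr t y))) => //.
  by apply: consr_cont1; case: Gcl.
split => [G Gcl|Gk G kcl Gcl cv].
  have [ic ib] := inner G Gcl; rewrite exprSr (mulrA C).
  by apply: cls1_bound => //; exact: continuous_measurable_fun.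
apply: (@DCT1 R (C * (2 / et) ^+ n) et) => //.
- by move=> k; apply: continuous_measurable_fun; case: (inner _ (kcl k)).
- by apply: continuous_measurable_fun; case: (inner _ Gcl).
- by move=> k t; case: (inner _ (kcl k)) => _; apply.
- move=> t; have [_ dct] := IH C et e0.
  by apply: dct; [move=> k; exact: (cls_consr' _ (ltW e0))|exact: (cls_consr' _ (ltW e0))|move=> y; exact: cv].
Qed.

Lemma inner_cls1 n C et (G : 'rV[R]_n.+1 -> R) : 0 < et -> cls C et G ->
    cls1 (C * (2 / et) ^+ n) et (fun t => iint (fun y => G (consr t y))).
Proof.
move=> e0 Gcl; split => [t|t]; last first.
  by have [/(_ _ (cls_consr t Gcl)) + _] := iint_main n (C * expR (- (et * `|t|))) e0; rewrite mulrAC.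
apply: continuous_scvg => u up; have [_ dct] := iint_main n C e0.
apply: dct; [move=> k; exact: (cls_consr' _ (ltW e0))|exact: (cls_consr' _ (ltW e0))|].
move=> y; apply: (scvg_cont (f := fun t => G (consr t y))) => //.
by apply: consr_cont1; case: Gcl.
Qed.

Lemma Cls_inner n (G : 'rV[R]_n.+1 -> R) : Cls G ->
  mu.-integrable setT (EFin \o (fun t => iint (fun y => G (consr t y)))).
Proof. by move=> [C [et [e0 Gcl]]]; exact: (cls1_int e0 (inner_cls1 e0 Gcl)). Qed.

Lemma Cls_consr n (G : 'rV[R]_n.+1 -> R) t : Cls G -> Cls (fun y => G (consr t y)).
Proof. by move=> [C [et [e0 Gcl]]]; exists C, et; split => //; exact: (cls_consr' _ (ltW e0)). Qed.

Lemma Cls_add n (G H : 'rV[R]_n -> R) : Cls G -> Cls H -> Cls (fun v => G v + H v).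
Proof.
move=> [C [et [e0 Gcl]]] [D [ze [z0 Hcl]]].
have C0 := cls_C0 Gcl; have D0 := cls_C0 Hcl.
exists (C + D), (Num.min et ze); split; first by rewrite lt_min e0.
have [Gc Gb] : cls C (Num.min et ze) G by apply: cls_le Gcl; rewrite ?ge_min ?lexx.
have [Hc Hb] : cls D (Num.min et ze) H by apply: cls_le Hcl; rewrite ?ge_min ?lexx ?orbT.
split => [v|v]; first exact: (continuousD (Gc v) (Hc v)).
by apply: le_trans (ler_normD _ _) _; rewrite mulrDl lerD.
Qed.

Lemma Cls_scale n (c : R) (G : 'rV[R]_n -> R) : Cls G -> Cls (fun v => c * G v).
Proof.
move=> [C [et [e0 [Gc Gb]]]]; exists (`|c| * C), et; split => //; split => [v|v].
  by apply: continuousM; [exact: cst_continuous|exact: Gc].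
by rewrite normrM -mulrA ler_wpM2l.
Qed.

Lemma Cls_0 n : Cls (fun _ : 'rV[R]_n => 0).
Proof.
exists 0, 1; split => //; split => [v|v]; first exact: cst_continuous.
by rewrite normr0 mul0r.
Qed.

Lemma Cls_sum n (I : Type) (r : seq I) (G : I -> 'rV[R]_n -> R) :
  (forall k, Cls (G k)) -> Cls (fun v => \sum_(k <- r) G k v).
Proof.
move=> Gk; elim: r => [|k r IH].
  by have := Cls_0 n; congr Cls; apply/funext => v; rewrite big_nil.
by have := Cls_add (Gk k) IH; congr Cls; apply/funext => v; rewrite big_cons.
Qed.

Lemma iint0 n : iint (fun _ : 'rV[R]_n => 0) = 0 :> R.
Proof.
have [/(_ (fun=> 0)) + _] := iint_main n 0 ltr01.
by rewrite mul0r => H; apply/eqP; rewrite -normr_le0; apply: H; split => [v|v]; [exact: cst_continuous|rewrite normr0 mul0r].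
Qed.

Lemma iint_ext n (G H : 'rV[R]_n -> R) : (forall v, G v = H v) -> iint G = iint H.
Proof. by move=> GH; congr iint; exact/funext. Qed.

Lemma iintD n (G H : 'rV[R]_n -> R) : Cls G -> Cls H -> iint (fun v => G v + H v) = iint G + iint H.
Proof.
elim: n G H => [|n IH] G H Gc Hc //=.
rewrite -RintegralD //; [|exact: Cls_inner|exact: Cls_inner].
by apply: eq_Rintegral => t _; apply: IH; exact: Cls_consr.
Qed.

Lemma iintZ n (c : R) (G : 'rV[R]_n -> R) : Cls G -> iint (fun v => c * G v) = c * iint G.
Proof.
elim: n G => [|n IH] G Gc //=.
rewrite -RintegralZl //; last exact: Cls_inner.
by apply: eq_Rintegral => t _; apply: IH; exact: Cls_consr.
Qed.

Lemma iint_sum n (I : Type) (r : seq I) (G : I -> 'rV[R]_n -> R) :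
  (forall k, Cls (G k)) -> iint (fun v => \sum_(k <- r) G k v) = \sum_(k <- r) iint (G k).
Proof.
move=> Gk; elim: r => [|k r IH].
  by rewrite big_nil -[RHS](iint0 n); apply: iint_ext => v; rewrite big_nil.
rewrite big_cons -IH -iintD //; last exact: Cls_sum.
by apply: iint_ext => v; rewrite big_cons.
Qed.

Lemma iint_le n (G H : 'rV[R]_n -> R) : Cls G -> Cls H -> (forall v, G v <= H v) -> iint G <= iint H.
Proof.
elim: n G H => [|n IH] G H Gc Hc GH //=.
apply: le_Rintegral => //; [exact: Cls_inner|exact: Cls_inner|].
by move=> t _; apply: IH => //; exact: Cls_consr.
Qed.

Lemma iint_norm n (G H : 'rV[R]_n -> R) : Cls G -> Cls H -> (forall v, `|G v| <= H v) -> `|iint G| <= iint H.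
Proof.
move=> Gc Hc GH; rewrite ler_norml; apply/andP; split.
  rewrite -mulN1r -iintZ //; apply: iint_le => //; first exact: Cls_scale.
  by move=> v; rewrite mulN1r; have := GH v; rewrite ler_norml => /andP[].
by apply: iint_le => // v; apply: le_trans (ler_norm _) (GH v).
Qed.

Lemma Cls_shift n (G : 'rV[R]_n -> R) (w : 'rV[R]_n) : Cls G -> Cls (fun v => G (v + w)).
Proof.
move=> [C [et [e0 Gcl]]]; have C0 := cls_C0 Gcl; have [Gc Gb] := Gcl.
exists (C * expR (et * l1 w)), et; split => //; split => [v|v].
  apply: (@continuous_comp_rV R n n (fun v => v + w) G) => [i|]; last exact: Gc.
  have -> : (fun v : 'rV[R]_n => (v + w) 0 i) = (fun v => v 0 i + w 0 i) by apply/funext => z; rewrite mxE.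
  have c1 : {for v, continuous (fun v : 'rV[R]_n => v 0 i)} by exact: coord_continuous.
  have c2 : {for v, continuous (fun _ : 'rV[R]_n => w 0 i)} by exact: cst_continuous.
  exact: (continuousD c1 c2).
apply: le_trans (Gb _) _; rewrite -mulrA ler_wpM2l // -expRD ler_expR lerNl opprB lerBlDr -mulrDr.
by rewrite ler_wpM2l ?(ltW e0)// l1_tri.
Qed.

Lemma iint_shift n (G : 'rV[R]_n -> R) (w : 'rV[R]_n) : Cls G -> iint (fun v => G (v + w)) = iint G.
Proof.
elim: n G w => [|n IH] G w Gc /=; first by congr G; apply/rowP => -[].
have [C [et [e0 Gcl]]] := Gc.
rewrite -(Rint_shift (w 0 ord0) e0 (inner_cls1 e0 Gcl)); apply: eq_Rintegral => t _.
rewrite -(IH _ (\row_i w 0 (lift ord0 i)) (Cls_consr _ Gc)); apply: iint_ext => y; congr G.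
by apply: consrP => [|i]; rewrite mxE ?consr0 ?consrS ?mxE ?consr0 ?consrS.
Qed.

(** Difference quotients of [G] along [w] have integral zero by translation invariance and converge
    to [H] under a common bound. No interchange of the order of integration is involved, and [w]
    need not be a coordinate direction. *)
Lemma iint_derive n (G H : 'rV[R]_n -> R) (w : 'rV[R]_n) : Cls G -> Cls H ->
  (forall v : 'rV[R]_n, is_derive v w G (H v)) -> iint H = 0.
Proof.
move=> Gc [C [et [e0 Hcl]]] dG; have C0 := cls_C0 Hcl; have [Hc Hb] := Hcl.
pose h (k : nat) : R := k.+1%:R^-1.
have h0 k : 0 < h k by rewrite invr_gt0.
have h1 k : h k <= 1 by rewrite invf_le1 // ler1n.
pose Gk k (v : 'rV[R]_n) := (h k)^-1 * (G (v + h k *: w) - G v).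
have Gkc k : continuous (Gk k).
  have [_ [_ [_ [c1 _]]]] := Cls_shift (h k *: w) Gc; have [_ [_ [_ [c2 _]]]] := Gc.
  move=> v; have c3 : {for v, continuous (fun _ : 'rV[R]_n => (h k)^-1)} by exact: cst_continuous.
  exact: (continuousM c3 (continuousB (c1 v) (c2 v))).
have dl v (t : R) : is_derive t (1:R) (fun t : R => G (v + t *: w)) (H (v + t *: w)).
  by have [d1 d2] := dG (v + t *: w); have := is_derive_line d1; rewrite d2.
have bk v k : `|Gk k v| <= C * expR (et * l1 w) * expR (- (et * l1 v)).
  rewrite /Gk normrM normfV (gtr0_norm (h0 k)) ler_pdivrMl // mulrC.
  have := @mvt_bound R (fun t : R => G (v + t *: w)) _ 0 (h k) (C * expR (et * l1 w) * expR (- (et * l1 v))) (ltW (h0 k)) (fun t _ => dl v t).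
  rewrite scale0r addr0 subr0; apply => t /andP[t0 th].
  apply: le_trans (Hb _) _; rewrite -mulrA ler_wpM2l // -expRD ler_expR lerNl opprB lerBlDr -mulrDr.
  rewrite ler_wpM2l ?(ltW e0)//; apply: le_trans (l1_tri v (t *: w)) _; rewrite lerD2l.
  apply: ler_sum => i _; rewrite mxE normrM (gtr0_norm t0) ler_piMl // ltW // (lt_le_trans th) //.
have cv v : scvg (Gk ^~ v) (H v).
  move=> e ee; have e2 : 0 < e / 2 by rewrite divr_gt0.
  have /continuous_rVP/(_ _ e2)[r r0 rP] := Hc v.
  have [K KP] := exists_nat_gt ((l1 w + 1) / r); exists K => k Kk.
  have hk : h k * (l1 w + 1) <= r.
    rewrite /h ler_pdivrMl //; rewrite -ler_pdivrMr //; apply: le_trans (ltW KP) _.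
    by rewrite ler_nat (leq_trans Kk).
  have dl2 (t : R) : is_derive t (1:R) (fun t : R => G (v + t *: w) - t * H v) (H (v + t *: w) - H v).
    have d1 : is_derive t (1:R) (fun t : R => t * H v) (H v).
      have := is_deriveZ (H v) (is_derive_id t (1:R)); rewrite -[_ *: 1]/(_ * _) mulr1.
      by congr (is_derive _ _ _ _); apply/funext => s; rewrite /= mulrC.
    exact: (is_deriveB (dl v t) d1).
  have := @mvt_bound R (fun t : R => G (v + t *: w) - t * H v) _ 0 (h k) (e / 2) (ltW (h0 k)) (fun t _ => dl2 t).
  rewrite scale0r addr0 subr0 mul0r subr0 => M.
  have {}M : `|G (v + h k *: w) - h k * H v - G v| <= e / 2 * h k.
    apply: M => t /andP[t0 th]; apply: ltW; apply: rP => i; rewrite !mxE addrAC subrr add0r normrM (gtr0_norm t0).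
    apply: lt_le_trans hk; apply: (@le_lt_trans _ _ (t * l1 w)).
      by rewrite ler_wpM2l ?(ltW t0)// /l1 (bigD1 i) //= lerDl; apply: sumr_ge0.
    by apply: ltr_pM; rewrite ?(ltW t0) ?l1_ge0 // ltrDl.
  rewrite /Gk; have -> : (h k)^-1 * (G (v + h k *: w) - G v) - H v = (h k)^-1 * (G (v + h k *: w) - h k * H v - G v).
    by move: (h k) (h0 k) (G _) (G v) (H v) => a a0 x y z; field; rewrite gt_eqF.
  rewrite normrM normfV (gtr0_norm (h0 k)) ltr_pdivrMl //; apply: le_lt_trans M _.
  by rewrite mulrC ltr_pM2l // ltr_pdivrMr // ltr_pMr // ltr1n.
have [_ dct] := iint_main n (C * expR (et * l1 w)) e0.
have Hcl' : cls (C * expR (et * l1 w)) et H.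
  apply: cls_le Hcl => //; last by rewrite mulr_ge0 ?expR_ge0.
  by rewrite ler_peMr // -expR0 ler_expR mulr_ge0 ?l1_ge0 ?(ltW e0).
have := dct Gk H (fun k => conj (Gkc k) (bk^~ k)) Hcl' cv.
have Gk0 k : iint (Gk k) = 0.
  rewrite iintZ; last by apply: Cls_add; [exact: Cls_shift|have := Cls_scale (-1) Gc; congr Cls; apply/funext => v; rewrite mulN1r].
  rewrite (_ : iint _ = iint (fun v => G (v + h k *: w) + -1 * G v)); last by apply: iint_ext => v; rewrite mulN1r.
  by rewrite iintD ?iint_shift ?iintZ ?mulN1r ?subrr ?mulr0 //; [exact: Cls_shift|exact: Cls_scale].
under eq_fun do rewrite Gk0; move=> c0; apply: scvg_unique c0 _ => e ee; exists 0%N => k _.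
by rewrite subrr normr0.
Qed.

End IteratedIntegral.

(** * Logarithmic change of variables and an exponential integral *)

Section ChangeOfVariables.
Context {R : realType}.
Notation mu := (@lebesgue_measure R).

(** The sign vectors, listed by the recursion that [iint] follows, so that the substitution can be
    made one variable at a time. *)
Fixpoint sgl n : seq 'rV[R]_n :=
  match n with
  | 0 => [:: 0]
  | n'.+1 => [seq consr 1 y | y <- sgl n'] ++ [seq consr (-1) y | y <- sgl n']
  end.

Lemma sgl_norm n ep : ep \in sgl n -> forall i, `|ep 0 i| = 1.
Proof.
elim: n ep => [|n IH] ep /=; first by move=> _ [].
rewrite mem_cat => /orP[] /mapP[y /IH yP ->] i;
  by case: (unliftP ord0 i) => [j ->|->]; rewrite ?consrS ?consr0 ?normrN1 ?normr1.
Qed.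

Lemma Xp_consr n (e de t : R) (ep v : 'rV[R]_n) :
  Xp (consr e ep) de (consr t v) = consr (e * de * expR (- t)) (Xp ep de v).
Proof. by apply: consrP => [|i]; rewrite mxE ?consr0 ?consrS ?consr0 ?consrS ?mxE. Qed.

Lemma jac_consr n (t : R) (v : 'rV[R]_n) : jac (consr t v) = expR (- t) * jac v.
Proof.
rewrite /jac big_ord_recl consr0 opprD expRD; congr (_ * expR (- _)).
by apply: eq_bigr => i _; rewrite consrS.
Qed.

Lemma Xp_cont n (ep : 'rV[R]_n) (de : R) v i : {for v, continuous (fun v : 'rV[R]_n => Xp ep de v 0 i)}.
Proof.
have -> : (fun v : 'rV[R]_n => Xp ep de v 0 i) = (fun v => ep 0 i * de * expR (- v 0 i)) by apply/funext => w; rewrite mxE.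
have c1 : {for v, continuous (fun v : 'rV[R]_n => expR (- v 0 i))}.
  apply: (@continuous_comp _ _ _ (fun v : 'rV[R]_n => - v 0 i) expR); last exact: continuous_expR.
  have c0 : {for v, continuous (fun v : 'rV[R]_n => v 0 i)} by exact: coord_continuous.
  exact: (continuousN c0).
have c2 : {for v, continuous (fun _ : 'rV[R]_n => ep 0 i * de)} by exact: cst_continuous.
exact: (continuousM c2 c1).
Qed.

Lemma jac_cont n (v : 'rV[R]_n) : {for v, continuous (@jac R n)}.
Proof.
apply: (@continuous_comp _ _ _ (fun v : 'rV[R]_n => - \sum_i v 0 i) expR); last exact: continuous_expR.
have c0 : {for v, continuous (fun v : 'rV[R]_n => \sum_i v 0 i)}.
  by apply: (cvg_bigsum (nbhs_filter v)) => i _; exact: coord_continuous.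
exact: (continuousN c0).
Qed.

Section Support.
Variables (n : nat) (g : 'rV[R]_n -> R) (de : R).
Hypothesis de0 : 0 < de.
Hypothesis gc : continuous g.
Hypothesis gs : forall (x : 'rV[R]_n) i, de <= `|x 0 i| -> g x = 0.

Lemma cpt_bounded : exists2 M : R, 0 <= M & forall x, `|g x| <= M.
Proof.
have [M M0 MP] := @closed_box_bounded R n setT g de (fun x _ => I) (fun x _ => @gc x).
exists M => // x; have [h|/existsNP[i /negP]] := pselect (forall i, `|x 0 i| <= de); first exact: MP.
by rewrite -ltNge => /ltW/gs ->; rewrite normr0.
Qed.

Lemma Cls_cpt : Cls g.
Proof.
have [M M0 MP] := cpt_bounded; exists (M * expR (de *+ n)), 1; split => //; split => // x.
have [h|/existsNP[i /negP]] := pselect (forall i, `|x 0 i| <= de); last first.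
  by rewrite -ltNge => /ltW/gs ->; rewrite normr0 !mulr_ge0 ?expR_ge0.
apply: le_trans (MP x) _; rewrite -mulrA ler_peMr // -expRD -[leLHS]expR0 ler_expR mul1r subr_ge0.
by rewrite -[n in de *+ n]card_ord -sumr_const; exact: ler_sum.
Qed.

Lemma Cls_Xp (ep : 'rV[R]_n) : (forall i, `|ep 0 i| = 1) -> Cls (fun v => g (Xp ep de v) * jac v).
Proof.
move=> ep1; have [M M0 MP] := cpt_bounded; exists M, 1; split => //; split => [v|v].
  have c1 := @continuous_comp_rV R n n (Xp ep de) g v (fun i => @Xp_cont n ep de v i) (@gc _).
  exact: (continuousM c1 (@jac_cont n v)).
have [h|/existsNP[i /negP]] := pselect (forall i, 0 <= v 0 i); last first.
  rewrite -ltNge => vi; rewrite (gs (i := i)) ?mul0r ?normr0 ?mulr_ge0 ?expR_ge0 //.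
  rewrite mxE !normrM ep1 mul1r (gtr0_norm de0) (gtr0_norm (expR_gt0 _)) ler_peMr ?(ltW de0)//.
  by rewrite -expR0 ler_expR oppr_ge0 ltW.
rewrite normrM (gtr0_norm (expR_gt0 _)) mul1r (_ : l1 v = \sum_i v 0 i) ?ler_wpM2r ?expR_ge0 //.
by apply: eq_bigr => i _; rewrite ger0_norm.
Qed.

End Support.

Lemma iintS n (G : 'rV[R]_n.+1 -> R) :
  iint G = Rintegral mu setT (fun t => iint (fun y => G (consr t y))).
Proof. by []. Qed.

Lemma iint_subst n (g : 'rV[R]_n -> R) (de : R) : 0 < de -> continuous g ->
  (forall (x : 'rV[R]_n) i, de <= `|x 0 i| -> g x = 0) ->
  iint g = de ^+ n * \sum_(ep <- sgl n) iint (fun v => g (Xp ep de v) * jac v).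
Proof.
move=> de0; elim: n g => [|n IH] g gc gs.
  rewrite /= big_seq1 expr0 mul1r /jac big_ord0 oppr0 expR0 mulr1; congr g.
  by apply/rowP => -[].
have [C [et [e0 gcl]]] := Cls_cpt gc gs.
have [hc _] := inner_cls1 e0 gcl.
rewrite /= (Rint_subst de0 hc); last first.
  move=> t td; rewrite -[RHS](iint0 n); apply: iint_ext => y.
  by apply: (gs _ ord0); rewrite consr0.
have step (e : R) : `|e| = 1 ->
    Rintegral mu setT (fun v => iint (fun y => g (consr (e * de * expR (- v)) y)) * expR (- v)) =
    de ^+ n * \sum_(ep <- [seq consr e y | y <- sgl n]) iint (fun v => g (Xp ep de v) * jac v).
  move=> e1; rewrite big_map.
  have Fc (y : 'rV[R]_n) : (forall i, `|y 0 i| = 1) -> Cls (fun v => g (Xp (consr e y) de v) * jac v).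
    move=> y1; apply: Cls_Xp => // i; by case: (unliftP ord0 i) => [j ->|->]; rewrite ?consrS ?consr0.
  (* The guard makes [F y] integrable for every [y], as the exchange of sum and integral requires;
     it holds on all of [sgl n]. *)
  pose F (y : 'rV[R]_n) v := if [forall i, `|y 0 i| == 1] then g (Xp (consr e y) de v) * jac v else 0.
  have Fc' y : Cls (F y).
    have [yP|/negbTE yP] := boolP [forall i, `|y 0 i| == 1].
      have -> : F y = (fun v => g (Xp (consr e y) de v) * jac v) by apply/funext => v; rewrite /F yP.
      by apply: Fc => i; apply/eqP; exact: (forallP yP).
    have -> : F y = (fun=> 0) by apply/funext => v; rewrite /F yP.
    exact: Cls_0.
  have FE y v : y \in sgl n -> F y v = g (Xp (consr e y) de v) * jac v.
    by move=> /sgl_norm yP; rewrite /F ifT //; apply/forallP => i; rewrite yP.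
  have -> : \sum_(y <- sgl n) iint (fun v => g (Xp (consr e y) de v) * jac v) = \sum_(y <- sgl n) iint (F y).
    by apply: eq_big_seq => y yn; apply: iint_ext => v; rewrite FE.
  rewrite -iint_sum // -iintZ; last exact: Cls_sum.
  rewrite iintS; apply: eq_Rintegral => t _; rewrite IH; last 2 first.
  - by move=> y; apply: (@continuous_comp_rV R n n.+1 (consr _) g); [exact: consr_cont|exact: gc].
  - by move=> y i yi; apply: (gs _ (lift ord0 i)); rewrite consrS.
  rewrite -mulrA mulr_suml [in RHS]iintZ; last first.
    by have := Cls_consr t (Cls_sum (sgl n) Fc').
  congr (_ * _); rewrite iint_sum; last by move=> y; have := Cls_consr t (Fc' y).
  apply: eq_big_seq => y yn; rewrite mulrC -iintZ; last first.
    apply: (@Cls_Xp n (fun z => g (consr (e * de * expR (- t)) z)) de) => //; [| |exact: sgl_norm].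
    - by move=> z; apply: (@continuous_comp_rV R n n.+1 (consr _) g); [exact: consr_cont|exact: gc].
    - by move=> z i yi; apply: (gs _ (lift ord0 i)); rewrite consrS.
  by apply: iint_ext => w; rewrite FE // Xp_consr jac_consr mulrCA.
rewrite (step 1) ?normr1 // (step (-1)) ?normrN1 // -mulrDr big_cat /= exprS mulrA //.
Qed.

Lemma cont_exp_aff n m (B : 'M[R]_(m, n)) (c ep : R) (b : 'I_m -> R) :
  continuous (fun u : 'rV[R]_n => expR (- (ep * l1 u + c * \sum_k `|\sum_i B k i * u 0 i + b k|))).
Proof.
move=> u; apply: (@continuous_comp _ _ _ (fun u : 'rV[R]_n => - (ep * l1 u + c * \sum_k `|\sum_i B k i * u 0 i + b k|)) expR); last exact: continuous_expR.
have cc (a : R) : {for u, continuous (fun _ : 'rV[R]_n => a)} by exact: cst_continuous.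
have ci i : {for u, continuous (fun u : 'rV[R]_n => u 0 i)} by exact: coord_continuous.
have c1 : {for u, continuous (@l1 R n)}.
  apply: (cvg_bigsum (nbhs_filter u)) => i _.
  by apply: (@continuous_comp _ _ _ (fun u : 'rV[R]_n => u 0 i) (@Num.norm R R)); [exact: ci|exact: norm_continuous].
have c2 k : {for u, continuous (fun u : 'rV[R]_n => \sum_i B k i * u 0 i)}.
  by apply: (cvg_bigsum (nbhs_filter u)) => i _; exact: (continuousM (cc _) (ci i)).
have c3 : {for u, continuous (fun u : 'rV[R]_n => \sum_k `|\sum_i B k i * u 0 i + b k|)}.
  apply: (cvg_bigsum (nbhs_filter u)) => k _.
  apply: (@continuous_comp _ _ _ (fun u : 'rV[R]_n => \sum_i B k i * u 0 i + b k) (@Num.norm R R)); last exact: norm_continuous.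
  exact: (continuousD (c2 k) (cc (b k))).
exact: (continuousN (continuousD (continuousM (cc ep) c1) (continuousM (cc c) c3))).
Qed.

Lemma Cls_exp_aff n m (B : 'M[R]_(m, n)) (c ep : R) (b : 'I_m -> R) : 0 < ep -> 0 <= c ->
  cls 1 ep (fun u : 'rV[R]_n => expR (- (ep * l1 u + c * \sum_k `|\sum_i B k i * u 0 i + b k|))).
Proof.
move=> e0 c0; split; first exact: cont_exp_aff.
move=> u; rewrite (gtr0_norm (expR_gt0 _)) mul1r ler_expR lerN2 lerDl mulr_ge0 //.
by apply: sumr_ge0.
Qed.

Lemma outer_bound n (G : 'rV[R]_n.+1 -> R) (X ka b0 : R) : Cls G -> 0 < ka ->
  (forall t, iint (fun y => G (consr t y)) <= X * expR (- (ka * `|t + b0|))) -> iint G <= X * (2 / ka).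
Proof.
move=> Gc k0 GX.
have cl : cls1 `|X| ka (fun t : R => X * expR (- (ka * `|t|))).
  split => [t|t]; last by rewrite normrM (gtr0_norm (expR_gt0 _)).
  by apply: cvgM; [exact: cvg_cst|exact: cexpabs].
rewrite -Rint_expabs // -(Rint_shift b0 k0 cl); rewrite iintS; apply: le_Rintegral => //; first exact: Cls_inner.
exact: (cls1_int k0 (cls1_shift b0 k0 cl)).
Qed.

Lemma annihilator_vec p m n (K : 'M[R]_(p, m)) (A : 'M[R]_(m, n)) (be : 'cV[R]_m) : K *m A = 0 ->
  K *m be != 0 -> exists2 w : 'rV[R]_m, w *m A = 0 & (w *m be) 0 0 = 1.
Proof.
move=> KA kb; have [k kP] : exists k, (K *m be) k 0 != 0.
  apply: contrapT => no; case/eqP: kb; apply/matrixP => k j; rewrite ord1 [RHS]mxE.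
  by apply/eqP/negPn/negP => h; apply: no; exists k.
have rE : (row k K *m be) 0 0 = (K *m be) k 0 by rewrite -row_mul mxE.
exists (((K *m be) k 0)^-1 *: row k K); first by rewrite -scalemxAl -row_mul KA row0 scaler0.
by rewrite -scalemxAl mxE rE mulVf.
Qed.

(* Only the directions in which B degenerates contribute a factor 1/ep. *)
Lemma exp_int_bound n m (B : 'M[R]_(m, n)) (c : R) : 0 < c -> exists2 C : R, 0 <= C &
  forall (ep : R) (b : 'I_m -> R), 0 < ep -> ep <= 1 ->
  iint (fun u : 'rV[R]_n => expR (- (ep * l1 u + c * \sum_k `|\sum_i B k i * u 0 i + b k|)))
  <= C * (ep ^- (n - \rank B)%N).
Proof.
elim: n B c => [|n IH] B c c0.
  exists 1 => // ep b e0 e1 /=; rewrite sub0n expr0 invr1 mulr1 -expR0 ler_expR oppr_le0.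
  by rewrite addr_ge0 ?mulr_ge0 ?l1_ge0 ?(ltW e0) ?(ltW c0)// sumr_ge0.
pose B' : 'M[R]_(m, n) := \matrix_(k, i) B k (lift ord0 i).
pose be : 'cV[R]_m := \col_k B k ord0.
have sumB k (t : R) (y : 'rV[R]_n) : \sum_i B k i * consr t y 0 i = be k 0 * t + \sum_i B' k i * y 0 i.
  by rewrite big_ord_recl consr0 mxE; congr (_ + _); apply: eq_bigr => i _; rewrite consrS mxE.
have BE : B = row_mx be B' :> 'M[R]_(m, 1 + n).
  apply/matrixP => k i; case: (splitP i) => j ij.
    have -> : i = lshift n j by apply: val_inj.
    by rewrite row_mxEl mxE; congr (B k _); apply: val_inj => /=; case: j ij => -[].
  have -> : i = rshift 1 j by apply: val_inj.
  by rewrite row_mxEr mxE; congr (B k _); apply: val_inj.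
have Gc (cc ep : R) (b : 'I_m -> R) : 0 < ep -> 0 <= cc -> Cls (fun u : 'rV[R]_n.+1 => expR (- (ep * l1 u + cc * \sum_k `|\sum_i B k i * u 0 i + b k|))).
  by move=> e0 c0'; exists 1, ep; split => //; exact: Cls_exp_aff.
have Gc' (cc ep : R) (b : 'I_m -> R) : 0 < ep -> 0 <= cc -> Cls (fun u : 'rV[R]_n => expR (- (ep * l1 u + cc * \sum_k `|\sum_i B' k i * u 0 i + b k|))).
  by move=> e0 c0'; exists 1, ep; split => //; exact: Cls_exp_aff.
have inner (K cc ep : R) (b b' : 'I_m -> R) t : 0 < ep -> 0 <= cc ->
    (forall y : 'rV[R]_n, K + (ep * l1 y + cc * \sum_k `|\sum_i B' k i * y 0 i + b' k|) <=
       ep * l1 (consr t y) + c * \sum_k `|\sum_i B k i * consr t y 0 i + b k|) ->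
    iint (fun y => expR (- (ep * l1 (consr t y) + c * \sum_k `|\sum_i B k i * consr t y 0 i + b k|))) <=
    expR (- K) * iint (fun y => expR (- (ep * l1 y + cc * \sum_k `|\sum_i B' k i * y 0 i + b' k|))).
  move=> e0 c0' H; rewrite -iintZ; last exact: Gc'.
  apply: iint_le; [exact: (Cls_consr t (Gc c ep b e0 (ltW c0)))|by apply: Cls_scale; exact: Gc'|].
  by move=> y; rewrite -expRD ler_expR -opprD lerN2.
have rB' : (\rank B' <= n)%N by exact: rank_leq_col.
(* Either the first column does not increase the rank, and its variable costs a factor [2 / ep]; or
   it is independent of the other columns, and its variable decays at the fixed rate [ka]. *)
have [rk|rk] := leqP (\rank B) (\rank B').
  have rkE : \rank B = \rank B'.
    apply/eqP; rewrite eqn_leq rk /=; have -> : B' = B *m (\matrix_(i, j) (i == lift ord0 j)%:R).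
      apply/matrixP => k j; rewrite !mxE (bigD1 (lift ord0 j)) //= mxE eqxx mulr1 big1 ?addr0// => i /negbTE ij.
      by rewrite mxE ij mulr0.
    exact: mxrankM_maxl.
  have [C C0 CP] := IH B' c c0; exists (2 * C); first by rewrite mulr_ge0.
  move=> ep b e0 e1.
  have -> : 2 * C * ep ^- (n.+1 - \rank B) = C * ep ^- (n - \rank B') * (2 / ep).
    by rewrite rkE subSn // exprS invfM; ring.
  apply: (@outer_bound _ _ _ ep 0) => //; first exact: (Gc c ep b e0 (ltW c0)).
  move=> t; rewrite addr0.
  apply: (le_trans (@inner (ep * `|t|) c ep b (fun k => be k 0 * t + b k) t e0 (ltW c0) _)).
    move=> y; rewrite l1_consr mulrDr addrA lerD2l ler_wpM2l ?(ltW c0)//.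
    by apply: ler_sum => k _; rewrite sumB addrCA addrA.
  by rewrite mulrC ler_wpM2r ?expR_ge0 // CP.
have kb : kermx B' *m be != 0.
  apply/eqP => kb; have : (kermx B' <= kermx B)%MS.
    apply/sub_kermxP/matrixP => k i; rewrite [RHS]mxE; case: (unliftP ord0 i) => [j ->|->].
      have /matrixP/(_ k j) := mulmx_ker B'; rewrite [LHS]mxE [RHS]mxE => E; rewrite mxE -[RHS]E.
      by apply: eq_bigr => j' _; rewrite [B' _ _]mxE.
    have /matrixP/(_ k 0) := kb; rewrite [LHS]mxE [RHS]mxE => E; rewrite mxE -[RHS]E.
    by apply: eq_bigr => j' _; rewrite [be _ _]mxE.
  move=> /mxrankS; rewrite !mxrank_ker; have := rank_leq_row B; have := rank_leq_row B'.
  by move: rk; move: (\rank B) (\rank B') => p q; clear; lia.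
(* Pairing the affine forms with [w] eliminates the variables [y] and leaves [t + b0]. Half of the
   coefficient [c] is spent on decay in [t], the other half is kept for the induction. *)
have [w wB wbe] := annihilator_vec (mulmx_ker B') kb.
have wb : \sum_k w 0 k * be k 0 = 1 by move: wbe; rewrite mxE.
have wB0 (y : 'rV[R]_n) : \sum_k w 0 k * (\sum_i B' k i * y 0 i) = 0.
  under eq_bigr do rewrite mulr_sumr; rewrite exchange_big /= big1 // => i _.
  have /matrixP/(_ 0 i) := wB; rewrite !mxE => E.
  by under eq_bigr do rewrite mulrA; rewrite -mulr_suml E mul0r.
have rk2 : (\rank B <= (\rank B').+1)%N.
  have -> : \rank B = \rank (row_mx be B') by rewrite -BE.
  rewrite -mxrank_tr tr_row_mx -addsmxE; apply: leq_trans (mxrank_adds_leqif _ _).1 _.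
  by rewrite !mxrank_tr -[leqRHS]add1n leq_add2r rank_leq_col.
have rkE : (n.+1 - \rank B = n - \rank B')%N.
  by move: rk rk2; move: (\rank B) (\rank B') => p q; clear; lia.
pose W := 1 + \sum_k `|w 0 k|.
have W0 : 0 < W by rewrite ltr_pwDl //; apply: sumr_ge0.
pose ka := c / 2 / W.
have c2 : 0 < c / 2 by rewrite divr_gt0.
have ka0 : 0 < ka by rewrite divr_gt0.
have [C C0 CP] := IH B' (c / 2) c2; exists (C * (2 / ka)); first by rewrite mulr_ge0 // divr_ge0 // ltW.
move=> ep b e0 e1; rewrite rkE mulrAC.
apply: (@outer_bound _ _ _ ka (\sum_k w 0 k * b k)) => //; first exact: (Gc c ep b e0 (ltW c0)).
move=> t; set b0 := \sum_k _.
apply: (le_trans (@inner (ka * `|t + b0|) (c / 2) ep b (fun k => be k 0 * t + b k) t e0 (ltW c2) _)).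
  move=> y; rewrite l1_consr; under [X in _ <= _ + c * X]eq_bigr do rewrite sumB -addrA addrCA.
  set z := fun k => \sum_i B' k i * y 0 i + (be k 0 * t + b k).
  have zE : \sum_k w 0 k * z k = t + b0.
    rewrite /z; under eq_bigr do rewrite !mulrDr mulrA; rewrite !big_split /= wB0 add0r -mulr_suml wb mul1r //.
  have le1 : ka * `|t + b0| <= c / 2 * \sum_k `|z k|.
    rewrite /ka -mulrA ler_wpM2l ?(ltW c2)// ler_pdivrMl // -zE.
    apply: le_trans (ler_norm_sum _ _ _) _; rewrite mulr_sumr; apply: ler_sum => k _.
    rewrite normrM ler_wpM2r // /W (bigD1 k) //= addrCA lerDl addr_ge0 //; exact: sumr_ge0.
  have l0 := mulr_ge0 (ltW e0) (normr_ge0 t).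
  have -> : c = c / 2 + c / 2 by rewrite -splitr.
  rewrite mulrDr mulrDl; move: le1 l0; rewrite -splitr /=.
  move: (ka * _) (ep * `|t|) (ep * l1 y) (\sum_k `|z k|) => p q r s; move: (c / 2) => c'; nra.
by rewrite mulrC ler_wpM2r ?expR_ge0 // CP.
Qed.

End ChangeOfVariables.

(** * Complex powers and local expansions *)

Section ComplexModulus.
Context {R : realType}.
Implicit Types (z w : R[i]).
Local Notation Re := (@complex.Re R).
Local Notation Im := (@complex.Im R).

Lemma cmodC z : ((cmod z)%:C)%C = `|z|.
Proof. by rewrite normc_def. Qed.

Lemma cmodM z w : cmod (z * w) = cmod z * cmod w.
Proof. by apply: complexI; rewrite rmorphM /= !cmodC normrM. Qed.

Lemma cmodD z w : cmod (z + w) <= cmod z + cmod w.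
Proof. by rewrite -lecR rmorphD /= !cmodC ler_normD. Qed.

Lemma cmodN z : cmod (- z) = cmod z.
Proof. by apply: complexI; rewrite !cmodC normrN. Qed.

Lemma cmodB z w : cmod (z - w) <= cmod z + cmod w.
Proof. by rewrite -(cmodN w); exact: cmodD. Qed.

Lemma cmod_ge0 z : 0 <= cmod z. Proof. exact: sqrtr_ge0. Qed.

Lemma cmod0 : cmod (0 : R[i]) = 0.
Proof. by apply: complexI; rewrite cmodC normr0. Qed.

Lemma cmod1 : cmod (1 : R[i]) = 1.
Proof. by apply: complexI; rewrite cmodC normr1. Qed.

Lemma cmod_eq0 z : (cmod z == 0) = (z == 0).
Proof. by rewrite -(inj_eq (@complexI R)) cmodC normr_eq0. Qed.

Lemma cmod_gt0 z : (0 < cmod z) = (z != 0).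
Proof. by rewrite lt_def cmod_ge0 andbT cmod_eq0. Qed.

Lemma cmodX z k : cmod (z ^+ k) = cmod z ^+ k.
Proof. by elim: k => [|k IH]; rewrite ?expr0 ?cmod1 // !exprS cmodM IH. Qed.

Lemma cmodV z : cmod z^-1 = (cmod z)^-1.
Proof. by apply: complexI; rewrite cmodC normfV fmorphV /= cmodC. Qed.

Lemma cmod_sum (I : Type) (r : seq I) (P : pred I) (F : I -> R[i]) :
  cmod (\sum_(i <- r | P i) F i) <= \sum_(i <- r | P i) cmod (F i).
Proof.
elim: r => [|i r IH]; first by rewrite !big_nil cmod0.
by rewrite !big_cons; case: ifP => // _; apply: le_trans (cmodD _ _) _; rewrite lerD2l.
Qed.

Lemma cmod_cofR (r : R) : cmod (cofR r) = `|r|.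
Proof. by rewrite /cmod /= expr0n addr0 sqrtr_sqr. Qed.

Lemma Re_le_cmod z : `|Re z| <= cmod z.
Proof. by rewrite -sqrtr_sqr ler_sqrt ?addr_ge0 ?sqr_ge0 // lerDl sqr_ge0. Qed.

Lemma Im_le_cmod z : `|Im z| <= cmod z.
Proof. by rewrite -sqrtr_sqr ler_sqrt ?addr_ge0 ?sqr_ge0 // lerDr sqr_ge0. Qed.

Lemma cmod_le z : cmod z <= `|Re z| + `|Im z|.
Proof.
rewrite -[leRHS]ger0_norm ?addr_ge0 // -sqrtr_sqr ler_sqrt ?sqr_ge0 //.
rewrite -(real_normK (num_real (Re z))) -(real_normK (num_real (Im z))).
by have := mulr_ge0 (normr_ge0 (Re z)) (normr_ge0 (Im z)); move: `|Re z| `|Im z| => a b; nra.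
Qed.

Lemma cReM z w : Re (z * w) = Re z * Re w - Im z * Im w.
Proof. by case: z w => [a b] [c d]. Qed.
Lemma cImM z w : Im (z * w) = Re z * Im w + Im z * Re w.
Proof. by case: z w => [a b] [c d] /=; rewrite addrC. Qed.
Lemma cReD z w : Re (z + w) = Re z + Re w.
Proof. by case: z w => [a b] [c d]. Qed.
Lemma cImD z w : Im (z + w) = Im z + Im w.
Proof. by case: z w => [a b] [c d]. Qed.
Lemma cext z w : Re z = Re w -> Im z = Im w -> z = w.
Proof. by case: z w => [a b] [c d] /= -> ->. Qed.
Lemma Re_sum (I : Type) (r : seq I) (P : pred I) (F : I -> R[i]) :
  Re (\sum_(i <- r | P i) F i) = \sum_(i <- r | P i) Re (F i).
Proof. by elim: r => [|i r IH]; rewrite ?big_nil // !big_cons; case: ifP => // _; rewrite cReD IH. Qed.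
Lemma Im_sum (I : Type) (r : seq I) (P : pred I) (F : I -> R[i]) :
  Im (\sum_(i <- r | P i) F i) = \sum_(i <- r | P i) Im (F i).
Proof. by elim: r => [|i r IH]; rewrite ?big_nil // !big_cons; case: ifP => // _; rewrite cImD IH. Qed.

Lemma cofRD (a b : R) : cofR (a + b) = cofR a + cofR b.
Proof. by apply: cext; rewrite ?cReD ?cImD //= addr0. Qed.
Lemma cofRM (a b : R) : cofR (a * b) = cofR a * cofR b.
Proof. by apply: cext; rewrite ?cReM ?cImM /= ?mulr0 ?mul0r ?subr0 ?addr0. Qed.
Lemma cofRN (a : R) : cofR (- a) = - cofR a.
Proof. by apply: cext => /=; rewrite ?oppr0. Qed.
Lemma cofR1 : cofR 1 = 1 :> R[i]. Proof. by []. Qed.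
Lemma cofR_nat k : cofR (k%:R : R) = k%:R.
Proof. by elim: k => [|k IH] //; rewrite -!natr1 cofRD IH. Qed.
Lemma cofRX (a : R) k : cofR (a ^+ k) = cofR a ^+ k.
Proof. by elim: k => [|k IH]; rewrite ?expr0 // !exprS cofRM IH. Qed.
Lemma cofRV (a : R) : cofR a^-1 = (cofR a)^-1.
Proof. exact: (fmorphV (@real_complex R)). Qed.

End ComplexModulus.

Section OneVariable.
Context {R : realType}.
Local Notation Re := (@complex.Re R).
Local Notation Im := (@complex.Im R).

Lemma is_derive_epsP (g : R -> R) (r D : R) : is_derive r (1 : R) g D <->
  forall e : R, 0 < e -> exists2 d : R, 0 < d & forall h : R, `|h| < d -> `|g (r + h) - g r - h * D| <= e * `|h|.
Proof.
split => [[dg <-] e e0|H].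
  have /cvgrPdist_lt/(_ e e0) : (fun h : R => h^-1 *: ((g \o shift r) (h *: (1:R)) - g r)) @ 0^' --> 'D_(1:R) g r by exact: dg.
  rewrite near_withinE => /nbhs_ballP[d /= d0 dP]; exists d => // h hd.
  have [->|h0] := eqVneq h 0; first by rewrite addr0 subrr mul0r subrr normr0 mulr0.
  have := dP h; rewrite /ball /= sub0r normrN => /(_ hd h0).
  rewrite -![_ *: _]/(_ * _) mulr1 distrC (addrC h r).
  have -> : g (r + h) - g r - h * 'D_(1:R) g r = h * (h^-1 * (g (r + h) - g r) - 'D_(1:R) g r).
    by move: ('D_(1:R) g r) (g (r + h)) (g r) => p q s; field.
  by move=> lt; rewrite normrM mulrC ler_wpM2r // ltW.
have cv : (fun h : R => h^-1 *: ((g \o shift r) (h *: (1:R)) - g r)) @ 0^' --> D.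
  apply/cvgrPdist_lt => e e0; have e2 : 0 < e / 2 by rewrite divr_gt0.
  have [d d0 dP] := H _ e2; rewrite near_withinE; apply/nbhs_ballP; exists d => //= h.
  rewrite /ball /= sub0r normrN => hd h0; have := dP h hd.
  rewrite -![_ *: _]/(_ * _) mulr1 (addrC h r) (distrC D).
  have -> : g (r + h) - g r - h * D = h * (h^-1 * (g (r + h) - g r) - D).
    by move: (g (r + h)) (g r) => q s; field.
  rewrite normrM mulrC ler_pM2r ?normr_gt0 // => le; apply: le_lt_trans le _.
  by rewrite ltr_pdivrMr // ltr_pMr // ltr1n.
split; first by apply: cvgP cv.
exact: (cvg_lim _ cv).
Qed.

Lemma is_derive_psum (c : nat -> R) N (t : R) :
  is_derive t (1 : R) (fun t : R => \sum_(j < N.+1) t ^+ j * c j) (\sum_(j < N) t ^+ j * (j.+1%:R * c j.+1)).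
Proof.
elim: N => [|N IH].
  rewrite big_ord0 (_ : (fun t => _) = (fun=> c 0%N)); first exact: is_derive_cst.
  by apply/funext => s; rewrite big_ord_recl big_ord0 expr0 mul1r addr0.
have -> : (fun t : R => \sum_(j < N.+2) t ^+ j * c j) = (fun t : R => \sum_(j < N.+1) t ^+ j * c j + t ^+ N.+1 * c N.+1).
  by apply/funext => s; rewrite big_ord_recr.
have d1 : is_derive t (1:R) (fun t : R => t ^+ N.+1 * c N.+1) (t ^+ N * (N.+1%:R * c N.+1)).
  by apply: (is_derive_eq (is_derive_expM N.+1 (c N.+1) t)) => /=; ring.
rewrite big_ord_recr /=; exact: (is_deriveD IH d1).
Qed.

Definition cexp (w : R[i]) : R[i] := Complex (expR (Re w) * cos (Im w)) (expR (Re w) * sin (Im w)).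

(** Consider the remainder for [t w] as a function of real [t] in [[0, 1]]: the derivative of the
    remainder of index [N + 1] is [w] times the one of index [N]. In real and imaginary parts each
    mean value step gains the factor [|a| + |b| <= 2 |w|]. *)
Lemma cexp_taylor N (w : R[i]) :
  cmod (cexp w - \sum_(j < N) w ^+ j / (j`!)%:R) <= 2 * (2 * cmod w) ^+ N * expR (cmod w).
Proof.
pose a := Re w; pose b := Im w.
pose c j : R[i] := w ^+ j / (j`!)%:R.
have cS j : j.+1%:R * c j.+1 = w * c j.
  rewrite /c exprS factS natrM; have : j.+1%:R != 0 :> R[i] by rewrite pnatr_eq0.
  have : j`!%:R != 0 :> R[i] by rewrite pnatr_eq0 -lt0n fact_gt0.
  by move: (j.+1%:R : R[i]) (j`!%:R : R[i]) (w ^+ j) => p q s q0 p0; field; rewrite q0.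
have RcS j : j.+1%:R * Re (c j.+1) = a * Re (c j) - b * Im (c j).
  by have := congr1 Re (cS j); rewrite !cReM -[j.+1%:R]cofR_nat /= mul0r subr0.
have IcS j : j.+1%:R * Im (c j.+1) = a * Im (c j) + b * Re (c j).
  by have := congr1 Im (cS j); rewrite !cImM -[j.+1%:R]cofR_nat /= mul0r addr0.
pose pR N (t : R) := expR (0 - t * (- a)) * cos (t * b) - \sum_(j < N) t ^+ j * Re (c j).
pose pI N (t : R) := expR (0 - t * (- a)) * sin (t * b) - \sum_(j < N) t ^+ j * Im (c j).
have dl (t : R) : is_derive t (1:R) (fun t : R => t * b) b.
  have := is_deriveZ b (is_derive_id t (1:R)); rewrite -[_ *: 1]/(_ * _) mulr1.
  by congr (is_derive _ _ _ _); apply/funext => s; rewrite /= mulrC.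
have dc (t : R) : is_derive t (1:R) (fun t : R => cos (t * b)) (- sin (t * b) * b).
  exact: (@is_derive1_comp R cos (fun t : R => t * b) t _ _ (is_derive_cos _) (dl t)).
have ds (t : R) : is_derive t (1:R) (fun t : R => sin (t * b)) (cos (t * b) * b).
  exact: (@is_derive1_comp R sin (fun t : R => t * b) t _ _ (is_derive_sin _) (dl t)).
have dpR M (t : R) : is_derive t (1:R) (pR M.+1) (a * pR M t - b * pI M t).
  have d1 := is_deriveM (is_derive_expaff 0 (- a) t) (dc t).
  have d2 := is_deriveB d1 (is_derive_psum (fun j => Re (c j)) M t).
  apply: (is_derive_eq d2); rewrite -![_ *: _]/(_ * _) /pR /pI.
  under eq_bigr do rewrite RcS mulrBr [X in X - _]mulrCA [X in _ - X]mulrCA.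
  rewrite sumrB -!mulr_sumr; ring.
have dpI M (t : R) : is_derive t (1:R) (pI M.+1) (a * pI M t + b * pR M t).
  have d1 := is_deriveM (is_derive_expaff 0 (- a) t) (ds t).
  have d2 := is_deriveB d1 (is_derive_psum (fun j => Im (c j)) M t).
  apply: (is_derive_eq d2); rewrite -![_ *: _]/(_ * _) /pR /pI.
  under eq_bigr do rewrite IcS mulrDr [X in X + _]mulrCA [X in _ + X]mulrCA.
  rewrite big_split /= -!mulr_sumr; ring.
have c0 : c 0%N = 1 by rewrite /c expr0 fact0 invr1 mulr1.
have p0 M : pR M.+1 0 = 0 /\ pI M.+1 0 = 0.
  rewrite /pR /pI !mul0r subr0 expR0 cos0 sin0 !big_ord_recl !expr0 c0 /= !mul1r ?mulr0.
  by rewrite !big1 ?addr0 ?subrr // => j _; rewrite expr0n mul0r.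
pose B M := (2 * cmod w) ^+ M * expR (cmod w).
have ab : `|a| + `|b| <= 2 * cmod w by have := Re_le_cmod w; have := Im_le_cmod w; rewrite -/a -/b; move: `|a| `|b| (cmod w) => p q s; lra.
have main M (t : R) : 0 <= t <= 1 -> `|pR M t| <= B M /\ `|pI M t| <= B M.
  elim: M t => [|M IH] t /andP[t0 t1].
    have et : expR (0 - t * - a) <= expR (cmod w).
      rewrite ler_expR sub0r mulrN opprK; apply: le_trans (ler_norm _) _.
      rewrite normrM (ger0_norm t0); apply: le_trans (Re_le_cmod w); rewrite -/a.
      by rewrite ler_piMl.
    rewrite /pR /pI /B !big_ord0 !subr0 expr0 mul1r !normrM (gtr0_norm (expR_gt0 _)).
    have cs (x : R) : `|cos x| <= 1 by rewrite ler_norml cos_geN1 cos_le1.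
    have sn (x : R) : `|sin x| <= 1 by rewrite ler_norml sin_geN1 sin_le1.
    by split; rewrite -[leRHS]mulr1 ler_pM ?expR_ge0.
  have BM : 0 <= B M by rewrite mulr_ge0 ?exprn_ge0 ?mulr_ge0 ?cmod_ge0 ?expR_ge0.
  have BS : (`|a| + `|b|) * B M <= B M.+1 by rewrite /B exprS -mulrA ler_wpM2r // mulr_ge0 ?exprn_ge0 ?mulr_ge0 ?cmod_ge0 ?expR_ge0.
  have BS0 := le_trans (mulr_ge0 (addr_ge0 (normr_ge0 a) (normr_ge0 b)) BM) BS.
  have Bt : B M.+1 * (t - 0) <= B M.+1 by rewrite subr0 ler_piMr.
  split; apply: le_trans Bt.
    have := @mvt_bound R (pR M.+1) _ 0 t (B M.+1) t0 (fun u _ => dpR M u).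
    rewrite (p0 M).1 subr0; apply => u /andP[u0 ut]; apply: le_trans BS.
    have [|h1 h2] := IH u; first by rewrite (ltW u0) (le_trans (ltW ut)).
    by apply: le_trans (ler_normB _ _) _; rewrite !normrM mulrDl lerD // ler_wpM2l.
  have := @mvt_bound R (pI M.+1) _ 0 t (B M.+1) t0 (fun u _ => dpI M u).
  rewrite (p0 M).2 subr0; apply => u /andP[u0 ut]; apply: le_trans BS.
  have [|h1 h2] := IH u; first by rewrite (ltW u0) (le_trans (ltW ut)).
  by apply: le_trans (ler_normD _ _) _; rewrite !normrM mulrDl lerD // ler_wpM2l.
have [|h1 h2] := main N 1; first by rewrite ler01 lexx.
apply: le_trans (cmod_le _) _.
have -> : Re (cexp w - \sum_(j < N) c j) = pR N 1.
  rewrite cReD /pR /cexp /= sub0r mulrN opprK !mul1r; congr (_ + _).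
  have -> z : Re (- z) = - Re z by case: z.
  by rewrite Re_sum; congr (- _); apply: eq_bigr => j _; rewrite expr1n mul1r.
have -> : Im (cexp w - \sum_(j < N) c j) = pI N 1.
  rewrite cImD /pI /cexp /= sub0r mulrN opprK !mul1r; congr (_ + _).
  have -> z : Im (- z) = - Im z by case: z.
  by rewrite Im_sum; congr (- _); apply: eq_bigr => j _; rewrite expr1n mul1r.
by rewrite -mulrA mulr2n mulrDl mul1r lerD.
Qed.

End OneVariable.

(** * Truncated powers with logarithms *)

Section RealPowers.
Context {R : realType}.
Local Notation Re := (@complex.Re R).
Local Notation Im := (@complex.Im R).

Lemma contP (g : R -> R) (r : R) : {for r, continuous g} <->
  forall e : R, 0 < e -> exists2 d : R, 0 < d & forall h : R, `|h| < d -> `|g (r + h) - g r| < e.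
Proof.
split => [/cvgrPdist_lt H e e0|H].
  have /nbhs_ballP[d /= d0 dP] := H e e0; exists d => // h hd.
  by have := dP (r + h); rewrite /ball /= opprD addrA subrr sub0r normrN distrC => /(_ hd).
apply/(@cvgrPdist_lt _ _ _ (nbhs r)) => e e0; have [d d0 dP] := H e e0.
apply/nbhs_ballP; exists d => //= t; rewrite /ball /= distrC => td; rewrite distrC.
by have := dP _ td; rewrite (addrC r) subrK.
Qed.

Lemma pow_le_exp j (et : R) : 0 < et -> exists2 K : R, 0 <= K & forall u : R, `|u| ^+ j <= K * expR (et * `|u|).
Proof.
move=> e0; case: j => [|j]; first by exists 1 => // u; rewrite expr0 mul1r -expR0 ler_expR mulr_ge0 ?(ltW e0).
have j0 : 0 < j.+1%:R :> R by [].
exists ((j.+1%:R / et) ^+ j.+1); first by rewrite exprn_ge0 ?divr_ge0 ?(ltW e0).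
move=> u; have -> : expR (et * `|u|) = expR (et * `|u| / j.+1%:R) ^+ j.+1.
  by rewrite -expRM_natl; congr expR; field; rewrite gt_eqF.
rewrite -exprMn; apply: lerXn2r; [by rewrite nnegrE|by rewrite nnegrE mulr_ge0 ?expR_ge0 // divr_ge0 ?(ltW e0)|].
have h1 := expR_ge1Dx (et * `|u| / j.+1%:R).
apply: (@le_trans _ _ (j.+1%:R / et * (et * `|u| / j.+1%:R))); last first.
  by rewrite ler_wpM2l ?divr_ge0 ?(ltW e0)//; apply: le_trans h1; rewrite lerDr.
by rewrite le_eqVlt; apply/orP; left; apply/eqP; field; rewrite !gt_eqF.
Qed.

(** For [tg] the cosine or the sine this is the real or imaginary part of [r_+ ^ (x + i y)],
    multiplied by [(ln r) ^ j]; the exponent [j] counts derivatives in the complex power. *)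
Definition pc (tg : R -> R) (x y : R) (j : nat) (r : R) : R :=
  if r <= 0 then 0 else expR (x * ln r) * tg (y * ln r) * ln r ^+ j.

Lemma pcE tg x y j (r : R) : 0 < r -> pc tg x y j r = expR (x * ln r) * tg (y * ln r) * ln r ^+ j.
Proof. by move=> r0; rewrite /pc [r <= 0]leNgt r0. Qed.

Section Trig.
Variable tg : R -> R.
Hypothesis tg1 : forall u, `|tg u| <= 1.
Hypothesis tgc : continuous tg.

Lemma pc_bound x y j (r : R) : 0 < r -> `|pc tg x y j r| <= expR (x * ln r) * `|ln r| ^+ j.
Proof.
move=> r0; rewrite pcE // !normrM (gtr0_norm (expR_gt0 _)) normrX.
by rewrite ler_wpM2r ?exprn_ge0 // ler_piMr ?expR_ge0.
Qed.

(** Powers of the logarithm are absorbed by a change [et] of the exponent, downwards for [r < 1] and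
    upwards for [r >= 1]. *)
Lemma pc_bound2 x j (et : R) : 0 < et -> exists2 K : R, 0 <= K & forall y r, 0 < r ->
  `|pc tg x y j r| <= K * (expR ((x - et) * ln r) + expR ((x + et) * ln r)).
Proof.
move=> e0; have [K K0 KP] := pow_le_exp j e0; exists K => // y r r0.
apply: le_trans (pc_bound _ _ _ r0) _; apply: (@le_trans _ _ (expR (x * ln r) * (K * expR (et * `|ln r|)))).
  by rewrite ler_wpM2l ?expR_ge0.
rewrite mulrCA ler_wpM2l // -expRD; have [l0|l0] := leP 0 (ln r).
  by rewrite (ger0_norm l0) -mulrDl lerDr expR_ge0.
by rewrite (ltr0_norm l0) mulrN -mulrBl lerDl expR_ge0.
Qed.

Lemma pc_cont x y j : 0 < x -> continuous (pc tg x y j).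
Proof.
move=> x0 r; apply/contP => e e0; have [r0|r0|->] := ltgtP r 0.
- exists (- r); first by rewrite oppr_gt0.
  move=> h; rewrite ltr_norml => /andP[_ hr]; rewrite /pc (ltW r0) ifT ?subrr ?normr0//.
  by rewrite -lerBrDl sub0r ltW.
- have cl := continuous_ln r0.
  have fc : {for r, continuous (fun r => expR (x * ln r) * tg (y * ln r) * ln r ^+ j)}.
    have c1 (k : R) : {for r, continuous (fun r => k * ln r)} by apply: cvgM; [exact: cvg_cst|exact: cl].
    apply: cvgM; first apply: cvgM.
    - by apply: (continuous_comp (c1 x)); exact: continuous_expR.
    - by apply: (continuous_comp (c1 y)); exact: tgc.
    - by apply: (@continuous_comp _ _ _ (@ln R) (fun t => t ^+ j)); [exact: cl|exact: exprn_continuous].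
  have /contP/(_ e e0)[d d0 dP] := fc; exists (Num.min d r); first by rewrite lt_min d0.
  move=> h; rewrite lt_min => /andP[hd]; rewrite ltr_norml => /andP[hr _].
  have rh : 0 < r + h by rewrite -ltrBlDl sub0r.
  by rewrite !pcE //; exact: dP.
- have x2 : 0 < x / 2 by rewrite divr_gt0.
  have [K K0 KP] := pc_bound2 x j x2.
  pose q := e / (2 * K + 1).
  have K1 : 0 < 2 * K + 1 by rewrite ltr_wpDl // mulr_ge0.
  have q0 : 0 < q by rewrite divr_gt0.
  pose d := expR ((x / 2)^-1 * ln q).
  exists (Num.min 1 d); first by rewrite lt_min ltr01 expR_gt0.
  move=> h; rewrite lt_min add0r => /andP[h1 hd]; rewrite [pc _ _ _ _ 0]/pc lexx subr0.
  have [h0|h0] := leP h 0; first by rewrite /pc h0 normr0.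
  rewrite (gtr0_norm h0) in h1 hd; apply: le_lt_trans (KP y h h0) _.
  have ln0 : ln h <= 0 by rewrite -ln1 ler_ln ?posrE // ltW.
  have E1 : x - x / 2 = x / 2 by field.
  have h2 : expR ((x + x / 2) * ln h) <= expR (x / 2 * ln h).
    by rewrite ler_expR ler_wnM2r // lerDr ltW.
  have h3 : expR (x / 2 * ln h) < q.
    rewrite -[ltRHS]lnK ?posrE // ltr_expR mulrC -ltr_pdivlMr // mulrC.
    by rewrite -[ltRHS]expRK ltr_ln ?posrE ?expR_gt0.
  rewrite E1; apply: (@le_lt_trans _ _ (K * (q + q))).
    by rewrite ler_wpM2l // lerD // ?(ltW h3) // (le_trans h2) // ltW.
  have -> : K * (q + q) = 2 * K * q by ring.
  rewrite /q mulrA ltr_pdivrMr // mulrC ltr_pM2l // ltrDl //.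
Qed.

Variable tg' : R -> R.
Hypothesis dtg : forall u : R, is_derive u (1 : R) tg (tg' u).

(** For [x > 1] the formula persists at [r = 0], where the power is [O(r ^ x)]. This permits
    differentiating [F_+ ^ s] across the zero set of [F]. *)
Lemma pc_derive x y (r : R) : 1 < x ->
  is_derive r (1 : R) (pc tg x y 0) (x * pc tg (x - 1) y 0 r + y * pc tg' (x - 1) y 0 r).
Proof.
move=> x1; have [r0|r0|->] := ltgtP r 0; apply/is_derive_epsP => e e0.
- exists (- r); first by rewrite oppr_gt0.
  move=> h; rewrite ltr_norml => /andP[_ hr]; rewrite /pc (ltW r0) ifT ?mulr0 ?addr0 ?mulr0 ?subrr ?normr0 ?mulr_ge0 ?(ltW e0)//.
  by rewrite -lerBrDl sub0r ltW.
- have dln := is_derive1_ln r0.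
  have dk (k : R) : is_derive r (1:R) (fun r => k * ln r) (k * r^-1) by have := is_deriveZ k dln; rewrite -[_ *: _]/(_ * _).
  have d1 : is_derive r (1:R) (fun r => expR (x * ln r)) (expR (x * ln r) * (x * r^-1)).
    exact: (@is_derive1_comp R expR (fun r => x * ln r) r _ _ (is_derive_expR _) (dk x)).
  have d2 : is_derive r (1:R) (fun r => tg (y * ln r)) (tg' (y * ln r) * (y * r^-1)).
    exact: (@is_derive1_comp R tg (fun r => y * ln r) r _ _ (dtg _) (dk y)).
  have d3 := is_deriveM d1 d2.
  have eE : expR ((x - 1) * ln r) = expR (x * ln r) * r^-1.
    by rewrite mulrBl mul1r expRB lnK.
  have -> : x * pc tg (x - 1) y 0 r + y * pc tg' (x - 1) y 0 r =
     expR (x * ln r) *: (tg' (y * ln r) * (y * r^-1)) + tg (y * ln r) *: (expR (x * ln r) * (x * r^-1)).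
    rewrite !pcE // eE expr0 !mulr1 -![_ *: _]/(_ * _).
    by move: (expR _) (tg _) (tg' _) (r^-1) => p q s u; ring.
  have /is_derive_epsP/(_ e e0)[d dd dP] := d3; exists (Num.min d r); first by rewrite lt_min dd.
  move=> h; rewrite lt_min => /andP[hd]; rewrite ltr_norml => /andP[hr _].
  have rh : 0 < r + h by rewrite -ltrBlDl sub0r.
  by rewrite (pcE _ _ _ _ rh) (pcE _ _ _ 0 r0) !expr0 !mulr1; exact: dP.
- have x10 : 0 < x - 1 by rewrite subr_gt0.
  (* This is [e ^ (1 / (x - 1))], so that [h ^ (x - 1) <= e] for [0 < h < d]. *)
  pose d := expR ((x - 1)^-1 * ln e).
  exists d; first exact: expR_gt0.
  have pc0 t a b : pc t a b 0 0 = 0 by rewrite /pc lexx.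
  move=> h hd; rewrite add0r !pc0 !mulr0 addr0 mulr0 !subr0.
  have [h0|h0] := leP h 0; first by rewrite /pc h0 normr0 mulr_ge0 ?(ltW e0).
  rewrite (gtr0_norm h0) in hd *; apply: le_trans (pc_bound x y 0 h0) _.
  rewrite expr0 mulr1.
  have -> : expR (x * ln h) = expR ((x - 1) * ln h) * h by rewrite mulrBl mul1r expRB lnK ?posrE // divfK // gt_eqF.
  rewrite ler_wpM2r ?(ltW h0)// -[leRHS]lnK ?posrE // ler_expR mulrC -ler_pdivlMr // mulrC.
  by rewrite -[leRHS]expRK ler_ln ?posrE ?expR_gt0 // ltW.
Qed.
End Trig.

Lemma cos1 (u : R) : `|cos u| <= 1. Proof. by rewrite ler_norml cos_geN1 cos_le1. Qed.
Lemma sin1' (u : R) : `|sin u| <= 1. Proof. by rewrite ler_norml sin_geN1 sin_le1. Qed.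

Lemma Re_cpowR (r : R) z : Re (cpowR r z) = pc cos (Re z) (Im z) 0 r.
Proof.
rewrite /cpowR /pc; case: leP => // r0 /=.
by rewrite expr0 mulr1 /powR gt_eqF.
Qed.

Lemma Im_cpowR (r : R) z : Im (cpowR r z) = pc sin (Re z) (Im z) 0 r.
Proof.
rewrite /cpowR /pc; case: leP => // r0 /=.
by rewrite expr0 mulr1 /powR gt_eqF.
Qed.

Lemma cpowR_cexp (r : R) z : 0 < r -> cpowR r z = cexp (z * cofR (ln r)).
Proof.
move=> r0; rewrite /cpowR leNgt r0 /= /cexp cReM cImM /= !mulr0 subr0 add0r /powR gt_eqF //.
Qed.

Lemma cexpD z w : cexp (z + w) = cexp z * cexp w :> R[i].
Proof.
rewrite /cexp cReD cImD expRD cosD sinD; apply: cext; rewrite ?cReM ?cImM /=; ring.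
Qed.

Lemma cpowR_le0 (r : R) z : r <= 0 -> cpowR r z = 0.
Proof. by rewrite /cpowR => ->. Qed.

Lemma cpowRD (r : R) z w : 0 < r -> cpowR r (z + w) = cpowR r z * cpowR r w.
Proof. by move=> r0; rewrite !cpowR_cexp // mulrDl cexpD. Qed.

Lemma cpowRS (r : R) z : cpowR r (z + 1) = cpowR r z * cofR r.
Proof.
have [r0|r0] := leP r 0; first by rewrite !cpowR_le0 // mul0r.
rewrite cpowRD //; congr (_ * _); rewrite cpowR_cexp // mul1r /cexp /= lnK ?posrE // cos0 sin0 mulr1 mulr0 //.
Qed.

Lemma cmod_cpowR (r : R) z : 0 < r -> cmod (cpowR r z) = expR (Re z * ln r).
Proof.
move=> r0; rewrite cpowR_cexp // /cmod /cexp /= !exprMn -mulrDr cos2Dsin2 mulr1 sqrtr_sqr gtr0_norm ?expR_gt0 //.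
by rewrite cReM /= mulr0 subr0.
Qed.

Lemma cpowR_max (r : R) z : cpowR (Num.max r 0) z = cpowR r z.
Proof. by rewrite maxEle; case: ifP => // r0; rewrite !cpowR_le0. Qed.

End RealPowers.

(** * Local expansions and orders of poles *)

Section LocalExpansions.
Context {R : realType}.
Implicit Types (e : R[i] -> R[i]) (z h : R[i]) (P : {poly R[i]}).

(** Approximation by polynomials to every finite order, including at [h = 0]. It follows from
    integral estimates, is stable under sums and products, and implies complex differentiability.
    [Lau M] is the punctured version for [h ^ M e], which retains enough of a Laurent expansion to
    decide the order of a pole. *)
Definition Tay e z := forall r : nat, exists P, exists C d : R, 0 < d /\
  forall h, cmod h < d -> cmod (e (z + h) - P.[h]) <= C * cmod h ^+ r.
Definition Lau M e z := forall r : nat, exists P, exists C d : R, 0 < d /\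
  forall h, 0 < cmod h < d -> cmod (h ^+ M * e (z + h) - P.[h]) <= C * cmod h ^+ r.

Lemma poly_bounded P : exists2 K : R, 0 <= K & forall h, cmod h <= 1 -> cmod P.[h] <= K.
Proof.
exists (\sum_(i < size P) cmod P`_i); first by apply: sumr_ge0 => i _; exact: cmod_ge0.
move=> h h1; rewrite horner_coef; apply: le_trans (cmod_sum _ _ _) _; apply: ler_sum => i _.
by rewrite cmodM cmodX ler_piMr ?cmod_ge0 // exprn_ile1 // cmod_ge0.
Qed.

Lemma Lau_pair M N e e' z r : Lau M e z -> Lau N e' z -> exists P Q, exists C d : R, [/\ 0 < d, d <= 1, 0 <= C &
  forall h, 0 < cmod h < d -> cmod (h ^+ M * e (z + h) - P.[h]) <= C * cmod h ^+ r /\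
    cmod (h ^+ N * e' (z + h) - Q.[h]) <= C * cmod h ^+ r].
Proof.
move=> /(_ r)[P [C [d [d0 dP]]]] /(_ r)[Q [D [d' [d0' dQ]]]].
exists P, Q, (`|C| + `|D|), (Num.min 1 (Num.min d d')); split.
- by rewrite !lt_min ltr01 d0.
- by rewrite ge_min lexx.
- exact: addr_ge0.
move=> h; rewrite !lt_min => /and4P[h0 _ h1 h2]; split.
  apply: le_trans (dP h _) _; first by rewrite h0.
  by rewrite ler_wpM2r ?exprn_ge0 ?cmod_ge0 //; apply: le_trans (ler_norm _) _; rewrite lerDl.
apply: le_trans (dQ h _) _; first by rewrite h0.
by rewrite ler_wpM2r ?exprn_ge0 ?cmod_ge0 //; apply: le_trans (ler_norm _) _; rewrite lerDr.
Qed.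

Lemma Lau_mul M N e e' z : Lau M e z -> Lau N e' z -> Lau (M + N) (fun s => e s * e' s) z.
Proof.
move=> eL eL' r; have [P [Q [C [d [d0 d1 C0 dP]]]]] := Lau_pair r eL eL'.
have [K K0 KP] := poly_bounded P; have [L L0 LP] := poly_bounded Q.
exists (P * Q), (C * (L + C) + K * C), d; split => // h hd; have [h1 h2] := dP h hd.
case/andP: hd => h0 hd; have hle : cmod h <= 1 by exact: ltW (lt_le_trans hd d1).
have hr : 0 <= cmod h ^+ r <= 1 by rewrite exprn_ge0 ?exprn_ile1 ?cmod_ge0.
rewrite hornerM exprD; set x := h ^+ M * e (z + h) in h1; set y := h ^+ N * e' (z + h) in h2.
have -> : h ^+ M * h ^+ N * (e (z + h) * e' (z + h)) - P.[h] * Q.[h] = (x - P.[h]) * y + P.[h] * (y - Q.[h]).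
  by rewrite /x /y; ring.
have yb : cmod y <= L + C.
  rewrite -[y](subrK Q.[h]) addrC; apply: le_trans (cmodD _ _) _; apply: lerD; first exact: LP.
  by apply: le_trans h2 _; rewrite ler_piMr //; case/andP: hr.
apply: le_trans (cmodD _ _) _; rewrite (cmodM (x - _) y) (cmodM P.[h]) mulrDl; apply: lerD.
  by rewrite mulrAC; apply: ler_pM; rewrite ?cmod_ge0.
by rewrite -mulrA ler_pM ?cmod_ge0 ?KP.
Qed.

Lemma Lau_up M N e z : Lau M e z -> Lau (M + N) e z.
Proof.
move=> eL r; have [P [C [d [d0 dP]]]] := eL r.
exists (P * 'X^N), `|C|, (Num.min 1 d); split; first by rewrite lt_min ltr01.
move=> h; rewrite lt_min => /and3P[h0 h1 hd].
rewrite hornerM hornerXn exprD mulrAC -mulrBl cmodM cmodX; apply: le_trans (_ : `|C| * cmod h ^+ r * 1 <= _); last by rewrite mulr1.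
apply: ler_pM; rewrite ?cmod_ge0 ?exprn_ge0 ?cmod_ge0 ?exprn_ile1 ?cmod_ge0 ?(ltW h1)//.
apply: le_trans (dP h _) _; first by rewrite h0.
by rewrite ler_wpM2r ?exprn_ge0 ?cmod_ge0 ?ler_norm.
Qed.

Lemma Lau_add M N e e' z : Lau M e z -> Lau N e' z -> Lau (M + N) (fun s => e s + e' s) z.
Proof.
move=> /(Lau_up N) eL /(Lau_up M) eL' r; rewrite addnC in eL'.
have [P [Q [C [d [d0 d1 C0 dP]]]]] := Lau_pair r eL eL'.
exists (P + Q), (C + C), d; split => // h hd; have [h1 h2] := dP h hd.
rewrite hornerD mulrDr opprD addrACA mulrDl; apply: le_trans (cmodD _ _) _; exact: lerD.
Qed.

Lemma Tay_Lau e z : Tay e z -> Lau 0 e z.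
Proof.
move=> eT r; have [P [C [d [d0 dP]]]] := eT r; exists P, C, d; split => // h /andP[_ hd].
by rewrite expr0 mul1r; exact: dP.
Qed.

Lemma Tay_pair e e' z r : Tay e z -> Tay e' z -> exists P Q, exists C d : R, [/\ 0 < d, d <= 1, 0 <= C &
  forall h, cmod h < d -> cmod (e (z + h) - P.[h]) <= C * cmod h ^+ r /\
    cmod (e' (z + h) - Q.[h]) <= C * cmod h ^+ r].
Proof.
move=> /(_ r)[P [C [d [d0 dP]]]] /(_ r)[Q [D [d' [d0' dQ]]]].
exists P, Q, (`|C| + `|D|), (Num.min 1 (Num.min d d')); split.
- by rewrite !lt_min ltr01 d0.
- by rewrite ge_min lexx.
- exact: addr_ge0.
move=> h; rewrite !lt_min => /and3P[_ h1 h2]; split.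
  apply: le_trans (dP h h1) _.
  by rewrite ler_wpM2r ?exprn_ge0 ?cmod_ge0 //; apply: le_trans (ler_norm _) _; rewrite lerDl.
apply: le_trans (dQ h h2) _.
by rewrite ler_wpM2r ?exprn_ge0 ?cmod_ge0 //; apply: le_trans (ler_norm _) _; rewrite lerDr.
Qed.

Lemma Tay_mul e e' z : Tay e z -> Tay e' z -> Tay (fun s => e s * e' s) z.
Proof.
move=> eL eL' r; have [P [Q [C [d [d0 d1 C0 dP]]]]] := Tay_pair r eL eL'.
have [K K0 KP] := poly_bounded P; have [L L0 LP] := poly_bounded Q.
exists (P * Q), (C * (L + C) + K * C), d; split => // h hd; have [h1 h2] := dP h hd.
have hle : cmod h <= 1 by exact: ltW (lt_le_trans hd d1).
have hr : 0 <= cmod h ^+ r <= 1 by rewrite exprn_ge0 ?exprn_ile1 ?cmod_ge0.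
rewrite hornerM; set x := e (z + h) in h1 *; set y := e' (z + h) in h2 *.
have -> : x * y - P.[h] * Q.[h] = (x - P.[h]) * y + P.[h] * (y - Q.[h]) by ring.
have yb : cmod y <= L + C.
  rewrite -[y](subrK Q.[h]) addrC; apply: le_trans (cmodD _ _) _; apply: lerD; first exact: LP.
  by apply: le_trans h2 _; rewrite ler_piMr //; case/andP: hr.
apply: le_trans (cmodD _ _) _; rewrite (cmodM (x - _) y) (cmodM P.[h]) mulrDl; apply: lerD.
  by rewrite mulrAC; apply: ler_pM; rewrite ?cmod_ge0.
by rewrite -mulrA ler_pM ?cmod_ge0 ?KP.
Qed.

Lemma Tay_add e e' z : Tay e z -> Tay e' z -> Tay (fun s => e s + e' s) z.
Proof.
move=> eL eL' r; have [P [Q [C [d [d0 d1 C0 dP]]]]] := Tay_pair r eL eL'.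
exists (P + Q), (C + C), d; split => // h hd; have [h1 h2] := dP h hd.
rewrite hornerD opprD addrACA mulrDl; apply: le_trans (cmodD _ _) _; exact: lerD.
Qed.

Lemma Tay_lin (al be : R[i]) z : Tay (fun s => al * s + be) z.
Proof.
move=> r; exists (al *: 'X + (al * z + be)%:P), 0, 1; split => // h _.
rewrite hornerD hornerZ hornerX hornerC mul0r.
by rewrite (_ : _ - _ = 0) ?cmod0 //; ring.
Qed.

Lemma Tay_cst (c : R[i]) z : Tay (fun=> c) z.
Proof.
by move=> r; exists c%:P, 0, 1; split => // h _; rewrite hornerC subrr cmod0 mul0r.
Qed.

(** With [q = al z + be], one step of the geometric series expresses the inverse through itself
    times [h], so each step raises the order of approximation by one. *)
Lemma Tay_inv (al be z : R[i]) : al * z + be != 0 -> Tay (fun s => (al * s + be)^-1) z.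
Proof.
set q := al * z + be => q0; have cq : 0 < cmod q by rewrite cmod_gt0.
pose d := cmod q / (2 * (cmod al + 1)).
have al1 : 0 < cmod al + 1 by rewrite ltr_wpDl ?cmod_ge0.
have d0 : 0 < d by rewrite divr_gt0 // mulr_gt0.
have lb h : cmod h < d -> cmod q / 2 <= cmod (q + al * h).
  move=> hd; have : cmod (al * h) <= cmod q / 2.
    rewrite cmodM; apply: (@le_trans _ _ ((cmod al + 1) * d)).
      by rewrite ler_pM ?cmod_ge0 ?(ltW hd) // lerDl.
    by rewrite /d le_eqVlt; apply/orP; left; apply/eqP; field; rewrite gt_eqF.
  have := cmodB (q + al * h) (al * h); rewrite addrK.
  by move: (cmod q) (cmod (q + al * h)) (cmod (al * h)) => a b c; lra.
have nz h : cmod h < d -> q + al * h != 0.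
  by move=> hd; rewrite -cmod_gt0; apply: lt_le_trans (lb h hd); rewrite divr_gt0.
have eE h : al * (z + h) + be = q + al * h by rewrite /q; ring.
elim => [|r [P [C [d' [d'0 dP]]]]].
  exists 0, (cmod q / 2)^-1, d; split => // h hd; rewrite horner0 subr0 expr0 mulr1 cmodV eE.
  by rewrite lef_pV2 ?lb // posrE ?cmod_gt0 ?nz ?divr_gt0.
exists (q^-1 *: (1 - al *: ('X * P))), (cmod (al / q) * C), (Num.min d d'); split; first by rewrite lt_min d0.
move=> h; rewrite lt_min => /andP[hd hd']; have := dP h hd'; rewrite eE.
have hq := nz h hd.
rewrite hornerZ hornerD hornerN hornerZ hornerM hornerX hornerC.
have -> : (q + al * h)^-1 - q^-1 * (1 - al * (h * P.[h])) = - (al / q * h * ((q + al * h)^-1 - P.[h])).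
  have E4 (u a x p : R[i]) : u != 0 -> u + a * x != 0 ->
      (u + a * x)^-1 - u^-1 * (1 - a * (x * p)) = - (a / u * x * ((u + a * x)^-1 - p)).
    by move=> u0 ux; field; rewrite u0 ux.
  exact: E4.
rewrite cmodN !cmodM exprS => H; rewrite mulrACA -!mulrA ler_wpM2l ?cmod_ge0 // ler_wpM2l ?cmod_ge0 //.
by rewrite ler_wpM2l ?cmod_ge0.
Qed.

Lemma Lau_inv (al be z : R[i]) : al != 0 -> exists M, Lau M (fun s => (al * s + be)^-1) z.
Proof.
move=> a0; have [q0|q0] := eqVneq (al * z + be) 0; last by exists 0%N; apply: Tay_Lau; exact: Tay_inv.
exists 1%N => r; exists (al^-1)%:P, 0, 1; split => // h /andP[h0 _].
have -> : al * (z + h) + be = al * h by rewrite -[RHS]add0r -q0; ring.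
rewrite hornerC mul0r expr1 (_ : _ - _ = 0) ?cmod0 //.
by rewrite cmod_gt0 in h0; field; rewrite a0.
Qed.

Lemma Lau_congr M e e' z (d : R) : 0 < d -> (forall h, 0 < cmod h < d -> e (z + h) = e' (z + h)) ->
  Lau M e z -> Lau M e' z.
Proof.
move=> d0 ee eL r; have [P [C [d' [d'0 dP]]]] := eL r; exists P, C, (Num.min d d'); split; first by rewrite lt_min d0.
by move=> h; rewrite lt_min => /and3P[h0 h1 h2]; rewrite -ee ?h0 //; apply: dP; rewrite h0.
Qed.

Lemma Tay_congr e e' z (d : R) : 0 < d -> (forall h, cmod h < d -> e (z + h) = e' (z + h)) ->
  Tay e z -> Tay e' z.
Proof.
move=> d0 ee eL r; have [P [C [d' [d'0 dP]]]] := eL r; exists P, C, (Num.min d d'); split; first by rewrite lt_min d0.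
by move=> h; rewrite lt_min => /andP[h1 h2]; rewrite -ee //; exact: dP.
Qed.

Lemma poly_X P : exists Q, P = Q * 'X + (P.[0])%:P.
Proof.
have /factor_theorem[Q QE] : root (P - (P.[0])%:P) 0 by rewrite rootE hornerD hornerN hornerC subrr.
by exists Q; rewrite -['X]subr0 -QE subrK.
Qed.

Lemma Tay_holo e z : Tay e z -> holo_at e z.
Proof.
move=> /(_ 2%N)[P [C [d [d0 dP]]]].
have ez : e z = P.[0].
  apply/eqP; rewrite -subr_eq0 -cmod_eq0 eq_le cmod_ge0 andbT.
  by have := dP 0; rewrite cmod0 addr0 expr0n /= mulr0; apply.
have [Q QE] := poly_X P; have [S SE] := poly_X Q; have [K K0 KP] := poly_bounded S.
have PE h : P.[h] = e z + h * Q.[0] + h * h * S.[h].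
  by rewrite {1}QE hornerD hornerM hornerX hornerC ez {1}SE hornerD hornerM hornerX hornerC; ring.
exists Q.[0] => ep ep0.
have C1 : 0 < `|C| + K + 1 by rewrite ltr_wpDl // addr_ge0.
exists (Num.min (Num.min 1 d) (ep / (`|C| + K + 1))); first by rewrite !lt_min ltr01 d0 divr_gt0.
move=> h; rewrite !lt_min => /andP[h0 /andP[/andP[h1 hd] hep]].
have hn : h != 0 by rewrite -cmod_gt0.
have -> : (e (z + h) - e z) / h - Q.[0] = h^-1 * (e (z + h) - P.[h]) + h * S.[h].
  by rewrite PE; move: (e (z + h)) (e z) => a b; field.
apply: le_lt_trans (cmodD _ _) _; rewrite !cmodM cmodV.
apply: (@le_lt_trans _ _ (cmod h * (`|C| + K))).
  rewrite mulrDr; apply: lerD; last by rewrite ler_wpM2l ?cmod_ge0 // KP // ltW.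
  rewrite ler_pdivrMl //; apply: le_trans (dP h hd) _.
  by rewrite expr2 mulrC -mulrA !ler_wpM2l ?cmod_ge0 ?ler_norm.
move: hep; rewrite ltr_pdivlMr // => hep; apply: le_lt_trans hep.
by rewrite ler_wpM2l ?cmod_ge0 // lerDl.
Qed.

Lemma Lau_pole M e z : Lau M e z -> pole_le e z M.
Proof.
move=> /(_ 0%N)[P [C [d [d0 dP]]]]; have [K K0 KP] := poly_bounded P.
exists (`|C| + K), (Num.min 1 d); first by rewrite lt_min ltr01.
move=> s; rewrite lt_min => /and3P[s0 s1 sd]; have := dP (s - z); rewrite s0 sd => /(_ isT).
rewrite (addrC z) subrK expr0 mulr1 => H.
rewrite -[X in cmod X](subrK P.[s - z]); apply: le_trans (cmodD _ _) _; apply: lerD; last by rewrite KP // ltW.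
exact: le_trans H (ler_norm _).
Qed.

Lemma pole_le_up e z (m M : nat) : (m <= M)%N -> pole_le e z m -> pole_le e z M.
Proof.
move=> mM [K [d d0 dP]]; exists `|K|, (Num.min 1 d); first by rewrite lt_min ltr01.
move=> s; rewrite lt_min => /and3P[s0 s1 sd].
rewrite -(subnK mM) exprD -mulrA cmodM cmodX; apply: le_trans (_ : 1 * `|K| <= _); last by rewrite mul1r.
apply: ler_pM; rewrite ?exprn_ge0 ?cmod_ge0 ?exprn_ile1 ?cmod_ge0 ?(ltW s1)//.
by apply: le_trans (dP s _) (ler_norm _); rewrite s0.
Qed.

(** Letting [ep] tend to zero kills the constant term; division by the variable lowers both the
    degree of the bound and the number of factors to be found. *)
Lemma poly_Xn P (q : nat) (C d : R) : 0 < d -> (forall ep : R, 0 < ep < d -> cmod P.[cofR ep] <= C * ep ^+ q) ->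
  exists Q, P = Q * 'X^q.
Proof.
elim: q P C d => [|q IH] P C d d0 H; first by exists P; rewrite expr0 mulr1.
have [Q QE] := poly_X P.
have [K K0 KP] := poly_bounded Q.
have PE x : P.[0] = P.[x] - Q.[x] * x.
  by rewrite {2}QE hornerD hornerM hornerX hornerC addrAC subrr add0r.
have P0 : P.[0] = 0.
  apply/eqP; rewrite -cmod_eq0 eq_le cmod_ge0 andbT leNgt; apply/negP => p0.
  pose ep := Num.min (Num.min (d / 2) 1) (cmod P.[0] / (2 * (`|C| + K + 1))).
  have C1 : 0 < `|C| + K + 1 by rewrite ltr_wpDl // addr_ge0.
  have e0 : 0 < ep by rewrite !lt_min ltr01 !divr_gt0 // mulr_gt0.
  have ed : ep < d by rewrite !gt_min ltr_pdivrMr // ltr_pMr // ltr1n.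
  have e1 : ep <= 1 by rewrite !ge_min lexx orbT.
  have ee : ep <= cmod P.[0] / (2 * (`|C| + K + 1)) by rewrite ge_min lexx orbT.
  have h1 : cmod P.[cofR ep] <= `|C| * ep.
    apply: le_trans (H ep _) _; first by rewrite e0.
    rewrite exprS mulrA; apply: le_trans (_ : `|C| * ep * 1 <= _); last by rewrite mulr1.
    apply: le_trans (ler_norm _) _; rewrite normrM normrM (gtr0_norm e0) ler_wpM2l ?mulr_ge0 ?(ltW e0)//.
    by rewrite ger0_norm ?exprn_ge0 ?exprn_ile1 ?(ltW e0).
  have h2 : cmod P.[0] <= `|C| * ep + K * ep.
    rewrite (PE (cofR ep)); apply: le_trans (cmodB _ _) _; apply: lerD => //.
    rewrite cmodM cmod_cofR (gtr0_norm e0) ler_wpM2r ?(ltW e0)// KP // cmod_cofR (gtr0_norm e0) //.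
  have h3 : (`|C| + K + 1) * ep <= cmod P.[0] / 2.
    move: ee; rewrite ler_pdivlMr ?mulr_gt0 // => ee; rewrite ler_pdivlMr //; apply: le_trans ee.
    have E5 (a b : R) : a * b * 2 = b * (2 * a) by ring.
    by rewrite E5.
  have F (a b c k : R) : 0 < a -> a <= b * c + k * c -> (b + k + 1) * c <= a / 2 -> 0 < c -> False by nra.
  exact: F p0 h2 h3 e0.
have [||S SE] := IH Q C (Num.min d 1) _ _; first by rewrite lt_min d0 ltr01.
  move=> ep; rewrite lt_min => /and3P[e0 ed e1]; have := H ep; rewrite e0 ed => /(_ isT).
  rewrite {1}QE P0 addr0 hornerM hornerX cmodM cmod_cofR (gtr0_norm e0) exprSr mulrA ler_pM2r //.
by exists S; rewrite QE P0 addr0 {1}SE -mulrA -exprSr.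
Qed.

(** If the known order [M] exceeds [m], approximate [h ^ M e] to order [M]. On the positive real ray
    this polynomial is [O(ep ^ (M - m))], hence divisible by that power of the variable, and the
    resulting bound holds for complex [h]. *)
Lemma Lau_real_bound M e z (m : nat) (C d : R) : Lau M e z -> 0 < d ->
  (forall ep : R, 0 < ep < d -> cmod (e (z + cofR ep)) <= C * ep ^- m) -> pole_le e z m.
Proof.
move=> eL d0 H; have [Mm|mM] := leqP M m; first by apply: pole_le_up Mm _; exact: Lau_pole.
have [P [C' [d' [d'0 dP]]]] := eL M.
have [q qE] : exists q, M = (q + m)%N by exists (M - m)%N; rewrite subnK // ltnW.
have [||Q QE] := @poly_Xn P q (`|C| + `|C'|) (Num.min (Num.min d 1) d') _ _; first by rewrite !lt_min d0 ltr01.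
  move=> ep; rewrite !lt_min => /andP[e0 /andP[/andP[ed e1] ed']].
  have := dP (cofR ep); rewrite cmod_cofR (gtr0_norm e0) e0 ed' => /(_ isT) h1.
  rewrite -[P.[_]](subrK (cofR ep ^+ M * e (z + cofR ep))) addrC; apply: le_trans (cmodD _ _) _.
  rewrite mulrDl; apply: lerD.
    rewrite cmodM cmodX cmod_cofR (gtr0_norm e0) qE exprD.
    have h2 := H ep; rewrite e0 ed in h2; have {}h2 := h2 isT.
    have em : 0 < ep ^+ m by rewrite exprn_gt0.
    rewrite -mulrA mulrC ler_wpM2r ?exprn_ge0 ?(ltW e0)//.
    rewrite mulrC -ler_pdivlMr //; apply: le_trans h2 _; rewrite ler_wpM2r ?invr_ge0 ?(ltW em)//; exact: ler_norm.
  rewrite -cmodN opprB; apply: le_trans h1 _; apply: le_trans (ler_norm _) _; rewrite normrM ler_wpM2l //.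
  by rewrite ger0_norm ?exprn_ge0 ?(ltW e0)// qE exprD ler_piMr ?exprn_ge0 ?exprn_ile1 ?(ltW e0) ?(ltW e1).
have [K K0 KP] := poly_bounded Q.
exists (K + `|C'|), (Num.min 1 d'); first by rewrite lt_min ltr01.
move=> s; rewrite lt_min => /and3P[s0 s1 sd]; have := dP (s - z); rewrite s0 sd => /(_ isT).
rewrite (addrC z) subrK; set h := s - z in s0 s1 sd * => h1.
have hq : 0 < cmod h ^+ q by rewrite exprn_gt0.
have : cmod (h ^+ M * e s) <= (K + `|C'|) * cmod h ^+ q.
  rewrite -[X in cmod X](subrK P.[h]) addrC; apply: le_trans (cmodD _ _) _; rewrite mulrDl; apply: lerD.
    by rewrite QE hornerM hornerXn cmodM cmodX ler_wpM2r ?(ltW hq)// KP // ltW.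
  apply: le_trans h1 _; apply: le_trans (ler_norm _) _; rewrite normrM ler_wpM2l // ger0_norm ?exprn_ge0 ?cmod_ge0 //.
  by rewrite qE exprD ler_piMr ?(ltW hq)// exprn_ile1 ?cmod_ge0 ?(ltW s1).
by rewrite qE exprD -mulrA cmodM cmodX mulrC ler_pM2r.
Qed.

End LocalExpansions.

(** * Integrals of complex powers against symbols *)

Section ComplexIntegrals.
Context {R : realType} {n : nat}.
Local Notation Re := (@complex.Re R).
Local Notation Im := (@complex.Im R).
Implicit Types (g : 'rV[R]_n -> R[i]).

Definition CCls g := Cls (fun v => Re (g v)) /\ Cls (fun v => Im (g v)).

Lemma Cls_ext (G H : 'rV[R]_n -> R) : (forall v, G v = H v) -> Cls G -> Cls H.
Proof. by move=> GH; congr Cls; exact/funext. Qed.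

Lemma CCls_ext g g' : (forall v, g v = g' v) -> CCls g -> CCls g'.
Proof. by move=> GH; congr CCls; exact/funext. Qed.

Lemma cint_ext g g' : (forall v, g v = g' v) -> cint g = cint g'.
Proof. by move=> GH; congr cint; exact/funext. Qed.

Lemma CCls_add g g' : CCls g -> CCls g' -> CCls (fun v => g v + g' v).
Proof.
move=> [g1 g2] [g1' g2']; split.
  by apply: Cls_ext (Cls_add g1 g1') => v; rewrite cReD.
by apply: Cls_ext (Cls_add g2 g2') => v; rewrite cImD.
Qed.

Lemma CCls_scale (c : R[i]) g : CCls g -> CCls (fun v => c * g v).
Proof.
move=> [g1 g2]; split.
  by apply: Cls_ext (Cls_add (Cls_scale (Re c) g1) (Cls_scale (- Im c) g2)) => v; rewrite cReM mulNr.
by apply: Cls_ext (Cls_add (Cls_scale (Re c) g2) (Cls_scale (Im c) g1)) => v; rewrite cImM.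
Qed.

Lemma CCls_0 : CCls (fun=> 0).
Proof. by split; exact: Cls_0. Qed.

Lemma CCls_sum (I : Type) (r : seq I) (G : I -> 'rV[R]_n -> R[i]) :
  (forall k, CCls (G k)) -> CCls (fun v => \sum_(k <- r) G k v).
Proof.
move=> Gk; elim: r => [|k r IH]; first by apply: CCls_ext CCls_0 => v; rewrite big_nil.
by apply: CCls_ext (CCls_add (Gk k) IH) => v; rewrite big_cons.
Qed.

Lemma cintD g g' : CCls g -> CCls g' -> cint (fun v => g v + g' v) = cint g + cint g'.
Proof.
move=> [g1 g2] [g1' g2']; apply: cext; rewrite ?cReD ?cImD /= -iintD //; apply: iint_ext => v.
  by rewrite cReD.
by rewrite cImD.
Qed.

Lemma cintZ (c : R[i]) g : CCls g -> cint (fun v => c * g v) = c * cint g.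
Proof.
move=> [g1 g2]; apply: cext; rewrite ?cReM ?cImM /=.
  rewrite -mulNr -!iintZ // -iintD; [|exact: Cls_scale|exact: Cls_scale].
  by apply: iint_ext => v; rewrite cReM mulNr.
rewrite -!iintZ // -iintD; [|exact: Cls_scale|exact: Cls_scale].
by apply: iint_ext => v; rewrite cImM.
Qed.

Lemma cint_0 : cint (fun _ : 'rV[R]_n => 0) = 0.
Proof. by apply: cext => /=; exact: iint0. Qed.

Lemma cint_sum (I : Type) (r : seq I) (G : I -> 'rV[R]_n -> R[i]) :
  (forall k, CCls (G k)) -> cint (fun v => \sum_(k <- r) G k v) = \sum_(k <- r) cint (G k).
Proof.
move=> Gk; elim: r => [|k r IH].
  by rewrite big_nil -[RHS]cint_0; apply: cint_ext => v; rewrite big_nil.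
rewrite big_cons -IH -cintD //; last exact: CCls_sum.
by apply: cint_ext => v; rewrite big_cons.
Qed.

Lemma cint_bound g H : CCls g -> Cls H -> (forall v, cmod (g v) <= H v) -> cmod (cint g) <= 2 * iint H.
Proof.
move=> [g1 g2] Hc gH; apply: le_trans (cmod_le _) _; rewrite mulr2n mulrDl mul1r /=; apply: lerD.
  by apply: iint_norm => // v; exact: le_trans (Re_le_cmod _) (gH v).
by apply: iint_norm => // v; exact: le_trans (Im_le_cmod _) (gH v).
Qed.

End ComplexIntegrals.

Section Glue.
Context {R : realType} {n : nat}.
Implicit Types (G H psi : 'rV[R]_n -> R).

(** Compact support of the amplitude becomes vanishing for [v_i < et]. This covers a collar of the
    boundary of the orthant and everything outside, so functions controlled on [Qp] extend to the
    whole space and integration by parts leaves no boundary term. *)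
Definition van0 (et : R) psi := forall (v : 'rV[R]_n) i, v 0 i < et -> psi v = 0.
Definition psup psi := exists2 et : R, 0 < et & van0 et psi.

Lemma not_Qp (v : 'rV[R]_n) : ~ Qp v -> exists i, v 0 i <= 0.
Proof. by move=> /existsNP[i /negP]; rewrite -leNgt => vi; exists i. Qed.

Lemma open_coord_lt (et : R) (i : 'I_n) : open [set y : 'rV[R]_n | y 0 i < et].
Proof.
rewrite openE => y /= yi; have d0 : 0 < et - y 0 i by rewrite subr_gt0.
apply: (rV_ball_near d0) => x /(_ i); rewrite ltr_norml => /andP[_].
by rewrite ltrBlDr subrK.
Qed.

Lemma glue_cont G et : 0 < et -> van0 et G -> (forall v, Qp v -> {for v, continuous G}) -> continuous G.
Proof.
move=> e0 vG Gc v; have [Qv|/not_Qp[i vi]] := pselect (Qp v); first exact: Gc.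
have vW : [set y : 'rV[R]_n | y 0 i < et] v by rewrite /=; exact: le_lt_trans vi e0.
apply: (@eq_on_continuous R n _ (fun=> 0) G v (@open_coord_lt et i) _ vW); last exact: cst_continuous.
by move=> y /vG ->.
Qed.

Lemma glue_derive G H w et : 0 < et -> van0 et G -> van0 et H ->
  (forall v, Qp v -> is_derive v w G (H v)) -> forall v : 'rV[R]_n, is_derive v w G (H v).
Proof.
move=> e0 vG vH Gd v; have [Qv|/not_Qp[i vi]] := pselect (Qp v); first exact: Gd.
have vW : [set y : 'rV[R]_n | y 0 i < et] v by rewrite /=; exact: le_lt_trans vi e0.
have oW := @open_coord_lt et i.
have E (y : 'rV[R]_n) : [set y : 'rV[R]_n | y 0 i < et] y -> (fun=> 0) y = G y by move=> /vG ->.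
have [d1 d2] := is_derive_cst (0 : R) v w.
split; first exact: (@eq_on_derivable R n _ (fun=> 0) G w v oW E vW d1).
by rewrite -(@eq_on_derive R n _ (fun=> 0) G w v oW E vW) d2 (vH v i).
Qed.

End Glue.

(** * Convergence and analyticity of the integrals *)

Section VSpace.
Context {R : realType} {n : nat}.
Variable Sig : seq (seq 'rV[int]_n).
Hypothesis cover : forall v : 'rV[R]_n, orthant v -> exists2 s, s \in Sig & coneR s v.
Hypothesis gen0 : forall a i, a \in gens Sig -> 0 <= a 0 i.
Local Notation Re := (@complex.Re R).
Local Notation Im := (@complex.Im R).
Implicit Types (mu : 'rV[int]_n -> int) (psi G : 'rV[R]_n -> R).

Lemma gens_lb (ka : 'rV[int]_n -> R) : (forall a, a \in gens Sig -> 0 < ka a) ->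
  exists2 k0 : R, 0 < k0 & forall a, a \in gens Sig -> k0 <= ka a.
Proof.
move=> kp; have [|k0 k00 kP] := @fin_lb R 'I_(size (gens Sig)) (fun j => ka (nth 0 (gens Sig) j)).
  by move=> j; apply: kp; rewrite mem_nth.
exists k0 => // a /(nthP 0)[j js <-]; exact: (kP (Ordinal js)).
Qed.

Lemma gens_ub (ka : 'rV[int]_n -> R) :
  exists2 k0 : R, 0 <= k0 & forall a, a \in gens Sig -> ka a <= k0.
Proof.
have [k0 k00 kP] := @fin_ub R 'I_(size (gens Sig)) (fun j => ka (nth 0 (gens Sig) j)).
exists k0 => // a /(nthP 0)[j js <-]; exact: (kP (Ordinal js)).
Qed.

Lemma mem_gens s (j : 'I_(size s)) : s \in Sig -> nth 0 s j \in gens Sig.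
Proof. by move=> sS; apply/gensP; exists s; rewrite ?mem_nth. Qed.

Lemma l1_cpt s (c : 'I_(size s) -> R) : s \in Sig -> Qp (cpt c) ->
  l1 (cpt c) = \sum_j c j * (wsum (nth 0 s j))%:R.
Proof.
move=> sS Qc; rewrite /l1; under eq_bigr do rewrite gtr0_norm ?Qc //.
have := congr1 (fun x : R => - ln x) (jac_cpt gen0 c sS); rewrite /jac /wexp !expRK !opprK => ->.
by apply: eq_bigr => j _; rewrite -pmulrn.
Qed.

(** On the orthant [l1] is linear in the cone coordinates with coefficient [<a>] at the generator
    [a]; positive rates at the finitely many generators therefore dominate a positive multiple of
    [l1]. *)
Lemma Cls_cone G (ka : 'rV[int]_n -> R) (C : R) : continuous G -> psup G -> 0 <= C ->
  (forall a, a \in gens Sig -> 0 < ka a) ->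
  (forall s (c : 'I_(size s) -> R), s \in Sig -> (forall j, 0 <= c j) -> Qp (cpt c) ->
    `|G (cpt c)| <= C * expR (- \sum_j c j * ka (nth 0 s j))) -> Cls G.
Proof.
move=> Gc [et e0 vG] C0 kp Gb; have [k0 k00 kP] := gens_lb kp.
have [A A0 AP] := gens_ub (fun a => (wsum a)%:R).
have A1 : 0 < A + 1 by rewrite ltr_wpDl.
exists C, (k0 / (A + 1)); split; first by rewrite divr_gt0.
split => // v; have [Qv|/not_Qp[i vi]] := pselect (Qp v); last first.
  by rewrite (vG v i) ?normr0 ?mulr_ge0 ?expR_ge0 // (le_lt_trans vi).
have [s sS [c c0 vE]] := Qp_cpt cover Qv; rewrite vE in Qv *.
apply: le_trans (Gb s c sS c0 Qv) _; rewrite ler_wpM2l // ler_expR lerN2 (l1_cpt sS Qv) mulr_sumr.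
apply: ler_sum => j _; rewrite mulrCA ler_wpM2l //.
apply: (@le_trans _ _ k0); last by apply: kP; exact: mem_gens.
rewrite -mulrA ler_piMr ?(ltW k00)// mulrC ler_pdivrMr // mul1r.
by apply: le_trans (AP _ (mem_gens j sS)) _; rewrite lerDl.
Qed.

Definition Bd mu psi := [/\ forall v, Qp v -> {for v, continuous psi}, bnd Sig mu psi & psup psi].

Variables (l : 'rV[int]_n -> nat) (F : 'rV[R]_n -> R).
Let li a := (l a)%:Z.
Hypothesis FS : Sym Sig li F.

Lemma F_bound : exists2 C0 : R, 0 < C0 & forall s (c : 'I_(size s) -> R), s \in Sig -> (forall j, 0 <= c j) -> Qp (cpt c) ->
  0 < F (cpt c) -> forall y : R, 0 <= y -> expR (y * ln (F (cpt c))) <= expR (y * C0) * expR (- \sum_j c j * (y * (l (nth 0 s j))%:R)).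
Proof.
have [C C00 CP] := Sym_bnd FS; exists (Num.max 1 (ln (C + 1))); first by rewrite lt_max ltr01.
move=> s c sS c0 Qc F0 y y0; rewrite -expRD ler_expR.
have -> : \sum_j c j * (y * (l (nth 0 s j))%:R) = y * \sum_j c j * (l (nth 0 s j))%:R.
  by rewrite mulr_sumr; apply: eq_bigr => j _; rewrite mulrCA.
rewrite -mulrBr ler_wpM2l //.
have := CP s sS c c0 Qc; rewrite gtr0_norm // => le.
have C1 : 0 < C + 1 by rewrite ltr_wpDl.
have : F (cpt c) <= (C + 1) * wexp li c.
  by apply: le_trans le _; rewrite ler_wpM2r ?(ltW (wexp_gt0 _ _))// lerDl.
rewrite -ler_ln ?posrE ?mulr_gt0 ?wexp_gt0 // lnM ?posrE ?wexp_gt0 // /wexp expRK => /le_trans; apply.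
apply: lerD; first by rewrite le_max lexx orbT.
by rewrite lerN2; apply: ler_sum => j _; rewrite -pmulrn.
Qed.

Section Powers.
Variables (x : R) (mu : 'rV[int]_n -> int).
Hypothesis x0 : 0 < x.
Hypothesis xmu : forall a, a \in gens Sig -> 0 < x * (l a)%:R + (mu a)%:~R.

(** Strict inequalities at finitely many generators leave room to lower the exponent by [et]; this
    room absorbs logarithms and small complex shifts. *)
Lemma margin : exists et : R, [/\ 0 < et, et < x & forall a, a \in gens Sig -> 0 < (x - et) * (l a)%:R + (mu a)%:~R].
Proof.
have lp a : 0 < (l a)%:R + 1 :> R by rewrite ltr_wpDl.
have [|k0 k00 kP] := gens_lb (ka := fun a => (x * (l a)%:R + (mu a)%:~R) / ((l a)%:R + 1)).
  by move=> a ag; rewrite divr_gt0 ?xmu.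
exists (Num.min (x / 2) (k0 / 2)); split.
- by rewrite lt_min !divr_gt0.
- by rewrite gt_min ltr_pdivrMr // ltr_pMr // ltr1n.
move=> a ag; have := kP a ag; rewrite ler_pdivlMr // => h1.
have h2 : Num.min (x / 2) (k0 / 2) <= k0 / 2 by rewrite ge_min lexx orbT.
have h3 := ler_wpM2r (ler0n R (l a)) h2.
have h4 : 0 <= k0 * (l a)%:R by rewrite mulr_ge0 ?(ltW k00).
have Fct (p q m k ll : R) : k * (ll + 1) <= p + m -> q <= k / 2 * ll -> 0 <= k * ll -> 0 < k -> 0 < p - q + m by nra.
rewrite mulrBl; exact: Fct h1 h3 h4 k00.
Qed.

Lemma pc_Bd_bound tg j psi : (forall u, `|tg u| <= 1) -> bnd Sig mu psi ->
  exists C : R, exists ka : 'rV[int]_n -> R, [/\ 0 <= C, (forall a, a \in gens Sig -> 0 < ka a) &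
  forall y s (c : 'I_(size s) -> R), s \in Sig -> (forall j, 0 <= c j) -> Qp (cpt c) ->
    `|pc tg x y j (F (cpt c)) * psi (cpt c)| <= C * expR (- \sum_j c j * ka (nth 0 s j))].
Proof.
move=> tg1 [D D0 DP]; have [et [e0 ex eP]] := margin.
have [K K0 KP] := pc_bound2 tg1 x j e0; have [C0 C00 FP] := F_bound.
pose y1 := x - et; pose y2 := x + et.
have y10 : 0 <= y1 by rewrite subr_ge0 ltW.
have y20 : 0 <= y2 by rewrite addr_ge0 ?(ltW x0) ?(ltW e0).
have C0' : 0 <= K * (expR (y1 * C0) + expR (y2 * C0)) * D by rewrite !mulr_ge0 ?addr_ge0 ?expR_ge0.
exists (K * (expR (y1 * C0) + expR (y2 * C0)) * D), (fun a => y1 * (l a)%:R + (mu a)%:~R).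
split => // y s c sS c0 Qc.
have [F0|F0] := leP (F (cpt c)) 0; first by rewrite /pc F0 mul0r normr0 mulr_ge0 ?expR_ge0.
have lc : 0 <= \sum_j c j * (l (nth 0 s j))%:R by apply: sumr_ge0 => k _; rewrite mulr_ge0.
have sE z : \sum_j c j * (z * (l (nth 0 s j))%:R) = z * \sum_j c j * (l (nth 0 s j))%:R.
  by rewrite mulr_sumr; apply: eq_bigr => k _; rewrite mulrCA.
have b1 := FP s c sS c0 Qc F0 y1 y10; have b2 := FP s c sS c0 Qc F0 y2 y20.
have b3 : expR (- \sum_j c j * (y2 * (l (nth 0 s j))%:R)) <= expR (- \sum_j c j * (y1 * (l (nth 0 s j))%:R)).
  rewrite !sE ler_expR lerN2 ler_wpM2r // /y1 /y2; lra.
have -> : expR (- \sum_k c k * (y1 * (l (nth 0 s k))%:R + (mu (nth 0 s k))%:~R)) =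
    expR (- \sum_j c j * (y1 * (l (nth 0 s j))%:R)) * wexp mu c.
  by rewrite /wexp -expRD -opprD -big_split; congr (expR (- _)); apply: eq_bigr => k _; rewrite mulrDr.
rewrite normrM mulrACA; apply: ler_pM => //; last exact: DP.
apply: le_trans (KP y _ F0) _; rewrite -mulrA ler_wpM2l // [leRHS]mulrDl; apply: lerD; first exact: b1.
by apply: le_trans b2 _; rewrite ler_wpM2l ?expR_ge0.
Qed.

Lemma pc_cont_F tg y j psi : (forall u, `|tg u| <= 1) -> continuous tg -> Bd mu psi ->
  continuous (fun v => pc tg x y j (F v) * psi v) /\ psup (fun v => pc tg x y j (F v) * psi v).
Proof.
move=> tg1 tgc [pc1 pb [et e0 vp]].
have v0 : van0 et (fun v => pc tg x y j (F v) * psi v) by move=> v i /vp ->; rewrite mulr0.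
split; last by exists et.
apply: (glue_cont e0 v0) => v Qv.
have cF : {for v, continuous F} by exact: (Sym_cont FS).
have c1 : {for v, continuous (fun v => pc tg x y j (F v))} by apply: (continuous_comp cF); exact: pc_cont.
exact: (continuousM c1 (pc1 v Qv)).
Qed.

Lemma pc_Cls tg y j psi : (forall u, `|tg u| <= 1) -> continuous tg -> Bd mu psi ->
  Cls (fun v => pc tg x y j (F v) * psi v).
Proof.
move=> tg1 tgc pB; have [c1 s1] := pc_cont_F y j tg1 tgc pB; have [_ pb _] := pB.
have [C [ka [C0 kp Cb]]] := pc_Bd_bound j tg1 pb.
by apply: (Cls_cone c1 s1 C0 kp); exact: Cb.
Qed.

End Powers.

Lemma one_le1 (u : R) : `|(fun=> 1) u| <= 1 :> R. Proof. by rewrite normr1. Qed.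
Lemma one_cont : continuous (fun _ : R => 1 : R). Proof. by move=> u; exact: cst_continuous. Qed.

Lemma pcj tg x y j (r : R) : pc tg x y j r = pc tg x y 0 r * ln r ^+ j.
Proof. by rewrite /pc; case: ifP => _; rewrite ?mul0r // expr0 mulr1. Qed.

Definition region (x : R) mu := 0 < x /\ forall a, a \in gens Sig -> 0 < x * (l a)%:R + (mu a)%:~R.

Lemma cpow_CCls (z : R[i]) mu psi j : region (Re z) mu -> Bd mu psi ->
  CCls (fun v => cpowR (F v) z * cofR (ln (F v) ^+ j * psi v)).
Proof.
move=> [x0 xmu] pB; split.
  apply: Cls_ext (pc_Cls x0 xmu (Im z) j cos1 (@continuous_cos R) pB) => v.
  by rewrite cReM /= mulr0 subr0 Re_cpowR pcj mulrA.
apply: Cls_ext (pc_Cls x0 xmu (Im z) j sin1' (@continuous_sin R) pB) => v.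
by rewrite cImM /= mulr0 add0r Im_cpowR pcj mulrA.
Qed.

Definition Val (z : R[i]) psi : R[i] := cint (fun v => cpowR (F v) z * cofR (psi v)).

Lemma Val_CCls (z : R[i]) mu psi : region (Re z) mu -> Bd mu psi ->
  CCls (fun v => cpowR (F v) z * cofR (psi v)).
Proof.
by move=> rg pB; apply: CCls_ext (cpow_CCls 0 rg pB) => v; rewrite expr0 mul1r.
Qed.

Lemma Bd_norm mu psi : Bd mu psi -> Bd mu (fun v => `|psi v|).
Proof.
move=> [c1 [C C0 CP] [et e0 vp]]; split.
- move=> v Qv; apply: (@continuous_comp _ _ _ psi (@Num.norm R R)); [exact: c1|exact: norm_continuous].
- by exists C => // s sS c c0 Qc; rewrite normr_id; exact: CP.
- by exists et => // v i /vp ->; rewrite normr0.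
Qed.

(** The exponential series of [F ^ h] is integrated term by term: the coefficients are the integrals
    with [(ln F) ^ j / j!], and the remainder of [cexp_taylor] is dominated by [H], which is
    integrable because of the margin. *)
Lemma Val_Tay (i : nat) mu psi (z : R[i]) : region (Re (z + i%:R)) mu -> Bd mu psi ->
  Tay (fun s => Val (s + i%:R) psi) z.
Proof.
move=> rg pB N; pose w := z + i%:R; pose x := Re w.
have [x0 xmu] := rg; have [et [e0 ex eP]] := margin x0 xmu.
have e2 : 0 < et / 2 by rewrite divr_gt0.
(* Half of the margin absorbs the power of the logarithm, the other half the factor
   [exp (|h| |ln F|)]. *)
have [K K0 KP] := pow_le_exp N e2.
pose g j v := cpowR (F v) w * cofR (ln (F v) ^+ j * psi v).
have gC j : CCls (g j) by exact: (cpow_CCls j rg pB).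
pose B := 2 * 2 ^+ N * K : R.
have B0 : 0 <= B by rewrite !mulr_ge0 ?exprn_ge0.
pose H v := B * ((pc (fun=> 1) (x - et) 0 0 (F v) + pc (fun=> 1) (x + et) 0 0 (F v)) * `|psi v|).
have pN := Bd_norm pB.
have HC : Cls H.
  apply: Cls_scale.
  have r1 : 0 < x - et by rewrite subr_gt0.
  have r2 : 0 < x + et by rewrite addr_gt0.
  have m2 a : a \in gens Sig -> 0 < (x + et) * (l a)%:R + (mu a)%:~R.
    move=> ag; apply: lt_le_trans (xmu a ag) _; rewrite lerD2r ler_wpM2r // lerDl ltW //.
  apply: Cls_ext (Cls_add (pc_Cls r1 eP 0 0 one_le1 one_cont pN) (pc_Cls r2 m2 0 0 one_le1 one_cont pN)) => v.
  by rewrite mulrDl.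
pose P : {poly R[i]} := \sum_(j < N) (cint (g j) / (j`!)%:R) *: 'X^j.
exists P, (2 * iint H), (et / 2); split => // h hd.
have rgh : region (Re (z + h + i%:R)) mu.
  have -> : Re (z + h + i%:R) = x + Re h by rewrite addrAC cReD.
  have rh : x - et < x + Re h.
    rewrite ltrD2l; have := Re_le_cmod h; rewrite ler_norml => /andP[h1 _]; apply: lt_le_trans h1.
    rewrite ltrN2; apply: lt_trans hd _; rewrite ltr_pdivrMr // ltr_pMr // ltr1n //.
  split; first by apply: lt_trans rh; rewrite subr_gt0.
  by move=> a ag; apply: lt_le_trans (eP a ag) _; rewrite lerD2r ler_wpM2r // ltW.
pose D v := cpowR (F v) (z + h + i%:R) * cofR (psi v) + (-1) * \sum_(j < N) (h ^+ j / (j`!)%:R) * g j v.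
have DE : Val (z + h + i%:R) psi - P.[h] = cint D.
  rewrite cintD; [|exact: (Val_CCls rgh pB)|by apply: CCls_scale; apply: CCls_sum => j; exact: CCls_scale].
  rewrite cintZ; last by apply: CCls_sum => j; exact: CCls_scale.
  rewrite cint_sum; last by move=> j; exact: CCls_scale.
  rewrite mulN1r; congr (_ - _); rewrite /P horner_sum; apply: eq_bigr => j _.
  by rewrite cintZ // hornerZ hornerXn; move: (cint _) (h ^+ j) (_^-1) => p q t; ring.
have DC : CCls D.
  apply: CCls_add; first exact: (Val_CCls rgh pB).
  by apply: CCls_scale; apply: CCls_sum => j; exact: CCls_scale.
have hN : 0 <= cmod h ^+ N by rewrite exprn_ge0 ?cmod_ge0.
rewrite DE; have -> : 2 * iint H * cmod h ^+ N = 2 * iint (fun v => cmod h ^+ N * H v) by rewrite iintZ //; ring.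
apply: cint_bound => //; first exact: Cls_scale.
move=> v; rewrite /D /H; have [F0|F0] := leP (F v) 0.
  rewrite /g !cpowR_le0 // mul0r add0r big1 ?mulr0 ?cmod0; last by move=> j _; rewrite mul0r mulr0.
  by rewrite /pc F0 addr0 mul0r !mulr0.
pose u := h * cofR (ln (F v)).
have -> : cpowR (F v) (z + h + i%:R) * cofR (psi v) + -1 * (\sum_(j < N) h ^+ j / j`!%:R * g j v) =
   cpowR (F v) w * cofR (psi v) * (cexp u - \sum_(j < N) u ^+ j / (j`!)%:R).
  rewrite mulrBr mulN1r; congr (_ - _).
    by rewrite addrAC cpowRD // [cpowR _ h]cpowR_cexp // mulrAC.
  rewrite mulr_sumr; apply: eq_bigr => j _; rewrite /g /u exprMn cofRM cofRX.
  by move: (cpowR _ _) (cofR (psi v)) (cofR _) (j`!%:R^-1) => p q r t; ring.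
rewrite !cmodM cmod_cpowR // cmod_cofR.
have cu : cmod u = cmod h * `|ln (F v)| by rewrite cmodM cmod_cofR.
have T := cexp_taylor N u; rewrite cu in T.
have hl : cmod h * `|ln (F v)| <= et / 2 * `|ln (F v)| by rewrite ler_wpM2r // ltW.
have T2 : cmod (cexp u - \sum_(j < N) u ^+ j / j`!%:R) <= B * cmod h ^+ N * expR (et * `|ln (F v)|).
  apply: le_trans T _; have -> : expR (et * `|ln (F v)|) = expR (et / 2 * `|ln (F v)|) * expR (et / 2 * `|ln (F v)|).
    by rewrite -expRD -mulrDl -splitr.
  have kk := KP (ln (F v)).
  rewrite !exprMn /B; have -> : 2 * (2 ^+ N * (cmod h ^+ N * `|ln (F v)| ^+ N)) = 2 * 2 ^+ N * cmod h ^+ N * `|ln (F v)| ^+ N by ring.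
  have -> : 2 * 2 ^+ N * K * cmod h ^+ N * (expR (et / 2 * `|ln (F v)|) * expR (et / 2 * `|ln (F v)|)) =
     2 * 2 ^+ N * cmod h ^+ N * (K * expR (et / 2 * `|ln (F v)|)) * expR (et / 2 * `|ln (F v)|) by ring.
  apply: ler_pM; rewrite ?expR_ge0 ?ler_expR // ?mulr_ge0 ?exprn_ge0 ?cmod_ge0 //.
  by rewrite ler_wpM2l ?mulr_ge0 ?exprn_ge0 ?cmod_ge0.
have T3 : expR (x * ln (F v)) * expR (et * `|ln (F v)|) <= pc (fun=> 1) (x - et) 0 0 (F v) + pc (fun=> 1) (x + et) 0 0 (F v).
  rewrite !pcE // expr0 !mulr1 -expRD; have [l0|l0] := leP 0 (ln (F v)).
    by rewrite (ger0_norm l0) -mulrDl lerDr expR_ge0.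
  by rewrite (ltr0_norm l0) mulrN -mulrBl lerDl expR_ge0.
have e3 : 0 <= expR (x * ln (F v)) * `|psi v| by rewrite mulr_ge0 ?expR_ge0.
apply: le_trans (ler_wpM2l e3 T2) _.
have -> : expR (x * ln (F v)) * `|psi v| * (B * cmod h ^+ N * expR (et * `|ln (F v)|)) =
  cmod h ^+ N * B * `|psi v| * (expR (x * ln (F v)) * expR (et * `|ln (F v)|)) by ring.
have -> (p : R) : cmod h ^+ N * (B * (p * `|psi v|)) = cmod h ^+ N * B * `|psi v| * p by ring.
by rewrite ler_wpM2l ?mulr_ge0.
Qed.

End VSpace.

(** * The two integrations by parts *)

Section Steps.
Context {R : realType} {n : nat}.
Variable Sig : seq (seq 'rV[int]_n).
Hypothesis cover : forall v : 'rV[R]_n, orthant v -> exists2 s, s \in Sig & coneR s v.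
Hypothesis gen0 : forall a i, a \in gens Sig -> 0 <= a 0 i.
Local Notation Re := (@complex.Re R).
Local Notation Im := (@complex.Im R).
Implicit Types (mu nu : 'rV[int]_n -> int) (psi g : 'rV[R]_n -> R).
Variables (l : 'rV[int]_n -> nat) (F : 'rV[R]_n -> R).
Let li a := (l a)%:Z.
Hypothesis FS : Sym Sig li F.
Local Notation region := (region (R := R) Sig l).
Local Notation Val := (Val F).

Definition Sy mu psi := Sym Sig mu psi /\ psup psi.

Lemma Sy_Bd mu psi : Sy mu psi -> Bd Sig mu psi.
Proof. by move=> [ps p0]; split => //; [move=> v Qv; exact: (Sym_cont ps)|exact: Sym_bnd]. Qed.

Lemma Bd_le mu nu psi : (forall a, a \in gens Sig -> mu a <= nu a) -> Bd Sig nu psi -> Bd Sig mu psi.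
Proof.
move=> mn [pc1 [C C0 CP] p0]; split => //; exists C => // s sS c c0 Qc.
apply: le_trans (CP s sS c c0 Qc) _; rewrite ler_wpM2l // ler_expR lerN2; apply: ler_sum => j _.
by rewrite ler_wpM2l // ler_int mn // mem_gens.
Qed.

Lemma psup_add psi g : psup psi -> psup g -> psup (fun v => psi v + g v).
Proof.
move=> [e e0 ev] [d d0 dv]; exists (Num.min e d); first by rewrite lt_min e0.
by move=> v i; rewrite lt_min => /andP[/ev -> /dv ->]; rewrite addr0.
Qed.

Lemma Bd_add mu psi g : Bd Sig mu psi -> Bd Sig mu g -> Bd Sig mu (fun v => psi v + g v).
Proof.
move=> [c1 b1 s1] [c2 b2 s2]; split; [|exact: bnd_add|exact: psup_add].
by move=> v Qv; exact: (continuousD (c1 v Qv) (c2 v Qv)).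
Qed.

Lemma Bd_scale mu (k : R) psi : Bd Sig mu psi -> Bd Sig mu (fun v => k * psi v).
Proof.
move=> [c1 b1 [e e0 ev]]; split; [|exact: bnd_scale|by exists e => // v i /ev ->; rewrite mulr0].
move=> v Qv; have ck : {for v, continuous (fun _ : 'rV[R]_n => k)} by exact: cst_continuous.
exact: (continuousM ck (c1 v Qv)).
Qed.

Lemma Sy_mul mu nu g psi : Sym Sig nu g -> Sy mu psi -> Sy (fun a => nu a + mu a) (fun v => g v * psi v).
Proof.
move=> gs [ps [e e0 ev]]; split; first exact: Sym_mul.
by exists e => // v i /ev ->; rewrite mulr0.
Qed.

Lemma van0_derive psi (e : R) w (v : 'rV[R]_n) i : van0 e psi -> v 0 i < e -> 'D_w psi v = 0.
Proof.
move=> ev vi; have vW : [set y : 'rV[R]_n | y 0 i < e] v by [].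
have E (y : 'rV[R]_n) : [set y : 'rV[R]_n | y 0 i < e] y -> (fun=> 0) y = psi y by move=> /ev ->.
rewrite -(@eq_on_derive R n _ (fun=> 0) psi w v (@open_coord_lt _ _ e i) E vW).
by have [_ ->] := is_derive_cst (0 : R) v w.
Qed.

Lemma Sy_pd mu psi i : Sy mu psi -> Sy mu (pd i psi).
Proof.
move=> [ps [e e0 ev]]; split; first exact: Sym_pd.
by exists e => // v j vj; rewrite /pd (van0_derive _ ev vj).
Qed.

Definition rai mu a psi : 'rV[R]_n -> R := fun v => - 'D_(realv a) psi v - (mu a)%:~R * psi v.

Lemma Sy_raise mu psi a : a \in gens Sig -> Sy mu psi -> Sy (inc mu a) (rai mu a psi).
Proof.
move=> ag [ps [e e0 ev]]; split; first exact: Sym_raise.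
by exists e => // v j vj; rewrite /rai (van0_derive _ ev vj) (ev v j vj) mulr0 !oppr0 addr0.
Qed.

Lemma Sy_mueq mu nu psi : (forall a, mu a = nu a) -> Sy mu psi -> Sy nu psi.
Proof. by move=> /funext ->. Qed.

Lemma Sy_sum mu (I : finType) (G : I -> 'rV[R]_n -> R) :
  (forall k, Sy mu (G k)) -> Sy mu (fun v => \sum_k G k v).
Proof.
move=> Gk; split; first by apply: Sym_sum => k; case: (Gk k).
have /choice[e eP] : forall k, exists e : R, 0 < e /\ van0 e (G k) by move=> k; have [_ [e e0 ev]] := Gk k; exists e.
have [|d d0 dP] := @fin_lb R I e; first by move=> k; case: (eP k).
exists d => // v i vi; rewrite big1 // => k _; have [_ ev] := eP k; apply: (ev v i).
exact: lt_le_trans vi (dP k).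
Qed.

Lemma Val_ext z psi g : (forall v, psi v = g v) -> Val z psi = Val z g.
Proof. by move=> pg; apply: cint_ext => v; rewrite pg. Qed.

Lemma ValD z mu psi g : region (Re z) mu -> Bd Sig mu psi -> Bd Sig mu g ->
  Val z (fun v => psi v + g v) = Val z psi + Val z g.
Proof.
move=> rg pB gB; rewrite -cintD; [|exact: (Val_CCls cover gen0 FS rg pB)|exact: (Val_CCls cover gen0 FS rg gB)].
by apply: cint_ext => v; rewrite cofRD mulrDr.
Qed.

Lemma ValZ z mu (k : R) psi : region (Re z) mu -> Bd Sig mu psi ->
  Val z (fun v => k * psi v) = cofR k * Val z psi.
Proof.
move=> rg pB; rewrite -cintZ; last exact: (Val_CCls cover gen0 FS rg pB).
by apply: cint_ext => v; rewrite cofRM mulrCA.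
Qed.

Lemma Val_sum z mu (I : finType) (G : I -> 'rV[R]_n -> R) : region (Re z) mu ->
  (forall k, Bd Sig mu (G k)) -> Val z (fun v => \sum_k G k v) = \sum_k Val z (G k).
Proof.
move=> rg Gk; rewrite -cint_sum; last by move=> k; exact: (Val_CCls cover gen0 FS rg (Gk k)).
apply: cint_ext => v; rewrite -mulr_sumr; congr (_ * _).
by elim/big_rec2: _ => // k y1 y2 _ <-; rewrite cofRD.
Qed.

Lemma ValS z psi : Val z (fun v => F v * psi v) = Val (z + 1) psi.
Proof. by apply: cint_ext => v; rewrite cpowRS cofRM mulrA. Qed.

Lemma region_shift (z : R[i]) mu : 1 < Re z -> region (Re z) mu ->
  region (Re (z - 1)) (fun a => li a + mu a).
Proof.
have -> : Re (z - 1) = Re z - 1 by rewrite cReD.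
move=> z1 [_ H]; split; first by rewrite subr_gt0.
by move=> a ag; have := H a ag; rewrite intrD -pmulrn mulrBl mul1r addrA subrK.
Qed.

(** The integral of the derivative of [F_+ ^ z psi] along [w] vanishes. The condition [1 < Re z]
    makes the truncated power differentiable; real and imaginary parts are the cosine and sine cases
    of [pc_derive]. *)
Lemma ibp z mu psi w (dF dpsi : 'rV[R]_n -> R) : 1 < Re z -> region (Re z) mu -> Bd Sig mu psi ->
  (forall v, Qp v -> is_derive v w F (dF v)) -> (forall v, Qp v -> is_derive v w psi (dpsi v)) ->
  Bd Sig (fun a => li a + mu a) (fun v => dF v * psi v) -> Bd Sig mu dpsi ->
  z * Val (z - 1) (fun v => dF v * psi v) + Val z dpsi = 0.
Proof.
move=> z1 rg pB dFP dpP B1 B2; have rg1 := region_shift z1 rg.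
have C1 := Val_CCls cover gen0 FS rg1 B1; have C2 := Val_CCls cover gen0 FS rg B2.
have C0 := Val_CCls cover gen0 FS rg pB.
rewrite -cintZ // -cintD //; last exact: CCls_scale.
have [hR hI] := CCls_add (CCls_scale z C1) C2.
have [c1 b1 [e e0 ev]] := pB; have [_ _ [e1 e10 ev1]] := B1; have [_ _ [e2 e20 ev2]] := B2.
pose d := Num.min e (Num.min e1 e2).
have d0 : 0 < d by rewrite !lt_min e0 e10.
pose x := Re z; pose y := Im z.
have Re1 : Re (z - 1) = x - 1 by rewrite cReD.
have Im1 : Im (z - 1) = y by rewrite cImD /= subr0.
have chain tg tg' : (forall u, `|tg u| <= 1) -> (forall u : R, is_derive u (1 : R) tg (tg' u)) ->
    forall v, Qp v -> is_derive v w (fun v => pc tg x y 0 (F v) * psi v)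
      ((x * pc tg (x - 1) y 0 (F v) + y * pc tg' (x - 1) y 0 (F v)) * (dF v * psi v) + pc tg x y 0 (F v) * dpsi v).
  move=> tg1 dtg v Qv.
  have dl : is_derive (0 : R) (1 : R) (fun t : R => F (v + t *: w)) (dF v).
    have [h1 h2] := dFP v Qv; have := @is_derive_line R 'rV[R]_n F v w 0.
    by rewrite scale0r addr0 h2; apply.
  have dp : is_derive (F (v + (0:R) *: w)) (1 : R) (pc tg x y 0) (x * pc tg (x - 1) y 0 (F v) + y * pc tg' (x - 1) y 0 (F v)).
    by rewrite scale0r addr0; apply: pc_derive.
  have d1 : is_derive v w (fun v => pc tg x y 0 (F v)) ((x * pc tg (x - 1) y 0 (F v) + y * pc tg' (x - 1) y 0 (F v)) * dF v).
    apply: derive_line_is.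
    exact: (@is_derive1_comp R (pc tg x y 0) (fun t : R => F (v + t *: w)) 0 _ _ dp dl).
  apply: (is_derive_eq (is_deriveM d1 (dpP v Qv))); rewrite -![_ *: _]/(_ * _).
  by move: (pc tg x y 0 _) (x * _ + _) (dF v) (psi v) (dpsi v) => p q r s t; ring.
have vn (G : 'rV[R]_n -> R) : van0 d (fun v => G v * psi v).
  by move=> v i; rewrite !lt_min => /andP[/ev -> _]; rewrite mulr0.
have vn2 (G H : 'rV[R]_n -> R) : van0 d (fun v => G v * (dF v * psi v) + H v * dpsi v).
  by move=> v i; rewrite !lt_min => /and3P[_ /ev1 -> /ev2 ->]; rewrite !mulr0 addr0.
apply: cext => /=.
  have CG : Cls (fun v => pc cos x y 0 (F v) * psi v).
    by case: C0 => C0 _; apply: Cls_ext C0 => v; rewrite cReM /= mulr0 subr0 Re_cpowR.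
  rewrite -[RHS](iint_derive CG hR (w := w)) // => v.
  have -> : Re (z * (cpowR (F v) (z - 1) * cofR (dF v * psi v)) + cpowR (F v) z * cofR (dpsi v)) =
     (x * pc cos (x - 1) y 0 (F v) + y * pc (fun u => - sin u) (x - 1) y 0 (F v)) * (dF v * psi v) + pc cos x y 0 (F v) * dpsi v.
    have pN (r : R) : pc (fun u => - sin u) (x - 1) y 0 r = - pc sin (x - 1) y 0 r.
      by rewrite /pc; case: ifP => _; rewrite ?oppr0 // mulrN mulNr.
    rewrite cReD !cReM !cImM !Re_cpowR !Im_cpowR Re1 Im1 pN /= -/x -/y.
    by move: (pc cos x y 0 _) (pc cos _ _ _ _) (pc sin _ _ _ _) (dF v) => p q r s; ring.
  apply: (glue_derive d0 (vn _) (vn2 (fun v => _) (fun v => _))) => u Qu.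
  exact: (chain cos (fun u => - sin u) cos1 (fun t => is_derive_cos t) u Qu).
have CG : Cls (fun v => pc sin x y 0 (F v) * psi v).
  by case: C0 => _ C0; apply: Cls_ext C0 => v; rewrite cImM /= mulr0 add0r Im_cpowR.
rewrite -[RHS](iint_derive CG hI (w := w)) // => v.
have -> : Im (z * (cpowR (F v) (z - 1) * cofR (dF v * psi v)) + cpowR (F v) z * cofR (dpsi v)) =
   (x * pc sin (x - 1) y 0 (F v) + y * pc cos (x - 1) y 0 (F v)) * (dF v * psi v) + pc sin x y 0 (F v) * dpsi v.
  rewrite cImD !cImM !cReM !Re_cpowR !Im_cpowR Re1 Im1 /= -/x -/y.
  by move: (pc sin x y 0 _) (pc cos _ _ _ _) (pc sin _ _ _ _) (dF v) => p q r s; ring.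
apply: (glue_derive d0 (vn _) (vn2 (fun v => _) (fun v => _))) => u Qu.
exact: (chain sin cos sin1' (fun t => is_derive_sin t) u Qu).
Qed.

Lemma Sy_derivable mu psi a v : a \in gens Sig -> Sy mu psi -> Qp v -> is_derive v (realv a) psi ('D_(realv a) psi v).
Proof. by move=> ag [ps _] Qv; split => //; exact: (Sym_dera ag ps). Qed.

Lemma inc_le mu a b : mu b <= inc mu a b.
Proof. by rewrite /inc lerDl. Qed.

(** In [ibp] write [D_a F = - rai F - l(a) F] and likewise for [psi] with [mu(a)]. The multiple of
    [F] turns [Val (z - 1)] back into [Val z], and the two scalar terms form the coefficient on the
    left. *)
Lemma Astep z mu psi a : a \in gens Sig -> 1 < Re z -> region (Re z) mu -> Sy mu psi ->
  ((l a)%:R * z + (mu a)%:~R) * Val z psi =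
  - z * Val (z - 1) (fun v => rai li a F v * psi v) - Val z (rai mu a psi).
Proof.
move=> ag z1 rg pS; have pB := Sy_Bd pS; have rg1 := region_shift z1 rg.
have RpB : Bd Sig mu (rai mu a psi).
  by apply: Bd_le (Sy_Bd (Sy_raise ag pS)) => b _; exact: inc_le.
have RFB : Bd Sig (fun b => li b + mu b) (fun v => rai li a F v * psi v).
  apply: Bd_le (Sy_Bd (Sy_mul (Sym_raise ag FS) pS)) => b _.
  by rewrite lerD2r; exact: inc_le.
have FpB : Bd Sig (fun b => li b + mu b) (fun v => F v * psi v) by exact: (Sy_Bd (Sy_mul FS pS)).
have dFE v : 'D_(realv a) F v * psi v = -1 * (rai li a F v * psi v) + - (l a)%:R * (F v * psi v).
  by rewrite /rai /li -pmulrn; move: ('D_(realv a) F v) (F v) (psi v) => p q r; ring.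
have dpE v : 'D_(realv a) psi v = -1 * rai mu a psi v + - (mu a)%:~R * psi v.
  by rewrite /rai; move: ('D_(realv a) psi v) (psi v) => p q; ring.
have I := @ibp z mu psi (realv a) (fun v => 'D_(realv a) F v) (fun v => 'D_(realv a) psi v) z1 rg pB.
have {}I : z * Val (z - 1) (fun v => 'D_(realv a) F v * psi v) + Val z (fun v => 'D_(realv a) psi v) = 0.
  apply: I.
  - by move=> v Qv; split => //; exact: (Sym_dera ag FS).
  - by move=> v Qv; exact: (Sy_derivable ag pS).
  - by rewrite (funext dFE); apply: Bd_add; apply: Bd_scale.
  - by rewrite (funext dpE); apply: Bd_add; apply: Bd_scale.
move: I; rewrite (Val_ext _ dFE) (Val_ext z dpE).
rewrite (ValD rg1 (Bd_scale _ RFB) (Bd_scale _ FpB)) (ValZ _ rg1 RFB) (ValZ _ rg1 FpB) ValS subrK.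
rewrite (ValD rg (Bd_scale _ RpB) (Bd_scale _ pB)) (ValZ _ rg RpB) (ValZ _ rg pB).
rewrite !cofRN cofR_nat cofR1.
have -> : cofR ((mu a)%:~R : R) = (mu a)%:~R.
  by case: (mu a) => k; rewrite ?NegzE ?mulrNz ?cofRN -!pmulrn cofR_nat.
move: (Val z psi) (Val z _) (Val (z - 1) _) ((l a)%:R : R[i]) ((mu a)%:~R : R[i]) => V A B L M H.
apply/eqP; rewrite -subr_eq0; apply/eqP; rewrite -[RHS]oppr0 -H; ring.
Qed.

Definition Dd (v : 'rV[R]_n) : R := \sum_m pd m F v ^+ 2.
Definition Tt (th psi : 'rV[R]_n -> R) : 'rV[R]_n -> R :=
  fun v => \sum_m pd m (fun v => pd m F v * (th v * psi v)) v.

Lemma Sy_Tt mu th psi : Sym Sig (fun a => - (li a + li a)) th -> Sy mu psi ->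
  Sy (fun a => mu a - li a) (Tt th psi).
Proof.
move=> ts pS; apply: Sy_sum => m; apply: Sy_pd.
apply: Sy_mueq (Sy_mul (Sym_pd m FS) (Sy_mul ts pS)) => a; ring.
Qed.

(** The components [pd m F] of the gradient give one [ibp] each, at exponent [z + 1], so [0 < Re z]
    is enough. The multiplier [th] of order [- 2 l] stays free: it is [1 / |grad F|^2] in the
    general step and a quotient with [D2] in the special initial one. *)
Lemma Tstep z mu th psi : Sym Sig (fun a => - (li a + li a)) th -> 0 < Re z -> region (Re z) mu -> Sy mu psi ->
  (z + 1) * Val z (fun v => Dd v * (th v * psi v)) = - Val (z + 1) (Tt th psi).
Proof.
move=> ts z0 rg pS; pose nu a := mu a - li a.
have cS m : Sy nu (fun v => pd m F v * (th v * psi v)).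
  by apply: Sy_mueq (Sy_mul (Sym_pd m FS) (Sy_mul ts pS)) => a; rewrite /nu; ring.
have Re1 : Re (z + 1) = Re z + 1 by rewrite cReD.
have rg1 : region (Re (z + 1)) nu.
  rewrite Re1; case: rg => _ rg; split; first by rewrite addr_gt0.
  move=> a ag; have := rg a ag; rewrite /nu intrB -[(li a)%:~R]pmulrn mulrDl mul1r.
  have E (p q r : R) : p + r + (q - r) = p + q by ring.
  by rewrite E.
have z1 : 1 < Re (z + 1) by rewrite Re1 ltrDr.
have dS m : Sy mu (fun v => pd m F v * (pd m F v * (th v * psi v))).
  by apply: Sy_mueq (Sy_mul (Sym_pd m FS) (cS m)) => a; rewrite /nu; ring.
have I m : (z + 1) * Val z (fun v => pd m F v * (pd m F v * (th v * psi v))) +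
    Val (z + 1) (pd m (fun v => pd m F v * (th v * psi v))) = 0.
  have := @ibp (z + 1) nu (fun v => pd m F v * (th v * psi v)) ('e_m) (pd m F) (pd m (fun v => pd m F v * (th v * psi v))) z1 rg1 (Sy_Bd (cS m)).
  rewrite addrK; apply.
  - by move=> v Qv; constructor; [apply: (@Sym_der R n Sig li F m v FS Qv)|].
  - by move=> v Qv; constructor => //; have [h _] := cS m; apply: (@Sym_der R n Sig nu _ m v h Qv).
  - by apply: Sy_Bd; apply: Sy_mueq (dS m) => a; rewrite /nu; ring.
  - by apply: Sy_Bd; apply: Sy_pd; exact: cS.
have -> : Val z (fun v => Dd v * (th v * psi v)) = \sum_m Val z (fun v => pd m F v * (pd m F v * (th v * psi v))).
  rewrite -(Val_sum rg (fun m => Sy_Bd (dS m))); apply: Val_ext => v.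
  by rewrite /Dd mulr_suml; apply: eq_bigr => m _; rewrite expr2 -mulrA.
have -> : Val (z + 1) (Tt th psi) = \sum_m Val (z + 1) (pd m (fun v => pd m F v * (th v * psi v))).
  by rewrite -(Val_sum rg1 (fun m => Sy_Bd (Sy_pd m (cS m)))).
by rewrite mulr_sumr -sumrN; apply: eq_bigr => m _; apply/eqP; rewrite -addr_eq0 I.
Qed.

End Steps.

(** * Meromorphic continuation *)

Section Continuation.
Context {R : realType} {n : nat}.
Variable Sig : seq (seq 'rV[int]_n).
Hypothesis cover : forall v : 'rV[R]_n, orthant v -> exists2 s, s \in Sig & coneR s v.
Hypothesis gen0 : forall a i, a \in gens Sig -> 0 <= a 0 i.
Hypothesis wpos : forall a, a \in gens Sig -> (0 < wsum a)%N.
Local Notation Re := (@complex.Re R).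
Local Notation Im := (@complex.Im R).
Implicit Types (mu nu lam : 'rV[int]_n -> int) (psi g : 'rV[R]_n -> R) (c e : R[i] -> R[i]).
Variables (l : 'rV[int]_n -> nat) (F : 'rV[R]_n -> R).
Let li a := (l a)%:Z.
Hypothesis FS : Sym Sig li F.
Hypothesis DP : lbnd Sig (fun a => (2 * l a)%:Z) (Dd F).
Variable S : set R[i].
Hypothesis Sint : forall k : nat, S (cofR (- k.+1%:R)).
Hypothesis Sgen : forall a (k : nat), a \in gens Sig -> (0 < l a)%N -> S (cofR (- ((wsum a + k)%:R / (l a)%:R))).
Local Notation region := (region (R := R) Sig l).
Local Notation Val := (Val F).
Local Notation Sy := (Sy Sig).
Local Notation Bd := (Bd (R:=R) Sig).

(** Coefficients of the representations: regular off [S], and with a finite-order expansion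
    everywhere. *)
Definition okc c := (forall z, ~ S z -> Tay c z) /\ (forall z, exists M, Lau M c z).
Definition wl (a : 'rV[int]_n) := (wsum a)%:Z.

Lemma okc_mul c c' : okc c -> okc c' -> okc (fun s => c s * c' s).
Proof.
move=> [t1 l1] [t2 l2]; split => z; first by move=> Sz; apply: Tay_mul; [exact: t1|exact: t2].
by have [M1 h1] := l1 z; have [M2 h2] := l2 z; exists (M1 + M2)%N; exact: Lau_mul.
Qed.

Lemma okc_lin (al be : R[i]) : okc (fun s => al * s + be).
Proof. by split => z; [move=> _|exists 0%N; apply: Tay_Lau]; exact: Tay_lin. Qed.

Lemma okc_cst (al : R[i]) : okc (fun=> al).
Proof. by split => z; [move=> _|exists 0%N; apply: Tay_Lau]; exact: Tay_cst. Qed.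

Lemma okc_inv (al be : R[i]) : (forall z, ~ S z -> al * z + be != 0) -> (al != 0) || (be != 0) ->
  okc (fun s => (al * s + be)^-1).
Proof.
move=> nz ab; split => z; first by move=> Sz; apply: Tay_inv; exact: nz.
have [a0|a0] := eqVneq al 0; last exact: Lau_inv.
by exists 0%N; apply: Tay_Lau; apply: Tay_inv; move: ab; rewrite a0 eqxx mul0r add0r.
Qed.

Section WithPredicate.
Variable ok : (R[i] -> R[i]) -> nat -> Prop.

(** Sums of terms [c(s) Val (s + i) psi], kept as an inductive shape because both integrations by
    parts act term by term. The bounds [i0] on the shifts and [lam] on the combined orders
    [i l + mu] determine through [reg] a half plane on which all terms converge. The predicate [ok]
    carries the information on coefficients that is needed to count poles. *)
Inductive Rep (i0 : nat) (lam : 'rV[int]_n -> int) : (R[i] -> R[i]) -> Prop :=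
| Rep0 : Rep i0 lam (fun=> 0)
| RepS c i mu psi e : okc c -> ok c i -> Sy mu psi -> (i0 <= i)%N ->
    (forall a, a \in gens Sig -> lam a <= (i * l a)%:Z + mu a) -> Rep i0 lam e ->
    Rep i0 lam (fun s => c s * Val (s + i%:R) psi + e s).

Definition reg (i0 : nat) lam (x : R) := 0 < x + i0%:R /\
  forall a, a \in gens Sig -> 0 < x * (l a)%:R + (lam a)%:~R.

Lemma reg_region i0 lam (s : R[i]) i mu : (i0 <= i)%N ->
  (forall a, a \in gens Sig -> lam a <= (i * l a)%:Z + mu a) -> reg i0 lam (Re s) ->
  region (Re (s + i%:R)) mu.
Proof.
move=> ii lm [x0 xl]; have -> : Re (s + i%:R) = Re s + i%:R by rewrite cReD -cofR_nat.
have le : (i0%:R : R) <= i%:R by rewrite ler_nat.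
split; first by apply: lt_le_trans x0 _; rewrite lerD2l.
move=> a ag; apply: lt_le_trans (xl a ag) _; rewrite mulrDl -addrA lerD2l.
have : ((lam a)%:~R : R) <= ((i * l a)%:Z + mu a)%:~R by rewrite ler_int lm.
by rewrite intrD -[X in _ <= X + _]pmulrn natrM.
Qed.

Lemma Rep_le i0 i1 lam lam' e : (i1 <= i0)%N -> (forall a, a \in gens Sig -> lam' a <= lam a) ->
  Rep i0 lam e -> Rep i1 lam' e.
Proof.
move=> ii ll; elim => [|c i mu psi e' oc oc' pS i0i lm _ IH]; first exact: Rep0.
apply: RepS oc oc' pS (leq_trans ii i0i) _ IH => a ag; exact: le_trans (ll a ag) (lm a ag).
Qed.

Lemma Rep_Tay i0 lam e z : Rep i0 lam e -> reg i0 lam (Re z) -> ~ S z -> Tay e z.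
Proof.
move=> re rg Sz; elim: re => [|c i mu psi e' [oc _] _ pS i0i lm _ IH]; first exact: Tay_cst.
apply: Tay_add IH; apply: Tay_mul; first exact: oc.
exact: (Val_Tay cover gen0 FS (reg_region i0i lm rg) (Sy_Bd pS)).
Qed.

Lemma Rep_Lau i0 lam e z : Rep i0 lam e -> reg i0 lam (Re z) -> exists M, Lau M e z.
Proof.
move=> re rg; elim: re => [|c i mu psi e' [_ oc] _ pS i0i lm _ [M IH]].
  by exists 0%N; apply: Tay_Lau; exact: Tay_cst.
have [N cN] := oc z; exists (N + 0 + M)%N; apply: Lau_add IH; apply: Lau_mul cN _; apply: Tay_Lau.
exact: (Val_Tay cover gen0 FS (reg_region i0i lm rg) (Sy_Bd pS)).
Qed.

Definition Zok (Z : seq R[i]) := forall p, p \in Z -> S p.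

Lemma Zok_cat Z Z' : Zok Z -> Zok Z' -> Zok (Z ++ Z').
Proof. by move=> h h' p; rewrite mem_cat => /orP[/h|/h']. Qed.

Definition cB c (i : nat) : R[i] -> R[i] := fun s => c s * - (1 * s + i.+1%:R)^-1.

Lemma okc_cB c i : okc c -> okc (cB c i).
Proof.
move=> oc; apply: okc_mul oc _.
have -> : (fun s : R[i] => - (1 * s + i.+1%:R)^-1) = (fun s => -1 * (1 * s + i.+1%:R)^-1).
  by apply/funext => s; rewrite mulN1r.
apply: okc_mul (okc_cst _) _; apply: okc_inv; last by rewrite oner_eq0.
move=> z Sz; apply/eqP => E; apply: Sz.
rewrite (_ : z = cofR (- i.+1%:R)) //; apply/eqP; rewrite cofRN cofR_nat -addr_eq0.
by move: E; rewrite mul1r => ->.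
Qed.

Hypothesis okB : forall c i, okc c -> ok c i -> ok (cB c i) i.+1.

Lemma th_inv : Sym Sig (fun a => - (li a + li a)) (fun v => (Dd F v)^-1).
Proof.
have h : Sym Sig (fun a => (2 * l a)%:Z) (Dd F).
  apply: Sym_sum => m; have := Sym_mul (Sym_pd m FS) (Sym_pd m FS).
  by apply: Sym_mueq; apply/funext => a; rewrite /li mul2n -addnn PoszD.
have := Sym_inv cover DP h; apply: Sym_mueq; apply/funext => a.
by rewrite /li mul2n -addnn PoszD.
Qed.

Lemma Dd_inv psi mu v : Sy mu psi -> Dd F v * ((Dd F v)^-1 * psi v) = psi v.
Proof.
move=> [_ [e e0 ev]]; have [Qv|/not_Qp[i vi]] := pselect (Qp v).
  by rewrite mulrA mulfV ?mul1r //; exact: (lbnd_neq0 cover DP Qv).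
by rewrite (ev v i) ?mulr0 // (le_lt_trans vi).
Qed.

(** The shift [i] grows by one while [mu] drops by [l], so the combined order is unchanged. Equality
    is lost at most where a new denominator vanishes, and these points are collected in [Z]. *)
Lemma Rep_B i0 lam e : Rep i0 lam e -> exists e' Z, [/\ Rep i0.+1 lam e', Zok Z &
  forall s, reg i0 lam (Re s) -> s \notin Z -> e' s = e s].
Proof.
elim => [|c i mu psi e1 oc oc' pS i0i lm _ [e1' [Z [re Zk eq]]]]; first by exists (fun=> 0), [::]; split => //; exact: Rep0.
exists (fun s => cB c i s * Val (s + i.+1%:R) (Tt F (fun v => (Dd F v)^-1) psi) + e1' s), (cofR (- i.+1%:R) :: Z); split.
- apply: RepS re; [exact: okc_cB|exact: okB|exact: (Sy_Tt FS th_inv pS)|by []|].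
  move=> a ag; apply: le_trans (lm a ag) _; rewrite /li mulSn PoszD.
  by move: ((i * l a)%:Z) ((l a)%:Z) (mu a) => p q r; lia.
- by move=> p; rewrite inE => /orP[/eqP ->|/Zk//]; exact: Sint.
move=> s rg; rewrite inE negb_or => /andP[sn sZ]; rewrite eq //; congr (_ + _).
have rr := reg_region i0i lm rg; have [r0 _] := rr.
have T := Tstep cover gen0 FS th_inv r0 rr pS.
have -> : s + i.+1%:R = s + i%:R + 1 by rewrite -natr1 addrA.
rewrite /cB -mulrA; congr (_ * _).
have nz : s + i%:R + 1 != 0.
  by rewrite -addrA natr1; apply: contra sn => /eqP E; rewrite cofRN cofR_nat -addr_eq0 E.
have -> : 1 * s + i.+1%:R = s + i%:R + 1 by rewrite mul1r -natr1 addrA.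
rewrite -[X in _ = X](mulKf nz); rewrite mulNr -mulrN; congr (_ * _); rewrite -T; congr (_ * _).
by apply: Val_ext => v; exact: (Dd_inv v pS).
Qed.

Lemma Rep_Bn k i0 lam e : Rep i0 lam e -> exists e' Z, [/\ Rep (i0 + k) lam e', Zok Z &
  forall s, reg i0 lam (Re s) -> s \notin Z -> e' s = e s].
Proof.
elim: k => [|k IH] re; first by exists e, [::]; rewrite addn0; split.
have [e1 [Z [r1 Zk eq]]] := IH re; have [e2 [Z' [r2 Zk' eq']]] := Rep_B r1.
exists e2, (Z ++ Z'); split; [by rewrite addnS|exact: Zok_cat|].
move=> s rg; rewrite mem_cat negb_or => /andP[sZ sZ']; rewrite eq' ?eq //.
case: rg => x0 xl; split => //; apply: lt_le_trans x0 _; rewrite lerD2l ler_nat leq_addr //.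
Qed.

End WithPredicate.

Let okT : (R[i] -> R[i]) -> nat -> Prop := fun _ _ => True.

Lemma Rep_weak ok i0 lam e : Rep ok i0 lam e -> Rep okT i0 lam e.
Proof. by elim => [|c i mu psi e' oc _ pS ii lm _ IH]; [exact: Rep0|exact: RepS oc I pS ii lm IH]. Qed.

(** Both new terms have their combined order raised at [a], but one of them loses a unit of shift;
    hence [i0.+1] in the hypothesis. The bound [wl b <= lam b] ensures that the denominator is
    [l(a) s + <a> + nu] with [nu] natural, whose zero is a candidate pole. *)
Lemma Rep_A i0 lam e a : a \in gens Sig -> (forall b, b \in gens Sig -> wl b <= lam b) ->
  Rep okT i0.+1 lam e -> exists e' Z, [/\ Rep okT i0 (inc lam a) e', Zok Z &
  forall s, reg i0 lam (Re s) -> s \notin Z -> e' s = e s].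
Proof.
move=> ag wlam; elim => [|c [//|i] mu psi e1 oc _ pS i0i lm _ [e1' [Z [re Zk eq]]]]; first by exists (fun=> 0), [::]; split => //; exact: Rep0.
pose La := ((i.+1 * l a)%:Z + mu a)%R.
have Law : wl a <= La by exact: le_trans (wlam a ag) (lm a ag).
have [nu nuE] : exists nu : nat, La = (wsum a + nu)%:Z.
  exists (absz (La - wl a)); rewrite PoszD gez0_abs ?subr_ge0 // -/(wl a).
  by move: (La) (wl a); clear => p q; lia.
have w0 := wpos ag.
pose den (s : R[i]) := (l a)%:R * s + (wsum a + nu)%:R.
have denE s : (l a)%:R * (s + i.+1%:R) + (mu a)%:~R = den s :> R[i].
  have := congr1 (fun z : int => z%:~R : R[i]) nuE; rewrite /La intrD -!pmulrn natrM /den => <-.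
  by move: ((l a)%:R : R[i]) (i.+1%:R : R[i]) ((mu a)%:~R : R[i]) => p q r; ring.
pose pl := cofR (- ((wsum a + nu)%:R / (l a)%:R)) : R[i].
(* For [l a = 0] the denominator is the positive constant [wsum a + nu] and produces no exceptional
   point. *)
pose Za := if (0 < l a)%N then [:: pl] else [::].
have den0 s : s \notin Za -> den s != 0.
  rewrite /Za /den; case: posnP => [->|l0] sn.
    by rewrite mul0r add0r pnatr_eq0 -lt0n addn_gt0 w0.
  apply: contra sn => /eqP E; rewrite inE; apply/eqP.
  have lz : (l a)%:R != 0 :> R[i] by rewrite pnatr_eq0 -lt0n.
  apply: (mulfI lz); rewrite /pl cofRN cofRM cofRV !cofR_nat mulrN mulrCA mulfV // mulr1.
  by apply/eqP; rewrite -addr_eq0 E.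
have okden : okc (fun s => (den s)^-1).
  apply: okc_inv; last by apply/orP; right; rewrite pnatr_eq0 -lt0n addn_gt0 w0.
  move=> z Sz; apply: den0; rewrite /Za; case: posnP => // l0; rewrite inE; apply/eqP => zE; apply: Sz.
  by rewrite zE; exact: Sgen.
pose c1 (s : R[i]) := c s * ((den s)^-1 * (-1 * s + - i.+1%:R)).
pose c2 (s : R[i]) := c s * ((den s)^-1 * -1).
exists (fun s => c1 s * Val (s + i%:R) (fun v => rai li a F v * psi v) + (c2 s * Val (s + i.+1%:R) (rai mu a psi) + e1' s)), (Za ++ Z).
split.
- apply: (@RepS _ _ _ _ _ (fun b => inc li a b + mu b)).
  + by apply: okc_mul oc _; apply: okc_mul okden _; exact: okc_lin.
  + by [].
  + exact: (Sy_mul (Sym_raise ag FS) pS).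
  + by [].
  + move=> b bg; have := lm b bg; rewrite /inc /li mulSn PoszD.
    by move: (lam b) ((i * l b)%:Z) ((l b)%:Z) (mu b) ((b == a)%:R : int) => p q r t u; lia.
  apply: (@RepS _ _ _ _ _ (inc mu a)).
  + by apply: okc_mul oc _; apply: okc_mul okden _; exact: okc_cst.
  + by [].
  + exact: Sy_raise.
  + by apply: ltnW; apply: leq_trans i0i _.
  + move=> b bg; have := lm b bg; rewrite /inc.
    by move: (lam b) ((i.+1 * l b)%:Z) (mu b) ((b == a)%:R : int) => p q t u; lia.
  exact: re.
- apply: Zok_cat Zk; rewrite /Za; case: posnP => // l0 p; rewrite inE => /eqP ->; exact: Sgen.
move=> s rg; rewrite mem_cat negb_or => /andP[sa sZ]; rewrite eq // addrA; congr (_ + _).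
have d0 := den0 s sa.
have rg' : reg i0.+1 lam (Re s).
  by case: rg => x0 xl; split => //; apply: lt_le_trans x0 _; rewrite lerD2l ler_nat.
have rr := reg_region i0i lm rg'.
have z1 : 1 < Re (s + i.+1%:R).
  have -> : Re (s + i.+1%:R) = Re s + i%:R + 1 by rewrite cReD -cofR_nat /= -natr1 addrA.
  rewrite ltrDr; case: rg => x0 _; apply: lt_le_trans x0 _; rewrite lerD2l ler_nat //.
have A := Astep cover gen0 FS ag z1 rr pS.
rewrite denE in A; have E1 : s + i.+1%:R - 1 = s + i%:R by rewrite -natr1 addrA addrK.
rewrite E1 in A.
have VE : Val (s + i.+1%:R) psi = (den s)^-1 * (den s * Val (s + i.+1%:R) psi) by rewrite mulKf.
rewrite VE A /c1 /c2.
have E7 (p q r t u x : R[i]) : p * (q * (-1 * x - u)) * r + p * (q * -1) * t = p * (q * (- (x + u) * r - t)) by ring.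
exact: E7.
Qed.

Lemma Rep_As w i0 lam e : {subset w <= gens Sig} -> (forall b, b \in gens Sig -> wl b <= lam b) ->
  Rep okT (i0 + size w) lam e -> exists e' Z, [/\ Rep okT i0 (fun b => lam b + (count_mem b w)%:Z) e', Zok Z &
  forall s, reg i0 lam (Re s) -> s \notin Z -> e' s = e s].
Proof.
elim: w i0 lam e => [|a w IH] i0 lam e wg wlam.
  rewrite addn0 => re; exists e, [::]; split => //.
  by rewrite (_ : (fun b => _) = lam) //; apply/funext => b; rewrite addr0.
rewrite /= addnS => re.
have ag : a \in gens Sig by apply: wg; rewrite inE eqxx.
have [e1 [Z1 [r1 k1 q1]]] := Rep_A ag wlam re.
have [||e2 [Z2 [r2 k2 q2]]] := IH i0 (inc lam a) e1 _ _ r1.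
- by move=> b bw; apply: wg; rewrite inE bw orbT.
- by move=> b bg; apply: le_trans (wlam b bg) (inc_le lam a b).
exists e2, (Z1 ++ Z2); split; [|exact: Zok_cat|].
  rewrite (_ : (fun b => _) = (fun b => inc lam a b + (count_mem b w)%:Z)) //; apply/funext => b.
  by rewrite /inc PoszD -addrA eq_sym; congr (_ + (_ + _)); case: eqP.
move=> s rg; rewrite mem_cat negb_or => /andP[s1 s2]; rewrite q2 ?q1 //.
  case: rg => x0 xl; split; first by apply: lt_le_trans x0 _; rewrite lerD2l ler_nat leq_addr.
  by [].
case: rg => x0 xl; split => // b bg; apply: lt_le_trans (xl b bg) _; rewrite lerD2l ler_int; exact: inc_le.
Qed.

(** The combined order for which convergence holds on [Re s > - k], provided the shifts are large
    enough. *)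
Definition lamk k (a : 'rV[int]_n) := wl a + (k * l a)%:Z.

(** Enlarging the half plane by one unit means raising the order by [l b] at every generator [b];
    accordingly [w] contains at least [l b] copies of [b], one constant-field step for each. *)
Lemma Rep_up J k e : Rep okT (J + k) (lamk k) e -> exists e' Z, [/\ Rep okT (J + k.+1) (lamk k.+1) e', Zok Z &
  forall s, reg (J + k) (lamk k) (Re s) -> s \notin Z -> e' s = e s].
Proof.
move=> re; pose w := flatten [seq nseq (l a) a | a <- gens Sig].
have wg : {subset w <= gens Sig}.
  by move=> b /flatten_mapP[a ag]; rewrite mem_nseq => /andP[_ /eqP ->].
have cw b : b \in gens Sig -> (l b <= count_mem b w)%N.
  rewrite /w; elim: (gens Sig) => // a r IH; rewrite inE /= count_cat count_nseq => /orP[/eqP ->|br].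
    by rewrite /= eqxx mul1n leq_addr.
  by apply: leq_trans (IH br) _; rewrite leq_addl.
(* Each constant-field step uses up one unit of shift, and the next half plane demands one unit more
   than the present one. *)
have [e1 [Z1 [r1 k1 q1]]] := Rep_Bn (ok := okT) (fun _ _ _ _ => I) (1 + size w) re.
have wlam b : b \in gens Sig -> wl b <= lamk k b by move=> _; rewrite /lamk lerDl.
rewrite addnA in r1; have [e2 [Z2 [r2 k2 q2]]] := Rep_As wg wlam r1.
exists e2, (Z1 ++ Z2); split; [|exact: Zok_cat|].
  apply: Rep_le r2; first by rewrite addn1 addnS.
  move=> b bg; have := cw b bg; rewrite /lamk mulSn PoszD.
  by move: (wl b) ((k * l b)%:Z) (l b) (count_mem b w) => p q r t; lia.
move=> s rg; rewrite mem_cat negb_or => /andP[s1 s2]; rewrite q2 ?q1 //.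
case: rg => x0 xl; split => //; apply: lt_le_trans x0 _; rewrite lerD2l ler_nat leq_addr //.
Qed.

End Continuation.

Lemma avoid_finite {R : realType} (Z : seq R[i]) (z : R[i]) :
  exists2 d : R, 0 < d & forall h : R[i], 0 < cmod h < d -> z + h \notin Z.
Proof.
elim: Z => [|p Z [d d0 dP]]; first by exists 1.
have [->|pz] := eqVneq p z.
  exists d => // h hd; rewrite inE negb_or dP // andbT.
  by case/andP: hd => h0 _; rewrite -subr_eq0 addrC addKr -cmod_gt0.
have c0 : 0 < cmod (p - z) by rewrite cmod_gt0 subr_eq0.
exists (Num.min d (cmod (p - z))); first by rewrite lt_min d0.
move=> h; rewrite lt_min => /and3P[h0 h1 h2]; rewrite inE negb_or dP ?h0 // andbT.
by apply/eqP => E; move: h2; rewrite -E addrC addKr ltxx.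
Qed.

(** * The initial step and the global continuation *)

Section FirstStep.
Context {R : realType} {n : nat}.
Variable Sig : seq (seq 'rV[int]_n).
Hypothesis cover : forall v : 'rV[R]_n, orthant v -> exists2 s, s \in Sig & coneR s v.
Hypothesis gen0 : forall a i, a \in gens Sig -> 0 <= a 0 i.
Hypothesis wpos : forall a, a \in gens Sig -> (0 < wsum a)%N.
Local Notation Re := (@complex.Re R).
Local Notation Im := (@complex.Im R).
Variables (l : 'rV[int]_n -> nat) (F : 'rV[R]_n -> R).
Let li a := (l a)%:Z.
Hypothesis FS : Sym Sig li F.
Hypothesis DP : lbnd Sig (fun a => (2 * l a)%:Z) (Dd F).
Variables (M1 M2 : 'rV[R]_n -> R).
Hypothesis M1S : Sym Sig (fun a => (2 * l a)%:Z) M1.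
Hypothesis M2S : Sym Sig (fun a => (2 * l a)%:Z) M2.
Let D2 v := Dd F v * M1 v + F v ^+ 2 * M2 v.
Hypothesis D2P : lbnd Sig (fun a => (4 * l a)%:Z) D2.
Variable S : set R[i].
Hypothesis Sint : forall k : nat, S (cofR (- k.+1%:R)).
Hypothesis Sgen : forall a (k : nat), a \in gens Sig -> (0 < l a)%N -> S (cofR (- ((wsum a + k)%:R / (l a)%:R))).
Hypothesis Sneg : forall z, S z -> Re z < 0.
Local Notation region := (region (R := R) Sig l).
Local Notation Val := (Val F).
Local Notation Sy := (Sy Sig).
Local Notation reg := (reg (R:=R) Sig l).

Lemma Sym_D2 : Sym Sig (fun a => (4 * l a)%:Z) D2.
Proof.
have h : Sym Sig (fun a => (2 * l a)%:Z) (Dd F).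
  apply: Sym_sum => m; have := Sym_mul (Sym_pd m FS) (Sym_pd m FS).
  by apply: Sym_mueq; apply/funext => a; rewrite /li mul2n -addnn PoszD.
have E : (fun a => (2 * l a)%:Z + (2 * l a)%:Z) = (fun a => (4 * l a)%:Z).
  by apply/funext => a; rewrite -PoszD -mulnDl.
apply: Sym_add; first by have := Sym_mul h M1S; rewrite E.
have h2 : Sym Sig (fun a => (2 * l a)%:Z) (fun v => F v ^+ 2).
  by have := Sym_mul FS FS; apply: Sym_mueq; apply/funext => a; rewrite /li mul2n -addnn PoszD.
by have := Sym_mul h2 M2S; rewrite E.
Qed.

Definition th1 v := M1 v * (D2 v)^-1.
Definition th2 v := M2 v * (D2 v)^-1.

Lemma Sym_th (M : 'rV[R]_n -> R) : Sym Sig (fun a => (2 * l a)%:Z) M ->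
  Sym Sig (fun a => - (li a + li a)) (fun v => M v * (D2 v)^-1).
Proof.
move=> MS; have := Sym_mul MS (Sym_inv cover D2P Sym_D2); apply: Sym_mueq; apply/funext => a.
by rewrite /li !PoszM; move: ((l a)%:Z) => p; lia.
Qed.

Variable psi : 'rV[R]_n -> R.
Hypothesis pS : Sy (@wl n) psi.

(** The result of an initial step with [D2] in place of [|grad F|^2]. Only the first term has the
    denominator [s + 1]; it is kept explicit so that its amplitude can be estimated when [d = 1]. *)
Definition ef1 : R[i] -> R[i] := fun s => cB (fun=> 1) 0 s * Val (s + 1%:R) (Tt F th1 psi) +
  (1 * Val (s + 2%:R) (fun v => th2 v * psi v) + 0).

Lemma Rep_ef1 ok : ok (cB (R := R) (fun=> 1) 0) 1%N -> ok (fun=> 1) 2%N -> Rep Sig l F S ok 1 (@wl n) ef1.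
Proof.
move=> o1 o2; apply: (@RepS _ _ _ _ _ _ _ _ _ _ _ (fun a => wl a - li a)) => //.
- by apply: okc_cB => //; exact: okc_cst.
- exact: (Sy_Tt FS (Sym_th M1S) pS).
- by move=> a ag; rewrite mul1n /li addrC subrK.
apply: (@RepS _ _ _ _ _ _ _ _ _ _ _ (fun a => - (li a + li a) + wl a)) => //.
- exact: okc_cst.
- exact: (Sy_mul (Sym_th M2S) pS).
- by move=> a ag; rewrite /li PoszM; move: (wl a) ((l a)%:Z) => p q; lia.
exact: Rep0.
Qed.

Lemma region_wl (x : R) : 0 < x -> region x (@wl n).
Proof.
move=> x0; split => // a ag; rewrite ltr_wpDl ?mulr_ge0 ?(ltW x0)// /wl -pmulrn ltr0n wpos //.
Qed.

(** By the definition of [D2], [psi] is the sum of [|grad F|^2 th1 psi], to which the gradient step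
    applies, and [F ^ 2 th2 psi], where [F ^ 2] raises the exponent by two without a denominator. *)
Lemma first_step s : 0 < Re s -> ef1 s = Val s psi.
Proof.
move=> s0; have rg := region_wl s0.
have T := Tstep cover gen0 FS (Sym_th M1S) s0 rg pS.
have nz : s + 1 != 0.
  apply/eqP => E; have := congr1 Re E; rewrite cReD /= => E'.
  by move: s0; rewrite -[Re s](addrK 1) E' sub0r oppr_gt0 ltr10.
have SyD M : Sym Sig (fun a => (2 * l a)%:Z) M -> Sy (@wl n) (fun v => Dd F v * (M v * (D2 v)^-1 * psi v)).
  move=> MS; have h : Sym Sig (fun a => (2 * l a)%:Z) (Dd F).
    apply: Sym_sum => m; have := Sym_mul (Sym_pd m FS) (Sym_pd m FS).
    by apply: Sym_mueq; apply/funext => a; rewrite /li mul2n -addnn PoszD.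
  apply: Sy_mueq (Sy_mul h (Sy_mul (Sym_th MS) pS)) => a.
  by rewrite /li PoszM; move: (wl a) ((l a)%:Z) => p q; lia.
have B1 : Bd Sig (@wl n) (fun v => Dd F v * (th1 v * psi v)) by apply: Sy_Bd; exact: SyD.
have B2 : Bd Sig (@wl n) (fun v => F v * (F v * (th2 v * psi v))).
  apply: Sy_Bd; apply: Sy_mueq (Sy_mul FS (Sy_mul FS (Sy_mul (Sym_th M2S) pS))) => a.
  by rewrite /li; move: (wl a) ((l a)%:Z) => p q; lia.
have pE v : psi v = Dd F v * (th1 v * psi v) + F v * (F v * (th2 v * psi v)).
  have [_ [e e0 ev]] := pS; have [Qv|/not_Qp[i vi]] := pselect (Qp v).
    have d0 := lbnd_neq0 cover D2P Qv; rewrite /th1 /th2.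
    have -> : Dd F v * (M1 v * (D2 v)^-1 * psi v) + F v * (F v * (M2 v * (D2 v)^-1 * psi v)) = D2 v * (D2 v)^-1 * psi v.
      have Eg (a b m1 m2 q p : R) : a * (m1 * q * p) + b * (b * (m2 * q * p)) = (a * m1 + b ^+ 2 * m2) * q * p by ring.
      exact: Eg.
    by rewrite mulfV // mul1r.
  by rewrite (ev v i) ?mulr0 ?addr0 // (le_lt_trans vi).
rewrite [RHS](Val_ext _ _ pE) (ValD cover gen0 FS rg B1 B2) !ValS /ef1 addr0 (mul1r (Val _ _)).
have -> : s + 1 + 1 = s + 2%:R by rewrite -addrA.
congr (_ + _); rewrite /cB !mul1r.
by rewrite -[RHS](mulKf nz) T mulNr mulrN.
Qed.

Definition negx (x : R) := Num.max 0 (- x).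
Definition kk (s : R[i]) : nat := (Num.truncn (negx (Re s))).+1.

Lemma kk_gt s : - (kk s)%:R < Re s.
Proof.
have h : negx (Re s) < (kk s)%:R by apply: truncnS_gt; rewrite num_real.
by rewrite ltrNl; apply: le_lt_trans h; rewrite le_max lexx orbT.
Qed.

Lemma kk_le s (K : nat) : (0 < K)%N -> - K%:R < Re s -> (kk s <= K)%N.
Proof.
move=> K0 h; rewrite /kk; have n0 : 0 <= negx (Re s) by rewrite le_max lexx.
rewrite truncn_lt_nat // /negx gt_max ltr0n K0 /= ltrNl //.
Qed.

Lemma reg_lamk J k (x : R) : - k%:R < x -> (0 < J)%N -> reg (J + k) (lamk l k) x.
Proof.
move=> xk J0; split.
  by rewrite natrD addrCA addrC addr_gt0 ?ltr0n // -ltrBlDr sub0r.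
move=> a ag; rewrite /lamk intrD -!pmulrn natrM addrCA -mulrDl ltr_pwDl ?ltr0n ?wpos //.
by rewrite mulr_ge0 // ltW // -ltrBlDr sub0r.
Qed.

Lemma reg_lamk_up J k (x : R) : reg J (@wl n) x -> reg (J + k) (lamk l k) x.
Proof.
move=> [x0 xl]; split; first by rewrite natrD addrA ltr_wpDr.
by move=> a ag; rewrite /lamk intrD addrA ltr_wpDr ?xl // -pmulrn.
Qed.

(** [Fc s] is computed by the representation of index [kk s], which converges at [s]. Successive
    representations agree off finite subsets of [S], so near any given point [Fc] coincides, off
    such a subset, with a single representation. The conclusion also retains [bJ] and [ef1], the two
    expressions that are estimated near [- 1/d]. *)
Theorem continuation ok J : (0 < J)%N ->
  (forall c i, okc S c -> ok c i -> ok (cB c i) i.+1) ->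
  ok (cB (R := R) (fun=> 1) 0) 1%N -> ok (fun=> 1) 2%N ->
  exists Fc bJ : R[i] -> R[i], exists Z : seq R[i],
    [/\ Rep Sig l F S ok J (@wl n) bJ, (forall s, 0 < Re s -> Fc s = Val s psi),
      (forall z, ~ S z -> Tay Fc z), (forall z, exists M, Lau M Fc z) &
      [/\ Zok S Z, (forall s, reg J (@wl n) (Re s) -> s \notin Z -> Fc s = bJ s) &
        (forall s, reg 1 (@wl n) (Re s) -> s \notin Z -> Fc s = ef1 s)]].
Proof.
move=> J0 okB o1 o2.
have [bJ [ZB [rB ZBk qB]]] := Rep_Bn cover gen0 FS DP Sint okB J.-1 (Rep_ef1 o1 o2).
rewrite add1n prednK // in rB.
have /choice[nx nxP] : forall ke : nat * (R[i] -> R[i]), exists eZ : (R[i] -> R[i]) * seq R[i],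
    Rep Sig l F S (fun _ _ => True) (J + ke.1) (lamk l ke.1) ke.2 ->
    [/\ Rep Sig l F S (fun _ _ => True) (J + ke.1.+1) (lamk l ke.1.+1) eZ.1, Zok S eZ.2 &
      forall s, reg (J + ke.1) (lamk l ke.1) (Re s) -> s \notin eZ.2 -> eZ.1 s = ke.2 s].
  move=> [k e] /=; have [re|nre] := pselect (Rep Sig l F S (fun _ _ => True) (J + k) (lamk l k) e); last by exists (e, [::]).
  by have [e' [Z H]] := Rep_up cover gen0 wpos FS DP Sint Sgen re; exists (e', Z).
pose E := fix E k := if k is k'.+1 then (nx (k', E k')).1 else bJ.
pose Zs k := (nx (k, E k)).2.
have RE k : Rep Sig l F S (fun _ _ => True) (J + k) (lamk l k) (E k).
  elim: k => [|k IH]; last by have [] := nxP (k, E k) IH.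
  rewrite addn0; apply: Rep_le (Rep_weak rB) => // a ag.
  by rewrite /lamk mul0n addr0.
have Zk k : Zok S (Zs k) by have [] := nxP (k, E k) (RE k).
have step k s : reg (J + k) (lamk l k) (Re s) -> s \notin Zs k -> E k.+1 s = E k s.
  by have [_ _] := nxP (k, E k) (RE k); apply.
pose ZK K := flatten [seq Zs j | j <- iota 0 K].
have ZKk K : Zok S (ZK K) by move=> p /flatten_mapP[j _]; exact: Zk.
have ZKj K j s : (j < K)%N -> s \notin ZK K -> s \notin Zs j.
  by move=> jK; apply: contra => sj; apply/flatten_mapP; exists j => //; rewrite mem_iota.
have cons k K s : (k <= K)%N -> (forall j, (k <= j)%N -> reg (J + j) (lamk l j) (Re s)) -> s \notin ZK K -> E K s = E k s.
  move=> kK rg sZ; have H d : (k + d <= K)%N -> E (k + d)%N s = E k s.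
    elim: d => [|d IH] dK; first by rewrite addn0.
    rewrite addnS in dK *; rewrite step; [exact: (IH (ltnW dK))|by apply: rg; rewrite leq_addr|].
    exact: ZKj dK sZ.
  by rewrite -(subnKC kK); apply: H; rewrite subnKC.
have regk k j x : - k%:R < x -> (k <= j)%N -> reg (J + j) (lamk l j) x.
  by move=> xk kj; apply: reg_lamk => //; apply: le_lt_trans xk; rewrite lerN2 ler_nat.
pose Fc s := E (kk s) s.
have FcE K s : (kk s <= K)%N -> s \notin ZK K -> Fc s = E K s.
  by move=> kK sZ; rewrite /Fc -(cons (kk s) K) // => j; apply: regk; exact: kk_gt.
have F0 s : reg J (@wl n) (Re s) -> s \notin ZK J -> Fc s = bJ s.
  move=> rg sZ; rewrite (FcE J) //; first by apply: (cons 0%N J) => // j _; exact: reg_lamk_up.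
  by apply: kk_le => //; case: rg => x0 _; rewrite -subr_gt0 opprK.
have F1 s : reg 1 (@wl n) (Re s) -> s \notin ZB ++ ZK J -> Fc s = ef1 s.
  move=> rg; rewrite mem_cat negb_or => /andP[sB sZ]; rewrite F0 ?qB //.
  case: rg => x0 xl; split => //; apply: lt_le_trans x0 _; rewrite lerD2l ler_nat //.
(* Within distance one of [z] the index [kk] exceeds [kk z] by at most one, so the next
   representation serves a whole neighbourhood. *)
have near z : exists2 d : R, 0 < d & forall h, cmod h < d -> z + h \notin ZK (kk z).+1 -> E (kk z).+1 (z + h) = Fc (z + h).
  exists 1 => // h h1 hZ; rewrite (FcE (kk z).+1) //; apply: kk_le => //.
  rewrite cReD; have := Re_le_cmod h; rewrite ler_norml => /andP[h2 _].
  rewrite -natr1 opprD; apply: ltr_leD; first exact: kk_gt.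
  by apply: le_trans h2; rewrite lerN2 ltW.
have rgz z : reg (J + (kk z).+1) (lamk l (kk z).+1) (Re z) by apply: regk (kk_gt z) _.
exists Fc, bJ, (ZB ++ ZK J); split => //.
- move=> s s0; rewrite F1 ?first_step //.
    by have [_ h] := region_wl s0; split => //; rewrite addr_gt0.
  apply/negP => sZ; have : S s by apply: Zok_cat sZ.
  by move=> /Sneg; rewrite ltNge ltW.
- move=> z Sz; have [d d0 dP] := near z; have [d' d'0 d'P] := avoid_finite (ZK (kk z).+1) z.
  have m0 : 0 < Num.min d d' by rewrite lt_min d0.
  apply: (Tay_congr m0 _ (Rep_Tay cover gen0 FS (RE _) (rgz z) Sz)) => h; rewrite lt_min => /andP[h1 h2].
  (* The centre itself is harmless: exceptional points lie in [S], and [z] does not. *)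
  apply: dP => //; have [->|h0] := eqVneq h 0; last by apply: d'P; rewrite cmod_gt0 h0.
  by rewrite addr0; apply/negP => /ZKk.
- move=> z; have [d d0 dP] := near z; have [d' d'0 d'P] := avoid_finite (ZK (kk z).+1) z.
  have [M LM] := Rep_Lau cover gen0 FS (RE _) (rgz z); exists M.
  have m0 : 0 < Num.min d d' by rewrite lt_min d0.
  apply: (Lau_congr m0 _ LM) => h; rewrite lt_min => /and3P[h0 h1 h2].
  by apply: dP => //; apply: d'P; rewrite h0.
split; [exact: Zok_cat| |by []].
by move=> s rg; rewrite mem_cat negb_or => /andP[_ sZ]; exact: F0.
Qed.

End FirstStep.

(** * At most one simple pole among the coefficients *)

Section SimplePole.
Context {R : realType}.
Variable s0 : R[i].
Implicit Types (c : R[i] -> R[i]).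

(** Recording that a pole at [s0 = - j] arose with [j <= i] makes the property inductive: the next
    gradient factor has its pole at [- (i + 1)], a different point, so it cannot increase the
    order. *)
Definition okS c (i : nat) := pole_le c s0 0 \/
  (pole_le c s0 1 /\ exists2 j : nat, (0 < j <= i)%N & s0 = - j%:R).

Lemma pole_mul c c' m m' : pole_le c s0 m -> pole_le c' s0 m' -> pole_le (fun s => c s * c' s) s0 (m + m').
Proof.
move=> [K [d d0 dP]] [K' [d' d'0 d'P]]; exists (`|K| * `|K'|), (Num.min d d'); first by rewrite lt_min d0.
move=> s; rewrite lt_min => /and3P[h0 h1 h2]; rewrite exprD mulrACA cmodM ler_pM ?cmod_ge0 //.
  by apply: le_trans (dP s _) (ler_norm _); rewrite h0.
by apply: le_trans (d'P s _) (ler_norm _); rewrite h0.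
Qed.

Lemma pole_Tay c : Tay c s0 -> pole_le c s0 0.
Proof. by move=> /Tay_Lau/Lau_pole. Qed.

Lemma okS_B c i : okS c i -> okS (cB c i) i.+1.
Proof.
have invE (z : R[i]) : (fun s : R[i] => - (1 * s + z)^-1) = (fun s => -1 * (1 * s + z)^-1).
  by apply/funext => s; rewrite mulN1r.
move=> H; have [E|E] := eqVneq (1 * s0 + i.+1%:R) 0.
  have s0E : s0 = - i.+1%:R by apply/eqP; rewrite -addr_eq0 -{1}[s0]mul1r E.
  case: H => [H|[_ [j /andP[_ ji] s0j]]]; last first.
    have : (j%:R : R[i]) = i.+1%:R by apply: oppr_inj; rewrite -s0j -s0E.
    by move=> /eqP; rewrite eqr_nat => /eqP jE; rewrite jE ltnn in ji.
  right; split; last by exists i.+1 => //; rewrite leqnn.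
  rewrite -[1%N]add0n; apply: pole_mul H _; exists 1, 1 => // s /andP[h0 _].
  have -> : (s - s0) ^+ 1 * - (1 * s + i.+1%:R)^-1 = -1.
    rewrite expr1 s0E opprK mul1r mulrN mulfV //; rewrite cmod_gt0 s0E opprK in h0; exact: h0.
  by rewrite cmodN cmod1.
have T : pole_le (fun s : R[i] => - (1 * s + i.+1%:R)^-1) s0 0.
  by apply: pole_Tay; rewrite invE; apply: Tay_mul; [exact: Tay_cst|exact: Tay_inv].
case: H => [H|[H [j /andP[j0 ji] s0j]]]; [left|right; split].
- by have := pole_mul H T.
- by have := pole_mul H T; rewrite addn0.
- by exists j => //; rewrite j0 ltnW.
Qed.

End SimplePole.

(** * Order of the pole *)

Section RealBounds.
Context {R : realType} {n : nat}.
Variable Sig : seq (seq 'rV[int]_n).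
Hypothesis cover : forall v : 'rV[R]_n, orthant v -> exists2 s, s \in Sig & coneR s v.
Hypothesis gen0 : forall a i, a \in gens Sig -> 0 <= a 0 i.
Hypothesis wpos : forall a, a \in gens Sig -> (0 < wsum a)%N.
Local Notation Re := (@complex.Re R).
Variables (l : 'rV[int]_n -> nat) (F : 'rV[R]_n -> R).
Let li a := (l a)%:Z.
Hypothesis FS : Sym Sig li F.
Variable Pn : set 'rV[R]_n.
Hypothesis HL : forall q, Pn q -> forall s (c : 'I_(size s) -> R), s \in Sig -> (forall j, 0 <= c j) ->
  \sum_j c j * (l (nth 0 s j))%:R <= dot (cpt c) q.
Local Notation region := (region (R := R) Sig l).
Local Notation Val := (Val F).
Local Notation Sy := (Sy Sig).

(** The constant [C0] depends on [F] alone. For real exponents bounded by [A], the dependence on the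
    exponent is thus confined to the weight [Wt], whose integral is estimated separately. *)
Lemma Val_real_bound : exists2 C0 : R, 0 < C0 & forall (i : nat) mu psi (sg A Cp : R) (Wt : 'rV[R]_n -> R),
  sg + i%:R <= A -> region (sg + i%:R) mu -> Bd Sig mu psi -> Cls Wt -> (forall v, 0 <= Wt v) -> 0 <= Cp ->
  (forall s (c : 'I_(size s) -> R), s \in Sig -> (forall j, 0 <= c j) -> Qp (cpt c) ->
    `|psi (cpt c)| * expR (- \sum_j c j * ((sg + i%:R) * (l (nth 0 s j))%:R)) <= Cp * Wt (cpt c)) ->
  cmod (Val (cofR sg + i%:R) psi) <= 2 * (expR (A * C0) * Cp * iint Wt).
Proof.
have [C0 C00 FP] := F_bound FS; exists C0 => // i mu psi sg A Cp Wt sA rg pB WC W0 Cp0 H.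
have ReE : Re (cofR sg + i%:R) = sg + i%:R by rewrite cReD -cofR_nat.
have rg' : region (Re (cofR sg + i%:R)) mu by rewrite ReE.
rewrite -iintZ //; apply: cint_bound; [exact: (Val_CCls cover gen0 FS rg' pB)|exact: Cls_scale|].
move=> v; have nn : 0 <= expR (A * C0) * Cp * Wt v by rewrite !mulr_ge0 ?expR_ge0.
have [_ _ [e e0 ev]] := pB.
have [Qv|/not_Qp[k vk]] := pselect (Qp v); last first.
  by rewrite cmodM cmod_cofR (ev v k) ?normr0 ?mulr0 // (le_lt_trans vk).
have [F0|F0] := leP (F v) 0; first by rewrite cpowR_le0 // mul0r cmod0.
have [s sS [c c0 vE]] := Qp_cpt cover Qv; rewrite vE in Qv F0 *.
rewrite cmodM cmod_cpowR // cmod_cofR ReE; case: rg => x0 _.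
have h1 := FP s c sS c0 Qv F0 _ (ltW x0).
apply: (@le_trans _ _ (expR ((sg + i%:R) * C0) * expR (- \sum_j c j * ((sg + i%:R) * (l (nth 0 s j))%:R)) * `|psi (cpt c)|)).
  by rewrite ler_wpM2r.
rewrite -mulrA [X in _ * X]mulrC -[leRHS]mulrA; apply: ler_pM; rewrite ?expR_ge0 ?mulr_ge0 ?expR_ge0 //.
  by rewrite ler_expR ler_wpM2r ?(ltW C00).
exact: H.
Qed.

Lemma wl_cpt s (c : 'I_(size s) -> R) : s \in Sig -> Qp (cpt c) -> \sum_j c j * ((wl (nth 0 s j))%:~R) = l1 (cpt c).
Proof. by move=> sS Qc; rewrite (l1_cpt gen0 sS Qc); apply: eq_bigr => j _; rewrite /wl -pmulrn. Qed.

Lemma dot_const (v : 'rV[R]_n) (t : R) : Qp v -> dot v (const_mx t) = t * l1 v.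
Proof.
move=> Qv; rewrite /dot /l1 mulr_sumr; apply: eq_bigr => i _.
by rewrite mxE gtr0_norm ?Qv // mulrC.
Qed.

Lemma dotD (v p q : 'rV[R]_n) : dot v (p + q) = dot v p + dot v q.
Proof. by rewrite /dot -big_split; apply: eq_bigr => i _; rewrite mxE mulrDr. Qed.

Lemma dotZ (v p : 'rV[R]_n) (t : R) : dot v (t *: p) = t * dot v p.
Proof. by rewrite /dot mulr_sumr; apply: eq_bigr => i _; rewrite mxE mulrCA. Qed.

Section General.
Variables (d : R) (k : nat) (B : 'M[R]_(k, n)) (rho : R).
Hypothesis d0 : 0 < d.
Hypothesis rho0 : 0 < rho.
Hypothesis Pd : Pn (const_mx d).
Hypothesis PB : forall (r : 'I_k) (t : R), `|t| = rho -> Pn (const_mx d + t *: row r B).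
Let ka := rho / (2 * d) / k.+1%:R.
(** Decay at rate of order [ep] in all directions and at a fixed rate along the rows of [B]; the
    zero summand matches the form of [exp_int_bound]. *)
Definition Wgt (ep : R) (v : 'rV[R]_n) : R := expR (- (ep * d * l1 v + ka * \sum_r `|\sum_i B r i * v 0 i + 0|)).

Lemma ka0 : 0 < ka.
Proof. by rewrite /ka !divr_gt0 // mulr_gt0. Qed.

(** With [x = - 1/d + ep < 0] and [L] the order at [v], the exponent [x L + l1 v] is at least
    [x <v, q> + l1 v] for every [q] in the polyhedron. At [q = (d, ..., d)] this is [ep d l1 v];
    moving [q] by plus or minus [rho] along a row of [B] adds [rho / (2 d)] times the modulus of
    that row applied to [v], since [ep <= 1 / (2 d)] keeps [x] below [- 1 / (2 d)]. *)
Lemma Wgt_ineq (ep : R) s (c : 'I_(size s) -> R) : 0 < ep -> ep <= (2 * d)^-1 ->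
  s \in Sig -> (forall j, 0 <= c j) -> Qp (cpt c) ->
  expR (- \sum_j c j * ((- d^-1 + ep) * (l (nth 0 s j))%:R + (wl (nth 0 s j))%:~R)) <= Wgt ep (cpt c).
Proof.
move=> e0 e1 sS c0 Qc; rewrite ler_expR lerN2.
pose x := - d^-1 + ep; pose v := cpt c; pose L := \sum_j c j * (l (nth 0 s j))%:R.
have -> : \sum_j c j * (x * (l (nth 0 s j))%:R + (wl (nth 0 s j))%:~R) = x * L + l1 v.
  rewrite -(wl_cpt sS Qc) /L mulr_sumr -big_split; apply: eq_bigr => j _; rewrite mulrDr; congr (_ + _).
  by rewrite mulrCA.
have x0 : x <= - (2 * d)^-1.
  rewrite /x; have -> : - (2 * d)^-1 = - d^-1 + (2 * d)^-1 by field; rewrite gt_eqF.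
  by rewrite lerD2l.
have dp : 0 < (2 * d)^-1 by rewrite invr_gt0 mulr_gt0.
have xn : x <= 0 by apply: le_trans x0 _; rewrite oppr_le0 ltW.
have key q : Pn q -> x * dot v q + l1 v <= x * L + l1 v.
  by move=> Pq; rewrite lerD2r ler_wnM2l // HL.
set X := x * L + l1 v in key *.
have dd : x * d = -1 + ep * d by rewrite /x mulrDl mulNr mulVf // gt_eqF.
have k1 : ep * d * l1 v <= X.
  apply: le_trans (key _ Pd); rewrite (dot_const d Qc) mulrA dd; have -> : (-1 + ep * d) * l1 v + l1 v = ep * d * l1 v by ring.
  exact: lexx.
have k2 r : rho / (2 * d) * `|\sum_i B r i * v 0 i + 0| <= X - ep * d * l1 v.
  pose y := \sum_i B r i * v 0 i.
  have dy : dot v (row r B) = y by apply: eq_bigr => i _; rewrite mxE mulrC.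
  have h t : `|t| = rho -> x * (t * y) <= X - ep * d * l1 v.
    move=> tr; have := key _ (PB r tr); rewrite dotD dotZ (dot_const d Qc) dy mulrDr mulrA dd => h.
    rewrite lerBrDr; apply: le_trans h; rewrite le_eqVlt; apply/orP; left; apply/eqP; ring.
  rewrite addr0 -/y; have y2 : rho / (2 * d) * `|y| <= - x * (rho * `|y|).
    rewrite [rho / _]mulrC -mulrA ler_wpM2r ?mulr_ge0 ?(ltW rho0)// lerNr //.
  apply: le_trans y2 _; have [yp|yn] := leP 0 y.
    have := h (- rho); rewrite normrN (gtr0_norm rho0) => /(_ erefl); rewrite ?(ger0_norm yp).
    by rewrite mulNr mulrN mulNr.
  have := h rho; rewrite (gtr0_norm rho0) => /(_ erefl).
  by rewrite (ltr0_norm yn) mulrN mulrN mulNr opprK.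
rewrite addrC -lerBrDr.
(* The inequalities for the [k] rows are added; division by [k.+1] in [ka] compensates, also for
   [k = 0]. *)
have S1 : (rho / (2 * d)) * (\sum_r `|\sum_i B r i * v 0 i + 0|) <= k.+1%:R * (X - ep * d * l1 v).
  rewrite mulr_sumr; apply: (@le_trans _ _ (\sum_(r < k) (X - ep * d * l1 v))).
    by apply: ler_sum => r _; exact: k2.
  rewrite sumr_const card_ord -[leLHS]mulr_natl ler_wpM2r ?subr_ge0 // ler_nat //.
rewrite /ka mulrAC ler_pdivrMr // [leRHS]mulrC; exact: S1.
Qed.

(** Since the combined order is at least [<a>], the integrand is dominated by a multiple of [Wgt],
    and [exp_int_bound] at rate [ep * d] gives the exponent. *)
Lemma gen_bound (i : nat) mu psi : Sy mu psi ->
  (forall a, a \in gens Sig -> wl a <= (i * l a)%:Z + mu a) -> d^-1 < i%:R ->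
  exists C d1 : R, [/\ 0 <= C, 0 < d1 & forall ep : R, 0 < ep < d1 ->
    cmod (Val (cofR (- d^-1 + ep) + i%:R) psi) <= C * ep ^- (n - \rank B)].
Proof.
move=> pS lm di; have pB := Sy_Bd pS; have [_ [Cp Cp0 CpP] _] := pB.
have [C0 C00 VB] := Val_real_bound.
have [CI CI0 CIP] := exp_int_bound B ka0.
pose d1 := Num.min (2 * d)^-1 d^-1.
have d10 : 0 < d1 by rewrite lt_min !invr_gt0 mulr_gt0 ?d0.
pose K := 2 * (expR (i%:R * C0) * Cp * (CI * d ^- (n - \rank B))).
exists K, d1; split => //; first by rewrite !mulr_ge0 ?expR_ge0 ?invr_ge0 ?exprn_ge0 ?(ltW d0).
move=> ep; rewrite lt_min => /and3P[e0 e1 e2].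
have ed0 : 0 < ep * d by rewrite mulr_gt0.
have ed1 : ep * d <= 1 by rewrite -ler_pdivlMr // mul1r ltW.
have WC : Cls (Wgt ep) by exists 1, (ep * d); split => //; apply: Cls_exp_aff => //; exact: ltW ka0.
have i0 : 0 < - d^-1 + ep + i%:R.
  by rewrite addrAC ltr_wpDr ?(ltW e0)// addrC subr_gt0.
have rg : region (- d^-1 + ep + i%:R) mu.
  split => // a ag; have := lm a ag; rewrite -(ler_int R) intrD -[X in _ <= X + _]pmulrn natrM => h.
  have g1 : Pn (const_mx d) by [].
  (* [HL] at a unit vector of cone coordinates gives [l(a) <= d <a>], so [- 1/d + ep] lies in the
     region of convergence. *)
  have La : (l a)%:R <= d * (wsum a)%:R :> R.
    case/gensP: (ag) => s sS /(nthP 0)[j js ja].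
    pose cc (k' : 'I_(size s)) : R := (k' == Ordinal js)%:R.
    have := HL g1 (c := cc) sS (fun k' => ler0n _ _).
    rewrite (bigD1 (Ordinal js)) //= /cc eqxx mul1r big1 ?addr0; last by move=> k' /negbTE ->; rewrite mul0r.
    rewrite ja /cpt (bigD1 (Ordinal js)) //= eqxx scale1r big1 ?addr0; last by move=> k' /negbTE ->; rewrite scale0r.
    move=> /le_trans; apply; rewrite ja /dot -(sum_realv_gen gen0 ag) mulr_sumr; apply: ler_sum => m _.
    by rewrite [const_mx _ _ _]mxE mulrC.
  have w0 : 0 < (wsum a)%:R :> R by rewrite ltr0n wpos.
  rewrite mulrDl -addrA; apply: lt_le_trans (_ : (- d^-1 + ep) * (l a)%:R + (wl a)%:~R <= _); last by rewrite lerD2l.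
  rewrite /wl -pmulrn mulrDl.
  have h2 : d^-1 * (l a)%:R <= (wsum a)%:R by rewrite ler_pdivrMl.
  have [l0|l0] := posnP (l a); first by rewrite l0 !mulr0 !add0r.
  have l0' : 0 < ep * (l a)%:R by rewrite mulr_gt0 // ltr0n.
  by rewrite mulNr; move: h2 l0'; move: (d^-1 * _) (ep * _) ((wsum a)%:R : R) => p q r; lra.
have {}VB := VB i mu psi (- d^-1 + ep) i%:R Cp (Wgt ep) _ rg pB WC (fun v => expR_ge0 _) Cp0.
apply: le_trans (VB _ _) _.
- by rewrite gerDr addrC subr_le0 ltW.
- move=> s c sS c0 Qc; apply: le_trans (_ : Cp * wexp mu c * expR (- \sum_j c j * ((- d^-1 + ep + i%:R) * (l (nth 0 s j))%:R)) <= _).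
    by rewrite ler_wpM2r ?expR_ge0 // CpP.
  rewrite -mulrA ler_wpM2l //; apply: le_trans (Wgt_ineq e0 (ltW e1) sS c0 Qc).
  rewrite /wexp -expRD ler_expR -opprD lerN2 -big_split /=; apply: ler_sum => j _.
  rewrite -mulrDr ler_wpM2l // [(_ + i%:R) * _]mulrDl addrCA lerD2l addrC.
  by have := lm _ (mem_gens j sS); rewrite -(ler_int R) intrD -[X in _ <= X + _]pmulrn natrM.
rewrite /K -!mulrA ler_wpM2l // ler_wpM2l ?expR_ge0 // ler_wpM2l //.
apply: le_trans (CIP (ep * d) (fun=> 0) ed0 ed1) _; rewrite ler_wpM2l // exprMn invfM mulrC lexx //.
Qed.
End General.

(** Here [d = 1]. An amplitude decaying like [exp (- 2 <v, q>)], compensated by order [- 3 l], gains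
    a fixed rate of decay along the single direction [q - (1, ..., 1)], which saves one power of
    [ep]. *)
Lemma spec_bound mu psi (q : 'rV[R]_n) (Cp : R) : Pn (const_mx 1) -> Pn q -> q != const_mx 1 ->
  Bd Sig mu psi -> (forall a, a \in gens Sig -> mu a = wl a - li a) -> 0 <= Cp ->
  (forall s (c : 'I_(size s) -> R), s \in Sig -> (forall j, 0 <= c j) -> Qp (cpt c) ->
    `|psi (cpt c)| <= Cp * expR (- (l1 (cpt c) - 3 * \sum_j c j * (l (nth 0 s j))%:R + 2 * dot (cpt c) q))) ->
  exists C d1 : R, [/\ 0 <= C, 0 < d1 & forall ep : R, 0 < ep < d1 ->
    cmod (Val (cofR (- 1 + ep) + 1%:R) psi) <= C * ep ^- (n - 1)].
Proof.
move=> P1 Pq q1 pB mE Cp0 CpP; have [C0 C00 VB] := Val_real_bound.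
pose B : 'M[R]_(1, n) := q - const_mx 1.
have rB : \rank B = 1%N by rewrite rank_rV subr_eq0 q1.
have h2 : 0 < 2^-1 :> R by rewrite invr_gt0.
have [CI CI0 CIP] := exp_int_bound B h2; rewrite rB in CIP.
exists (2 * (expR (1 * C0) * Cp * CI)), 2^-1; split => //; first by rewrite !mulr_ge0 ?expR_ge0.
move=> ep /andP[e0 e1]; have ele1 : ep <= 1 by apply: le_trans (ltW e1) _; rewrite invf_le1 ?ler1n.
pose Wt v := expR (- (ep * l1 v + 2^-1 * \sum_k `|\sum_i B k i * v 0 i + 0|)).
have WC : Cls Wt by exists 1, ep; split => //; apply: Cls_exp_aff => //; exact: ltW.
have sE : -1 + ep + 1%:R = ep by ring.
have lw a : a \in gens Sig -> (l a)%:R <= (wsum a)%:R :> R.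
  move=> ag; case/gensP: (ag) => s sS /(nthP 0)[j js ja].
  pose cc (k' : 'I_(size s)) : R := (k' == Ordinal js)%:R.
  have := HL P1 (c := cc) sS (fun k' => ler0n _ _).
  rewrite (bigD1 (Ordinal js)) //= /cc eqxx mul1r big1 ?addr0; last by move=> k' /negbTE ->; rewrite mul0r.
  rewrite ja /cpt (bigD1 (Ordinal js)) //= eqxx scale1r big1 ?addr0; last by move=> k' /negbTE ->; rewrite scale0r.
  move=> /le_trans; apply; rewrite ja /dot -(sum_realv_gen gen0 ag); apply: ler_sum => m _.
  by rewrite [const_mx _ _ _]mxE mulr1.
have rg : region (-1 + ep + 1%:R) mu.
  rewrite sE; split => // a ag; rewrite mE // intrB /wl /li -!pmulrn.
  have w0 : 0 < (wsum a)%:R :> R by rewrite ltr0n wpos.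
  have [l0|l0] := posnP (l a); first by rewrite l0 mulr0 subr0 add0r.
  have l0' : 0 < ep * (l a)%:R by rewrite mulr_gt0 // ltr0n.
  have Fct (p w u : R) : 0 < p -> u <= w -> 0 < p + (w - u) by lra.
  exact: Fct l0' (lw a ag).
have {}VB := VB 1%N mu psi (-1 + ep) 1 Cp Wt _ rg pB WC (fun v => expR_ge0 _) Cp0.
apply: le_trans (VB _ _) _.
- by rewrite sE.
- move=> s c sS c0 Qc; rewrite sE; apply: le_trans (ler_wpM2r (expR_ge0 _) (CpP s c sS c0 Qc)) _.
  rewrite -mulrA ler_wpM2l // -expRD ler_expR -opprD lerN2.
  pose L := \sum_j c j * (l (nth 0 s j))%:R; pose v := cpt c.
  have -> : \sum_j c j * (ep * (l (nth 0 s j))%:R) = ep * L.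
    by rewrite /L mulr_sumr; apply: eq_bigr => j _; rewrite mulrCA.
  have L1 : L <= l1 v by have := HL P1 sS c0; rewrite dot_const // mul1r.
  have L2 : L <= dot v q by exact: HL.
  have -> : \sum_k `|\sum_i B k i * v 0 i + 0| = `|dot v q - l1 v|.
    rewrite big_ord1 addr0; congr `|_|; have -> : l1 v = dot v (const_mx 1) by rewrite dot_const // mul1r.
    rewrite /dot -sumrB; apply: eq_bigr => i _; rewrite !mxE mulrBl mulrC; congr (_ - _).
    by rewrite mulrC.
  rewrite -/L -/v; move: L1 L2 (l1_ge0 v) e0 e1.
  move: (l1 v) L (dot v q) => a x b L1 L2 a0 e0' e1'.
  (* Both gaps [b - x] and [a - x] are nonnegative. With [ep < 1/2] they dominate [ep (a - x)] plus
     half of the modulus of [b - a]. *)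
  have ab : `|b - a| <= (b - x) + (a - x) by rewrite ler_norml; lra.
  have : ep * (a - x) <= 2^-1 * (a - x) by rewrite ler_wpM2r ?subr_ge0 // ltW.
  move: ab; move: `|b - a| => y ab h; nra.
rewrite -!mulrA ler_wpM2l // ler_wpM2l ?expR_ge0 // ler_wpM2l //.
exact: (CIP ep (fun=> 0) e0 ele1).
Qed.

Variable S : set R[i].

(** [b] allows for a simple pole of the coefficients; it may be zero when [x0] is not a negative
    integer, since [okS] then excludes a pole. *)
Lemma Rep_bound J e (m : nat) (x0 : R) : Rep Sig l F S (okS (cofR x0)) J (@wl n) e ->
  (forall (i : nat) mu psi, (J <= i)%N -> Sy mu psi -> (forall a, a \in gens Sig -> wl a <= (i * l a)%:Z + mu a) ->
    exists C d1 : R, [/\ 0 <= C, 0 < d1 & forall ep : R, 0 < ep < d1 ->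
      cmod (Val (cofR (x0 + ep) + i%:R) psi) <= C * ep ^- m]) ->
  forall b : nat, (b = 1%N \/ (b = 0%N /\ forall j : nat, (0 < j)%N -> cofR x0 <> - j%:R)) ->
  exists C d1 : R, [/\ 0 <= C, 0 < d1 & forall ep : R, 0 < ep < d1 ->
    cmod (e (cofR (x0 + ep))) <= C * ep ^- (m + b)].
Proof.
move=> re H b bP; elim: re => [|c i mu psi e1 _ oc pS Ji lm _ [C1 [d1 [C10 d10 h1]]]].
  by exists 0, 1; split => // ep _; rewrite cmod0 mul0r.
have [C2 [d2 [C20 d20 h2]]] := H i mu psi Ji pS lm.
have [K [d3 d30 h3]] : exists K : R, exists2 d3 : R, 0 < d3 & forall s, 0 < cmod (s - cofR x0) < d3 -> cmod ((s - cofR x0) ^+ b * c s) <= K.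
  have up (pl : pole_le c (cofR x0) 0) : pole_le c (cofR x0) b by apply: pole_le_up pl.
  case: bP => [->|[b0 no]]; case: oc => [pl|[pl [j /andP[j0 _] jE]]] //.
  - exact: (pole_le_up (leq0n 1) pl).
  - exact: up.
  - by case: (no j j0).
exists (`|K| * C2 + C1), (Num.min (Num.min d1 d2) (Num.min d3 1)); split.
- by rewrite addr_ge0 // mulr_ge0.
- by rewrite !lt_min d10 d20 d30 ltr01.
move=> ep; rewrite !lt_min => /andP[e0 /andP[/andP[e1' e2] /andP[e3 e4]]].
have em : 0 < ep ^- (m + b) by rewrite invr_gt0 exprn_gt0.
have dE : cofR (x0 + ep) - cofR x0 = cofR ep by rewrite cofRD addrAC subrr add0r.
have := h3 (cofR (x0 + ep)); rewrite dE cmod_cofR (gtr0_norm e0) e0 e3 => /(_ isT).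
rewrite cmodM cmodX cmod_cofR (gtr0_norm e0) => hc.
have hc' : cmod (c (cofR (x0 + ep))) <= `|K| * ep ^- b.
  rewrite ler_pdivlMr ?exprn_gt0 // mulrC; exact: le_trans hc (ler_norm _).
apply: le_trans (cmodD _ _) _; rewrite mulrDl; apply: lerD; last by apply: h1; rewrite e0.
rewrite cmodM; apply: le_trans (ler_pM (cmod_ge0 _) (cmod_ge0 _) hc' (h2 ep _)) _; first by rewrite e0.
by rewrite exprD invfM mulrACA [X in _ * X <= _]mulrC lexx.
Qed.

End RealBounds.

(** * Geometry of the principal face *)

Section PrincipalFace.
Context {R : realType} {n : nat}.
Variables (f : 'rV[R]_n -> R) (Sig : seq (seq 'rV[int]_n)).
Hypothesis f0 : f 0 = 0.
Hypothesis df0 : forall i : 'I_n, 'D_('e_i : 'rV[R]_n) f 0 = 0.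
Hypothesis Pne : newton f !=set0.
Hypothesis sub : simplicial_subdivision (newton f) Sig.
Let P := newton f.
Let d := dval P.

Lemma newton_cpt q : P q -> forall s (c : 'I_(size s) -> R), s \in Sig -> (forall j, 0 <= c j) ->
  \sum_j c j * (lw f (nth 0 s j))%:R <= dot (cpt c) q.
Proof.
move=> Pq s c sS c0.
have cs : coneR s (cpt c) by exists c.
have [_ /(_ _ cs) [am _]] := alphP sub sS.
have -> : \sum_j c j * (lw f (nth 0 s j))%:R = dot (cpt c) (mi_pt (alph f s)).
  rewrite /cpt dot_suml; apply: eq_bigr => j _; congr (_ * _).
  by rewrite (lwE sub sS) ?mem_nth // (dot_wt sub) //; apply/gensP; exists s; rewrite ?mem_nth.
exact: newton_lb (cone_orthant sub sS cs) am Pq.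
Qed.

Lemma face_sub (tau : set 'rV[R]_n) : is_face P tau -> tau `<=` P.
Proof. by move=> [_ [a [l [_ ->]]]] x []. Qed.

(** Differences of affinely independent points of the face are the rows of [B]; interiority of the
    diagonal point lets it move a fixed distance both ways along each of them. *)
Lemma principal_dirs tau k : is_face P tau -> relint tau (const_mx d) -> affdim tau k ->
  exists (B : 'M[R]_(k, n)) (rho : R), [/\ \rank B = k, 0 < rho, P (const_mx d) &
    forall r (t : R), `|t| = rho -> P (const_mx d + t *: row r B)].
Proof.
move=> tf [td [e e0 eP]] [[p [tp rp]] _].
pose B := \matrix_(j < k) (p (lift ord0 j) - p ord0).
have [C C0 CP] := @fin_ub R _ (fun ji : 'I_k * 'I_n => `|B ji.1 ji.2|).
exists B, (e / (C + 1)); have C1 : 0 < C + 1 by rewrite ltr_wpDl.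
split => //; [by rewrite divr_gt0|exact: face_sub td|].
move=> r t tE; apply: (face_sub tf); apply: eP.
  (* The displaced point is an affine combination with coefficients [1], [t], [- t], hence in the
     affine hull of the face. *)
  exists 3%N, (fun j : 'I_3 => nth 0 [:: 1; t; - t] j),
    (fun j : 'I_3 => nth 0 [:: const_mx d; p (lift ord0 r); p ord0] j); split.
    by rewrite !big_ord_recl big_ord0 /= addr0 addrN addr0.
  split; first by case=> -[|[|[|]]] //= _; exact: tp.
  by rewrite !big_ord_recl big_ord0 /= rowK scale1r addr0 scaleNr -scalerBr.
move=> i; have -> : (const_mx d + t *: row r B) 0 i - (const_mx d : 'rV[R]_n) 0 i = t * B r i.
  by rewrite !mxE addrAC subrr add0r.
rewrite normrM tE mulrAC ltr_pdivrMr // ltr_pM2l //.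
by apply: le_lt_trans (CP (r, i)) _; rewrite ltrDl.
Qed.

(* A zero-dimensional face is a point of the support, so [d] is then an integer. *)
Lemma principal_vertex tau (z : int) : is_face P tau -> relint tau (const_mx d) -> affdim tau 0 ->
  d^-1 = z%:~R -> d = 1.
Proof.
move=> tf [td _] [_ t2] dz.
have uq x y : tau x -> tau y -> x = y.
  move=> tx ty; have := t2 (fun j : 'I_2 => if j == ord0 then x else y).
  move=> /(_ (fun j => _)) H; have : (\rank (\matrix_(j < 1) ((if lift ord0 j == ord0 :> 'I_2 then x else y) - x)) <= 0)%N.
    by apply: H => j; case: ifP.
  rewrite leqn0 mxrank_eq0 => /eqP/matrixP E; apply/rowP => i.
  by have := E 0 i; rewrite !mxE /= => /eqP; rewrite subr_eq0 => /eqP.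
have [_ [a [l [va tE]]]] := tf.
have [k [w [p [w0 [w1 [pA dE]]]]]] := face_sub tf td.
have Pp j : P (p j) by have [al [sa ap]] := pA j; exact: newton_ge sa ap.
have lE : dot (realv a) (const_mx d) = l%:~R by move: td; rewrite tE => -[].
have s0 : \sum_j w j * (dot (realv a) (p j) - l%:~R) = 0.
  under eq_bigr do rewrite mulrBr; rewrite sumrB -mulr_suml w1 mul1r -lE dE [X in _ - X]dotC dot_suml.
  by rewrite -sumrB big1 // => j _; rewrite dotC subrr.
have g0 j : 0 <= w j * (dot (realv a) (p j) - l%:~R).
  by rewrite mulr_ge0 // subr_ge0; exact: va.
have [j wj] : exists j, w j != 0.
  apply: contrapT => no; move: w1; rewrite big1; first by move/eqP; rewrite eq_sym oner_eq0.
  by move=> j _; apply/eqP/negPn/negP => nw; apply: no; exists j.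
have tp : dot (realv a) (p j) = l%:~R.
  have /eqP : w j * (dot (realv a) (p j) - l%:~R) = 0 by apply: (psumr_eq0P (fun j _ => g0 j) s0).
  by rewrite mulf_eq0 (negbTE wj) /= subr_eq0 => /eqP.
have pd : p j = const_mx d by apply: uq => //; rewrite tE.
have [al [sa ap]] := pA j.
have Pa : P (mi_pt al) by exact: newton_mi.
(* The reflection of [al] through [p j] is coordinatewise above [al], hence in the polyhedron. A
   supporting functional that is minimal at [p j] must then be minimal at [al] too, so [al] is on
   the face. *)
have Pr : P (p j + (p j - mi_pt al)).
  apply: (newton_ge sa) => i; rewrite !mxE; apply: le_trans (ap i) _; rewrite lerDl subr_ge0; exact: ap.
have ta : tau (mi_pt al).
  rewrite tE; split => //=; apply/eqP; rewrite eq_le (va _ Pa) andbT.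
  have := va _ Pr; rewrite /= !dotD -[- mi_pt al]scaleN1r dotZ tp.
  have Fct (x y : R) : x <= x + (x + -1 * y) -> y <= x by lra.
  exact: Fct.
have /rowP/(_ (Ordinal (n_gt0 f0 df0 Pne))) := uq _ _ ta td; rewrite !mxE => dN.
have d0 : 0 < d := dval_gt0 f0 df0 Pne.
have : z * (al (Ordinal (n_gt0 f0 df0 Pne)) : int) = 1.
  apply/eqP; rewrite -(eqr_int R) intrM -dz.
  have -> : ((al (Ordinal (n_gt0 f0 df0 Pne)))%:Z)%:~R = d by rewrite -dN.
  by apply/eqP; rewrite mulVf ?gt_eqF.
move: dN; case: (al _) => [|[|N]] dN; [|by rewrite -dN|]; first by rewrite mulr0.
by case: z {dz} => [[|[|z]]|z]; rewrite ?mul0r // => /eqP; rewrite /= ; lia.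
Qed.
End PrincipalFace.

Lemma pole_le_add {R : realType} (e e' : R[i] -> R[i]) z m : pole_le e z m -> pole_le e' z m ->
  pole_le (fun s => e s + e' s) z m.
Proof.
move=> [K [d1 d10 h1]] [K' [d2 d20 h2]]; exists (K + K'), (Num.min d1 d2); first by rewrite lt_min d10.
move=> s; rewrite lt_min => /and3P[s0 s1 s2]; rewrite mulrDr; apply: le_trans (cmodD _ _) _.
by apply: lerD; [apply: h1|apply: h2]; rewrite s0.
Qed.

Lemma psup_eq {R : realType} {n : nat} (g h : 'rV[R]_n -> R) : psup g -> psup h ->
  (forall v, Qp v -> g v = h v) -> forall v, g v = h v.
Proof.
move=> [e1 e10 v1] [e2 e20 v2] gh v; have [/gh//|/not_Qp[k vk]] := pselect (Qp v).
by rewrite (v1 v k) ?(v2 v k) // (le_lt_trans vk).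
Qed.

Lemma is_derive_sqmul {R : realType} {n : nat} (g a : 'rV[R]_n -> R) v w (c : R) : derivable g v w ->
  'D_w g v = - c * g v -> derivable a v w ->
  is_derive v w (fun u => g u ^+ 2 * a u) (g v ^+ 2 * ('D_w a v + - (2 * c) * a v)).
Proof.
move=> d1 p da; have d2 : derivable (fun u => g u * g u) v w by exact: (derivableM d1 d1).
have -> : (fun u => g u ^+ 2 * a u) = (fun u => (g u * g u) * a u) by [].
constructor; first exact: (derivableM d2 da).
transitivity ('D_w (fun u => g u * g u) v * a v + (g v * g v) * 'D_w a v); first exact: (derive_mul d2 da).
rewrite (derive_mul d1 d1) p; ring.
Qed.

(** * Continuation on one orthant and the order at [- 1/d] *)

Section LocalContinuation.
Context {R : realType} {n : nat}.
Variables (U : set 'rV[R]_n) (f : 'rV[R]_n -> R) (Sig : seq (seq 'rV[int]_n)).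
Hypothesis f0 : f 0 = 0.
Hypothesis df0 : forall i : 'I_n, 'D_('e_i : 'rV[R]_n) f 0 = 0.
Hypothesis Pne : newton f !=set0.
Hypothesis fhat : in_hatE U f.
Hypothesis sf : smooth_on U f.
Hypothesis sub : simplicial_subdivision (newton f) Sig.
Variables (r de : R).
Hypothesis rU : box r `<=` U.
Hypothesis de0 : 0 < de.
Hypothesis der : de < r.
Variable b : {ffun 'I_n -> bool}.
Let X := Xp (sgv b) de : 'rV[R]_n -> 'rV[R]_n.
Hypothesis lbD : lbnd Sig (fun a => (2 * lw f a)%:Z) (Dsum f \o X).
Hypothesis lbD2 : lbnd Sig (fun a => (4 * lw f a)%:Z) (D2sum f Sig \o X).
Variable sg : R.
Hypothesis sg1 : sg ^+ 2 = 1.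
Local Notation Re := (@complex.Re R).

Let l := lw f.
Let P := newton f.
Let d := dval P.
Let cover := orthant_cone sub.
Let gen0 a i := gens_ge0 sub (a:=a) i.
Let wpos a := wsum_gt0 sub (a:=a).
Let fk : Csm (box r) f := fsm sf rU.
Let F v := sg * f (X v).
(** The monomial [x_1 ... x_n] is replaced by zero, so that sums can run over all cones without a
    side condition. *)
Let mk (k : 'I_(size Sig)) (v : 'rV[R]_n) : R :=
  if ~~ [forall i, alk f k i == 1%N] then mono (alk f k) (X v) else 0.
Let M1 v := \sum_k mk k v ^+ 2.
Let M2 v := Mall f Sig (X v).

Lemma loc_FS : Sym Sig (fun a => (l a)%:Z) F.
Proof. exact/Sym_scale/(sym_f fhat sf sub rU b de0 der). Qed.

Lemma loc_pd i v : Qp v -> pd i F v = - (sg * th i f (X v)).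
Proof.
move=> Qv; have H := is_derive_pull (sgv_norm b) de0 der ('e_i : 'rV[R]_n) fk Qv.
transitivity (sg * (- \sum_k ('e_i : 'rV[R]_n) 0 k * th k f (X v))).
  apply: derive_val; apply: is_deriveZ.
rewrite (bigD1 i) //= big1 ?addr0; last by move=> k ki; rewrite mxE eqxx (negbTE ki) mul0r.
by rewrite mxE !eqxx mul1r mulrN.
Qed.

Lemma loc_Dd v : Qp v -> Dd F v = Dsum f (X v).
Proof.
by move=> Qv; apply: eq_bigr => i _; rewrite loc_pd // sqrrN exprMn sg1 mul1r.
Qed.

Lemma lbnd_congr mu (g h : 'rV[R]_n -> R) : (forall v, Qp v -> g v = h v) -> lbnd Sig mu g -> lbnd Sig mu h.
Proof. by move=> gh [C C0 CP]; exists C => // s sS c c0 Qc; rewrite -gh //; exact: CP. Qed.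

Lemma loc_DP : lbnd Sig (fun a => (2 * l a)%:Z) (Dd F).
Proof. by apply: lbnd_congr lbD => v Qv; rewrite loc_Dd. Qed.

Lemma loc_M1 v : M1 v = Mno1 f Sig (X v).
Proof.
rewrite /M1 /Mno1 [RHS]big_mkcond; apply: eq_bigr => k _; rewrite /mk; case: ifP => // _.
by rewrite expr0n.
Qed.

Lemma loc_mk k : Sym Sig (fun a => (l a)%:Z) (mk k).
Proof.
have [pk|pk] := boolP (~~ [forall i, alk f k i == 1%N]).
  have -> : mk k = mono (alk f k) \o X by apply/funext => v; rewrite /mk pk.
  exact: (sym_mono sub b de0 der).
have -> : mk k = (fun=> 0) by apply/funext => v; rewrite /mk (negbTE pk).
by move=> q; exact: Sk_0.
Qed.

Lemma Sym_sq (g : 'rV[R]_n -> R) : Sym Sig (fun a => (l a)%:Z) g -> Sym Sig (fun a => (2 * l a)%:Z) (fun v => g v ^+ 2).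
Proof.
move=> gS; apply: Sym_mueq (_ : Sym Sig (fun a => (l a)%:Z + (l a)%:Z) (fun v => g v * g v)).
  by apply/funext => a; rewrite mul2n -addnn PoszD.
exact: Sym_mul.
Qed.

Lemma loc_M1S : Sym Sig (fun a => (2 * l a)%:Z) M1.
Proof. by apply: Sym_sum => k; apply: Sym_sq; exact: loc_mk. Qed.

Lemma loc_M2S : Sym Sig (fun a => (2 * l a)%:Z) M2.
Proof.
apply: (@Sym_sum _ _ _ _ _ _ (fun (k : 'I_(size Sig)) v => mono (alk f k) (X v) ^+ 2)) => k; apply: Sym_sq; exact: (sym_mono sub b de0 der).
Qed.

Let D2 v := Dd F v * M1 v + F v ^+ 2 * M2 v.

Lemma loc_D2P : lbnd Sig (fun a => (4 * l a)%:Z) D2.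
Proof.
by apply: lbnd_congr lbD2 => v Qv; rewrite /D2 loc_Dd // loc_M1 /F exprMn sg1 mul1r.
Qed.

Lemma loc_pd_mk k i v : Qp v -> derivable (mk k) v ('e_i : 'rV[R]_n) /\ pd i (mk k) v = - (alk f k i)%:R * mk k v.
Proof.
move=> Qv; split; first exact: Sym_der (loc_mk k) Qv.
rewrite /mk; case: ifP => _; last by rewrite mulr0; exact: derive_cst.
have H := is_derive_pull (sgv_norm b) de0 der ('e_i : 'rV[R]_n) (Csm_mono (alk f k) (@open_box R n r)) Qv.
rewrite [LHS](@derive_val _ _ _ _ _ _ _ H) (bigD1 i) //= big1 ?addr0; last by move=> j ji; rewrite mxE eqxx (negbTE ji) mul0r.
by rewrite mxE !eqxx mul1r th_mono mulNr.
Qed.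

Variable psi : 'rV[R]_n -> R.
Hypothesis pS : Sy Sig (@wl n) psi.
Let A m v := pd m F v * ((D2 v)^-1 * psi v).
Let h (k : 'I_(size Sig)) v := \sum_m (pd m (A m) v + - (2 * (alk f k m)%:R) * A m v).

Lemma loc_A m : Sy Sig (fun a => wl a - 3 * (l a)%:Z) (A m).
Proof.
have D2i := Sym_inv cover loc_D2P (Sym_D2 loc_FS loc_M1S loc_M2S).
apply: Sy_mueq (Sy_mul (Sym_pd m loc_FS) (Sy_mul D2i pS)) => a.
by rewrite PoszM; lia.
Qed.

Lemma loc_h k : Sy Sig (fun a => wl a - 3 * (l a)%:Z) (h k).
Proof.
apply: Sy_sum => m; have [p1 p2] := Sy_pd m (loc_A m); have [a1 [e e0 ev]] := loc_A m; split.
  by apply: Sym_add => //; exact: Sym_scale.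
apply: psup_add => //; exists e => // v j vj; by rewrite (ev v j) // mulr0.
Qed.

Lemma loc_G k : Sy Sig (fun a => wl a - (l a)%:Z) (fun v => mk k v ^+ 2 * h k v).
Proof.
apply: Sy_mueq (Sy_mul (Sym_sq (loc_mk k)) (loc_h k)) => a.
by rewrite PoszM; lia.
Qed.

(* Each monomial satisfies [pd m mk = - alpha_m mk], so differentiating
   [mk^2] gives back the factor [mk^2]. *)
Lemma loc_Tt v : Tt F (th1 F M1 M2) psi v = \sum_k mk k v ^+ 2 * h k v.
Proof.
have T1 := Sy_Tt loc_FS (Sym_th cover loc_FS loc_M1S loc_M2S loc_D2P loc_M1S) pS.
move: v; apply: (@psup_eq _ _ (Tt F (th1 F M1 M2) psi) (fun v => \sum_k mk k v ^+ 2 * h k v));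
  [by case: T1|by have [] := Sy_sum loc_G|] => v Qv.
under [RHS]eq_bigr do rewrite mulr_sumr; rewrite exchange_big /=; apply: eq_bigr => m _.
have E : (fun v => pd m F v * (th1 F M1 M2 v * psi v)) = (fun v => \sum_k (mk k v ^+ 2 * A m v)).
  apply/funext => u; rewrite -mulr_suml /th1 -/(D2 u) -/(M1 u) /A; ring.
rewrite E; have [AS _] := loc_A m; have dA : derivable (A m) v ('e_m : 'rV[R]_n) := Sym_der AS Qv.
have dk k : is_derive v ('e_m : 'rV[R]_n) (fun v => mk k v ^+ 2 * A m v)
    (mk k v ^+ 2 * (pd m (A m) v + - (2 * (alk f k m)%:R) * A m v)).
  by have [d1 p1] := loc_pd_mk k m Qv; exact: is_derive_sqmul.
have -> : (fun v => \sum_k mk k v ^+ 2 * A m v) = \sum_k (fun v => mk k v ^+ 2 * A m v).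
  by apply/funext => u; rewrite fct_sumE.
rewrite /pd derive_sum => [|k]; last by have [] := dk k.
by apply: eq_bigr => k _; exact: derive_val.
Qed.

Lemma loc_mk_bound k v : Qp v -> mk k v ^+ 2 <= (de ^+ (\sum_i alk f k i)) ^+ 2 * expR (- (2 * dot v (mi_pt (alk f k)))).
Proof.
move=> Qv; have nn : 0 <= (de ^+ (\sum_i alk f k i)) ^+ 2 * expR (- (2 * dot v (mi_pt (alk f k)))).
  by rewrite mulr_ge0 ?expR_ge0 // sqr_ge0.
rewrite /mk; case: ifP => _; last by rewrite expr0n.
rewrite -[leLHS]real_normK ?num_real // /mono normr_prod; under eq_bigr do rewrite normrX mxE !normrM sgv_norm mul1r (gtr0_norm de0) (gtr0_norm (expR_gt0 _)) exprMn.
rewrite big_split /= prodrXr exprMn ler_wpM2l ?sqr_ge0 //.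
under eq_bigr do rewrite -expRM_natl; rewrite -expR_sum -expRM_natl ler_expR mulr_sumr -mulrN -sumrN mulr_sumr.
by rewrite le_eqVlt; apply/orP; left; apply/eqP; apply: eq_bigr => i _; rewrite mxE; ring.
Qed.

Section Special.
Hypothesis d1 : d = 1.
Hypothesis Pd : P (const_mx d).

(** [mk k ^ 2] decays like [exp (- 2 <v, q>)] for an exponent [q] other than [(1, ..., 1)], and
    [h k] has order [<a> - 3 l], as [spec_bound] requires. *)
Lemma loc_special_term k : exists C e : R, [/\ 0 <= C, 0 < e & forall ep : R, 0 < ep < e ->
  cmod (Val F (cofR (- 1 + ep) + 1%:R) (fun v => mk k v ^+ 2 * h k v)) <= C * ep ^- (n - 1)].
Proof.
have [pk|pk] := boolP (~~ [forall i, alk f k i == 1%N]); last first.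
  exists 0, 1; split => // ep _; rewrite (_ : Val _ _ _ = 0) ?cmod0 ?mul0r //.
  transitivity (cint (fun _ : 'rV[R]_n => (0 : R[i]))); last exact: cint_0.
  by apply: cint_ext => v; rewrite /mk (negbTE pk) expr0n mul0r mulr0.
have [[hS hp] GB] := (loc_h k, Sy_Bd (loc_G k)); have [Ch Ch0 hb] := Sym_bnd hS.
pose Cm := (de ^+ (\sum_i alk f k i)) ^+ 2.
have q1 : (mi_pt (alk f k) : 'rV[R]_n) != const_mx 1.
  apply: contra pk => /eqP/rowP E; apply/forallP => i; have := E i; rewrite !mxE => /eqP.
  by rewrite pnatr_eq1.
have P1 : P (const_mx 1) by rewrite -d1.
have Pq : P (mi_pt (alk f k)) by apply: newton_mi; exact: (alk_supp sub).
apply: (spec_bound cover gen0 wpos loc_FS (newton_cpt sub) P1 Pq q1 GB _ (_ : 0 <= Cm * Ch)) => //.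
  by rewrite mulr_ge0 // sqr_ge0.
move=> s c sS c0 Qc; rewrite normrM ger0_norm ?sqr_ge0 //.
have := hb s sS c c0 Qc; have := loc_mk_bound k Qc; rewrite -/Cm => b1 b2.
apply: le_trans (ler_pM (sqr_ge0 _) (normr_ge0 _) b1 b2) _.
have Fct (x y z w : R) : x * y * (z * w) = x * z * (y * w) by ring.
rewrite Fct; apply: ler_wpM2l; first by rewrite mulr_ge0 // sqr_ge0.
rewrite /wexp -expRD ler_expR -opprD lerN2.
have -> : \sum_j c j * (wl (nth 0 s j) - 3 * (l (nth 0 s j))%:Z)%:~R =
    l1 (cpt c) - 3 * \sum_j c j * (l (nth 0 s j))%:R.
  rewrite -(wl_cpt gen0 sS Qc) mulr_sumr -sumrB; apply: eq_bigr => j _.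
  by rewrite intrB intrM -!pmulrn mulrBr mulrCA.
by rewrite addrC lexx.
Qed.

(** The term with denominator [s + 1] has size [ep ^ -1] times [ep ^ - (n - 1)], the other one
    [ep ^ - n]: the extra denominator does not lead beyond [n]. *)
Lemma loc_special : exists C e : R, 0 < e /\ forall ep : R, 0 < ep < e ->
  cmod (ef1 F M1 M2 psi (cofR (- 1 + ep))) <= C * ep ^- n.
Proof.
have /choice[Ck CkP] := loc_special_term; have /choice[ek ekP] := CkP.
have d0 : 0 < d := dval_gt0 f0 df0 Pne.
have n0 : (0 < n)%N := n_gt0 f0 df0 Pne.
have [e1 e10 e1P] := @fin_lb R _ ek (fun k => let: And3 _ h _ := ekP k in h).
have th2S : Sy Sig (fun a => wl a - 2 * (l a)%:Z) (fun v => th2 F M1 M2 v * psi v).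
  apply: Sy_mueq (Sy_mul (Sym_th cover loc_FS loc_M1S loc_M2S loc_D2P loc_M2S) pS) => a; lia.
(* A matrix [B] without rows gives the crude exponent [n]; the shift 2 exceeds [1/d = 1]. *)
have [||C2 [e2 [C20 e20 h2]]] := gen_bound cover gen0 wpos loc_FS (newton_cpt sub) (B := 0 : 'M[R]_(0, n)) d0 ltr01 Pd
   (fun r => match r with Ordinal m H => False_ind _ (notF H) end) (i := 2) th2S.
- by move=> a _; rewrite PoszM; lia.
- by rewrite d1 invr1 ltr1n.
rewrite mxrank0 subn0 d1 invr1 in h2.
exists (\sum_k Ck k + C2), (Num.min e1 e2); split; first by rewrite lt_min e10.
move=> ep; rewrite lt_min => /and3P[p0 p1 p2]; rewrite mulrDl.
have cE : cmod (cB (fun=> 1) 0 (cofR (-1 + ep))) = ep^-1.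
  rewrite /cB cmodM cmod1 mul1r cmodN cmodV mul1r -cofR1 -cofRD addrAC addNr add0r.
  by rewrite cmod_cofR gtr0_norm.
rewrite /ef1 addr0 mul1r; apply: le_trans (cmodD _ _) _; apply: lerD; last by apply: h2; rewrite p0.
rewrite cmodM cE.
have rg : region Sig l (Re (cofR (-1 + ep) + 1%:R)) (fun a => wl a - (l a)%:Z).
  rewrite -cofR1 -cofRD /= addrAC addNr add0r; split => // a ag.
  rewrite intrB -!pmulrn; have := lw_dval Pne sub ag; rewrite -/P -/d d1 mul1r.
  have w0 : 0 < (wsum a)%:R :> R by rewrite ltr0n wpos.
  rewrite -/(l a); have [l0|l0] := posnP (l a); first by rewrite l0 mulr0 subr0 add0r.
  have l0' : 0 < ep * (l a)%:R by rewrite mulr_gt0 // ltr0n.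
  have Fct (p w u : R) : 0 < p -> u <= w -> 0 < p + (w - u) by lra.
  exact: Fct l0'.
have -> : Val F (cofR (-1 + ep) + 1%:R) (Tt F (th1 F M1 M2) psi) = \sum_k Val F (cofR (-1 + ep) + 1%:R) (fun v => mk k v ^+ 2 * h k v).
  rewrite -(Val_sum cover gen0 loc_FS rg) => [|k]; last exact: Sy_Bd (loc_G k).
  by apply: Val_ext; exact: loc_Tt.
have -> : (\sum_k Ck k) * ep ^- n = ep^-1 * \sum_k Ck k * ep ^- (n - 1).
  rewrite -mulr_suml mulrCA -invfM -exprS subn1 prednK //.
rewrite ler_wpM2l ?invr_ge0 ?(ltW p0) //; apply: le_trans (cmod_sum _ _ _) _.
apply: ler_sum => k _; have [_ _ H] := ekP k; apply: H; rewrite p0 /=.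
exact: lt_le_trans p1 (e1P k).
Qed.
End Special.

Variable S : set R[i].
Hypothesis Sint : forall k : nat, S (cofR (- k.+1%:R)).
Hypothesis Sgen : forall a (k : nat), a \in gens Sig -> (0 < l a)%N -> S (cofR (- ((wsum a + k)%:R / (l a)%:R))).
Hypothesis Sneg : forall z, S z -> Re z < 0.

Lemma loc_reg J (ep : R) : 0 < ep -> d^-1 <= J%:R -> reg Sig l J (@wl n) (- d^-1 + ep).
Proof.
move=> e0 dJ; have d0 : 0 < d := dval_gt0 f0 df0 Pne; split.
  by rewrite addrAC ltr_wpDl // addrC subr_ge0.
move=> a ag; have := lw_dval Pne sub ag; rewrite -/P -/d -/(l a) -ler_pdivrMl // => la.
rewrite -pmulrn; have w0 : 0 < (wsum a)%:R :> R by rewrite ltr0n wpos.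
have [l0|l0] := posnP (l a); first by rewrite l0 mulr0 add0r.
have l0' : 0 < ep * (l a)%:R by rewrite mulr_gt0 // ltr0n.
have Fct (p w u v : R) : 0 < p * v -> u * v <= w -> 0 < (- u + p) * v + w by lra.
exact: Fct.
Qed.

Theorem local_continuation : exists Fc : R[i] -> R[i],
  [/\ (forall s, 0 < Re s -> Fc s = Val F s psi), (forall z, ~ S z -> Tay Fc z),
    (forall z, exists M, Lau M Fc z) &
    forall tau k, is_face P tau -> relint tau (const_mx d) -> affdim tau k ->
      pole_le Fc (cofR (- d^-1))
        (if `[< exists z : int, d^-1 = z%:~R >] then minn (n - k).+1 n else (n - k)%N)].
Proof.
have d0 : 0 < d := dval_gt0 f0 df0 Pne.
(* Shifts larger than [1/d] make all exponents in [bJ] positive near [- 1/d]. *)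
pose J := (Num.truncn d^-1).+1.
have dJ : d^-1 < J%:R by rewrite truncnS_gt.
pose s0 := cofR (- d^-1).
have ok1 i : okS s0 (fun=> 1) i by left; apply: pole_Tay; exact: Tay_cst.
have [Fc [bJ [Z [rb FV FT FL [ZS Fb Fe]]]]] := @continuation R n Sig cover gen0 wpos l F loc_FS loc_DP
  M1 M2 loc_M1S loc_M2S loc_D2P S Sint Sgen Sneg psi pS (okS s0) J isT (fun c i _ h => okS_B h) (okS_B (ok1 0%N)) (ok1 2%N).
exists Fc; split => // tau k tf tr ta.
have [dz dz0 dzP] := avoid_finite Z s0.
have [M LM] := FL s0.
have fin m (C e : R) (G : R[i] -> R[i]) (J' : nat) : 0 < e -> d^-1 <= J'%:R ->
    (forall s, reg Sig l J' (@wl n) (Re s) -> s \notin Z -> Fc s = G s) ->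
    (forall ep : R, 0 < ep < e -> cmod (G (cofR (- d^-1 + ep))) <= C * ep ^- m) -> pole_le Fc s0 m.
  move=> e0 dJ' GE GB; apply: (Lau_real_bound (d := Num.min e dz) (C := C) LM); first by rewrite lt_min e0.
  move=> ep; rewrite lt_min => /and3P[p0 p1 p2]; rewrite GE.
  - by rewrite -cofRD; apply: GB; rewrite p0.
  - by rewrite -cofRD; exact: loc_reg.
  - by apply: dzP; rewrite cmod_cofR gtr0_norm // p0.
have [B [rho [rB rho0 Pd PB]]] := principal_dirs tf tr ta.
have H i mu ps : (J <= i)%N -> Sy Sig mu ps -> (forall a, a \in gens Sig -> wl a <= (i * l a)%:Z + mu a) ->
    exists C d1 : R, [/\ 0 <= C, 0 < d1 & forall ep : R, 0 < ep < d1 ->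
      cmod (Val F (cofR (- d^-1 + ep) + i%:R) ps) <= C * ep ^- (n - k)].
  move=> Ji ps1 lm; have := gen_bound cover gen0 wpos loc_FS (newton_cpt sub) d0 rho0 Pd PB ps1 lm.
  rewrite rB; apply; apply: lt_le_trans dJ _; by rewrite ler_nat.
have RB := Rep_bound rb H.
case: asboolP => [[z dz']|noz].
  (* For [k > 0] one extra factor keeps the order at most [n]. For [k = 0] integrality forces
     [d = 1], and [ef1] is used in place of [bJ]. *)
  have [k0|k0] := posnP k.
    move: ta; rewrite k0 => ta; have d1 := principal_vertex f0 df0 Pne tf tr ta dz'.
    have [C [e [e0 eP]]] := loc_special d1 Pd.
    have d1' : d = 1 by [].
    rewrite subn0 (minn_idPr (leqnSn n)); apply: (fin n C e _ 1%N e0 _ Fe); first by rewrite d1' invr1.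
    by move=> ep pe; rewrite d1' invr1; exact: eP.
  have [C [e [C0 e0 eP]]] := RB 1%N (or_introl erefl).
  have kn : (k <= n)%N by rewrite -rB rank_leq_col.
  have -> : minn (n - k).+1 n = (n - k + 1)%N by rewrite addn1; apply/minn_idPl; lia.
  exact: (fin _ C e bJ J e0 (ltW dJ) Fb).
have [|C [e [C0 e0 eP]]] := RB 0%N.
  right; split => // j j0 E; apply: noz; exists j%:Z; move: E; rewrite -cofR_nat -cofRN => -[/oppr_inj ->].
  by rewrite -pmulrn.
rewrite addn0 in eP; exact: (fin _ C e bJ J e0 (ltW dJ) Fb).
Qed.
End LocalContinuation.

(** * Local zeta functions *)

Lemma sgl_sgv {R : realType} n (ep : 'rV[R]_n) : ep \in sgl n -> exists b, ep = sgv b.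
Proof.
move=> /sgl_norm H; exists [ffun i => ep 0 i < 0]; apply/rowP => i; rewrite mxE ffunE.
have := H i; have [e0|e0] := ltP (ep 0 i) 0; first by rewrite ltr0_norm // expr1 => <-; rewrite opprK.
by rewrite ger0_norm // expr0.
Qed.

Lemma compact_coord_lt {R : realType} n (K : set 'rV[R]_n) (de : R) i : 0 < de -> compact K -> K `<=` box de ->
  exists2 c : R, c < de & forall x, K x -> `|x 0 i| <= c.
Proof.
move=> de0 cK Kd; have [[x0 Kx0]|K0] := pselect (K !=set0); last first.
  by exists 0 => // x Kx; case: K0; exists x.
have [||x xK xP] := @compact_EVT_max _ R (fun x : 'rV[R]_n => `|x 0 i|) K _ cK; first by exists x0.
  apply: continuous_subspaceT => x; apply: (@continuous_comp _ _ _ (fun x : 'rV[R]_n => x 0 i) (fun t : R => `|t|)).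
    exact: coord_continuous.
  exact: norm_continuous.
exists `|x 0 i|; first by apply: Kd; rewrite inE in xK.
by move=> y Ky; apply: xP; rewrite inE.
Qed.

(** The gap between the support and the box is what becomes the collar [ln de - ln de'] in
    logarithmic coordinates. *)
Lemma supp_margin {R : realType} n (phi : 'rV[R]_n -> R[i]) (de : R) : 0 < de ->
  compact (supp phi) -> supp phi `<=` box de ->
  exists de' : R, [/\ 0 < de', de' < de & forall (x : 'rV[R]_n) i, de' < `|x 0 i| -> phi x = 0].
Proof.
move=> de0 cs sb; have /choice[c cP] : forall i : 'I_n, exists c : R, c < de /\ forall x, supp phi x -> `|x 0 i| <= c.
  by move=> i; have [c h1 h2] := compact_coord_lt i de0 cs sb; exists c.
have [|e e0 eP] := @fin_lb R _ (fun i => de - c i); first by move=> i; rewrite subr_gt0; case: (cP i).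
exists (Num.max (de - e) (de / 2)); split.
- by rewrite lt_max divr_gt0 ?orbT.
- by rewrite gt_max gtrBl e0 ltr_pdivrMr // ltr_pMr // ltr1n.
move=> x i; rewrite gt_max => /andP[h _]; apply/eqP/negPn/negP => px.
have : supp phi x by apply: subset_closure.
move=> /(proj2 (cP i) x); have := eP i; move: h.
have Fct (a b u v : R) : a - b < u -> b <= a - v -> u <= v -> False by lra.
exact: Fct.
Qed.

Section Amplitude.
Context {R : realType} {n : nat}.
Variables (f : 'rV[R]_n -> R) (Sig : seq (seq 'rV[int]_n)) (r de de' : R).
Hypothesis gen0 : forall a i, a \in gens Sig -> 0 <= a 0 i.
Hypothesis fk : Csm (box r) f.
Hypothesis de'0 : 0 < de'.
Hypothesis dd' : de' < de.
Hypothesis der : de < r.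
Variable rho : 'rV[R]_n -> R.
Hypothesis rs : smooth_on setT rho.
Hypothesis rv : forall (x : 'rV[R]_n) i, de' < `|x 0 i| -> rho x = 0.
Local Notation Re := (@complex.Re R).
Local Notation Im := (@complex.Im R).
Let de0 : 0 < de := lt_trans de'0 dd'.

(** Vanishing order zero is no condition, so the pullback of a smooth function has order 0 and the
    product has the order of the Jacobian. *)
Lemma amplitude_Sy (ep : 'rV[R]_n) : (forall i, `|ep 0 i| = 1) ->
  Sy Sig (@wl n) (fun v => rho (Xp ep de v) * jac v).
Proof.
move=> ep1; split.
  have rk : Csm (box r) rho by apply/smooth_onP => s x _; exact: rs.
  have := Sym_mul (Sym_pull (m := fun=> 0%N) gen0 ep1 de0 der rk (fun a _ => VanA_0 _ _ _)) (Sym_jac gen0).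
  by apply: Sym_mueq; apply/funext => a; rewrite add0r.
exists (ln de - ln de'); first by rewrite subr_gt0 ltr_ln ?posrE.
move=> v i vi; rewrite (rv (i := i)) ?mul0r // mxE !normrM ep1 mul1r (gtr0_norm de0) (gtr0_norm (expR_gt0 _)).
rewrite -{1}(lnK de'0) -{1}(lnK de0) -expRD ltr_expR.
have Fct (x y z : R) : x < y - z -> z < y + - x by lra.
exact: Fct.
Qed.

(** Smoothness of [f] is known in the box only; outside it [rho] vanishes on an open set, so the
    product is locally zero. *)
Lemma amplitude_cont (sg : R) (H : R -> R) : continuous H -> continuous (fun x => H (sg * f x) * rho x).
Proof.
move=> Hc x; have [xb|xb] := pselect (box de x).
  have fc : {for x, continuous f} by apply: (Ck_cont (fk 0)) => i; exact: lt_trans (xb i) der.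
  apply: continuousM; last by have [] := rs [::] (x := x) I.
  apply: (@continuous_comp _ _ _ (fun x => sg * f x) H); last exact: Hc.
  by apply: continuousM => //; exact: cst_continuous.
have [i xi] : exists i, de <= `|x 0 i|.
  by apply: contrapT => no; apply: xb => i; rewrite ltNge; apply/negP => h; apply: no; exists i.
pose O := [set y : 'rV[R]_n | de' < `|y 0 i|].
have oO : open O.
  apply: (@open_comp _ _ (fun y : 'rV[R]_n => `|y 0 i|) [set t | de' < t]); last exact: open_gt.
  move=> y _; apply: (@continuous_comp _ _ _ (fun x : 'rV[R]_n => x 0 i) (fun t : R => `|t|)).
    exact: coord_continuous.
  exact: norm_continuous.
apply: (eq_on_continuous (g := fun=> 0) oO _ (lt_le_trans dd' xi)); last exact: cst_continuous.
by move=> y yO; rewrite (rv yO) mulr0.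
Qed.

Section Power.
Variables (sg : R) (s : R[i]).
Hypothesis s0 : 0 < Re s.

Lemma amplitude_Re : (fun x => Re (cpowR (sg * f x) s * cofR (rho x))) =
  (fun x => pc cos (Re s) (Im s) 0 (sg * f x) * rho x).
Proof. by apply/funext => x; rewrite cReM Re_cpowR /= mulr0 subr0. Qed.

Lemma amplitude_Im : (fun x => Im (cpowR (sg * f x) s * cofR (rho x))) =
  (fun x => pc sin (Re s) (Im s) 0 (sg * f x) * rho x).
Proof. by apply/funext => x; rewrite cImM Im_cpowR /= mulr0 add0r. Qed.

Lemma amplitude_CCls : CCls (fun x => cpowR (sg * f x) s * cofR (rho x)).
Proof.
split; rewrite (amplitude_Re, amplitude_Im); apply: (Cls_cpt (de := de)).
- by apply: amplitude_cont; apply: pc_cont => //; [exact: cos1|exact: continuous_cos].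
- by move=> x i h; rewrite (rv (lt_le_trans dd' h)) mulr0.
- by apply: amplitude_cont; apply: pc_cont => //; [exact: sin1'|exact: continuous_sin].
- by move=> x i h; rewrite (rv (lt_le_trans dd' h)) mulr0.
Qed.

Lemma amplitude_subst : cint (fun x => cpowR (sg * f x) s * cofR (rho x)) =
  cofR (de ^+ n) * \sum_(ep <- sgl n) Val (fun v => sg * f (Xp ep de v)) s (fun v => rho (Xp ep de v) * jac v).
Proof.
have E (g : 'rV[R]_n -> R) : continuous g -> (forall (x : 'rV[R]_n) i, de' < `|x 0 i| -> g x = 0) ->
    iint g = de ^+ n * \sum_(ep <- sgl n) iint (fun v => g (Xp ep de v) * jac v).
  by move=> gc gv; apply: iint_subst => // x i h; apply: (gv x i); exact: lt_le_trans h.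
apply: cext.
  rewrite cReM /= mul0r subr0 amplitude_Re E.
  - rewrite Re_sum; congr (_ * _); apply: eq_bigr => ep _; apply: iint_ext => v.
    by rewrite cReM Re_cpowR /= mulr0 subr0 mulrA.
  - by apply: amplitude_cont; apply: pc_cont => //; [exact: cos1|exact: continuous_cos].
  - by move=> x i h; rewrite (rv h) mulr0.
rewrite cImM /= mul0r addr0 amplitude_Im E.
- rewrite Im_sum; congr (_ * _); apply: eq_bigr => ep _; apply: iint_ext => v.
  by rewrite cImM Im_cpowR /= mulr0 add0r mulrA.
- by apply: amplitude_cont; apply: pc_cont => //; [exact: sin1'|exact: continuous_sin].
- by move=> x i h; rewrite (rv h) mulr0.
Qed.
End Power.
End Amplitude.

Section Extendable.
Context {R : realType}.
Local Notation Re := (@complex.Re R).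
Variables (S : set R[i]) (s0 : R[i]) (N : nat -> Prop).
Implicit Types (G : R[i] -> R[i]).

(** A form of the conclusion stable under linear combinations, over orthants, signs and parts of the
    test function; [N] gathers the bounds on the order coming from all descriptions of the principal
    face. *)
Definition extendable G := exists Fc : R[i] -> R[i],
  [/\ (forall s, 0 < Re s -> Fc s = G s), (forall z, ~ S z -> Tay Fc z),
    (forall z, exists M, Lau M Fc z) & forall m, N m -> pole_le Fc s0 m].

Lemma extendable_ext G H : (forall s, 0 < Re s -> G s = H s) -> extendable G -> extendable H.
Proof. by move=> GH [Fc [FG FT FL FN]]; exists Fc; split => // s sp; rewrite FG // GH. Qed.

Lemma extendable_add G H : extendable G -> extendable H -> extendable (fun s => G s + H s).
Proof.
move=> [A [AG AT AL AN]] [B [BG BT BL BN]]; exists (fun s => A s + B s); split.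
- by move=> s sp; rewrite AG ?BG.
- by move=> z zS; apply: Tay_add; [exact: AT|exact: BT].
- by move=> z; have [M1 L1] := AL z; have [M2 L2] := BL z; exists (M1 + M2)%N; exact: Lau_add.
- by move=> m Nm; apply: pole_le_add; [exact: AN|exact: BN].
Qed.

Lemma extendable_scale (c : R[i]) G : extendable G -> extendable (fun s => c * G s).
Proof.
move=> [A [AG AT AL AN]]; exists (fun s => c * A s); split.
- by move=> s sp; rewrite AG.
- by move=> z zS; apply: Tay_mul; [exact: Tay_cst|exact: AT].
- move=> z; have [M L] := AL z; exists (0 + M)%N; apply: Lau_mul => //; apply: Tay_Lau; exact: Tay_cst.
- by move=> m Nm; apply: (@pole_mul _ s0 (fun=> c) A 0 m); [apply: pole_Tay; exact: Tay_cst|exact: AN].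
Qed.

Lemma extendable_sum (I : eqType) (rr : seq I) (G : I -> R[i] -> R[i]) :
  (forall k, k \in rr -> extendable (G k)) -> extendable (fun s => \sum_(k <- rr) G k s).
Proof.
elim: rr => [|k rr IH] H.
  apply: (@extendable_ext (fun=> 0)); first by move=> s _; rewrite big_nil.
  exists (fun=> 0); split => //; first by move=> z _; exact: Tay_cst.
    by move=> z; exists 0%N; apply: Tay_Lau; exact: Tay_cst.
  by move=> m _; exists 0, 1 => // s _; rewrite mulr0 cmod0.
apply: (@extendable_ext (fun s => G k s + \sum_(k <- rr) G k s)); first by move=> s _; rewrite big_cons.
by apply: extendable_add; [apply: H; rewrite mem_head|apply: IH => j jr; apply: H; rewrite inE jr orbT].
Qed.
End Extendable.

Theorem theorem9p1 (R : realType) (n : nat) (U : set 'rV[R]_n)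
  (f : 'rV[R]_n -> R) (Sig : seq (seq 'rV[int]_n)) :
  open U -> U 0 -> smooth_on U f -> f 0 = 0 ->
  (forall i : 'I_n, 'D_('e_i : 'rV[R]_n) f 0 = 0) ->
  newton f !=set0 -> in_hatE U f -> nondeg_R U f ->
  simplicial_subdivision (newton f) Sig ->
  let P := newton f in
  let d := dval P in
  let S : set R[i] :=
    [set z | exists r : R,
       (cand_poles P Sig r \/ exists k : nat, (0 < k)%N /\ r = - k%:R) /\
       z = cofR r] in
  let order_ok (F : R[i] -> R[i]) : Prop :=
    forall (tau : set 'rV[R]_n) (k : nat),
      is_face P tau -> relint tau (const_mx d) -> affdim tau k ->
      pole_le F (cofR (- d^-1))
        (if `[< exists z : int, d^-1 = z%:~R >] then minn (n - k).+1 n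
         else (n - k)%N) in
  (cand_poles P Sig (- d^-1) /\ (forall r, cand_poles P Sig r -> r <= - d^-1)) /\
  exists V : set 'rV[R]_n, open V /\ V 0 /\ V `<=` U /\
    forall phi : 'rV[R]_n -> R[i],
      smooth_on setT (fun x => complex.Re (phi x)) ->
      smooth_on setT (fun x => complex.Im (phi x)) ->
      compact (supp phi) -> supp phi `<=` V ->
      mero_ext S (Zplus f phi) order_ok /\
      mero_ext S (Zminus f phi) order_ok /\
      mero_ext S (Zabs f phi) order_ok.
Proof.
move=> oU U0 sf f0 df0 Pne fhat fnd sub P d S order_ok.
have cand := cand_polesP f0 df0 Pne sub; split; first exact: cand.
have d0 : 0 < d := dval_gt0 f0 df0 Pne.
have [r r0 rU] := box_in_U oU U0.
have [de [de0 der lb]] := lower_bounds Pne fhat fnd sf sub r0 rU.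
exists (box de); split; first exact: open_box.
split; first by move=> i; rewrite mxE normr0.
split; first by move=> x xd; apply: rU => i; exact: lt_trans (xd i) der.
move=> phi sR sI cs sb.
have [de' [de'0 dd' pv]] := supp_margin de0 cs sb.
have gen0 a i : a \in gens Sig -> 0 <= a 0 i := gens_ge0 sub i.
have fk : Csm (box r) f := fsm sf rU.
have Sint k : S (cofR (- k.+1%:R)) by exists (- k.+1%:R); split => //; right; exists k.+1.
have Sgen a k : a \in gens Sig -> (0 < lw f a)%N -> S (cofR (- ((wsum a + k)%:R / (lw f a)%:R))).
  move=> ag l0; exists (- ((wsum a + k)%:R / (lw f a)%:R)); split => //; left; exists k, a.
  rewrite (lsuppE sub ag); split; first exact: (gens_rays sub).
  split; first by rewrite ltr0n.
  rewrite natrD -(sum_realv sub ag); congr (- ((_ + _) / _)); by apply: eq_bigr => i _; rewrite mxE.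
have Sneg z : S z -> complex.Re z < 0.
  move=> [q [[cq|[k [k0 ->]]] ->]] /=; last by rewrite oppr_lt0 ltr0n.
  by apply: le_lt_trans (proj2 cand q cq) _; rewrite oppr_lt0 invr_gt0.
pose N m := exists tau k, [/\ is_face P tau, relint tau (const_mx d), affdim tau k &
  m = if `[< exists z : int, d^-1 = z%:~R >] then minn (n - k).+1 n else (n - k)%N].
pose ext := extendable S (cofR (- d^-1)) N.
have Wext (sg : R) (rho : 'rV[R]_n -> R) : sg ^+ 2 = 1 -> smooth_on setT rho ->
    (forall (x : 'rV[R]_n) i, de' < `|x 0 i| -> rho x = 0) -> ext (fun s => cint (fun x => cpowR (sg * f x) s * cofR (rho x))).
  move=> sg1 rs rv; apply: extendable_ext.
    by move=> s s0; symmetry; exact: (amplitude_subst fk de'0 dd' der rs rv sg s0).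
  apply: extendable_scale; apply: extendable_sum => ep eps.
  have pS := amplitude_Sy gen0 de'0 dd' der rs rv (sgl_norm eps).
  have [b bE] := sgl_sgv eps; subst ep; have [lb1 lb2] := lb b.
  have [Fc [h1 h2 h3 h4]] := local_continuation f0 df0 Pne fhat sf sub rU de0 der lb1 lb2 sg1 pS Sint Sgen Sneg.
  exists Fc; split; [exact: h1|exact: h2|exact: h3|].
  move=> m Nm; have [tau [k [t1 t2 t3 mE]]] := Nm; rewrite mE; exact: (h4 tau k t1 t2 t3).
have vR (x : 'rV[R]_n) i : de' < `|x 0 i| -> complex.Re (phi x) = 0 by move=> h; rewrite (pv x i).
have vI (x : 'rV[R]_n) i : de' < `|x 0 i| -> complex.Im (phi x) = 0 by move=> h; rewrite (pv x i).
pose ic : R[i] := Complex 0 1.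
(* Amplitudes are real-valued, so the test function is split into its real and imaginary parts. *)
have spl (g : R[i]) x : g * phi x = g * cofR (complex.Re (phi x)) + ic * (g * cofR (complex.Im (phi x))).
  by apply: cext; rewrite ?cReD ?cImD ?cReM ?cImM /= ?cReM ?cImM /=; ring.
have CC (sg : R) s : 0 < complex.Re s -> CCls (fun x => cpowR (sg * f x) s * phi x).
  move=> s0; apply: (CCls_ext (fun x => esym (spl (cpowR (sg * f x) s) x))); apply: CCls_add.
    exact: (amplitude_CCls fk dd' der sR vR).
  by apply: CCls_scale; exact: (amplitude_CCls fk dd' der sI vI).
have Zext (sg : R) : sg ^+ 2 = 1 -> ext (fun s => cint (fun x => cpowR (sg * f x) s * phi x)).
  move=> sg1; apply: extendable_ext (extendable_add (Wext sg _ sg1 sR vR) (extendable_scale ic (Wext sg _ sg1 sI vI))).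
  move=> s s0; have c1 := amplitude_CCls fk dd' der sR vR sg s0; have c2 := amplitude_CCls fk dd' der sI vI sg s0.
  rewrite -(cintZ ic c2) -(cintD c1 (CCls_scale ic c2)); apply: cint_ext => x; by rewrite -spl.
have fin G : ext G -> mero_ext S G order_ok.
  move=> [Fc [h1 h2 h3 h4]]; exists Fc; split => //; split; first by move=> z zS; apply: Tay_holo; exact: h2.
  split; first by move=> z _; have [M LM] := h3 z; exists M; exact: Lau_pole.
  by move=> tau k t1 t2 t3; apply: h4; exists tau, k.
have p1 : (1 : R) ^+ 2 = 1 by rewrite expr1n.
have m1 : (-1 : R) ^+ 2 = 1 by rewrite sqrrN expr1n.
split; [|split]; apply: fin.
- apply: extendable_ext (Zext 1 p1) => s _; apply: cint_ext => x; by rewrite cpowR_max mul1r.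
- apply: extendable_ext (Zext (-1) m1) => s _; apply: cint_ext => x; by rewrite cpowR_max mulN1r.
(* The power of the modulus is the sum of the two truncated powers, also at zeros of [f], where all
   three are 0 by convention. *)
apply: extendable_ext (extendable_add (Zext 1 p1) (Zext (-1) m1)) => s s0.
rewrite -(cintD (CC _ _ s0) (CC _ _ s0)); apply: cint_ext => x; rewrite -mulrDl; congr (_ * _).
rewrite mul1r mulN1r; have [fx|fx] := leP (f x) 0.
  by rewrite (cpowR_le0 _ fx) add0r ler0_norm.
by rewrite (cpowR_le0 (r := - f x)) ?oppr_le0 ?(ltW fx) // addr0 gtr0_norm.
Qed.
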